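(* Let $\alpha:\mathbb{R}\to(0,1)$ with $\max_{x\in\mathbb{R}}\alpha(x)<1$ and $\alpha^*=\min_{x\in\mathbb{R}}\alpha(x)>0$. Let $A=\{x\in\mathbb{R}:\alpha(x)=\alpha^*\}$ be unbounded and suppose that there are $1>c_1\ge c_2\ge0$ and $a_1,a_2\in(0,\infty)$ with $$\lim_{x\to\infty}x^{-c_1}\ell(A\cap[0,x])=a_1,\qquad \lim_{x\to\infty}x^{-c_2}\ell\big(A\cap(-\infty,0)\cap[-x,0]\big)=a_2 .$$ Suppose $\ell(\partial A)=0$ and $A=A_\beta=\{x\in\mathbb{R}:\alpha(x)<\alpha^*+\beta<1\}$ for all $\beta>0$ small enough. Suppose the limits $\alpha_I=\lim_{x\to\infty,\,x\notin A}\alpha(x)$ and $\alpha_J=\lim_{x\to-\infty,\,x\notin A}\alpha(x)$ exist and set $\alpha_\circ=\min\{\alpha_I,\alpha_J\}$. Let $X$ be the process of the context. Then: (1) if $\frac{2\alpha^*}{1+c_1}<\alpha_\circ$, then $$\lim_{t\to\infty}\frac1t\int_0^t1_{\{X(s)\in A\}}ds=1\ \text{ a.s.,}\qquad \lim_{t\to\infty}P(X(t)\in A)=1;$$ (2) if $\frac{2\alpha^*}{1+c_1}>\alpha_\circ$, then for any $K>0$, $$\lim_{t\to\infty}\frac1t\int_0^t1_{\{X(s)\in[-K,K]^c\cap A^c\}}ds=1\ \text{ a.s.}$$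
   Context: $\ell$ is Lebesgue measure on $\mathbb{R}$; $\alpha$ is Borel measurable. $B$ is a standard one-dimensional Brownian motion started at $0$. $\sigma$ is a right-continuous strictly increasing pure-jump process with $\sigma(0)=0$ which, conditionally on the path of $B$, has independent increments with $$\mathbb{E}\big[e^{-\lambda\sigma(y)}\mid B(w),w\le y\big]=e^{-\int_0^y\lambda^{\alpha(B_w)}dw},$$ i.e. its jump intensity at time $w$ is $\nu(ds,B_w)\,dw$ with $\nu(ds,x)=\frac{\alpha(x)s^{-\alpha(x)-1}}{\Gamma(1-\alpha(x))}ds$. $L(t)=\inf\{s\ge0:\sigma(s)>t\}$ and $X(t)=B(L(t))$. *)

(* Defs.v *)
From HB Require Import structures.
From mathcomp Require Import all_boot all_order all_algebra.
From mathcomp Require Import all_classical all_reals all_analysis.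
From mathcomp Require Import measurable_realfun.

Set Implicit Arguments.
Unset Strict Implicit.
Unset Printing Implicit Defensive.

Import Order.TTheory GRing.Theory Num.Theory.
Import numFieldNormedType.Exports.

Local Open Scope classical_set_scope.
Local Open Scope ring_scope.

Section conditioning.
Context (d : measure_display) (T : measurableType d) (R : realType).
Variable P : probability T R.

(* [Y] is a version of [E(Z | G)], for a sub-sigma-algebra [G].  Only used for
   nonnegative [Z], for which no integrability is required. *)
Definition is_cond_exp (G : set (set T)) (Z Y : T -> \bar R) : Prop :=
  (forall S : set (\bar R), measurable S -> G (Y @^-1` S)) /\
  (forall E : set T, G E ->
     (\int[P]_(om in E) Z om = \int[P]_(om in E) Y om)%E).

(* P(E_0 /\ ... /\ E_(n-1) | G) = prod_i P(E_i | G) a.s.; [p i] is a version of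
   P(E_i | G). *)
Definition cond_indep_events (G : set (set T)) (n : nat)
    (E : 'I_n -> set T) : Prop :=
  exists p : 'I_n -> T -> R,
    (forall i, is_cond_exp G (fun om => (\1_(E i) om)%:E)
                             (fun om => (p i om)%:E)) /\
    is_cond_exp G (fun om => (\1_([set om' | forall i, E i om']) om)%:E)
                  (fun om => (\prod_(i < n) p i om)%:E).

End conditioning.

Section processes.
Context (d : measure_display) (T : measurableType d) (R : realType).
Variable P : probability T R.

Notation mu := (@lebesgue_measure R).

(* Processes are indexed by [R], but only their values at times [0 <= t] are
   ever used. *)
Implicit Types (B sigma : R -> {RV P >-> R}) (alpha : R -> R).

Record standard_Brownian_motion B : Prop := {
  BM_start : forall om, B 0 om = 0 ;
  BM_continuous : forall om, {within `[0, +oo[, continuous (fun t : R => B t om)} ;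
  BM_gaussian : forall s t : R, 0 <= s -> s < t ->
    forall S : set R, measurable S ->
      P [set om | S (B t om - B s om)] = normal_prob 0 (Num.sqrt (t - s)) S ;
  BM_indep : forall (n : nat) (t : nat -> R) (S : 'I_n -> set R),
    0 <= t 0%N -> (forall i : nat, t i <= t i.+1) ->
    (forall i, measurable (S i)) ->
    P [set om | forall i : 'I_n, S i (B (t i.+1) om - B (t i) om)] =
    (\prod_(i < n) P [set om | S i (B (t i.+1) om - B (t i) om)%R])%E }.

(* The sigma-algebra generated by [B(w)], [0 <= w <= z]; for [z = +oo] it is the
   one generated by the whole path. *)
Definition past B (z : \bar R) : set (set T) :=
  <<s [set E | exists (w : R) (S : set R),
         [/\ 0 <= w, (w%:E <= z)%E, measurable S & E = B w @^-1` S]] >>.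

Definition Gamma (z : R) : R :=
  \int[mu]_(t in `]0, +oo[) (t `^ (z - 1) * expR (- t)).

(* The measure nu(ds, x) on ]0, +oo[, written [nu alpha x]. *)
Definition nu alpha (x : R) (D : set R) : \bar R :=
  (\int[mu]_(s in D `&` `]0%R, +oo[)
     (alpha x * s `^ (- alpha x - 1) / Gamma (1 - alpha x))%:E)%E.

Definition jump (f : R -> R) (w : R) : R := f w - lim (f u @[u --> w^'-]).

(* The conditional Laplace transform is required given [B(w), w <= z] for every
   [z] in [[y, +oo]]: [z = y] is the formula involving only the past up to [y],
   and [z = +oo] says that, given the whole path, the law of [sigma(y)] depends
   only on the path up to [y]. *)
Record conditional_subordinator alpha B sigma : Prop := {
  sub_start : forall om, sigma 0 om = 0 ;
  sub_increasing : forall om (s t : R), 0 <= s -> s < t -> sigma s om < sigma t om ;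
  sub_right_continuous : forall om (t : R), 0 <= t ->
    sigma u om @[u --> t^'+] --> sigma t om ;
  sub_pure_jump : forall om (t : R), 0 <= t ->
    (sigma t om)%:E =
    \esum_(w in `]0, t]) (jump (fun u : R => sigma u om) w)%:E ;
  sub_indep : forall (n : nat) (t : nat -> R) (S : 'I_n -> set R),
    0 <= t 0%N -> (forall i : nat, t i <= t i.+1) ->
    (forall i, measurable (S i)) ->
    cond_indep_events P (past B +oo%E)
      (fun i : 'I_n => [set om | S i (sigma (t i.+1) om - sigma (t i) om)]) ;
  sub_laplace : forall (lambda y : R) (z : \bar R),
    0 <= lambda -> 0 <= y -> (y%:E <= z)%E ->
    is_cond_exp P (past B z)
      (fun om => (expR (- (lambda * sigma y om)))%:E)
      (fun om => (expR (- \int[mu]_(w in `[0, y])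
                            (lambda `^ alpha (B w om))))%:E) ;
  sub_jump_intensity : forall (s t : R) (D : set R),
    0 <= s -> s <= t -> measurable D -> D `<=` `]0, +oo[ ->
    is_cond_exp P (past B +oo%E)
      (fun om => counting
         [set w : R | s < w <= t /\ D (jump (fun u : R => sigma u om) w)])
      (fun om => (\int[mu]_(w in `]s, t]) nu alpha (B w om) D)%E) }.

Definition inverse_process sigma (t : R) (om : T) : R :=
  inf [set s : R | 0 <= s /\ t < sigma s om].

Definition subordinated_process B sigma (t : R) (om : T) : R :=
  B (inverse_process sigma t om) om.

(* (1/t) int_0^t 1_{X(s) in A} ds *)
Definition occupation_fraction (X : R -> T -> R) (A : set R) (t : R) (om : T)
    : R :=
  t^-1 * \int[mu]_(s in `[0, t]) \1_A (X s om).

End processes.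

(* Main.v *)
(* Write Phi_y(l) = int_0^y l^alpha(B_w) dw, so that E[exp(-l sigma(y)) | B] = exp(-Phi_y(l)).

   The subordinator is large: P(sigma(y) <= z) <= e E[exp(-Phi_y(1/z))], and Phi_y(1/z) is at
   least z^-a times the time spent by B, up to time y, in a set D where alpha <= a.  If D has
   mass of order x^c in [-x, x], this time is of order y^((1+c)/2): it is estimated by a second
   moment bound over many well separated time scales.  Hence sigma(y) > y^zeta for every
   zeta < (1+c)/(2a), up to a probability that is summable along y_j = exp(j^4).

   The time spent by X in a bad closed set F is small: cut [0, y] into cells and add up the
   increments of sigma over the cells in which B comes close to F.  Given B, the Laplace
   exponent of this sum tends to int_0^y 1_F(B_w) l^alpha(B_w) dw, whose mean is controlled by
   the growth of the mass of F; so the sum is at most y_j^xi for some xi < zeta, again up to a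
   summable probability.  Borel-Cantelli along y_j, and the monotonicity of sigma between two
   grid points, give the almost sure statements.  Taking F = closure of the complement of A
   gives (1), and F = closure of A, together with [-K, K], gives (2); the boundary of A is null
   and is thus never charged by the mean occupation measure of B.

   For P(X(t) in A), suppose that X(t) is in F.  Then sigma jumps over t in a cell in which B
   comes close to F.  Either Phi(1/t) > M before this cell, which has probability at most
   e^(1-M), or else the law of sigma / t given B has near 1 a density bounded by some C(M); this
   density bound comes from the identity x m(dx) = (m * k)(dx) obtained by differentiating the
   Laplace transform of m.  A dyadic decomposition of the increment over the cell then bounds
   the probability by C(M) times the same mean exposure E int 1_F(B_w) t^-alpha(B_w) dw. *)
Require Import Defs.
From HB Require Import structures.
From mathcomp Require Import all_boot all_order all_algebra.
From mathcomp Require Import all_classical all_reals all_analysis.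
From mathcomp Require Import measurable_realfun.
From mathcomp Require Import ring lra.

Set Implicit Arguments.
Unset Strict Implicit.
Unset Printing Implicit Defensive.

Import Order.TTheory GRing.Theory Num.Theory.
Import numFieldNormedType.Exports.

Local Open Scope classical_set_scope.
Local Open Scope ring_scope.

(** The obstacle is that [inverse_process sigma t] depends on [sigma], so that no conditional law
    given the path applies to the time at which [X] reads the path. Everything is therefore
    expressed by increments of [sigma] over a deterministic partition, and the mesh tends to 0 only
    in the mean of the Laplace exponent, where dominated convergence applies. The comparison of 2
    astar / (1 + c1) with alphao is one of growth exponents. When B runs up to y, a set where alpha
    is close to a and where B spends a time y^kappa consumes about y^(kappa / a) of the clock. This
    gives (1 + c1) / (2 astar) for A, 1 / alphao for the far part of the complement of A, where B
    may spend a time of order y, and 1 / (2 (astar + beta)) for a bounded part of it, where kappa =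
    1/2. The gap beta puts the last exponent below the first, so that the first two compete. In (2)
    the interval [-K, K] has exponent at most 1 / (2 astar) <= (1 + c1) / (2 astar) < 1 / alphao,
    hence is negligible together with A. *)

(** * Integrals weighted by functions of a measurable map; paths evaluated at random times *)

Section change_of_sets.
Local Open Scope ereal_scope.
Context (d d' : measure_display) (T : measurableType d) (T' : measurableType d')
  (R : realType) (m : {measure set T -> \bar R}).
Import HBNNSimple.

(** Simple functions increase to [f], and on a level set of such a function the claim is the
    hypothesis. With [p] the map to the conditioning space, this lets a variable be replaced by its
    conditional expectation under any nonnegative weight that is a function of [p], without
    integrability. *)
Lemma le_integral_comp (p : T -> T') (Z Y : T -> R) (f : T' -> \bar R) :
  measurable_fun setT p -> measurable_fun setT Z -> measurable_fun setT Y ->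
  (forall x, 0 <= Z x)%R -> (forall x, 0 <= Y x)%R ->
  measurable_fun setT f -> (forall y, 0 <= f y) ->
  (forall S, measurable S ->
    \int[m]_(x in p @^-1` S) (Z x)%:E <= \int[m]_(x in p @^-1` S) (Y x)%:E) ->
  \int[m]_x (f (p x) * (Z x)%:E) <= \int[m]_x (f (p x) * (Y x)%:E).
Proof.
move=> mp mZ mY Z0 Y0 mf f0 ZY.
pose g := nnsfun_approx measurableT mf.
have mg n : measurable_fun setT (fun x => (g n (p x))%:E).
  by apply/measurable_EFinP; apply: measurableT_comp.
have cvg_g (W : T -> R) : measurable_fun setT W -> (forall x, 0 <= W x)%R ->
    \int[m]_x ((g n (p x))%:E * (W x)%:E) @[n --> \oo] --> \int[m]_x (f (p x) * (W x)%:E).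
  move=> mW W0.
  have -> : \int[m]_x (f (p x) * (W x)%:E) =
      \int[m]_x limn (fun n => (g n (p x))%:E * (W x)%:E).
    apply: eq_integral => x _; apply/esym/cvg_lim => //.
    apply: cvgeZr => //.
    by move: (@cvg_nnsfun_approx _ _ _ _ measurableT f mf (fun x _ => f0 x) (p x) Logic.I).
  apply: cvg_monotone_convergence => //.
  - by move=> n; apply: emeasurable_funM => //; apply/measurable_EFinP.
  - by move=> n x _; rewrite mule_ge0// lee_fin.
  - move=> x _ a b ab; apply: lee_wpmul2r; rewrite lee_fin; first exact: W0.
    exact/lefP/nd_nnsfun_approx.
have int_g (W : T -> R) n : measurable_fun setT W -> (forall x, 0 <= W x)%R ->
    \int[m]_x ((g n (p x))%:E * (W x)%:E) =
    \sum_(r \in range (g n)) (r%:E * \int[m]_(x in p @^-1` (g n @^-1` [set r])) (W x)%:E).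
  move=> mW W0.
  have mI r : measurable_fun setT (fun x => \1_(g n @^-1` [set r]) (p x) : R).
    exact: (measurableT_comp (measurable_indic (measurable_sfunP _ (measurable_set1 r)))).
  transitivity (\int[m]_x (\sum_(r \in range (g n))
      (r * \1_(g n @^-1` [set r]) (p x))%:E * (W x)%:E)).
    apply: eq_integral => x _; rewrite fimfunE -fsumEFin// !fsbig_finite//= ge0_sume_distrl//.
    by move=> r _; rewrite nnfun_muleindic_ge0.
  rewrite ge0_integral_fsum//; last 2 first.
  - move=> r; apply: emeasurable_funM => //; apply/measurable_EFinP => //.
    apply: measurable_funM => //.
  - by move=> r x _; apply: mule_ge0; [rewrite EFinM nnfun_muleindic_ge0|rewrite lee_fin].
  apply: eq_fsbigr => r rg.
  have r0 : (0 <= r)%R by move: rg; rewrite inE => -[y _ <-].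
  under eq_integral do rewrite EFinM -muleA.
  rewrite ge0_integralZl//.
  - congr *%E; rewrite [RHS]integral_mkcond; apply: eq_integral => x _.
    rewrite patchE /indic/=; case: ifPn => h.
      by have -> : p x \in g n @^-1` [set r]; [by rewrite inE; move: h; rewrite inE|rewrite mul1e].
    have -> : (p x \in g n @^-1` [set r]) = false; last by rewrite mul0e.
    by apply/negbTE; apply: contra h; rewrite !inE.
  - apply: emeasurable_funM => //; apply/measurable_EFinP => //.

  - by move=> x _; rewrite mule_ge0// lee_fin.
have gZ := cvg_g _ mZ Z0; have gY := cvg_g _ mY Y0.
rewrite -(cvg_lim _ gZ)// -(cvg_lim _ gY)//; apply: lee_lim.
- by apply/cvg_ex; eexists; exact: gZ.
- by apply/cvg_ex; eexists; exact: gY.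
apply: nearW => n; rewrite !int_g//.
rewrite !fsbig_finite//=; apply: lee_sum => r _.
have [r0|r0] := leP 0%R r; first by apply: lee_wpmul2l; [rewrite lee_fin|apply: ZY].
have -> : g n @^-1` [set r] = set0.
  by apply/seteqP; split => // y /= yr; move: r0; rewrite -yr ltNge fun_ge0.
by rewrite preimage_set0 !integral_set0.
Qed.

Lemma eq_integral_comp (p : T -> T') (Z Y : T -> R) (f : T' -> \bar R) :
  measurable_fun setT p -> measurable_fun setT Z -> measurable_fun setT Y ->
  (forall x, 0 <= Z x)%R -> (forall x, 0 <= Y x)%R ->
  measurable_fun setT f -> (forall y, 0 <= f y) ->
  (forall S, measurable S ->
    \int[m]_(x in p @^-1` S) (Z x)%:E = \int[m]_(x in p @^-1` S) (Y x)%:E) ->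
  \int[m]_x (f (p x) * (Z x)%:E) = \int[m]_x (f (p x) * (Y x)%:E).
Proof.
move=> mp mZ mY Z0 Y0 mf f0 ZY.
by apply/eqP; rewrite eq_le !le_integral_comp// => S mS; rewrite ZY.
Qed.

End change_of_sets.

Section paths.
Context (d : measure_display) (T : measurableType d) (R : realType).

(** The random time is approximated from below by multiples of 1/(n+1). The approximating times take
    countably many values, so that the path at such a time is measurable, and continuity passes to
    the limit. *)
Lemma measurable_path (b : R -> T -> R) (l : T -> R) :
  (forall w, 0 <= w -> measurable_fun setT (b w)) ->
  (forall x, {within `[0, +oo[, continuous (fun w => b w x)}) ->
  measurable_fun setT l -> (forall x, 0 <= l x) ->
  measurable_fun setT (fun x => b (l x) x).
Proof.
move=> mb cb ml l0.
pose k (n : nat) x : nat := Num.truncn (n.+1%:R * l x).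
pose a n x := (k n x)%:R / n.+1%:R : R.
have a_cvg x : a n x @[n --> \oo] --> l x.
  apply/cvgrPdist_le => e e0; near=> n.
  have nl0 : 0 <= n.+1%:R * l x :> R by rewrite mulr_ge0.
  have /andP[k1 k2] := truncn_itv nl0.
  have n0 : (0 : R) < n.+1%:R by [].
  have -> : l x - a n x = (n.+1%:R * l x - (k n x)%:R) / n.+1%:R.
    by rewrite /a mulrBl mulrAC mulfV ?mul1r// gt_eqF.
  rewrite ger0_norm; last by rewrite divr_ge0// subr_ge0.
  apply: (@le_trans _ _ (n.+1%:R^-1)).
    rewrite ler_pdivrMr// mulVf ?gt_eqF// lerBlDr addrC natr1.
    exact: ltW.
  by apply: ltW; near: n; exact: (near_infty_natSinv_lt (PosNum e0)).
apply: (@measurable_fun_cvg _ _ _ setT (fun n x => b (a n x) x)).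
- move=> n _ Y mY; rewrite setTI.
  have -> : (fun x => b (a n x) x) @^-1` Y =
      \bigcup_i ((k n @^-1` [set i]) `&` (b (i%:R / n.+1%:R) @^-1` Y)).
    apply/seteqP; split => x /=.
      by move=> Yx; exists (k n x).
    by move=> [i _ [/= ki]]; rewrite /a ki.
  apply: bigcup_measurable => i _; apply: measurableI; last first.
    by rewrite -[X in measurable X]setTI; apply: mb => //; rewrite divr_ge0.
  have -> : k n @^-1` [set i] = [set x | n.+1%:R * l x \in `[i%:R, i.+1%:R[].
    apply/seteqP; split => x /=; rewrite in_itv/=.
      by move=> <-; exact: truncn_itv (mulr_ge0 _ _).
    by move=> h; apply: truncn_def.
  rewrite -[X in measurable X]setTI.
  have ml' : measurable_fun setT (fun x => n.+1%:R * l x) by apply: measurable_funM.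
  exact: (ml' measurableT _ (measurable_itv `[i%:R, i.+1%:R[)).
- move=> x _.
  have /continuous_within_itvcyP[cx _] := cb x.
  (* At 0 the path is only right-continuous as a function on the line; there the approximating times
     are constantly 0. *)
  have [lx0|lx0] := eqVneq (l x) 0.
    have -> : (fun n => b (a n x) x) = (fun n => b (l x) x); last exact: cvg_cst.
    by apply/funext => n; rewrite /a /k lx0 mulr0 truncn0 mul0r.
  have {}lx0 : 0 < l x by rewrite lt_neqAle eq_sym lx0 l0.
  have clx : {for l x, continuous (fun w => b w x)} by apply: cx; rewrite in_itv/= lx0.
  have := @cvg_comp _ _ _ (a ^~ x) (fun w => b w x) _ _ _ (a_cvg x) clx; exact.
Unshelve. all: by end_near. Qed.

Lemma measurable_indic_comp d' (T' : measurableType d') (A : set T') (f : T -> T') :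
  measurable A -> measurable_fun setT f ->
  measurable_fun setT (fun x => \1_A (f x) : R).
Proof. by move=> mA mf; exact: (measurableT_comp (measurable_indic mA) mf). Qed.

End paths.

(** * Laplace transforms and densities *)

Section bernstein.
Context (R : realType).
Implicit Types (f g : nat -> R) (z : R).

(* [bern n f z] is the mean of [f] under the binomial law with parameters [n] and [z]. *)
Fixpoint bern n f z : R :=
  if n is n'.+1 then z * bern n' (fun k => f k.+1) z + (1 - z) * bern n' f z
  else f 0%N.

Lemma bern_poly n f : exists p : {poly R}, forall z, bern n f z = p.[z].
Proof.
elim: n f => [|n IH] f; first by exists (f 0%N)%:P => z; rewrite hornerC.
have [p Hp] := IH (fun k => f k.+1); have [q Hq] := IH f.
exists ('X * p + (1 - 'X) * q) => z /=.
by rewrite Hp Hq !hornerE.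
Qed.

Lemma bern_lin n f g (c : R) z :
  bern n (fun k => f k + c * g k) z = bern n f z + c * bern n g z.
Proof. by elim: n f g => [//|n IH] f g /=; rewrite !IH; ring. Qed.

Lemma bern_cst n (c : R) z : bern n (fun=> c) z = c.
Proof. by elim: n => //= n ->; ring. Qed.

Lemma le_bern n f g z : 0 <= z <= 1 -> (forall k, f k <= g k) ->
  bern n f z <= bern n g z.
Proof.
move=> /andP[z0 z1]; elim: n f g => [|n IH] f g fg //=.
by rewrite lerD// ler_wpM2l// ?subr_ge0// IH.
Qed.

(** Squared bias plus binomial variance. The centre [c] is arbitrary because the induction shifts it
    by 1. *)
Lemma bern_variance n (c : R) z :
  bern n (fun k => (k%:R - c) ^+ 2) z = (n%:R * z - c) ^+ 2 + n%:R * z * (1 - z).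
Proof.
elim: n c => [|n IH] c /=; first by ring.
rewrite IH.
have -> : (fun k : nat => (k.+1%:R - c) ^+ 2) = (fun k => (k%:R - (c - 1)) ^+ 2).
  by apply/funext => k; rewrite -natr1; ring.
by rewrite IH -natr1; ring.
Qed.

(** Bernstein's proof of the Weierstrass theorem, at a single point: [h] differs from [h z] by at
    most e/2 plus a multiple of (x - z)^2, and the mean of this square is z (1 - z) / n. *)
Lemma bern_cvg (h : R -> R) (K z : R) : 0 <= z <= 1 -> (forall x, `|h x| <= K) ->
  {for z, continuous h} ->
  bern n.+1 (fun k => h (k%:R / n.+1%:R)) z @[n --> \oo] --> h z.
Proof.
move=> z01 hK /cvgrPdist_le ch.
have K0 : 0 <= K by exact: le_trans (hK 0).
apply/cvgrPdist_le => e e0.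
have /ch/nbhs_ballP[d /= d0 hd] : 0 < e / 2 by rewrite divr_gt0.
(* Beyond distance [d] the quadratic term is at least 2K, which bounds any difference of values of
   [h]. *)
pose C := 2 * K / d ^+ 2.
have C0 : 0 <= C by apply: divr_ge0; [exact: mulr_ge0|exact: sqr_ge0].
have hC x : `|h x - h z| <= e / 2 + C * (x - z) ^+ 2.
  have [xz|xz] := ltP `|z - x| d.
    by rewrite distrC (le_trans (hd x xz))// lerDl mulr_ge0// sqr_ge0.
  rewrite (le_trans (ler_normB _ _))// (@le_trans _ _ (2 * K))//.
    by rewrite mulr_natl mulr2n lerD.
  apply: ler_wpDl; first by rewrite divr_ge0// ltW.
  rewrite /C mulrAC ler_pdivlMr ?exprn_gt0// ler_wpM2l ?mulr_ge0//.
  by rewrite -(real_normK (num_real (x - z))) distrC lerXn2r// nnegrE ltW.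
near=> n.
have n0 : (0 : R) < n.+1%:R by [].
have bound : bern n.+1 (fun k => e / 2 + C * (k%:R / n.+1%:R - z) ^+ 2) z <= e.
  have -> : (fun k : nat => e / 2 + C * (k%:R / n.+1%:R - z) ^+ 2) =
      (fun k => e / 2 + (C / n.+1%:R ^+ 2) * (k%:R - n.+1%:R * z) ^+ 2).
    apply/funext => k; congr (_ + _); field.
    by rewrite gt_eqF.
  rewrite (bern_lin n.+1 (fun=> e / 2)) bern_cst bern_variance subrr expr0n/= add0r.
  have -> : C / n.+1%:R ^+ 2 * (n.+1%:R * z * (1 - z)) = C * z * (1 - z) * n.+1%:R^-1.
    by field; rewrite gt_eqF.
  rewrite -lerBrDl; have -> : e - e / 2 = e / 2 by field.
  apply: (@le_trans _ _ (C * n.+1%:R^-1)).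
    move: z01 => /andP[z0 z1]; rewrite ler_wpM2r// -mulrA ler_piMr//.
    by rewrite mulr_ile1// ?subr_ge0// gerBl.
  have -> : e / 2 = (C + 1) * (e / 2 / (C + 1)).
    by rewrite [RHS]mulrC divfK// gt_eqF// ltr_wpDl.
  apply: ler_pM => //; first by rewrite lerDl.
  apply: ltW; near: n.
  have e1 : 0 < e / 2 / (C + 1) by rewrite !divr_gt0// ltr_wpDl.
  exact: (near_infty_natSinv_lt (PosNum e1)).
have sub (s : R) : bern n.+1 (fun k => s * (h (k%:R / n.+1%:R) - h z)) z =
    s * (bern n.+1 (fun k => h (k%:R / n.+1%:R)) z - h z).
  have -> : (fun k : nat => s * (h (k%:R / n.+1%:R) - h z)) =
      (fun k => - (s * h z) + s * h (k%:R / n.+1%:R)).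
    by apply/funext => k; ring.
  rewrite (bern_lin n.+1 (fun=> - (s * h z))) bern_cst; ring.
rewrite ler_norml; apply/andP; split.
  rewrite lerNl opprB -[leLHS]mul1r -sub (le_trans _ bound)//.
  by apply: le_bern => // k; rewrite mul1r (le_trans (ler_norm _)).
rewrite -opprB -mulN1r -sub (le_trans _ bound)//.
apply: le_bern => // k; rewrite mulN1r (le_trans (ler_norm _))// normrN.
exact: hC.
Unshelve. all: by end_near. Qed.

End bernstein.

(** * Integrals determined by moments on [0, 1] *)

Section moments.
Local Open Scope ereal_scope.
Context (R : realType).

Lemma integrable_mul_bounded d (T : measurableType d) (m : {measure set T -> \bar R})
  (W u : T -> R) (K : R) : m.-integrable setT (EFin \o W) ->
  measurable_fun setT u -> (forall x, `|u x| <= K)%R ->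
  m.-integrable setT (fun x => (W x * u x)%:E).
Proof.
move=> iW mu uK.
apply: (@eq_integrable _ _ _ _ _ measurableT ((EFin \o W) \* (EFin \o u))).
  by move=> x _; rewrite /= EFinM.
apply: integrableMl => //; exists K; split; first exact: num_real.
by move=> M KM x _ /=; apply: le_trans (uK x) (ltW KM).
Qed.

Context (d1 d2 : measure_display) (T1 : measurableType d1) (T2 : measurableType d2)
  (m1 : {measure set T1 -> \bar R}) (m2 : {measure set T2 -> \bar R})
  (W1 Z1 : T1 -> R) (W2 Z2 : T2 -> R).
Hypotheses (iW1 : m1.-integrable setT (EFin \o W1))
  (iW2 : m2.-integrable setT (EFin \o W2))
  (mZ1 : measurable_fun setT Z1) (mZ2 : measurable_fun setT Z2)
  (Z101 : forall x, (0 <= Z1 x <= 1)%R) (Z201 : forall x, (0 <= Z2 x <= 1)%R).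
Hypothesis moments : forall k : nat,
  \int[m1]_x (W1 x * Z1 x ^+ k)%:E = \int[m2]_x (W2 x * Z2 x ^+ k)%:E.

Let horner_bounded d (T : measurableType d) (Z : T -> R) (p : {poly R}) :
  (forall x, (0 <= Z x <= 1)%R) -> exists K : R, forall x, (`|p.[Z x]| <= K)%R.
Proof.
move=> Z01; elim/poly_ind: p => [|p c [K HK]].
  by exists 0%R => x; rewrite horner0 normr0.
exists (K + `|c|)%R => x; rewrite !hornerE (le_trans (ler_normD _ _))// lerD//.
rewrite normrM; have /andP[z0 z1] := Z01 x.
by rewrite (le_trans _ (HK x))// ler_piMr// ger0_norm.
Qed.

Let horner_measurable d (T : measurableType d) (Z : T -> R) (p : {poly R}) :
  measurable_fun setT Z -> measurable_fun setT (fun x => p.[Z x]).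
Proof.
move=> mZ; elim/poly_ind: p => [|p c IH].
  by under eq_fun do rewrite horner0; exact: measurable_cst.
under eq_fun do rewrite !hornerE.
by apply: measurable_funD => //; apply: measurable_funM.
Qed.

(** Polynomials are built by Horner's scheme, which multiplies by the variable; the induction
    therefore carries an additional power [Z ^+ k]. *)
Let eq_poly (p : {poly R}) :
  \int[m1]_x (W1 x * p.[Z1 x])%:E = \int[m2]_x (W2 x * p.[Z2 x])%:E.
Proof.
suff H : forall k : nat, \int[m1]_x (W1 x * (Z1 x ^+ k * p.[Z1 x]))%:E =
    \int[m2]_x (W2 x * (Z2 x ^+ k * p.[Z2 x]))%:E.
  have := H 0%N.
  by under eq_integral do rewrite expr0 mul1r; under [RHS]eq_integral do rewrite expr0 mul1r.
elim/poly_ind: p => [|p c IH] k.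
  by rewrite !integral0_eq// => x _; rewrite horner0 mulr0 mulr0.
have step d (T : measurableType d) (m : {measure set T -> \bar R}) (W Z : T -> R) :
    m.-integrable setT (EFin \o W) -> measurable_fun setT Z ->
    (forall x, (0 <= Z x <= 1)%R) ->
    \int[m]_x (W x * (Z x ^+ k * (p * 'X + c%:P).[Z x]))%:E =
    \int[m]_x (W x * (Z x ^+ k.+1 * p.[Z x]))%:E + c%:E * \int[m]_x (W x * Z x ^+ k)%:E.
  move=> iW mZ Z01.
  have [K HK] := horner_bounded p Z01.
  have Zk j x : (`|Z x ^+ j| <= 1)%R.
    by have /andP[? ?] := Z01 x; rewrite normrX ger0_norm// exprn_ile1.
  have i2 : m.-integrable setT (fun x => (W x * Z x ^+ k)%:E).
    by apply: (@integrable_mul_bounded _ _ _ _ _ 1%R) => //; exact: measurable_funX.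
  rewrite -integralZl// -integralD//=.
  - apply: eq_integral => x _; rewrite hornerMXaddC -EFinM -EFinD; congr EFin.
    by rewrite exprS; ring.
  - apply: (@integrable_mul_bounded _ _ _ _ _ K) => //.
      by apply: measurable_funM; [exact: measurable_funX|exact: horner_measurable].
    by move=> x; rewrite normrM (le_trans _ (HK x))// ler_piMl.
  - exact: integrableZl.
by rewrite !step// IH moments.
Qed.

Let pass_limit d (T : measurableType d) (m : {measure set T -> \bar R})
  (W Z : T -> R) (h : nat -> R -> R) (l : R -> R) (K : R) :
  m.-integrable setT (EFin \o W) -> measurable_fun setT Z ->
  (forall n, measurable_fun setT (fun x => h n (Z x))) ->
  (forall n x, `|h n (Z x)| <= K)%R ->
  (forall x, h n (Z x) @[n --> \oo] --> l (Z x)) ->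
  \int[m]_x (W x * h n (Z x))%:E @[n --> \oo] --> \int[m]_x (W x * l (Z x))%:E.
Proof.
move=> iW mZ mh hK hl; have [mW _] := integrableP _ _ _ iW.
have mW' : measurable_fun setT W by exact/measurable_EFinP.
apply: (@dominated_cvg _ _ _ _ _ measurableT _ _ (fun x => (`|W x| * K)%:E)) => //=.
- by move=> n; apply/measurable_EFinP/measurable_funM.
- by move=> x _; apply: cvg_EFin; [exact: nearW|apply: cvgM => //; exact: cvg_cst].
- apply: (@integrable_mul_bounded _ _ _ _ _ `|K|%R) => //.
  exact: (integrable_abse iW).
- by move=> n x _; rewrite lee_fin normrM ler_wpM2l.
Qed.

(** Equal moments give equal integrals of the Bernstein polynomials of [h], which are bounded by [K]
    and converge to [h] pointwise; the integrable weights provide the domination. *)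
Lemma eq_integral_continuous (h : R -> R) (K : R) : continuous h ->
  (forall x, `|h x| <= K)%R ->
  \int[m1]_x (W1 x * h (Z1 x))%:E = \int[m2]_x (W2 x * h (Z2 x))%:E.
Proof.
move=> ch hK.
pose b n z := bern n.+1 (fun k => h (k%:R / n.+1%:R)%R) z.
have bK d (T : measurableType d) (Z : T -> R) n x : (forall x, (0 <= Z x <= 1)%R) ->
    (`|b n (Z x)| <= K)%R.
  move=> Z01; rewrite ler_norml -{1}(bern_cst n.+1 (- K)%R (Z x)) -{2}(bern_cst n.+1 K (Z x)).
  by apply/andP; split; apply: le_bern => // k; have := hK (k%:R / n.+1%:R)%R; rewrite ler_norml => /andP[].
have mb d (T : measurableType d) (Z : T -> R) n : measurable_fun setT Z ->
    measurable_fun setT (fun x => b n (Z x)).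
  move=> mZ; have [p Hp] := bern_poly n.+1 (fun k => h (k%:R / n.+1%:R)%R).
  by under eq_fun do rewrite /b Hp; exact: horner_measurable.
have L1 : \int[m1]_x (W1 x * b n (Z1 x))%:E @[n --> \oo] --> \int[m1]_x (W1 x * h (Z1 x))%:E.
  apply: (@pass_limit _ _ _ _ _ _ _ K) => //; [by move=> n; exact: mb|by move=> n x; exact: bK|].
  by move=> x; apply: bern_cvg (Z101 x) hK _; exact: ch.
have L2 : \int[m2]_x (W2 x * b n (Z2 x))%:E @[n --> \oo] --> \int[m2]_x (W2 x * h (Z2 x))%:E.
  apply: (@pass_limit _ _ _ _ _ _ _ K) => //; [by move=> n; exact: mb|by move=> n x; exact: bK|].
  by move=> x; apply: bern_cvg (Z201 x) hK _; exact: ch.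
apply: (cvg_unique _ _ L2); first exact: ereal_hausdorff.
have <- : (fun n => \int[m1]_x (W1 x * b n (Z1 x))%:E) =
    (fun n => \int[m2]_x (W2 x * b n (Z2 x))%:E); last exact: L1.
apply/funext => n; have [p Hp] := bern_poly n.+1 (fun k => h (k%:R / n.+1%:R)%R).
rewrite (eq_integral (fun x => (W1 x * p.[Z1 x])%:E)); last by move=> x _; rewrite /b Hp.
by rewrite eq_poly; apply: eq_integral => x _; rewrite /b Hp.
Qed.

(** Reaches discontinuous functions, such as indicators of closed intervals, as bounded pointwise
    limits of continuous ones. *)
Lemma eq_integral_limit (h : nat -> R -> R) (l : R -> R) (K : R) :
  (forall n, continuous (h n)) -> (forall n x, `|h n x| <= K)%R ->
  (forall x, h n x @[n --> \oo] --> l x) ->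
  \int[m1]_x (W1 x * l (Z1 x))%:E = \int[m2]_x (W2 x * l (Z2 x))%:E.
Proof.
move=> ch hK hl.
have mh n : measurable_fun setT (h n) by exact: continuous_measurable_fun.
have L1 := @pass_limit _ _ _ _ _ h l K iW1 mZ1
  (fun n => measurableT_comp (mh n) mZ1) (fun n x => hK n (Z1 x)) (fun x => hl (Z1 x)).
have L2 := @pass_limit _ _ _ _ _ h l K iW2 mZ2
  (fun n => measurableT_comp (mh n) mZ2) (fun n x => hK n (Z2 x)) (fun x => hl (Z2 x)).
apply: (cvg_unique _ _ L2); first exact: ereal_hausdorff.
have <- : (fun n => \int[m1]_x (W1 x * h n (Z1 x))%:E) =
    (fun n => \int[m2]_x (W2 x * h n (Z2 x))%:E); last exact: L1.
by apply/funext => n; exact: eq_integral_continuous (ch n) (hK n).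
Qed.

End moments.

(** * Uniqueness of Laplace transforms *)

Section laplace_uniqueness.
Local Open Scope ereal_scope.
Context (R : realType) (d1 d2 : measure_display)
  (T1 : measurableType d1) (T2 : measurableType d2)
  (m1 : {measure set T1 -> \bar R}) (m2 : {measure set T2 -> \bar R}).

(** Continuous approximation of the indicator of [c, e] divided by z: a plateau with sides of slope
    n. At z = exp(-X) the division removes the weight exp(-X) that is introduced for integrability;
    [Num.max z c] equals z on [c, e] and keeps the quotient bounded. *)
Let bump (c e : R) (n : nat) (z : R) : R :=
  (Num.max 0 (1 - n%:R * Num.max 0 (Num.max (c - z) (z - e))) / Num.max z c)%R.

Let bump_bounded (c e : R) n z : (0 < c)%R -> (`|bump c e n z| <= c^-1)%R.
Proof.
move=> c0; have zc : (0 < Num.max z c)%R by rewrite lt_max c0 orbT.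
have m0 (y : R) : (0 <= Num.max 0 y)%R by rewrite le_max lexx.
rewrite /bump ger0_norm; last by rewrite divr_ge0// ltW.
rewrite -[leRHS]mul1r ler_pM ?invr_ge0 ?(ltW zc)//.
  by rewrite ge_max ler01/= gerBl mulr_ge0.
by rewrite lef_pV2// le_max lexx orbT.
Qed.

Let bump_continuous (c e : R) n : (0 < c)%R -> continuous (bump c e n).
Proof.
move=> c0 z; have zc : (0 < Num.max z c)%R by rewrite lt_max c0 orbT.
have c1 : {for z, continuous (fun z : R => c - z)%R}.
  by apply: continuousB; [exact: cst_continuous|exact: (fun=> id)].
have c2 : {for z, continuous (fun z : R => z - e)%R}.
  by apply: continuousB; [exact: (fun=> id)|exact: cst_continuous].
have c3 := continuous_max c1 c2.
have c4 := continuous_max (@cst_continuous R R 0%R z) c3.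
have c5 : {for z, continuous (fun z : R => 1 - n%:R * Num.max 0 (Num.max (c - z) (z - e)))%R}.
  apply: continuousB; first exact: cst_continuous.
  by apply: continuousM => //; exact: cst_continuous.
have c6 := continuous_max (@cst_continuous R R 0%R z) c5.
have c7 := continuous_max ((fun=> id) : {for z, continuous (@idfun R)}) (@cst_continuous R R c z).
rewrite /continuous_at /bump; apply: cvgM; first exact: c6.
by apply: cvgV; [rewrite gt_eqF|exact: c7].
Qed.

Let bump_limit (c e z : R) : (0 < c)%R ->
  bump c e n z @[n --> \oo] --> ((\1_(`[c, e]%classic) z) / Num.max z c)%R.
Proof.
move=> c0; apply: cvgM; last exact: cvg_cst.
rewrite indicE; case: (boolP (z \in `[c, e]%classic)) => [|/negP].
  rewrite inE/= in_itv/= => /andP[cz ze].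
  rewrite (_ : (fun n => _) = fun=> 1%R); first exact: cvg_cst.
  apply/funext => n; rewrite (max_idPl (_ : Num.max (c - z) (z - e) <= 0)%R); last first.
    by rewrite ge_max !subr_le0 cz.
  by rewrite mulr0 subr0; apply/max_idPr.
rewrite inE/= in_itv/= => zce.
set w := Num.max _ _; have w0 : (0 < w)%R.
  rewrite /w lt_max ltxx/= lt_max !subr_gt0.
  by move: zce => /negP; rewrite negb_and -!ltNge.
apply: cvg_near_cst; near=> n.
apply/max_idPl; rewrite subr_le0 -ler_pdivrMr// mul1r.
by near: n; exact: nbhs_infty_ger.
Unshelve. all: by end_near. Qed.

(** With Z = exp(-X) and the weight W = g exp(-X), the transforms at the integers k + 1 are the
    moments of Z under W. Only W has to be integrable, so that the two measures may be infinite, as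
    is the product with Lebesgue measure in [size_biased_density]. *)
Lemma laplace_unique (g1 X1 : T1 -> R) (g2 X2 : T2 -> R) :
  measurable_fun setT g1 -> measurable_fun setT X1 ->
  measurable_fun setT g2 -> measurable_fun setT X2 ->
  (forall x, 0 <= g1 x)%R -> (forall x, 0 <= X1 x)%R ->
  (forall x, 0 <= g2 x)%R -> (forall x, 0 <= X2 x)%R ->
  \int[m1]_x (g1 x * expR (- X1 x))%:E < +oo ->
  (forall k : nat, \int[m1]_x (g1 x * expR (- (k.+1%:R * X1 x)))%:E =
                   \int[m2]_x (g2 x * expR (- (k.+1%:R * X2 x)))%:E) ->
  forall u v : R,
  \int[m1]_x (g1 x * \1_(`[u, v]%classic) (X1 x))%:E =
  \int[m2]_x (g2 x * \1_(`[u, v]%classic) (X2 x))%:E.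
Proof.
move=> mg1 mX1 mg2 mX2 g10 X10 g20 X20 fin L u v.
have mW d (T : measurableType d) (g X : T -> R) : measurable_fun setT g ->
    measurable_fun setT X -> measurable_fun setT (fun x => g x * expR (- X x))%R.
  move=> mg mX; apply: measurable_funM => //.
  by apply: measurableT_comp => //; apply: measurableT_comp.
have i1 : m1.-integrable setT (EFin \o (fun x => g1 x * expR (- X1 x))%R).
  apply/integrableP; split; first by apply/measurable_EFinP; exact: mW.
  by under eq_integral do rewrite /= ger0_norm ?mulr_ge0 ?expR_ge0//.
have i2 : m2.-integrable setT (EFin \o (fun x => g2 x * expR (- X2 x))%R).
  apply/integrableP; split; first by apply/measurable_EFinP; exact: mW.
  under eq_integral do rewrite /= ger0_norm ?mulr_ge0 ?expR_ge0//.
  have : \int[m2]_x (g2 x * expR (- (1%:R * X2 x)))%:E < +oo.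
    by rewrite -(L 0%N); under eq_integral do rewrite mul1r.
  by under eq_integral do rewrite mul1r.
pose c := expR (- v); pose e := expR (- u).
have c0 : (0 < c)%R by exact: expR_gt0.
have Zb d (T : measurableType d) (X : T -> R) : (forall x, 0 <= X x)%R ->
    forall x, (0 <= expR (- X x) <= 1)%R.
  by move=> X0 x; rewrite expR_ge0/= -[leRHS]expR0 ler_expR lerNl oppr0.
have mZ d (T : measurableType d) (X : T -> R) : measurable_fun setT X ->
    measurable_fun setT (fun x => expR (- X x)).
  by move=> mX; apply: measurableT_comp => //; apply: measurableT_comp.
have momE d (T : measurableType d) (m : {measure set T -> \bar R}) (g X : T -> R) k :
    \int[m]_x (g x * expR (- X x) * expR (- X x) ^+ k)%:E =
    \int[m]_x (g x * expR (- (k.+1%:R * X x)))%:E.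
  apply: eq_integral => x _; congr EFin; rewrite -mulrA -exprS -expRM_natl mulrN.
  by [].
have mom k : \int[m1]_x (g1 x * expR (- X1 x) * expR (- X1 x) ^+ k)%:E =
             \int[m2]_x (g2 x * expR (- X2 x) * expR (- X2 x) ^+ k)%:E.
  by rewrite !momE.
have := @eq_integral_limit R _ _ _ _ _ _ _ _ _ _ i1 i2 (mZ _ _ _ mX1) (mZ _ _ _ mX2)
  (Zb _ _ _ X10) (Zb _ _ _ X20) mom (bump c e) _ c^-1%R
  (fun n => @bump_continuous c e n c0) (fun n z => @bump_bounded c e n z c0)
  (fun z => @bump_limit c e z c0).
have E (gx x : R) :
    (gx * expR (- x) * (\1_(`[c, e]%classic) (expR (- x)) / Num.max (expR (- x)) c))%R =
    (gx * \1_(`[u, v]%classic) x)%R.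
  have -> : \1_(`[c, e]%classic) (expR (- x)) = \1_(`[u, v]%classic) x :> R.
    rewrite !indicE; congr (_%:R); congr nat_of_bool.
    apply/idP/idP; rewrite !inE/= !in_itv/= !ler_expR !lerN2 => /andP[? ?]; exact/andP.
  rewrite indicE; case: (boolP (x \in _)) => [|_]; last by rewrite mul0r !mulr0.
  rewrite inE/= in_itv/= => /andP[_ xv].
  rewrite (max_idPl _); last by rewrite ler_expR lerN2.
  by rewrite mul1r mulr1 mulfK// gt_eqF// expR_gt0.
by under eq_integral do rewrite E; under [RHS]eq_integral do rewrite E.
Qed.

End laplace_uniqueness.

Section power_integral.
Context (R : realType).
Notation mu := (@lebesgue_measure R).

Lemma integral_indic_itvcc (x y : R) : x <= y ->
  (\int[mu]_s (\1_(`[x, y]%classic) s)%:E = (y - x)%:E)%E.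
Proof.
move=> xy; rewrite integral_indic// setIT -[LHS]/(mu `[x, y]%classic).
rewrite lebesgue_measure_itv/= lte_fin; move: xy.
by rewrite le_eqVlt => /predU1P[->|->//]; rewrite ltxx subrr.
Qed.

Lemma continuous_powR (p x : R) : 0 < x -> {for x, continuous (fun y : R => y `^ p)}.
Proof.
move=> x0; apply: differentiable_continuous; apply/derivable1_diffP.
by apply: derivable_powR; rewrite in_itv/= x0.
Qed.

(** The interval is exhausted by [r / (i+2), r], where the fundamental theorem of calculus applies;
    the value of the primitive at the lower end is nonnegative and is dropped. *)
Lemma le_integral_powRN (a r : R) : a < 1 -> 0 < r ->
  (\int[mu]_(s in `]0%R, r]) (s `^ (- a))%:E <= (r `^ (1 - a) / (1 - a))%:E)%E.
Proof.
move=> a1 r0; have a1' : 0 < 1 - a by rewrite subr_gt0.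
pose F (i : nat) : set R := `[r / i.+2%:R, r]%classic.
have UF : \bigcup_i F i = `]0, r]%classic.
  apply/seteqP; split => [x [i _]|x]; rewrite /F/= !in_itv/= => /andP[x1 x2].
    by rewrite x2 andbT (lt_le_trans _ x1)// divr_gt0.
  have e0 : 0 < x / r by rewrite divr_gt0.
  have [N _ HN] := near_infty_natSinv_lt (PosNum e0).
  exists N => //=; rewrite in_itv/= x2 andbT.
  have := HN N.+1 (leqnSn N) => /= /ltW.
  by rewrite ler_pdivlMr// mulrC.
have mF i : measurable (F i) by exact: measurable_itv.
have mf i : measurable_fun (F i) (fun s : R => (s `^ (- a))%:E).
  by apply: measurable_funTS; apply/measurable_EFinP; exact: measurable_powR.
have H : (\int[mu]_(x in F i) (x `^ (- a))%:E)%E @[i --> \oo] -->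
    (\int[mu]_(x in `]0%R, r]) (x `^ (- a))%:E)%E.
  rewrite -UF; apply: ge0_nondecreasing_set_cvg_integral => //.
  - apply/nondecreasing_seqP => i; apply/subsetPset => x.
    rewrite /F/= !in_itv/= => /andP[x1 ->]; rewrite andbT (le_trans _ x1)//.
    by rewrite ler_pM2l// lef_pV2 ?posrE// ler_nat.
  - by move=> i x _; rewrite lee_fin powR_ge0.
rewrite -(cvg_lim _ H)//; apply: lime_le; first by apply/cvg_ex; eexists; exact: H.
apply: nearW => i.
have i0 : 0 < r / i.+2%:R by rewrite divr_gt0.
have ir : r / i.+2%:R < r by rewrite ltr_pdivrMr// ltr_pMr// ltr1n.
pose G (x : R) := x `^ (1 - a) / (1 - a).
have dG (x : R) : 0 < x -> derivable G x 1.
  by move=> x0; apply: derivableM; [apply: derivable_powR; rewrite in_itv/= x0|exact: derivable_cst].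
have cG (x : R) : 0 < x -> {for x, continuous G}.
  by move=> x0; apply: differentiable_continuous; apply/derivable1_diffP; exact: dG.
rewrite /F (@continuous_FTC2 _ _ G)//.
- rewrite -EFinB lee_fin lerBlDr lerDl; apply: divr_ge0; [exact: powR_ge0|exact: ltW].
- apply: continuous_in_subspaceT => x; rewrite inE/= in_itv/= => /andP[x1 _].
  by apply: continuous_powR; exact: lt_le_trans x1.
- split.
  + by move=> x; rewrite in_itv/= => /andP[x1 _]; apply: dG; exact: lt_trans x1.
  + by apply: cvg_at_right_filter; exact: cG.
  + by apply: cvg_at_left_filter; exact: cG.
- move=> x; rewrite in_itv/= => /andP[x1 _]; have x0 : 0 < x by exact: lt_trans x1.
  rewrite /G derive1Mr; last by apply: derivable_powR; rewrite in_itv/= x0.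
  rewrite powR_derive1 ?in_itv/= ?x0// mulrAC mulfV ?gt_eqF// mul1r; congr (_ `^ _).
  by ring.
Qed.

End power_integral.

(** * A density bound from a self-improving inequality *)

Section density.
Context (R : realType).
Notation mu := (@lebesgue_measure R).

(* With [q = 1/(1-a)], absorb the part [s <= c u^q] of the integral into the
   supremum of [u^q P(H, u <= X <= u+delta)]; the powers of [u] match exactly. *)
Lemma density_bound (K a : R) : 0 <= K -> 0 < a < 1 ->
  exists2 C : R, 0 <= C & forall (d : measure_display) (T : measurableType d)
    (P : probability T R) (H : set T) (X : T -> R) (delta : R),
  measurable H -> measurable_fun setT X -> 0 < delta ->
  (forall u : R, 0 < u <= 1 ->
    (u%:E * P (H `&` X @^-1` `[u, (u + delta)%R]) <=
     \int[mu]_(s in `]0%R, 2%R])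
       ((K * s `^ (- a))%:E * P (H `&` X @^-1` `[(u - s)%R, (u - s + delta)%R])))%E) ->
  forall u : R, 2^-1 <= u <= 1 ->
    (P (H `&` X @^-1` `[u, (u + delta)%R]) <= (C * delta)%:E * P H)%E.
Proof.
move=> K0 /andP[a0 a1]; have a1' : 0 < 1 - a by rewrite subr_gt0.
pose q := (1 - a)^-1; have q0 : 0 < q by rewrite invr_gt0.
pose k := 2 `^ q * K / (1 - a).
have k0 : 0 <= k by rewrite /k divr_ge0 ?(ltW a1')// mulr_ge0// powR_ge0.
(* [k] collects the constants of the near part s <= c u^q. The choice of [c] makes k c^(1-a) at most
   1/2, which allows the absorption, and c <= 1/2 keeps u - s >= u / 2 on that part. *)
pose c1 : R := (2 * (k + 1))^-1.
have c10 : 0 < c1 by rewrite invr_gt0 mulr_gt0// ltr_wpDl.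
pose c : R := Num.min 2^-1 (c1 `^ q).
have c0 : 0 < c by rewrite lt_min invr_gt0 ltr0n/= powR_gt0.
have c12 : c <= 2^-1 by rewrite ge_min lexx.
have ck : k * c `^ (1 - a) <= 2^-1.
  have : c `^ (1 - a) <= c1.
    have -> : c1 = (c1 `^ q) `^ (1 - a) by rewrite -powRrM mulVf ?powRr1 ?ltW// gt_eqF.
    by apply: ge0_ler_powR; rewrite ?nnegrE ?powR_ge0 ?(ltW a1') ?(ltW c0)// ge_min lexx orbT.
  move=> cc1; apply: (@le_trans _ _ (k * c1)); first by rewrite ler_wpM2l.
  rewrite /c1 invfM mulrCA ler_piMr ?invr_ge0// ler_pdivrMr ?mul1r ?lerDl//.
  by rewrite ltr_wpDl.
pose C := 2 `^ q * (2 * K * c `^ (- a)).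
have C0 : 0 <= C by rewrite !mulr_ge0 ?powR_ge0.
exists C => // d T P H X delta mH mX d0 Hyp.
have mN u v : measurable (H `&` X @^-1` `[u, v]).
  by apply: measurableI => //; rewrite -[X in measurable X]setTI; exact: mX.
pose J u : set R := `[u, u + delta]%classic.
pose N u := P (H `&` X @^-1` `[u, u + delta]).
have NH u : (N u <= P H)%E by rewrite le_measure ?inE//; exact: subIsetl.
have PHfin : P H \is a fin_num by rewrite fin_num_measure.
have Nfin u : N u \is a fin_num by rewrite /N fin_num_measure.
pose m := fine (P H); have m0 : 0 <= m by rewrite fine_ge0.
pose F u := fine (N u).
have F0 u : 0 <= F u by rewrite fine_ge0.
have Fm u : F u <= m by rewrite fine_le.
(* The supremum [Q] of this set is at most P(H), hence finite, without which Q <= Q / 2 + ... would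
   say nothing. *)
pose S := [set u `^ q * F u | u in `]0, 1]].
have S1 : S (1 `^ q * F 1) by exists 1 => //=; rewrite in_itv/= ltr01 lexx.
have Sub : ubound S m.
  move=> y [u /=]; rewrite in_itv/= => /andP[u0 u1] <-{y}.
  by rewrite (le_trans _ (Fm u))// ler_piMl// -[leRHS](powRr0 u) ger_powR ?u0// ltW.
have supS : has_sup S by split; [exists (1 `^ q * F 1)|exists m].
pose Q := sup S.
have QP u : 0 < u <= 1 -> u `^ q * F u <= Q.
  by move=> u01; apply: sup_upper_bound => //; exists u => //=; rewrite in_itv.
have Q0 : 0 <= Q by apply: le_trans (QP 1 _); rewrite ?mulr_ge0 ?powR_ge0// ltr01 lexx.
have mJ u : measurable (J u) by exact: measurable_itv.
have mG u : measurable_fun setT (fun z : measurableTypeR R * T =>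
    (\1_H z.2 * \1_(J u) (X z.2 + z.1))%:E : \bar R).
  apply/measurable_EFinP; apply: measurable_funM.
    by apply: measurable_indic_comp => //; exact: measurable_snd.
  apply: measurable_indic_comp => //; apply: measurable_funD => //.
  exact: (measurableT_comp mX measurable_snd).
have NE u s : N (u - s) = (\int[P]_om
    (\1_H om * \1_(J u) (X om + s))%:E)%E.
  have := integral_indic P measurableT (mN (u - s) (u - s + delta)).
  rewrite setIT /N => <-; apply: eq_integral => om _.
  rewrite !indicE in_setI -mulnb natrM; congr (_ * _)%:E; congr (_%:R); congr nat_of_bool.
  by apply/idP/idP; rewrite !inE /J/= !in_itv/= => /andP[h1 h2]; apply/andP; clear - h1 h2; split; lra.
have mNs u : measurable_fun setT (fun s : R => N (u - s)).
  under eq_fun do rewrite NE.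
  exact: (measurable_fun_fubini_tonelli_F (m2 := P) _ (mG u) (fun z => _)).
(* Tonelli: for fixed [om], the set of [s] with X om + s in [u, u + delta] has length delta. The far
   part of the integral, where the kernel is bounded, costs no more than this. *)
have intN (u : R) : (\int[mu]_s N (u - s)%R <= (delta * m)%:E)%E.
  under eq_integral do rewrite NE.
  rewrite (fubini_tonelli (m1 := mu) (m2 := P) _ (mG u)); last first.
    by move=> z; rewrite lee_fin mulr_ge0.
  apply: (@le_trans _ _ (\int[P]_om (delta * \1_H om)%:E)%E).
    apply: ge0_le_integral => //.
    - by move=> om _; apply: integral_ge0 => s _; rewrite lee_fin mulr_ge0.
    - apply: (measurable_fun_fubini_tonelli_G (m1 := mu) _ (mG u)).
      by move=> z; rewrite lee_fin mulr_ge0.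
    - by apply/measurable_EFinP; apply: measurable_funM => //; exact: measurable_indic.
    - move=> om _; under eq_integral do rewrite EFinM /=.
      rewrite ge0_integralZl//; last first.
        by apply/measurable_EFinP; apply: measurable_indic_comp => //; exact: measurable_funD.
      rewrite mulrC EFinM lee_wpmul2l ?lee_fin//.
      have -> : (fun s : R => (\1_(J u) (X om + s))%:E) =
          (fun s : R => (\1_(`[u - X om, u - X om + delta]%classic) s)%:E : \bar R).
        apply/funext => s; rewrite !indicE; congr (_%:R%:E); congr nat_of_bool.
        by apply/idP/idP; rewrite !inE /J/= !in_itv/= => /andP[h1 h2]; apply/andP; clear - h1 h2; split; lra.
      by rewrite integral_indic_itvcc ?lee_fin; lra.
  under eq_integral do rewrite EFinM.
  rewrite ge0_integralZl ?lee_fin ?(ltW d0)//; last first.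
    by apply/measurable_EFinP; exact: measurable_indic.
  by rewrite integral_indic// setIT EFinM /m fineK.
have main u : 0 < u <= 1 -> u `^ q * F u <= 2^-1 * Q + K * c `^ (- a) * (delta * m).
  move=> /[dup] u01 /andP[u0 u1].
  pose r := c * u `^ q.
  have r0 : 0 < r by rewrite mulr_gt0// powR_gt0.
  have ru : r <= u / 2.
    rewrite /r [leRHS]mulrC ler_pM ?powR_ge0 ?(ltW c0)//.
    have q1 : 1 <= q by rewrite /q invf_ge1//; lra.
    by rewrite -[leRHS]powRr1 ?(ltW u0)// ger_powR ?u0.
  (* This is what fixes q = 1 / (1 - a): the integral of s^(-a) up to c u^q is linear in u, like the
     left-hand side of the hypothesis. *)
  have r1a : r `^ (1 - a) = c `^ (1 - a) * u.
    rewrite /r powRM ?powR_ge0 ?(ltW c0)// -powRrM mulVf ?gt_eqF//.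
    by rewrite powRr1 ?ltW.
  have rNa : r `^ (- a) = c `^ (- a) * u `^ (- (q * a)).
    by rewrite /r powRM ?powR_ge0 ?(ltW c0)// -powRrM mulrN.
  have mk : measurable_fun setT (fun s : R => (K * s `^ (- a))%:E).
    by apply/measurable_EFinP; apply: measurable_funM => //; exact: measurable_powR.
  have mkN : measurable_fun setT (fun s : R => (K * s `^ (- a))%:E * N (u - s)%R)%E.
    exact: emeasurable_funM.
  have kN0 (s : R) : (0 <= (K * s `^ (- a))%:E * N (u - s)%R)%E.
    by rewrite mule_ge0// lee_fin mulr_ge0// powR_ge0.
  have part1 : (\int[mu]_(s in `]0%R, r]) ((K * s `^ (- a))%:E * N (u - s)%R) <=
      (2^-1 * Q * u `^ (- q) * u)%:E)%E.
    apply: (@le_trans _ _ (\int[mu]_(s in `]0%R, r])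
        ((K * (2 `^ q * u `^ (- q) * Q))%:E * (s `^ (- a))%:E))%E).
      apply: ge0_le_integral => //=.
      - exact: measurable_funTS.
      - by apply: measurable_funTS; apply: emeasurable_funM => //;
          apply/measurable_EFinP; exact: measurable_powR.
      move=> s; rewrite in_itv/= => /andP[s0 sr].
      rewrite -[N (u - s)%R]fineK// -EFinM -EFinM lee_fin -!mulrA ler_wpM2l//.
      have -> : 2 `^ q * (u `^ (- q) * (Q * s `^ (- a))) =
          2 `^ q * u `^ (- q) * Q * s `^ (- a) by ring.
      rewrite mulrC ler_wpM2r ?powR_ge0//.
      have us0 : 0 < u - s by clear - sr ru u0; lra.
      have us : 0 < u - s <= 1 by rewrite us0/=; clear - s0 u1; lra.
      have hq : 0 < (u - s) `^ q by rewrite powR_gt0.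
      have := QP _ us; rewrite mulrC -ler_pdivlMr// => /le_trans; apply.
      rewrite mulrC ler_wpM2r// powRN -invf_div lef_pV2 ?posrE//; last first.
        by rewrite divr_gt0 ?powR_gt0.
      rewrite ler_pdivrMr ?powR_gt0// -powRM//; last exact: ltW.
      by apply: ge0_ler_powR; rewrite ?nnegrE; clear - q0 u0 us0 sr ru; lra.
    rewrite ge0_integralZl//; last 3 first.
    - by apply: measurable_funTS; apply/measurable_EFinP; exact: measurable_powR.
    - by move=> s _; rewrite lee_fin powR_ge0.
    - by rewrite lee_fin !mulr_ge0 ?powR_ge0.
    apply: (@le_trans _ _ ((K * (2 `^ q * u `^ (- q) * Q))%:E * (r `^ (1 - a) / (1 - a))%:E)%E).
      by apply: lee_wpmul2l; [rewrite lee_fin !mulr_ge0 ?powR_ge0|exact: le_integral_powRN].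
    rewrite -EFinM lee_fin r1a.
    have -> : K * (2 `^ q * u `^ (- q) * Q) * (c `^ (1 - a) * u / (1 - a)) =
        k * c `^ (1 - a) * (Q * u `^ (- q) * u) by rewrite /k; ring.
    have -> : 2^-1 * Q * u `^ (- q) * u = 2^-1 * (Q * u `^ (- q) * u) by ring.
    by rewrite ler_wpM2r// !mulr_ge0 ?powR_ge0// ltW.
  have part2 : (\int[mu]_(s in `]r, 2%R]) ((K * s `^ (- a))%:E * N (u - s)%R) <=
      (K * r `^ (- a) * (delta * m))%:E)%E.
    apply: (@le_trans _ _ (\int[mu]_(s in `]r, 2%R]) ((K * r `^ (- a))%:E * N (u - s)%R))%E).
      apply: ge0_le_integral => //=.
      - exact: measurable_funTS.
      - by apply: measurable_funTS; apply: emeasurable_funM => //; exact: mNs.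
      move=> s; rewrite in_itv/= => /andP[sr _].
      rewrite lee_wpmul2r// lee_fin ler_wpM2l// !powRN lef_pV2 ?posrE ?powR_gt0//.
        by apply: ge0_ler_powR; rewrite ?nnegrE; clear - a0 r0 sr; lra.
      exact: lt_trans sr.
    rewrite ge0_integralZl//; last 2 first.
    - by apply: measurable_funTS; exact: mNs.
    - by rewrite lee_fin mulr_ge0 ?powR_ge0.
    rewrite [leRHS]EFinM lee_wpmul2l ?lee_fin ?mulr_ge0 ?powR_ge0//.
    by apply: le_trans (intN u); apply: ge0_subset_integral => //; exact: mNs.
  have : (u%:E * N u <= (2^-1 * Q * u `^ (- q) * u + K * r `^ (- a) * (delta * m))%:E)%E.
    apply: (le_trans (Hyp u u01)); rewrite EFinD; apply: le_trans (leeD part1 part2).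
    rewrite -ge0_integral_setU//.
    - apply: ge0_subset_integral => //.
      + exact: measurableU.
      + exact: measurable_funTS.
      + move=> s /=; rewrite !in_itv/= => /andP[s0 s2].
        by have [sr|sr] := leP s r; [left|right]; rewrite ?s0 ?s2 ?sr.
    - exact: measurable_funTS.
    - apply/disj_setPS => s [] /=; rewrite !in_itv/= => /andP[_ sr] /andP[].
      by rewrite ltNge sr.
  rewrite -[N u]fineK// -/(F u) -EFinM lee_fin rNa => H1.
  have H2 := ler_wpM2l (powR_ge0 u (q - 1)) H1.
  have uq : u `^ (q - 1) * u = u `^ q by rewrite mulrC mulr_powRB1// ltW.
  have uN0 : u != 0 by rewrite gt_eqF.
  have uqN : u `^ q * u `^ (- q) = 1 by rewrite -powRD ?uN0 ?implybT// subrr powRr0.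
  have uqa : u `^ (q - 1) * u `^ (- (q * a)) = 1.
    rewrite -powRD ?uN0 ?implybT//; have -> : q - 1 - q * a = 0; last by rewrite powRr0.
    by rewrite /q; field; rewrite gt_eqF.
  move: H2; rewrite mulrA uq mulrDr.
  have -> : u `^ (q - 1) * (2^-1 * Q * u `^ (- q) * u) =
      2^-1 * Q * ((u `^ (q - 1) * u) * u `^ (- q)) by ring.
  have -> : u `^ (q - 1) * (K * (c `^ (- a) * u `^ (- (q * a))) * (delta * m)) =
      K * c `^ (- a) * (delta * m) * (u `^ (q - 1) * u `^ (- (q * a))) by ring.
  by rewrite uq uqN uqa !mulr1.
have QC : Q <= 2 * K * c `^ (- a) * (delta * m).
  suff : Q <= 2^-1 * Q + K * c `^ (- a) * (delta * m) by lra.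
  apply: ge_sup; first by exists (1 `^ q * F 1).
  by move=> _ [u /= u01 <-]; apply: main; move: u01; rewrite in_itv.
move=> u /andP[u2 u1]; have u0 : 0 < u by lra.
rewrite -/(N u) -[N u]fineK// -[P H]fineK// -EFinM lee_fin -/(F u) -/m.
have uq0 : 0 < u `^ q by rewrite powR_gt0.
have := QP u; rewrite u0 u1 => /(_ isT); rewrite mulrC -ler_pdivlMr// => /le_trans; apply.
rewrite ler_pdivrMr// (le_trans QC)//.
have -> : C * delta * m * u `^ q = 2 * K * c `^ (- a) * (delta * m) * (2 `^ q * u `^ q).
  by rewrite /C; ring.
rewrite ler_peMr//; first by rewrite !mulr_ge0 ?powR_ge0// ltW.
rewrite -powRM ?(ltW u0)// -[leLHS](powRr0 (2 * u)); apply: ler_powR; clear - u2 q0; lra.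
Qed.

End density.

(** * Increments of powers, the power kernel and Euler's Gamma function *)

Section power_estimates.
Context (R : realType).
Notation mu := (@lebesgue_measure R).
Implicit Types (p h l : R).

(** Young's inequality for (1 + x)^p and 1 with the conjugate exponents 1/p and 1/(1-p). *)
Lemma powR_bernoulli p (x : R) : 0 < p < 1 -> -1 <= x -> (1 + x) `^ p <= 1 + p * x.
Proof.
move=> /andP[p0 p1] x1; have p1' : 0 < 1 - p by rewrite subr_gt0.
have x0 : 0 <= 1 + x by lra.
have := @conjugate_powR _ ((1 + x) `^ p) 1 p^-1 (1 - p)^-1 (powR_ge0 _ _) ler01.
rewrite !invr_gt0 !invrK => /(_ p0 p1').
rewrite mulr1 -powRrM mulfV ?gt_eqF// powRr1// powR1 mul1r.
by move=> /(_ ltac:(lra)) /le_trans; apply; lra.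
Qed.

(** Bernoulli's inequality, used at l for the upper bound and at l + h for the lower one. The loss l
    / (l + h) does not depend on p, hence can be taken out of an integral over exponents that vary
    along the path. *)
Lemma powR_increment p l h : 0 < p < 1 -> 0 < l -> 0 < h ->
  h * (p * l `^ (p - 1) * (l / (l + h))) <= (l + h) `^ p - l `^ p <= h * (p * l `^ (p - 1)).
Proof.
move=> p01 l0 h0; have /andP[p0 p1] := p01.
have lh0 : 0 < l + h by rewrite addr_gt0.
have lp y : 0 < y -> y `^ p = y * y `^ (p - 1) by move=> y0; rewrite mulr_powRB1// ltW.
apply/andP; split; last first.
  have : (1 + h / l) `^ p <= 1 + p * (h / l).
    by apply: powR_bernoulli => //; rewrite (@le_trans _ _ 0)// divr_ge0// ltW.
  move/(ler_wpM2l (powR_ge0 l p)).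
  rewrite -powRM ?(ltW l0)//; last by rewrite addr_ge0// divr_ge0// ltW.
  have -> : l * (1 + h / l) = l + h by field; rewrite gt_eqF.
  rewrite lerBlDl => /le_trans; apply.
  rewrite lp// mulrDr mulr1 lerD2l le_eqVlt; apply/orP; left; apply/eqP.
  by field; rewrite gt_eqF.
have : (1 - h / (l + h)) `^ p <= 1 - p * (h / (l + h)).
  have b1 : -1 <= - (h / (l + h)) by rewrite lerN2 ler_pdivrMr// mul1r lerDr ltW.
  by have := powR_bernoulli p01 b1; rewrite mulrN.
move/(ler_wpM2l (powR_ge0 (l + h) p)).
have d0 : 1 - h / (l + h) = l / (l + h) by field; rewrite gt_eqF.
rewrite -powRM ?(ltW lh0)//; last by rewrite d0 divr_ge0 ?ltW.
rewrite d0 (_ : (l + h) * (l / (l + h)) = l); last by field; rewrite gt_eqF.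
move=> H; have {H} : (l + h) `^ p - l `^ p >= (l + h) `^ p * (p * (h / (l + h))) by lra.
apply: le_trans.
have -> : h * (p * l `^ (p - 1) * (l / (l + h))) = (l * l `^ (p - 1)) * (p * (h / (l + h))).
  by ring.
rewrite -lp//; apply: ler_wpM2r.
  by apply: mulr_ge0; [exact: ltW|apply: divr_ge0; exact: ltW].
by apply: ge0_ler_powR; rewrite ?nnegrE ?ltW// ltrDl.
Qed.

(* [s ^ (- p)] on [0 < s], and [0] elsewhere *)
Definition pow_kernel p (s : R) : R := \1_(`]0, +oo[%classic) s * expR (- (p * ln s)).

Lemma pow_kernelE p s : 0 < s -> pow_kernel p s = s `^ (- p).
Proof.
move=> s0; rewrite /pow_kernel indicE mem_set/= ?in_itv/= ?s0//.
by rewrite mul1r /powR gt_eqF// mulNr.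
Qed.

Lemma pow_kernel_ge0 p s : 0 <= pow_kernel p s.
Proof. by rewrite mulr_ge0 ?expR_ge0. Qed.

Lemma pow_kernel_le0 p s : s <= 0 -> pow_kernel p s = 0.
Proof.
by move=> s0; rewrite /pow_kernel indicE memNset ?mul0r//= in_itv/= andbT => /lt_geF; rewrite s0.
Qed.

(** Joint measurability in exponent and argument is the reason for writing the kernel with [expR]
    and [ln]: it becomes a composition of measurable functions. *)
Lemma measurable_pow_kernel d (T : measurableType d) (q s : T -> R) :
  measurable_fun setT q -> measurable_fun setT s ->
  measurable_fun setT (fun x => pow_kernel (q x) (s x)).
Proof.
move=> mq ms; apply: measurable_funM; first exact: measurable_indic_comp.
apply: measurableT_comp => //; apply: measurableT_comp => //.
by apply: measurable_funM => //; apply: measurableT_comp.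
Qed.

(** Lebesgue measure is determined by its values on half-open intervals, so that its image under
    multiplication by l is l^-1 times itself. *)
Lemma integral_scale (f : R -> \bar R) l : 0 < l -> measurable_fun setT f ->
  (forall x, 0 <= f x)%E ->
  (\int[mu]_s f (l * s)%R = (l^-1)%:E * \int[mu]_s f s)%E.
Proof.
move=> l0 mf f0.
have ml : measurable_fun setT (fun s : measurableTypeR R => (l * s)%R : measurableTypeR R).
  exact: measurable_funM.
have l1 : 0 <= l^-1 by rewrite invr_ge0 ltW.
pose nl : {nonneg R} := NngNum l1.
pose phi : {mfun measurableTypeR R >-> measurableTypeR R} :=
  HB.pack (fun s : measurableTypeR R => (l * s)%R : measurableTypeR R)
    (isMeasurableFun.Build _ _ _ _ _ ml).
have E (A : set (measurableTypeR R)) : measurable A ->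
    mscale nl mu A = pushforward mu phi A.
  move=> mA; rewrite /mscale/= (lebesgue_measure_unique (mu := mscale (NngNum (ltW l0)) (pushforward mu phi)))//.
    by rewrite /mscale/= muleA -EFinM mulVf ?mul1e// gt_eqF.
  move=> _ [[a b] /= ab <-].
  rewrite /mscale/= /pushforward.
  have -> : (fun s : R => l * s) @^-1` `]a, b]%classic = `]a / l, b / l]%classic.
    by apply/seteqP; split => s; rewrite /= !in_itv/= ltr_pdivrMr// ler_pdivlMr// [l * _]mulrC.
  rewrite !lebesgue_measure_itv/= !lte_fin ltr_pM2r ?invr_gt0//.
  case: ifPn => _; last by rewrite mule0.
  by rewrite -!EFinB -EFinM; congr EFin; field; rewrite gt_eqF.
transitivity (\int[mscale nl mu]_s f s)%E; last by rewrite ge0_integral_mscale.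
rewrite [RHS](eq_measure_integral (pushforward mu phi)); last by move=> A mA _; exact: E.
by rewrite ge0_integral_pushforward.
Qed.

Lemma lebesgue_measure_translate (x : R) (A : set R) : measurable A ->
  mu ((fun s => s + x) @^-1` A) = mu A.
Proof.
move=> mA.
have ml : measurable_fun setT (fun s : measurableTypeR R => (s + x)%R : measurableTypeR R).
  exact: measurable_funD.
pose phi : {mfun measurableTypeR R >-> measurableTypeR R} :=
  HB.pack (fun s : measurableTypeR R => (s + x)%R : measurableTypeR R)
    (isMeasurableFun.Build _ _ _ _ _ ml).
rewrite [RHS](lebesgue_measure_unique (mu := pushforward mu phi))// => _ [[a b] /= ab <-].
rewrite /pushforward.
have -> : (fun s : R => s + x) @^-1` `]a, b]%classic = `]a - x, b - x]%classic.
  by apply/seteqP; split => s; rewrite /= !in_itv/= ltrBlDr lerBrDr.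
rewrite !lebesgue_measure_itv/= !lte_fin ltrD2r.
by case: ifPn => // _; rewrite -!EFinB; congr EFin; ring.
Qed.

(* [gam p] is the value of Euler's Gamma function at [1 - p]. *)
Definition gam p : R := fine (\int[mu]_s (pow_kernel p s * expR (- s))%:E).

Let gam_ereal p := (\int[mu]_s (pow_kernel p s * expR (- s))%:E)%E.

Let measurable_gam_fun p :
  measurable_fun setT (fun s : R => (pow_kernel p s * expR (- s))%:E).
Proof.
apply/measurable_EFinP; apply: measurable_funM.
  by apply: measurable_pow_kernel.
by apply: measurableT_comp => //; apply: measurableT_comp => //.
Qed.

Lemma gam_fin p : 0 <= p < 1 -> gam_ereal p \is a fin_num.
Proof.
move=> /andP[p0 p1]; rewrite ge0_fin_numE; last first.
  by apply: integral_ge0 => s _; rewrite lee_fin mulr_ge0 ?pow_kernel_ge0 ?expR_ge0.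
have mf := measurable_gam_fun p.
pose A := `]0, 1]%classic : set R.
have mA : measurable A by exact: measurable_itv.
pose g (s : R) := \1_A s * s `^ (- p) + exponential_pdf 1 s.
apply: (@le_lt_trans _ _ (\int[mu]_s (g s)%:E)%E).
  apply: ge0_le_integral => //.
  - by move=> s _; rewrite lee_fin mulr_ge0 ?pow_kernel_ge0 ?expR_ge0.
  - apply/measurable_EFinP; apply: measurable_funD; last exact: measurable_exponential_pdf.
    apply: measurable_funM; first exact: measurable_indic.
    exact: measurable_powR.
  - move=> s _; rewrite lee_fin /g.
    have [s0|s0] := leP s 0.
      by rewrite pow_kernel_le0// mul0r addr_ge0 ?mulr_ge0 ?powR_ge0// exponential_pdf_ge0.
    rewrite pow_kernelE//.
    have es : expR (- s) <= 1 by rewrite -expR0 ler_expR oppr_le0 ltW.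
    have [s1|s1] := leP s 1.
      have -> : \1_A s = 1 :> R by rewrite indicE mem_set// /A/= in_itv/= s0 s1.
      rewrite mul1r -[leLHS]addr0 lerD ?exponential_pdf_ge0//.
      by rewrite ler_piMr ?powR_ge0.
    rewrite -[leLHS]add0r lerD ?mulr_ge0 ?powR_ge0//.
    have -> : exponential_pdf 1 s = expR (- s).
      by rewrite exponential_pdfE ?(ltW s0)// mul1r mulN1r.
    rewrite ler_piMl ?expR_ge0// -[leRHS](powRr0 s); apply: ler_powR; first exact: ltW.
    by rewrite oppr_le0.
rewrite /g; under eq_integral do rewrite EFinD.
rewrite ge0_integralD//; last 4 first.
- by move=> s _; rewrite lee_fin mulr_ge0 ?powR_ge0.
- apply/measurable_EFinP; apply: measurable_funM; first exact: measurable_indic.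
  exact: measurable_powR.
- by move=> s _; rewrite lee_fin exponential_pdf_ge0.
- by apply/measurable_EFinP; exact: measurable_exponential_pdf.
rewrite lte_add_pinfty//; last by rewrite integral_exponential_pdf ?ltry.
have -> : (fun s : R => (\1_A s * s `^ (- p))%:E) = (fun s : R => (s `^ (- p))%:E) \_ A.
  by apply/funext => s; rewrite patchE indicE; case: ifPn => _; rewrite (mul1r,mul0r).
rewrite -integral_mkcond; apply: le_lt_trans (le_integral_powRN p1 ltr01) _.
by rewrite ltry.
Qed.

(** On ]0, 1] the integrand is at least exp(-1). The bound is uniform in p, which bounds the factor
    1 / [gam] of the kernels below. *)
Lemma gam_ge p : 0 <= p < 1 -> expR (- 1) <= gam p.
Proof.
move=> p01; have /andP[p0 p1] := p01.
rewrite -lee_fin /gam fineK; last exact: gam_fin.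
have mf := measurable_gam_fun p.
pose A := `]0, 1]%classic : set R.
have mA : measurable A by exact: measurable_itv.
apply: (@le_trans _ _ (\int[mu]_s (expR (- 1) * \1_A s)%:E)%E).
  under eq_integral do rewrite EFinM.
  rewrite ge0_integralZl ?lee_fin ?expR_ge0//; last first.
    by apply/measurable_EFinP; exact: measurable_indic.
  rewrite integral_indic// setIT -[X in (_ <= _ * X)%E]/(mu A) lebesgue_measure_itv/= lte_fin ltr01.
  by rewrite oppr0 adde0 mule1.
apply: ge0_le_integral => //.
  by apply/measurable_EFinP; apply: measurable_funM => //; exact: measurable_indic.
move=> s _; rewrite lee_fin indicE; case: (boolP (s \in A)) => [|_]; last first.
  by rewrite mulr0 mulr_ge0 ?pow_kernel_ge0 ?expR_ge0.
rewrite inE /A/= in_itv/= => /andP[s0 s1].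
rewrite mulr1 pow_kernelE// -[leLHS]mul1r ler_pM ?expR_ge0//; last by rewrite ler_expR lerN2.
by rewrite -[leLHS](powRr0 s) ger_powR ?s0// oppr_le0.
Qed.

Lemma gam_scale p l : 0 <= p < 1 -> 0 < l ->
  (\int[mu]_s (pow_kernel p s * expR (- (l * s)))%:E = (l `^ (p - 1) * gam p)%:E)%E.
Proof.
move=> p01 l0.
have mf := measurable_gam_fun p.
have -> : (\int[mu]_s (pow_kernel p s * expR (- (l * s)))%:E)%E =
    (\int[mu]_s ((l `^ p)%:E * (pow_kernel p (l * s)%R * expR (- (l * s)))%:E))%E.
  apply: eq_integral => s _; rewrite -EFinM mulrA; congr (_ * _)%:E.
  have [s0|s0] := leP s 0.
    by rewrite !pow_kernel_le0 ?mulr0// pmulr_rle0.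
  rewrite !pow_kernelE ?mulr_gt0// powRM ?(ltW l0) ?(ltW s0)//.
  by rewrite mulrA -powRD; [rewrite subrr powRr0 mul1r|rewrite (gt_eqF l0) implybT].
have mf' : measurable_fun setT (fun s : R => (pow_kernel p (l * s)%R * expR (- (l * s)))%:E).
  apply: (measurableT_comp mf (_ : measurable_fun setT (fun s : R => l * s))).
  exact: measurable_funM.
rewrite ge0_integralZl//; last 2 first.
- by move=> s _; rewrite lee_fin mulr_ge0 ?pow_kernel_ge0 ?expR_ge0.
- by rewrite lee_fin powR_ge0.
rewrite (integral_scale (f := fun s => (pow_kernel p s * expR (- s))%:E))//; last first.
  by move=> s; rewrite lee_fin mulr_ge0 ?pow_kernel_ge0 ?expR_ge0.
rewrite -[X in (_ * (_ * X))%E]fineK; last exact: gam_fin.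
rewrite -!EFinM mulrA; congr (_ * _)%:E.
by rewrite powRB; [rewrite powRr1// ltW|rewrite (gt_eqF l0) implybT].
Qed.

Lemma measurable_gam d (T : measurableType d) (q : T -> R) :
  measurable_fun setT q -> measurable_fun setT (fun x => gam (q x)).
Proof.
move=> mq; have mh : measurable_fun setT (fun z : T * measurableTypeR R =>
    (pow_kernel (q z.1) z.2 * expR (- z.2))%:E).
  apply/measurable_EFinP; apply: measurable_funM.
    apply: measurable_pow_kernel; last exact: measurable_snd.
    exact: (measurableT_comp mq measurable_fst).
  by apply: measurableT_comp => //; apply: measurableT_comp => //.
apply: (measurableT_comp (fine_measurable measurableT)).
apply: (measurable_fun_fubini_tonelli_F (m2 := mu) _ mh).
by move=> z; rewrite lee_fin mulr_ge0 ?pow_kernel_ge0 ?expR_ge0.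
Qed.

End power_estimates.

Section exponential_increment.
Context (R : realType).

Let increment (A b : R) : expR (- A) - expR (- (A + b)) = expR (- A) * (1 - expR (- b)).
Proof. by rewrite opprD expRD mulrBr mulr1. Qed.

Lemma expR_increment_bound (A b D : R) (n : nat) : 0 <= b -> n.+1%:R * b <= D ->
  0 <= n.+1%:R * (expR (- A) - expR (- (A + b))) <= D * expR (- A).
Proof.
move=> b0 bD; rewrite increment; have e1 : expR (- b) <= 1.
  by rewrite -expR0 ler_expR oppr_le0.
apply/andP; split; first by rewrite !mulr_ge0 ?expR_ge0// subr_ge0.
rewrite mulrCA mulrC ler_wpM2r ?expR_ge0// (le_trans _ bD)// ler_wpM2l//.
by have := expR_ge1Dx (- b); lra.
Qed.

(** Difference quotient of the exponential when the increment is known only up to the factor [r n].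
    The lower bound comes from 1 - exp(-b) >= b / (1 + b). *)
Lemma expR_increment_cvg (A D : R) (b r : nat -> R) : 0 <= D ->
  (forall n, 0 <= b n) -> (forall n, D * r n <= n.+1%:R * b n <= D) ->
  r n @[n --> \oo] --> (1 : R) ->
  n.+1%:R * (expR (- A) - expR (- (A + b n))) @[n --> \oo] --> D * expR (- A).
Proof.
move=> D0 b0 bD rl.
pose L n := D * r n / (1 + D / n.+1%:R) * expR (- A).
apply: (@squeeze_cvgr _ _ _ _ L (fun=> D * expR (- A))).
- apply: nearW => n; have /andP[b1 b2] := bD n.
  have /andP[_ ->] := expR_increment_bound A (b0 n) b2; rewrite andbT.
  rewrite increment /L mulrCA [leLHS]mulrC ler_wpM2l ?expR_ge0//.
  have n0 : (0 : R) < n.+1%:R by [].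
  have bn : b n <= D / n.+1%:R by rewrite ler_pdivlMr// mulrC.
  have p1 : 0 < 1 + b n by rewrite ltr_wpDr.
  have p2 : 0 < 1 + D / n.+1%:R by apply: lt_le_trans p1 _; rewrite lerD2l.
  apply: (@le_trans _ _ (n.+1%:R * b n / (1 + b n))).
    have Drn : D * r n / (1 + D / n.+1%:R) <= n.+1%:R * b n / (1 + D / n.+1%:R).
      by rewrite ler_wpM2r// invr_ge0 ltW.
    apply: (le_trans Drn); rewrite ler_wpM2l ?mulr_ge0//.
    by rewrite lef_pV2 ?posrE// lerD2l.
  rewrite -mulrA ler_wpM2l//.
  have : expR (- b n) <= (1 + b n)^-1.
    by rewrite expRN lef_pV2 ?posrE ?expR_gt0//; exact: expR_ge1Dx.
  have -> : b n / (1 + b n) = 1 - (1 + b n)^-1 by field; rewrite gt_eqF.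
  by lra.
- rewrite /L -[X in _ --> X](_ : D * 1 / (1 + D * 0) * expR (- A) = _); last first.
    by rewrite mulr0 addr0 divr1 mulr1.
  apply: cvgM; last exact: cvg_cst.
  apply: cvgM; first by apply: cvgM => //; exact: cvg_cst.
  apply: cvgV; first by rewrite mulr0 addr0 oner_eq0.
  apply: cvgD; first exact: cvg_cst.
  by apply: cvgM; [exact: cvg_cst|exact: cvg_harmonic].
- exact: cvg_cst.
Qed.

End exponential_increment.

Section time_integral.
Context (R : realType) (d' : measure_display) (T' : measurableType d') (w : R).
Notation mu := (@lebesgue_measure R).
Implicit Types f : T' -> R -> R.

(** Real-valued, hence 0 by default if the integral is infinite; this is why boundedness of the
    integrand is assumed in most of what follows. *)
Definition time_int f (y : T') : R := \int[mu]_(v in `[0, w]) f y v.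

Definition jointly_measurable f :=
  measurable_fun setT (fun z : T' * measurableTypeR R => f z.1 z.2).

Lemma jointly_measurable_section f y : jointly_measurable f -> measurable_fun setT (f y).
Proof.
move=> mf; have := measurableT_comp mf (@measurable_pair1 _ _ T' (measurableTypeR R) y).
exact.
Qed.

Lemma integrable_time f y (K : R) : jointly_measurable f ->
  (forall v, `|f y v| <= K) -> mu.-integrable `[0, w] (EFin \o f y).
Proof.
move=> mf fK; apply: measurable_bounded_integrable => //.
- by rewrite /= lebesgue_measure_itv/=; case: ifPn => _; rewrite ?ltry// -EFinB ltry.
- by apply: measurable_funTS; exact: jointly_measurable_section.
- exists K; split; first exact: num_real.
  by move=> M KM v _ /=; exact: le_trans (fK v) (ltW KM).
Qed.

Lemma time_intE f y (K : R) : jointly_measurable f -> (forall v, `|f y v| <= K) ->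
  (\int[mu]_(v in `[0%R, w]) (f y v)%:E = (time_int f y)%:E)%E.
Proof.
move=> mf fK; rewrite /time_int /Rintegral fineK//.
by apply: integrable_fin_num => //; exact: (integrable_time mf fK).
Qed.

Lemma time_int_indic f y :
  (\int[mu]_(v in `[0%R, w]) (f y v)%:E =
   \int[mu]_v (\1_(`[0%R, w]%classic) v * f y v)%:E)%E.
Proof.
rewrite integral_mkcond; apply: eq_integral => v _.
by rewrite patchE indicE; case: ifPn => _; rewrite (mul1r, mul0r).
Qed.

Lemma jointly_measurable_indic f : jointly_measurable f ->
  measurable_fun setT (fun z : T' * measurableTypeR R =>
    (\1_(`[0, w]%classic : set R) z.2 * f z.1 z.2)%:E).
Proof.
move=> mf; apply/measurable_EFinP; apply: measurable_funM => //.
by apply: measurable_indic_comp => //; exact: measurable_snd.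
Qed.

Lemma measurable_time_int f : jointly_measurable f -> (forall y v, 0 <= f y v) ->
  measurable_fun setT (time_int f).
Proof.
move=> mf f0; rewrite /time_int /Rintegral.
apply: (measurableT_comp (fine_measurable measurableT)).
under eq_fun do rewrite time_int_indic.
apply: (measurable_fun_fubini_tonelli_F (m2 := mu) _ (jointly_measurable_indic mf)).
by move=> z; rewrite lee_fin mulr_ge0.
Qed.

Lemma le_time_int f g y (K K' : R) : jointly_measurable f -> jointly_measurable g ->
  (forall v, `|f y v| <= K) -> (forall v, `|g y v| <= K') ->
  (forall v, f y v <= g y v) -> time_int f y <= time_int g y.
Proof.
move=> mf mg fK gK fg; apply: le_Rintegral => //.
- exact: (integrable_time mf fK).
- exact: (integrable_time mg gK).
Qed.

Lemma time_int_ge0 f y : (forall v, 0 <= f y v) -> 0 <= time_int f y.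
Proof. by move=> f0; apply: Rintegral_ge0 => v _. Qed.

Lemma time_intZ f y (K c : R) : jointly_measurable f -> (forall v, `|f y v| <= K) ->
  time_int (fun y v => c * f y v) y = c * time_int f y.
Proof. by move=> mf fK; rewrite /time_int RintegralZl//; exact: (integrable_time mf fK). Qed.

Lemma time_intB f g y (K : R) : jointly_measurable f -> jointly_measurable g ->
  (forall v, `|f y v| <= K) -> (forall v, `|g y v| <= K) ->
  time_int (fun y v => f y v - g y v) y = time_int f y - time_int g y.
Proof.
move=> mf mg fK gK; rewrite /time_int RintegralB//.
- exact: (integrable_time mf fK).
- exact: (integrable_time mg gK).
Qed.

Lemma time_int_le_cst f y (K : R) : 0 <= w -> jointly_measurable f ->
  (forall v, 0 <= f y v <= K) -> time_int f y <= K * w.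
Proof.
move=> w0 mf fK.
have fK' v : `|f y v| <= K by have /andP[h1 h2] := fK v; rewrite ger0_norm.
have K0 : 0 <= K by have /andP[h1 h2] := fK 0; exact: le_trans h2.
have -> : K * w = time_int (fun _ _ => K) y.
  rewrite /time_int Rintegral_cst//= lebesgue_measure_itv/= lte_fin.
  by move: w0; rewrite le_eqVlt => /predU1P[<-|->]; rewrite ?ltxx//= subr0.
apply: (le_time_int (K := K) (K' := K)) => //.
- exact: measurable_cst.
- by move=> v; rewrite ger0_norm.
- by move=> v; have /andP[] := fK v.
Qed.

End time_integral.

(** * Conditional density of a variable with a mixed stable Laplace exponent *)

Section conditional_density.
Context (R : realType) (d d' : measure_display) (T : measurableType d)
  (T' : measurableType d') (P : probability T R) (pi : T -> T') (w a : R)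
  (ps th : T' -> R -> R) (X : T -> R).
Notation mu := (@lebesgue_measure R).
Hypotheses (mpi : measurable_fun setT pi) (a01 : 0 < a < 1)
  (mps : jointly_measurable ps) (mth : jointly_measurable th)
  (ps0 : forall y v, 0 < ps y v) (psa : forall y v, ps y v <= a)
  (th0 : forall y v, 0 <= th y v) (th1 : forall y v, th y v <= 1)
  (w0 : 0 <= w) (mX : measurable_fun setT X) (X0 : forall om, 0 <= X om).

(** In the application [X] is sigma w / t, [ps] is alpha along the path and [th], equal to
    t^(-alpha), is the factor produced by the rescaling by t. *)
Definition exponent (l : R) := time_int w (fun y v => th y v * l `^ ps y v).

Hypothesis laplaceX : forall (l : R) (E : set T'), 0 <= l -> measurable E ->
  (\int[P]_(om in pi @^-1` E) (expR (- (l * X om)))%:E =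
   \int[P]_(om in pi @^-1` E) (expR (- exponent l (pi om)))%:E)%E.

Definition exponent_deriv (l : R) :=
  time_int w (fun y v => th y v * (ps y v * l `^ (ps y v - 1))).

(** The kernel k of the identity x m(dx) = (m * k)(dx): s times the jump density at s, integrated
    along the path. Its Laplace transform is [exponent_deriv]. *)
Definition exponent_kernel (s : R) :=
  time_int w (fun y v => th y v * (ps y v / gam (ps y v) * pow_kernel (ps y v) s)).

Let ps01 y v : 0 < ps y v < 1.
Proof. by rewrite ps0 (le_lt_trans (psa y v))//; case/andP: a01. Qed.

Let ps01' y v : 0 <= ps y v < 1.
Proof. by have /andP[h1 h2] := ps01 y v; rewrite h2 ltW. Qed.

Let mpow (g : T' -> R -> R) (l : R) : jointly_measurable g ->
  jointly_measurable (fun y v => l `^ g y v).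
Proof. by move=> mg; exact: (measurableT_comp (measurable_powRr l) mg). Qed.

Let mphi l : jointly_measurable (fun y v => th y v * l `^ ps y v).
Proof. by apply: measurable_funM => //; exact: mpow. Qed.

Let mderiv l : jointly_measurable (fun y v => th y v * (ps y v * l `^ (ps y v - 1))).
Proof.
apply: measurable_funM => //; apply: measurable_funM => //.
by apply: (mpow (g := fun y v => ps y v - 1)); apply: measurable_funB.
Qed.

Let pow_le (l p : R) : 0 <= l -> 0 <= p <= 1 -> l `^ p <= l + 1.
Proof.
move=> l0 /andP[p0 p1]; have [l1|l1] := leP l 1.
  apply: (@le_trans _ _ 1); last by rewrite lerDr.
  have [->|ln0] := eqVneq l 0.
    by rewrite /powR eqxx; case: (p == 0).
  by rewrite -[leRHS](powRr0 l) ger_powR// l1 lt_neqAle eq_sym ln0 l0.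
apply: (@le_trans _ _ l); last by rewrite lerDl.
by rewrite -[leRHS]powRr1 ?(ltW (lt_trans _ l1))// ler_powR// ltW.
Qed.

Let phi_bound l : 0 <= l -> forall y v, `|th y v * l `^ ps y v| <= l + 1.
Proof.
move=> l0 y v; rewrite ger0_norm ?mulr_ge0 ?powR_ge0//.
rewrite -[leRHS]mul1r ler_pM ?powR_ge0// pow_le//.
by have /andP[h1 h2] := ps01 y v; rewrite !ltW.
Qed.

Let deriv_bound l : 0 < l -> forall y v,
  `|th y v * (ps y v * l `^ (ps y v - 1))| <= l^-1 + 1.
Proof.
move=> l0 y v; have /andP[h1 h2] := ps01 y v.
rewrite ger0_norm ?mulr_ge0 ?powR_ge0 ?(ltW h1)//.
rewrite -[leRHS]mul1r ler_pM ?mulr_ge0 ?powR_ge0 ?(ltW h1)//.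
rewrite -[leRHS]mul1r ler_pM ?powR_ge0 ?(ltW h1) ?(ltW h2)//.
have -> : l `^ (ps y v - 1) = l^-1 `^ (1 - ps y v).
  by rewrite -powR_inv1 ?(ltW l0)// -powRrM; congr (_ `^ _); ring.
by apply: pow_le; rewrite ?invr_ge0 ?(ltW l0)//; apply/andP; split; lra.
Qed.

Let exponent_ge0 l y : 0 <= exponent l y.
Proof. by apply: time_int_ge0 => v; rewrite mulr_ge0 ?powR_ge0. Qed.

Let deriv_ge0 l y : 0 <= exponent_deriv l y.
Proof. by apply: time_int_ge0 => v; rewrite !mulr_ge0 ?powR_ge0// ltW. Qed.

Let mexponent l : measurable_fun setT (exponent l).
Proof.
by apply: measurable_time_int => // y v; rewrite mulr_ge0 ?powR_ge0.
Qed.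

Let mexponent_deriv l : measurable_fun setT (exponent_deriv l).
Proof.
by apply: measurable_time_int => // y v; rewrite !mulr_ge0 ?powR_ge0// ltW.
Qed.

Let exponent_increment l h y : 0 < l -> 0 < h ->
  h * (l / (l + h) * exponent_deriv l y) <= exponent (l + h) y - exponent l y
    <= h * exponent_deriv l y.
Proof.
move=> l0 h0; have lh0 : 0 < l + h by rewrite addr_gt0.
pose K := (l + h + 1) + (l + 1) + h * (l^-1 + 1).
have li : 0 <= l^-1 + 1 by rewrite addr_ge0 ?invr_ge0// ltW.
have hli : 0 <= h * (l^-1 + 1) by rewrite mulr_ge0// ltW.
have K1 v : `|th y v * (l + h) `^ ps y v| <= K.
  apply: le_trans (phi_bound (ltW lh0) y v) _; rewrite /K; lra.
have K2 v : `|th y v * l `^ ps y v| <= K.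
  apply: le_trans (phi_bound (ltW l0) y v) _; rewrite /K; lra.
have mB : jointly_measurable (fun y v => th y v * (l + h) `^ ps y v - th y v * l `^ ps y v).
  by apply: measurable_funB; exact: mphi.
have KB v : `|th y v * (l + h) `^ ps y v - th y v * l `^ ps y v| <= K + K.
  by rewrite (le_trans (ler_normB _ _))// lerD.
have mD c : jointly_measurable (fun y v => c * (th y v * (ps y v * l `^ (ps y v - 1)))).
  by apply: measurable_funM => //; exact: mderiv.
have KD c v : `|c * (th y v * (ps y v * l `^ (ps y v - 1)))| <= `|c| * (l^-1 + 1).
  by rewrite normrM ler_wpM2l// deriv_bound.
rewrite mulrA -(time_intB w (mphi (l + h)) (mphi l) K1 K2).
rewrite -!(time_intZ w _ (mderiv l) (deriv_bound l0 y)).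
apply/andP; split.
- apply: (le_time_int w (mD _) mB (KD _) KB) => v.
  have /andP[h1 _] := powR_increment (ps01 y v) l0 h0.
  rewrite -mulrBr; have -> : h * (l / (l + h)) * (th y v * (ps y v * l `^ (ps y v - 1))) =
    th y v * (h * (ps y v * l `^ (ps y v - 1) * (l / (l + h)))) by ring.
  by rewrite ler_wpM2l.
- apply: (le_time_int w mB (mD _) KB (KD _)) => v.
  have /andP[_ h2] := powR_increment (ps01 y v) l0 h0.
  by rewrite -mulrBr mulrCA ler_wpM2l.
Qed.

Let mE (E : set T') : measurable E -> measurable (pi @^-1` E).
Proof. by move=> mE; rewrite -[X in measurable X]setTI; exact: mpi. Qed.

Let mexpX l : measurable_fun setT (fun om => expR (- (l * X om))).
Proof.
by apply: measurableT_comp => //; apply: measurableT_comp => //; apply: measurable_funM.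
Qed.

Let mexpPhi l : measurable_fun setT (fun om => expR (- exponent l (pi om))).
Proof.
apply: measurableT_comp => //; apply: measurableT_comp => //.
exact: (measurableT_comp (mexponent l) mpi).
Qed.

Let integrable01 (D : set T) (f : T -> R) (K : R) : measurable D ->
  measurable_fun setT f -> (forall om, 0 <= f om <= K) -> P.-integrable D (EFin \o f).
Proof.
move=> mD mf f01; apply: measurable_bounded_integrable => //.
- by rewrite (le_lt_trans (probability_le1 P mD))// ltry.
- exact: measurable_funTS.
- exists K; split; first exact: num_real.
  move=> M KM om _ /=; have /andP[h1 h2] := f01 om.
  by rewrite ger0_norm// (le_trans h2)// ltW.
Qed.

Let expR01 (x : R) : 0 <= x -> 0 <= expR (- x) <= 1.
Proof. by move=> x0; rewrite expR_ge0 -expR0 ler_expR lerNl oppr0. Qed.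

(** Both sides of the Laplace identity are differentiated in l along the steps 1/(n+1). The
    difference quotients are dominated by their limits, which are bounded. *)
Let laplace_deriv_exponent l E : 0 < l -> measurable E ->
  (\int[P]_(om in pi @^-1` E) (X om * expR (- (l * X om)))%:E =
   \int[P]_(om in pi @^-1` E) (exponent_deriv l (pi om) * expR (- exponent l (pi om)))%:E)%E.
Proof.
move=> l0 mE'; have mD := mE mE'.
pose h (n : nat) : R := n.+1%:R^-1.
have h0 n : 0 < h n by rewrite invr_gt0.
have hh n : n.+1%:R * h n = 1 :> R by rewrite mulfV// gt_eqF.
pose fX n om := n.+1%:R * (expR (- (l * X om)) - expR (- ((l + h n) * X om))).
pose fP n om := n.+1%:R * (expR (- exponent l (pi om)) - expR (- exponent (l + h n) (pi om))).
have E1 n : (\int[P]_(om in pi @^-1` E) (fX n om)%:E = \int[P]_(om in pi @^-1` E) (fP n om)%:E)%E.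
  have lh0 : 0 < l + h n by rewrite addr_gt0.
  have step (f g : T -> R) : measurable_fun setT f -> measurable_fun setT g ->
      (forall om, 0 <= f om <= 1) -> (forall om, 0 <= g om <= 1) ->
      (\int[P]_(om in pi @^-1` E) (n.+1%:R * (f om - g om))%:E = n.+1%:R%:E *
      (\int[P]_(om in pi @^-1` E) (f om)%:E - \int[P]_(om in pi @^-1` E) (g om)%:E))%E.
    move=> mf mg f01 g01.
    have if_ := integrable01 mD mf f01; have ig_ := integrable01 mD mg g01.
    under eq_integral do rewrite EFinM EFinB.
    rewrite integralZl//; last exact: integrableB.
    by rewrite integralB.
  have sX := step (fun om => expR (- (l * X om))) (fun om => expR (- ((l + h n) * X om)))
    (mexpX l) (mexpX (l + h n)) (fun om => expR01 (mulr_ge0 (ltW l0) (X0 om)))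
    (fun om => expR01 (mulr_ge0 (ltW lh0) (X0 om))).
  have sP := step (fun om => expR (- exponent l (pi om)))
    (fun om => expR (- exponent (l + h n) (pi om)))
    (mexpPhi l) (mexpPhi (l + h n)) (fun om => expR01 (exponent_ge0 l (pi om)))
    (fun om => expR01 (exponent_ge0 (l + h n) (pi om))).
  rewrite /fX /fP sX sP (laplaceX (ltW l0) mE') (laplaceX (ltW lh0) mE').
  by [].
have bX n om : 0 <= fX n om <= X om * expR (- (l * X om)).
  rewrite /fX mulrDl; apply: expR_increment_bound.
    by rewrite mulr_ge0// ltW.
  by rewrite mulrA hh mul1r.
have incr n om := exponent_increment (pi om) l0 (h0 n).
have bP n om : 0 <= fP n om <= exponent_deriv l (pi om) * expR (- exponent l (pi om)).
  have /andP[i1 i2] := incr n om.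
  rewrite /fP -[exponent (l + h n) (pi om)](subrKC (exponent l (pi om))).
  apply: expR_increment_bound.
    apply: le_trans i1; rewrite !mulr_ge0 ?deriv_ge0 ?divr_ge0 ?invr_ge0 ?addr_ge0 ?(ltW l0) ?(ltW (h0 n))//.
  apply: (@le_trans _ _ (n.+1%:R * (h n * exponent_deriv l (pi om)))); first by rewrite ler_wpM2l.
  by rewrite mulrA hh mul1r.
have cX om : fX n om @[n --> \oo] --> X om * expR (- (l * X om)).
  rewrite /fX; under eq_fun do rewrite mulrDl.
  apply: (@expR_increment_cvg _ _ _ _ (fun=> 1)) => //; last exact: cvg_cst.
  - by move=> n; rewrite mulr_ge0// ltW.
  - by move=> n; rewrite mulrA hh !mul1r mulr1 lexx.
have cP om : fP n om @[n --> \oo] --> exponent_deriv l (pi om) * expR (- exponent l (pi om)).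
  rewrite /fP; have -> : (fun n => n.+1%:R * (expR (- exponent l (pi om)) -
      expR (- exponent (l + h n) (pi om)))) = (fun n => n.+1%:R * (expR (- exponent l (pi om)) -
      expR (- (exponent l (pi om) + (exponent (l + h n) (pi om) - exponent l (pi om)))))).
    by apply/funext => n; rewrite subrKC.
  apply: (@expR_increment_cvg _ _ _ _ (fun n => l / (l + h n))) => //.
  - move=> n; have /andP[i1 _] := incr n om; apply: le_trans i1.
    by rewrite !mulr_ge0 ?deriv_ge0 ?divr_ge0 ?invr_ge0 ?addr_ge0 ?(ltW l0) ?(ltW (h0 n)).
  - move=> n; have /andP[i1 i2] := incr n om.
    have := ler_wpM2l (ler0n R n.+1) i1; have := ler_wpM2l (ler0n R n.+1) i2.
    rewrite ![n.+1%:R * (h n * _)]mulrA hh !mul1r => ->.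
    by rewrite mulrC => ->.
  - rewrite -[X in _ --> X](_ : l / (l + 0) = 1); last by rewrite addr0 mulfV ?gt_eqF.
    apply: cvgM; first exact: cvg_cst.
    apply: cvgV; first by rewrite addr0 gt_eqF.
    by apply: cvgD; [exact: cvg_cst|exact: cvg_harmonic].
have mfX n : measurable_fun setT (fX n).
  by apply: measurable_funM => //; apply: measurable_funB; exact: mexpX.
have mfP n : measurable_fun setT (fP n).
  by apply: measurable_funM => //; apply: measurable_funB; exact: mexpPhi.
have dominated (f : nat -> T -> R) (g : T -> R) (K : R) : (forall n, measurable_fun setT (f n)) ->
    (forall om, f n om @[n --> \oo] --> g om) -> (forall n om, 0 <= f n om <= g om) ->
    (forall om, g om <= K) ->
    (\int[P]_(om in pi @^-1` E) (f n om)%:E @[n --> \oo] --> \int[P]_(om in pi @^-1` E) (g om)%:E)%E.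
  move=> mf fg bf gK.
  apply: (@dominated_cvg _ _ _ _ _ mD _ _ (fun=> K%:E)) => //=.
  - by move=> n; apply: measurable_funTS; exact/measurable_EFinP.
  - by move=> om _; apply: cvg_EFin; [exact: nearW|exact: fg].
  - by apply: finite_measure_integrable_cst.
  - move=> n om _; have /andP[f0 fK] := bf n om.
    by rewrite lee_fin ger0_norm// (le_trans fK).
have L1 := dominated fX (fun om => X om * expR (- (l * X om))) l^-1 mfX cX bX.
have L2 := dominated fP (fun om => exponent_deriv l (pi om) * expR (- exponent l (pi om)))
  ((l^-1 + 1) * w) mfP cP bP.
have B1 om : X om * expR (- (l * X om)) <= l^-1.
  have : l * X om <= expR (l * X om) by have := expR_ge1Dx (l * X om); lra.
  by move=> h1; rewrite -(ler_pM2l l0) mulfV ?gt_eqF// expRN mulrA ler_pdivrMr ?expR_gt0// mul1r.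
have B2 om : exponent_deriv l (pi om) * expR (- exponent l (pi om)) <= (l^-1 + 1) * w.
  apply: (@le_trans _ _ (exponent_deriv l (pi om))).
    rewrite ler_piMr ?deriv_ge0//.
    by have /andP[_] := expR01 (exponent_ge0 l (pi om)).
  apply: time_int_le_cst => // v; rewrite !mulr_ge0 ?powR_ge0 ?(ltW (ps0 _ _))//=.
  by apply: le_trans (deriv_bound l0 (pi om) v); exact: ler_norm.
apply: (cvg_unique _ _ (L2 B2)); first exact: ereal_hausdorff.
have <- : (fun n => \int[P]_(om in pi @^-1` E) (fX n om)%:E)%E =
    (fun n => \int[P]_(om in pi @^-1` E) (fP n om)%:E)%E by apply/funext => n; exact: E1.
exact: L1.
Qed.

(** [exponent_deriv] is a function of [pi], so that it may serve as a weight under which exp(-Phi)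
    is turned back into exp(-l X). *)
Lemma laplace_deriv l (E : set T') : 0 < l -> measurable E ->
  (\int[P]_om (\1_E (pi om) * X om * expR (- (l * X om)))%:E =
   \int[P]_om (\1_E (pi om) * exponent_deriv l (pi om) * expR (- (l * X om)))%:E)%E.
Proof.
move=> l0 mE'.
have indE (f : T -> R) : (\int[P]_om (\1_E (pi om) * f om)%:E = \int[P]_(om in pi @^-1` E) (f om)%:E)%E.
  rewrite [RHS]integral_mkcond; apply: eq_integral => om _; rewrite patchE indicE.
  have -> : (om \in pi @^-1` E) = (pi om \in E) by apply/idP/idP; rewrite !inE.
  by case: ifPn => _; rewrite (mul1r, mul0r).
under eq_integral do rewrite -mulrA; under [RHS]eq_integral do rewrite -mulrA.
rewrite indE laplace_deriv_exponent// -!indE.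
have := @eq_integral_comp _ _ T T' R P pi (fun om => expR (- exponent l (pi om)))
  (fun om => expR (- (l * X om))) (fun y => (\1_E y * exponent_deriv l y)%:E).
under eq_integral do rewrite -EFinM -mulrA; under [X in _ = X]eq_integral do rewrite -EFinM -mulrA.
apply => //.
- by apply/measurable_EFinP; apply: measurable_funM => //; exact: measurable_indic.
- by move=> y; rewrite lee_fin mulr_ge0.
- by move=> S mS; rewrite (laplaceX (ltW l0) mS).
Qed.

Let kern (s : R) y v := th y v * (ps y v / gam (ps y v) * pow_kernel (ps y v) s).

Let gam_gt0 (p : R) : 0 <= p < 1 -> 0 < gam p.
Proof. by move=> p01; apply: lt_le_trans (gam_ge p01); exact: expR_gt0. Qed.

Let kern_ge0 s y v : 0 <= kern s y v.
Proof.
rewrite !mulr_ge0 ?pow_kernel_ge0 ?invr_ge0 ?th0 ?(ltW (ps0 y v))//.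
exact: ltW (gam_gt0 (ps01' y v)).
Qed.

Let mkern3 : measurable_fun setT
  (fun z : (T' * measurableTypeR R) * measurableTypeR R => kern z.1.2 z.1.1 z.2).
Proof.
have m1 : measurable_fun setT
    (fun z : (T' * measurableTypeR R) * measurableTypeR R => (z.1.1, z.2) : T' * measurableTypeR R).
  apply/measurable_fun_pairP; split; last exact: measurable_snd.
  exact: (measurableT_comp measurable_fst measurable_fst).
have mps3 := measurableT_comp mps m1; have mth3 := measurableT_comp mth m1.
apply: measurable_funM => //; apply: measurable_funM.
  apply: measurable_funM => //.
  have -> : (fun z : (T' * measurableTypeR R) * measurableTypeR R => (gam (ps z.1.1 z.2))^-1) =
      (fun z => (gam (ps z.1.1 z.2)) `^ (-1)).
    by apply/funext => z; rewrite powR_inv1// ltW// gam_gt0.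
  exact: (measurableT_comp (measurable_powR (-1)) (measurable_gam mps3)).
apply: measurable_pow_kernel => //.
exact: (measurableT_comp measurable_snd measurable_fst).
Qed.

Let mkern s : jointly_measurable (kern s).
Proof.
have m1 : measurable_fun setT
    (fun z : T' * measurableTypeR R => ((z.1, s : measurableTypeR R), z.2)).
  apply/measurable_fun_pairP; split; last exact: measurable_snd.
  by apply/measurable_fun_pairP; split; [exact: measurable_fst|exact: measurable_cst].
exact: (measurableT_comp mkern3 m1).
Qed.

(** For s <= 1 the power is largest at the exponent a; for 1 < s <= 2 it is at most 1, while 2
    s^(-a) >= 1. The factor e bounds 1 / [gam]. *)
Let kern_bound s y v : 0 < s -> s <= 2 -> kern s y v <= th y v * (2 * expR 1 * s `^ (- a)).
Proof.
move=> s0 s2; rewrite ler_wpM2l// pow_kernelE//.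
have /andP[h1 h2] := ps01 y v; have g0 := gam_gt0 (ps01' y v).
have g1 : ps y v / gam (ps y v) <= expR 1.
  apply: (@le_trans _ _ (1 * (gam (ps y v))^-1)).
    by rewrite ler_wpM2r ?invr_ge0// ltW.
  by rewrite mul1r -[leRHS]invrK -expRN lef_pV2 ?posrE ?expR_gt0// gam_ge.
have -> : 2 * expR 1 * s `^ (- a) = expR 1 * (2 * s `^ (- a)) by ring.
apply: ler_pM => //; [by apply: divr_ge0; exact: ltW|exact: powR_ge0|].
have [s1|s1] := leP s 1.
  apply: (@le_trans _ _ (s `^ (- a))); last by rewrite ler_peMl ?powR_ge0// ler1n.
  by rewrite ger_powR ?s0// lerN2.
apply: (@le_trans _ _ 1).
  by rewrite -[leRHS](powRr0 s) ler_powR ?oppr_le0// ltW.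
have /andP[a0 a1] := a01.
rewrite -ler_pdivrMl// mulr1 -(powR_inv1 (ler0n R 2)).
apply: (@le_trans _ _ (2 `^ (- a))); first by rewrite ler_powR ?ler1n// lerN2 ltW.
by rewrite !powRN lef_pV2 ?posrE ?powR_gt0//; apply: ge0_ler_powR; rewrite ?nnegrE ?(ltW s0) ?(ltW a0).
Qed.

Let kern_bounded s y : exists K : R, forall v, `|kern s y v| <= K.
Proof.
have [s0|s0] := leP s 0.
  by exists 0 => v; rewrite /kern pow_kernel_le0// !mulr0 normr0.
have g1 v : ps y v / gam (ps y v) <= expR 1.
  have /andP[h1 h2] := ps01 y v; have g0 := gam_gt0 (ps01' y v).
  apply: (@le_trans _ _ (1 * (gam (ps y v))^-1)).
    by rewrite ler_wpM2r ?invr_ge0// ltW.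
  by rewrite mul1r -[leRHS]invrK -expRN lef_pV2 ?posrE ?expR_gt0// gam_ge.
exists (1 * (expR 1 * (s^-1 + 1))) => v; rewrite ger0_norm//.
rewrite ler_pM// ?mulr_ge0 ?pow_kernel_ge0 ?invr_ge0 ?(ltW (ps0 y v)) ?(ltW (gam_gt0 (ps01' y v)))//.
rewrite ler_pM// ?pow_kernel_ge0 ?mulr_ge0 ?invr_ge0 ?(ltW (ps0 y v)) ?(ltW (gam_gt0 (ps01' y v)))//.
rewrite pow_kernelE//; have -> : s `^ (- ps y v) = s^-1 `^ ps y v.
  by rewrite -powR_inv1 ?(ltW s0)// -powRrM mulN1r.
by apply: pow_le; [rewrite invr_ge0 ltW|have /andP[h1 h2] := ps01 y v; rewrite !ltW].
Qed.

Let kernel_ge0 s y : 0 <= exponent_kernel s y.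
Proof. by apply: time_int_ge0 => v; exact: kern_ge0. Qed.

Let kernelE s y : (\int[mu]_v (\1_(`[0%R, w]%classic) v * kern s y v)%:E =
  (exponent_kernel s y)%:E)%E.
Proof.
have [K HK] := kern_bounded s y.
by rewrite -time_int_indic (time_intE w (mkern s) HK).
Qed.

Let mkernel : measurable_fun setT
  (fun z : T' * measurableTypeR R => exponent_kernel z.2 z.1).
Proof.
exact: (@measurable_time_int R _ (T' * measurableTypeR R)%type w
  (fun z v => kern z.2 z.1 v) mkern3 (fun z v => kern_ge0 z.2 z.1 v)).
Qed.

Let kernel_laplace l y : 0 < l ->
  (\int[mu]_s (exponent_kernel s y * expR (- (l * s)))%:E = (exponent_deriv l y)%:E)%E.
Proof.
move=> l0.
pose F (z : measurableTypeR R * measurableTypeR R) :=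
  (expR (- (l * z.1)) * (\1_(`[0%R, w]%classic : set R) z.2 * kern z.1 y z.2))%:E.
have mF : measurable_fun setT F.
  apply/measurable_EFinP; apply: measurable_funM.
    apply: measurableT_comp => //; apply: measurableT_comp => //.
    by apply: measurable_funM => //; exact: measurable_fst.
  apply: measurable_funM; first by apply: measurable_indic_comp => //; exact: measurable_snd.
  have m1 : measurable_fun setT
      (fun z : measurableTypeR R * measurableTypeR R => ((y, z.1), z.2)).
    apply/measurable_fun_pairP; split; last exact: measurable_snd.
    by apply/measurable_fun_pairP; split; [exact: measurable_cst|exact: measurable_fst].
  exact: (measurableT_comp mkern3 m1).
have F0 z : (0 <= F z)%E by rewrite lee_fin; apply: mulr_ge0; [exact: expR_ge0|apply: mulr_ge0 => //; exact: kern_ge0].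
transitivity (\int[mu]_s \int[mu]_v F (s, v))%E.
  apply: eq_integral => s _; rewrite mulrC EFinM -kernelE -ge0_integralZl//.
  - apply/measurable_EFinP; apply: measurable_funM; first exact: measurable_indic.
    exact: (jointly_measurable_section y (mkern s)).
  - by move=> v _; rewrite lee_fin mulr_ge0// kern_ge0.
rewrite (fubini_tonelli (m1 := mu) (m2 := mu) F mF F0).
rewrite -(time_intE w (mderiv l) (deriv_bound l0 y)).
rewrite (time_int_indic w (fun y v => th y v * (ps y v * l `^ (ps y v - 1)))).
apply: eq_integral => v _.
have -> : (fun s : R => F (s, v)) = (fun s : R =>
  ((\1_(`[0%R, w]%classic) v * (th y v * (ps y v / gam (ps y v))))%:E *
   (pow_kernel (ps y v) s * expR (- (l * s)))%:E)%E).
  by apply/funext => s; rewrite /F /kern/= -EFinM; congr EFin; ring.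
have /andP[h1 h2] := ps01 y v; have g0 := gam_gt0 (ps01' y v).
rewrite ge0_integralZl//; last 3 first.
- apply/measurable_EFinP; apply: measurable_funM; first exact: measurable_pow_kernel.
  by apply: measurableT_comp => //; apply: measurableT_comp => //; apply: measurable_funM.
- by move=> s _; rewrite lee_fin mulr_ge0 ?pow_kernel_ge0 ?expR_ge0.
- by rewrite lee_fin !mulr_ge0 ?invr_ge0 ?(ltW h1) ?(ltW g0).
rewrite gam_scale// -EFinM; congr EFin.
by field; rewrite gt_eqF.
Qed.

(** Both sides have the same Laplace transforms at the positive integers: differentiation gives the
    factor [exponent_deriv], which is the transform of the kernel. Uniqueness is applied between [T]
    and its product with the line. *)
Lemma size_biased_density (E : set T') (u v : R) : measurable E ->
  (\int[P]_om (\1_E (pi om) * X om * \1_(`[u, v]%classic) (X om))%:E =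
   \int[mu]_s \int[P]_om (\1_E (pi om) * exponent_kernel s (pi om) *
      \1_(`[u, v]%classic) (X om + Num.max s 0))%:E)%E.
Proof.
move=> mE'.
have mkpi : measurable_fun setT
    (fun z : T * measurableTypeR R => exponent_kernel z.2 (pi z.1)).
  have m1 : measurable_fun setT (fun z : T * measurableTypeR R => (pi z.1, z.2)).
    apply/measurable_fun_pairP; split; last exact: measurable_snd.
    exact: (measurableT_comp mpi measurable_fst).
  exact: (measurableT_comp mkernel m1).
have mI : measurable_fun setT (fun om => \1_E (pi om) : R) by exact: measurable_indic_comp.
pose g2 (z : T * measurableTypeR R) := \1_E (pi z.1) * exponent_kernel z.2 (pi z.1).
(* The truncation keeps the variable nonnegative on the whole product, as uniqueness requires; the
   kernel vanishes where it has an effect. *)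
pose X2 (z : T * measurableTypeR R) := X z.1 + Num.max z.2 0.
have mg2 : measurable_fun setT g2.
  by apply: measurable_funM => //; exact: (measurableT_comp mI measurable_fst).
have mX2 : measurable_fun setT X2.
  apply: measurable_funD; first exact: (measurableT_comp mX measurable_fst).
  by apply: measurable_maxr => //; exact: measurable_snd.
have g20 z : 0 <= g2 z by rewrite mulr_ge0// kernel_ge0.
have X20 z : 0 <= X2 z by rewrite addr_ge0// le_max lexx orbT.
have mi2 : measurable_fun setT
    (fun z => (g2 z * \1_(`[u, v]%classic) (X2 z))%:E).
  by apply/measurable_EFinP; apply: measurable_funM => //; exact: measurable_indic_comp.
transitivity (\int[(P \x mu)%E]_z (g2 z * \1_(`[u, v]%classic) (X2 z))%:E)%E; last first.
  by rewrite (fubini_tonelli2 (m1 := P) (m2 := mu) _ mi2)//; move=> z; rewrite lee_fin mulr_ge0.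
apply: (laplace_unique (g1 := fun om => \1_E (pi om) * X om)) => //.
- exact: measurable_funM.
- by move=> om; rewrite mulr_ge0.
- apply: (@le_lt_trans _ _ (\int[P]_om (cst 1 om))%E); last first.
    by rewrite integral_cst// mul1e (le_lt_trans (probability_le1 P measurableT))// ltry.
  apply: ge0_le_integral => //.
  + by move=> om _; rewrite lee_fin !mulr_ge0 ?expR_ge0.
  + apply/measurable_EFinP; apply: measurable_funM; first exact: measurable_funM.
    by apply: measurableT_comp => //; apply: measurableT_comp.
  + move=> om _; rewrite lee_fin -mulrA -[leRHS]mul1r ler_pM ?mulr_ge0 ?expR_ge0//.
    rewrite expRN ler_pdivrMr ?expR_gt0// mul1r.
    by have := expR_ge1Dx (X om); lra.
move=> k; have k0 : (0 : R) < k.+1%:R by [].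
rewrite laplace_deriv//.
have mi3 : measurable_fun setT (fun z => (g2 z * expR (- (k.+1%:R * X2 z)))%:E).
  apply/measurable_EFinP; apply: measurable_funM => //.
  by apply: measurableT_comp => //; apply: measurableT_comp => //; apply: measurable_funM.
rewrite (fubini_tonelli1 (m1 := P) (m2 := mu) _ mi3)//; last first.
  by move=> z; rewrite lee_fin mulr_ge0 ?expR_ge0.
apply: eq_integral => om _; rewrite /fubini_F.
have -> : (fun s : R => (g2 (om, s) * expR (- (k.+1%:R * X2 (om, s))))%:E) =
    (fun s : R => ((\1_E (pi om) * expR (- (k.+1%:R * X om)))%:E *
      (exponent_kernel s (pi om) * expR (- (k.+1%:R * s)))%:E)%E).
  apply/funext => s; rewrite -EFinM /g2 /X2/=; congr EFin.
  have [s0|s0] := leP s 0.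
    suff -> : exponent_kernel s (pi om) = 0 by rewrite !(mul0r, mulr0).
    rewrite /exponent_kernel /time_int; under eq_Rintegral do rewrite pow_kernel_le0// !mulr0.
    by rewrite Rintegral_cst//= ?mul0r// lebesgue_measure_itv/=; case: ifPn => _; rewrite ?ltry// -EFinB ltry.
  rewrite mulrDr opprD expRD; ring.
rewrite ge0_integralZl//.
- by rewrite kernel_laplace// -EFinM; congr EFin; ring.
- apply/measurable_EFinP; apply: measurable_funM.
    exact: (measurableT_comp mkpi (@measurable_pair1 _ _ T (measurableTypeR R) om)).
  by apply: measurableT_comp => //; apply: measurableT_comp => //; apply: measurable_funM.
- by move=> s _; rewrite lee_fin mulr_ge0 ?expR_ge0// kernel_ge0.
Qed.

(** On the left X >= u, so that u is at most the size-biasing factor X. On the right, shifts s > 2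
    do not contribute, since X >= 0 and u + delta <= 2, and for s <= 2 the kernel is at most 2 e
    s^(-a) times [exponent] at 1, which is bounded by M on E. *)
Lemma interval_density_step (M u delta : R) (E : set T') : measurable E ->
  (forall y, E y -> exponent 1 y <= M) -> 0 < u <= 1 -> 0 < delta <= 1 ->
  (u%:E * P (pi @^-1` E `&` X @^-1` `[u, (u + delta)%R]) <=
   \int[mu]_(s in `]0%R, 2%R]) ((2 * expR 1 * M * s `^ (- a))%:E *
     P (pi @^-1` E `&` X @^-1` `[(u - s)%R, (u - s + delta)%R])))%E.
Proof.
move=> mE' EM /andP[u0 u1] /andP[d0 d1].
pose J (x : R) : set R := `[x, x + delta]%classic.
have mJ x : measurable (J x) by exact: measurable_itv.
have mI : measurable_fun setT (fun om => \1_E (pi om) : R) by exact: measurable_indic_comp.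
have PE x : (P (pi @^-1` E `&` X @^-1` `[x, (x + delta)%R]) =
    \int[P]_om (\1_E (pi om) * \1_(J x) (X om))%:E)%E.
  have mA : measurable (pi @^-1` E `&` X @^-1` `[x, (x + delta)%R]).
    by apply: measurableI; [exact: mE|rewrite -[X in measurable X]setTI; exact: mX].
  rewrite -[in LHS](setIT (_ `&` _)) -integral_indic//.
  apply: eq_integral => om _; rewrite !indicE in_setI -mulnb natrM.
  by congr (_ * _)%:E; congr (_%:R); congr nat_of_bool; apply/idP/idP; rewrite !inE.
have step1 : (u%:E * P (pi @^-1` E `&` X @^-1` `[u, (u + delta)%R]) <=
    \int[P]_om (\1_E (pi om) * X om * \1_(J u) (X om))%:E)%E.
  rewrite PE -ge0_integralZl ?lee_fin ?(ltW u0)//; last first.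
    by apply/measurable_EFinP; apply: measurable_funM => //; exact: measurable_indic_comp.
  apply: ge0_le_integral => //.
  - by move=> om _; rewrite mule_ge0 ?lee_fin ?(ltW u0)// mulr_ge0.
  - apply: emeasurable_funM => //; apply/measurable_EFinP; apply: measurable_funM => //.
    exact: measurable_indic_comp.
  - apply/measurable_EFinP; apply: measurable_funM; first exact: measurable_funM.
    exact: measurable_indic_comp.
  - move=> om _; rewrite -EFinM lee_fin mulrCA -mulrA ler_wpM2l//.
    rewrite [\1_(J u) _]indicE; case: (boolP (X om \in J u)); last by rewrite !mulr0.
    by rewrite inE /J/= in_itv/= => /andP[uX _]; rewrite !mulr1.
apply: (le_trans step1); rewrite size_biased_density//.
have PEs s : P (pi @^-1` E `&` X @^-1` `[(u - s)%R, (u - s + delta)%R]) =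
    (\int[P]_om (\1_E (pi om) * \1_(J u) (X om + s))%:E)%E.
  rewrite PE; apply: eq_integral => om _; congr (_ * _)%:E.
  rewrite !indicE; congr (_%:R); congr nat_of_bool.
  by apply/idP/idP; rewrite !inE /J/= !in_itv/= => /andP[h1 h2]; apply/andP; split; lra.
under [leRHS]eq_integral do rewrite PEs.
rewrite [leRHS]integral_mkcond.
have mg : measurable_fun setT (fun z : measurableTypeR R * T =>
    (\1_E (pi z.2) * \1_(J u) (X z.2 + z.1) : R)%:E).
  apply/measurable_EFinP; apply: measurable_funM; first exact: (measurableT_comp mI measurable_snd).
  apply: measurable_indic_comp => //; apply: measurable_funD => //.
  exact: (measurableT_comp mX measurable_snd).
have mkpi : measurable_fun setT
    (fun z : measurableTypeR R * T => exponent_kernel z.1 (pi z.2)).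
  have m1 : measurable_fun setT (fun z : measurableTypeR R * T => (pi z.2, z.1)).
    apply/measurable_fun_pairP; split; last exact: measurable_fst.
    exact: (measurableT_comp mpi measurable_snd).
  exact: (measurableT_comp mkernel m1).
have mg' : measurable_fun setT (fun z : measurableTypeR R * T =>
    (\1_E (pi z.2) * exponent_kernel z.1 (pi z.2) * \1_(J u) (X z.2 + Num.max z.1 0) : R)%:E).
  apply/measurable_EFinP; apply: measurable_funM.
    by apply: measurable_funM => //; exact: (measurableT_comp mI measurable_snd).
  apply: measurable_indic_comp => //; apply: measurable_funD.
    exact: (measurableT_comp mX measurable_snd).
  by apply: measurable_maxr => //; exact: measurable_fst.
have M0 : forall y, E y -> 0 <= M by move=> y Ey; exact: le_trans (exponent_ge0 1 y) (EM y Ey).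
have [E0|/set0P[y0 Ey0]] := eqVneq E set0.
  rewrite [leLHS]integral0_eq; last first.
    by move=> s _; rewrite integral0_eq// => om _; rewrite E0 indicE in_set0 !mul0r.
  apply: integral_ge0 => s _; rewrite patchE; case: ifPn => // _.
  by rewrite integral0_eq ?mule0// => om _; rewrite E0 indicE in_set0 mul0r.
have {}M0 := M0 _ Ey0.
apply: ge0_le_integral => //.
- by move=> s _; apply: integral_ge0 => om _; rewrite lee_fin !mulr_ge0// kernel_ge0.
- apply: (measurable_fun_fubini_tonelli_F (m2 := P) _ mg').
  by move=> z; rewrite lee_fin !mulr_ge0// kernel_ge0.
- have mI02 : measurable (`]0%R, 2%R]%classic : set (measurableTypeR R)) by exact: measurable_itv.
  apply/(measurable_restrictT _ mI02); apply: measurable_funTS.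
  apply: emeasurable_funM.
    by apply/measurable_EFinP; apply: measurable_funM => //; exact: measurable_powR.
  apply: (measurable_fun_fubini_tonelli_F (m2 := P) _ mg).
  by move=> z; rewrite lee_fin mulr_ge0.
move=> s _; rewrite patchE; case: ifPn; last first.
  rewrite notin_setE/= in_itv/= => sN; rewrite integral0_eq// => om _.
  have [s0|s0] := leP s 0.
    suff -> : exponent_kernel s (pi om) = 0 by rewrite !(mul0r, mulr0).
    rewrite /exponent_kernel /time_int; under eq_Rintegral do rewrite pow_kernel_le0// !mulr0.
    by rewrite Rintegral_cst//= ?mul0r// lebesgue_measure_itv/=; case: ifPn => _; rewrite ?ltry// -EFinB ltry.
  have s2 : 2 < s by rewrite ltNge; apply/negP => s2; apply: sN; rewrite s0.
  rewrite (_ : \1_(J u) _ = 0) ?mulr0// indicE memNset//= /J/= in_itv/= => /andP[_].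
  by apply/negP; rewrite -ltNge; have := X0 om; lra.
rewrite inE/= in_itv/= => /andP[s0 s2].
rewrite -ge0_integralZl//; last 2 first.
- exact: (measurableT_comp mg (@measurable_pair1 _ _ (measurableTypeR R) T s)).
- by rewrite lee_fin !mulr_ge0 ?expR_ge0 ?powR_ge0.
apply: ge0_le_integral => //.
- by move=> om _; rewrite lee_fin !mulr_ge0// kernel_ge0.
- apply: (measurableT_comp mg' (@measurable_pair1 _ _ (measurableTypeR R) T s)).
- apply: emeasurable_funM => //.
  apply: (measurableT_comp mg (@measurable_pair1 _ _ (measurableTypeR R) T s)).
move=> om _; rewrite -EFinM lee_fin (max_idPl (ltW s0)) -/(J u) mulrA ler_wpM2r//.
rewrite indicE; case: (boolP (pi om \in E)); last by rewrite !(mul0r, mulr0).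
rewrite inE => Eom; rewrite mul1r mulr1.
have th_bound v : `|th (pi om) v| <= 1 by rewrite ger0_norm.
have mth' : jointly_measurable (fun y v => 2 * expR 1 * s `^ (- a) * th y v).
  exact: measurable_funM.
have thb' v : `|2 * expR 1 * s `^ (- a) * th (pi om) v| <= 2 * expR 1 * s `^ (- a).
  by rewrite ger0_norm ?mulr_ge0 ?expR_ge0 ?powR_ge0// ler_piMr// !mulr_ge0 ?expR_ge0 ?powR_ge0.
have [Ks HKs] := kern_bounded s (pi om).
apply: (@le_trans _ _ (time_int w (fun y v => 2 * expR 1 * s `^ (- a) * th y v) (pi om))).
  apply: (le_time_int w (mkern s) mth' HKs thb') => v.
  by apply: le_trans (kern_bound (pi om) v s0 s2) _; rewrite mulrC.
rewrite (time_intZ w _ mth th_bound).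
have -> : time_int w th (pi om) = exponent 1 (pi om).
  by apply: eq_Rintegral => v _; rewrite powR1 mulr1.
rewrite [leRHS]mulrAC ler_wpM2l ?EM// !mulr_ge0 ?expR_ge0 ?powR_ge0//.
Qed.

End conditional_density.

(** The constant precedes all other data: it depends on M and a alone, hence serves every time t and
    every cell at once. *)
Lemma conditional_density_bound (R : realType) (M a : R) : 0 <= M -> 0 < a < 1 ->
  exists2 C : R, 0 <= C & forall (d d' : measure_display) (T : measurableType d)
    (T' : measurableType d') (P : probability T R) (pi : T -> T') (w : R)
    (ps th : T' -> R -> R) (X : T -> R),
  measurable_fun setT pi -> jointly_measurable ps -> jointly_measurable th ->
  (forall y v, 0 < ps y v) -> (forall y v, ps y v <= a) ->
  (forall y v, 0 <= th y v) -> (forall y v, th y v <= 1) ->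
  0 <= w -> measurable_fun setT X -> (forall om, 0 <= X om) ->
  (forall (l : R) (E : set T'), 0 <= l -> measurable E ->
    (\int[P]_(om in pi @^-1` E) (expR (- (l * X om)))%:E =
     \int[P]_(om in pi @^-1` E) (expR (- exponent w ps th l (pi om)))%:E)%E) ->
  forall (E : set T') (u delta : R), measurable E ->
    (forall y, E y -> exponent w ps th 1 y <= M) ->
    2^-1 <= u <= 1 -> 0 < delta <= 1 ->
    (P (pi @^-1` E `&` X @^-1` `[u, (u + delta)%R]) <=
     (C * delta)%:E * P (pi @^-1` E))%E.
Proof.
move=> M0 a01; have K0 : 0 <= 2 * expR 1 * M by rewrite !mulr_ge0 ?expR_ge0.
have [C C0 HC] := density_bound K0 a01; exists C => //.
move=> d d' T T' P pi w ps th X mpi mps mth ps0 psa th0 th1 w0 mX X0 LX E u delta mE EM u1 /[dup] d1 /andP[d0 _].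
apply: HC => //; first by rewrite -[X in measurable X]setTI; exact: mpi.
by move=> u' u'01; apply: (interval_density_step (ps := ps) (th := th) (w := w)).
Qed.

(** * Increments of the subordinator given the path *)

Lemma indic_iff (R : pzRingType) (X Y : Type) (A : set X) (A' : set Y) x y :
  (A x <-> A' y) -> \1_A x = \1_A' y :> R.
Proof.
by move=> AA; rewrite !indicE; congr ((nat_of_bool _)%:R); apply/idP/idP; rewrite !inE => /AA.
Qed.

Lemma indicI_iff (R : pzRingType) (X Y Z : Type) (A : set X) (A1 : set Y) (A2 : set Z) x y z :
  (A x <-> A1 y /\ A2 z) -> \1_A x = \1_A1 y * \1_A2 z :> R.
Proof.
move=> AA; rewrite !indicE -natrM mulnb; congr ((nat_of_bool _)%:R).
by apply/idP/andP; rewrite !inE => /AA.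
Qed.

Section conditioning_on_path.
Context (R : realType) (d : measure_display) (T : measurableType d)
  (P : probability T R).

Lemma integral_indicM (E : set T) (f : T -> \bar R) :
  (\int[P]_(om in E) f om = \int[P]_om ((\1_E om)%:E * f om))%E.
Proof.
rewrite integral_mkcond; apply: eq_integral => om _.
by rewrite patchE indicE; case: ifPn => _; rewrite (mul1e, mul0e).
Qed.

(** The set where the version is negative belongs to the sigma-algebra, so that the integral of [p]
    over it equals that of Z >= 0; hence it is null. *)
Lemma cond_exp_ge0 (C : set (set T)) (Z p : T -> R) :
  (forall S, C S -> measurable S) ->
  (forall om, 0 <= Z om) ->
  is_cond_exp P <<s C >> (fun om => (Z om)%:E) (fun om => (p om)%:E) ->
  {ae P, forall om, 0 <= p om}.
Proof.
move=> mC Z0 [mp Zp].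
have sub S : <<s C >> S -> measurable S.
  by apply: smallest_sub => //; exact: sigma_algebra_measurable.
pose N := [set om | p om < 0].
have GN : <<s C >> N.
  have -> : N = (fun om => (p om)%:E) @^-1` [set x | (x < 0)%E].
    by apply/seteqP; split => om /=; rewrite lte_fin.
  apply: mp; have -> : [set x : \bar R | (x < 0)%E] = `]-oo, 0%E[%classic.
      by apply/seteqP; split => x /=; rewrite in_itv.
    exact: emeasurable_itv.
have mN := sub _ GN.
have mpP : measurable_fun setT (fun om => (p om)%:E).
  by move=> _ S mS; rewrite setTI; apply: sub; exact: mp.
have I1 : (0 <= \int[P]_(om in N) (p om)%:E)%E.
  by rewrite -Zp//; apply: integral_ge0 => om _; rewrite lee_fin.
have I2 : (\int[P]_(om in N) (- p om)%:E <= 0)%E.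
  have -> : (\int[P]_(om in N) (- p om)%:E = - \int[P]_(om in N) (p om)%:E)%E.
    have -> : (fun om => (p om)%:E) = (fun om => - (- p om)%:E)%E.
      by apply/funext => om; rewrite -EFinN opprK.
    by rewrite integral_ge0N ?oppeK// => om; rewrite /N/= lee_fin oppr_ge0 => /ltW.
  by rewrite oppe_le0.
have I0 : (\int[P]_(om in N) `|(- p om)%:E| = 0)%E.
  rewrite (eq_integral (fun om => (- p om)%:E)).
    by apply/eqP; rewrite eq_le I2/=; apply: integral_ge0 => om; rewrite /N/= lee_fin oppr_ge0 => /ltW.
  by move=> om; rewrite inE /N/= => pom; rewrite ger0_norm// oppr_ge0 ltW.
have mNp : measurable_fun N (fun om => (- p om)%:E).
  by apply: measurable_funTS; apply/measurable_EFinP; apply: measurableT_comp => //; apply/measurable_EFinP.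
have := (ae_eq_integral_abs P mN mNp).1 I0.
apply: filterS => om H; rewrite leNgt; apply/negP => pom.
by have := H pom => /= -[] /eqP; rewrite oppr_eq0 => /eqP p0; rewrite p0 ltxx in pom.
Qed.

Context (B : R -> {RV P >-> R}).

(** The clause [w%:E <= +oo], which always holds, makes this literally the generating family of
    [past B +oo]. *)
Definition path_events : set (set T) :=
  [set E | exists (w : R) (S : set R),
     [/\ 0 <= w, (w%:E <= +oo)%E, measurable S & E = B w @^-1` S]].

(** The points of [T] with the sigma-algebra of the whole path. Measurability with respect to the
    past becomes measurability of a function on this type, and the identity [to_path] becomes the
    map on which one conditions. *)
Definition path_space := g_sigma_algebraType path_events.

Definition to_path (om : T) : path_space := om.

Lemma path_events_measurable S : path_events S -> measurable S.
Proof.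
move=> [w [A [w0 _ mA ->]]]; rewrite -[X in measurable X]setTI.
exact: (measurable_funP (B w)).
Qed.

Lemma past_measurable S : past B +oo%E S -> measurable S.
Proof.
apply: smallest_sub; first exact: sigma_algebra_measurable.
exact: path_events_measurable.
Qed.

Lemma measurable_to_path : measurable_fun setT to_path.
Proof. by move=> _ S mS; rewrite setTI; exact: past_measurable. Qed.

Lemma measurable_path_eval (w : R) : 0 <= w -> measurable_fun setT (B w : path_space -> R).
Proof.
move=> w0 _ S mS; rewrite setTI; apply: sub_sigma_algebra.
by exists w, S; split => //; rewrite leey.
Qed.

Lemma cond_exp_measurable (Z : T -> \bar R) (p : T -> R) :
  is_cond_exp P (past B +oo%E) Z (fun om => (p om)%:E) ->
  measurable_fun setT (p : path_space -> R).
Proof.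
by move=> [mp _]; apply/measurable_EFinP => _ S mS; rewrite setTI; exact: mp.
Qed.

Lemma nonneg_version (Z p : T -> R) : (forall om, 0 <= Z om) ->
  is_cond_exp P (past B +oo%E) (fun om => (Z om)%:E) (fun om => (p om)%:E) ->
  exists2 q : path_space -> R, measurable_fun setT q /\ (forall y, 0 <= q y) &
    {ae P, forall om, p om = q (to_path om)}.
Proof.
move=> Z0 Zp; exists (fun y => Num.max (p y) 0).
  split; last by move=> y; rewrite le_max lexx orbT.
  by apply: measurable_maxr => //; exact: cond_exp_measurable Zp.
have := cond_exp_ge0 path_events_measurable Z0 Zp; apply: filterS => om p0.
by rewrite /to_path (max_idPl p0).
Qed.

End conditioning_on_path.

(** * Conditional independence and Laplace transforms of increments *)

Section conditional_increments.
Context (R : realType) (d : measure_display) (T : measurableType d)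
  (P : probability T R) (alpha : R -> R) (B sigma : R -> {RV P >-> R}).
Hypotheses (subH : conditional_subordinator alpha B sigma).
Notation mu := (@lebesgue_measure R).
Local Notation pathT := (path_space B).

Lemma conditional_independence (s t : R) (S0 S1 : set R) : 0 <= s -> s <= t ->
  measurable S0 -> measurable S1 ->
  exists p0 p1 : pathT -> R,
  [/\ measurable_fun setT p0 /\ (forall y, 0 <= p0 y),
      measurable_fun setT p1 /\ (forall y, 0 <= p1 y) &
   forall E : set pathT, measurable E ->
  [/\ (\int[P]_(om in E) (\1_S0 (sigma s om))%:E = \int[P]_(om in E) (p0 om)%:E)%E,
      (\int[P]_(om in E) (\1_S1 (sigma t om - sigma s om))%:E = \int[P]_(om in E) (p1 om)%:E)%E &
      (\int[P]_(om in E) (\1_S0 (sigma s om) * \1_S1 (sigma t om - sigma s om))%:E =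
       \int[P]_(om in E) (p0 om * p1 om)%:E)%E]].
Proof.
move=> s0 st mS0 mS1.
(* Independence is stated along infinite nondecreasing sequences of times, hence the repetition of
   [t]. As sigma 0 = 0, the first increment is [sigma s]. *)
pose tt (i : nat) : R := if i == 0%N then 0 else if i == 1%N then s else t.
pose SS (i : 'I_2) : set R := if i == ord0 then S0 else S1.
have tt0 : 0 <= tt 0%N by [].
have ttS i : tt i <= tt i.+1 by case: i => [|[|i]].
have mSS i : measurable (SS i) by rewrite /SS; case: ifP.
have [p [Hp Hpp]] := sub_indep subH tt0 ttS mSS.
have ind_ge0 (A : set T) om : 0 <= \1_A om :> R by [].
have [q0 [mq0 q00] aeq0] := nonneg_version (ind_ge0 _) (Hp ord0).
have [q1 [mq1 q10] aeq1] := nonneg_version (ind_ge0 _) (Hp ord_max).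
have mT (q : T -> R) : measurable_fun setT (q : pathT -> R) -> measurable_fun setT q.
  by move=> mq; exact: (measurableT_comp mq (measurable_to_path (B:=B))).
have mp i : measurable_fun setT (p i) by apply: mT; exact: cond_exp_measurable (Hp i).
exists q0, q1; split => // E mE'; have mE : measurable (E : set T) by exact: past_measurable mE'.
have ae_int (f g : T -> R) : measurable_fun setT f -> measurable_fun setT g ->
    {ae P, forall om, f om = g om} ->
    (\int[P]_(om in E) (f om)%:E = \int[P]_(om in E) (g om)%:E)%E.
  move=> mf mg fg; apply: ae_eq_integral => //.
  - by apply: measurable_funTS; exact/measurable_EFinP.
  - by apply: measurable_funTS; exact/measurable_EFinP.
  - by apply: filterS fg => om -> _.
split.
- rewrite -(ae_int (p ord0) q0 (mp _) (mT _ mq0) aeq0) -(Hp ord0).2//.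
  apply: eq_integral => om _; congr EFin; apply: indic_iff.
  by rewrite /= /SS/= /tt/= (sub_start subH) subr0.
- by rewrite -(ae_int (p ord_max) q1 (mp _) (mT _ mq1) aeq1) -(Hp ord_max).2//.
- have aepq : {ae P, forall om, p ord0 om * p ord_max om = q0 om * q1 om}.
    by apply: filterS2 aeq0 aeq1 => om -> ->.
  rewrite -(ae_int (fun om => p ord0 om * p ord_max om) (fun om => q0 om * q1 om) _ _ aepq).
  + have := Hpp.2 E mE'; under [X in _ = X -> _]eq_integral do rewrite big_ord_recl big_ord1.
    have -> : lift ord0 ord0 = ord_max :> 'I_2 by exact: val_inj.
    move=> <-; apply: eq_integral => om _; congr EFin; symmetry; apply: indicI_iff; split.
      move=> h; have := h ord0; have := h ord_max.
      by rewrite /= /SS/= /tt/= (sub_start subH) subr0.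
    move=> [h0 h1] i; case: (unliftP ord0 i) => [j|] -> /=; rewrite /SS/= /tt/=.
      by rewrite ord1.
    by rewrite (sub_start subH) subr0.
  + by apply: measurable_funM; exact: mp.
  + by apply: measurable_funM; exact: mT.
Qed.

Let mto : measurable_fun setT (to_path B : T -> pathT).
Proof. exact: measurable_to_path. Qed.

Let msigma s : measurable_fun setT (sigma s) := measurable_funP (sigma s).

Let mdiff s t : measurable_fun setT (fun om => sigma t om - sigma s om).
Proof. exact: measurable_funB. Qed.

Let intM (E : set pathT) (f : T -> R) :
  (\int[P]_(om in E) (f om)%:E = \int[P]_om ((\1_E (to_path B om) * f om)%:E))%E.
Proof. by rewrite integral_indicM; apply: eq_integral => om _; rewrite -EFinM. Qed.

Let mindic (E : set pathT) : measurable E -> measurable_fun setT (\1_E : pathT -> R).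
Proof. by move=> mE; exact: measurable_indic. Qed.

(** Given the path, the two events are independent. The conditional probability [p1] of the second
    is a function of the path, hence a legitimate weight under which the bound on the first, known
    on all path events inside [H], may be integrated. *)
Lemma le_product_prob (s t c : R) (H : set pathT) (S0 S1 : set R) : 0 <= s -> s <= t ->
  measurable S0 -> measurable S1 -> measurable H -> 0 <= c ->
  (forall E : set pathT, measurable E -> E `<=` H ->
     (P (E `&` sigma s @^-1` S0) <= c%:E * P E)%E) ->
  (P (H `&` (sigma s @^-1` S0 `&` (fun om => sigma t om - sigma s om)%R @^-1` S1)) <=
   c%:E * P (H `&` (fun om => sigma t om - sigma s om)%R @^-1` S1))%E.
Proof.
move=> s0 st mS0 mS1 mH c0 HE.
have [p0 [p1 [[mp0 p00] [mp1 p10] Hp]]] := conditional_independence s0 st mS0 mS1.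
have [_ H1 H01] := Hp H mH.
pose D om := sigma t om - sigma s om.
have mHT : measurable (H : set T) by exact: past_measurable mH.
have mA0 : measurable (sigma s @^-1` S0) by rewrite -[X in measurable X]setTI; exact: msigma.
have mA1 : measurable (D @^-1` S1) by rewrite -[X in measurable X]setTI; exact: mdiff.
have PE (E A : set T) : measurable E -> measurable A ->
    (P (E `&` A) = \int[P]_(om in E) (\1_A om)%:E)%E.
  by move=> mE mA; rewrite integral_indic// setIC.
have indE (A : set R) (f : T -> R) om : \1_(f @^-1` A) om = \1_A (f om) :> R.
  by rewrite !indicE; congr (_%:R); congr nat_of_bool; apply/idP/idP; rewrite !inE.
rewrite PE//; last exact: measurableI.
rewrite (PE H (D @^-1` S1))//.
have -> : (\int[P]_(om in H) (\1_(sigma s @^-1` S0 `&` D @^-1` S1) om)%:E =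
    \int[P]_(om in H) (\1_S0 (sigma s om) * \1_S1 (D om))%:E)%E.
  by apply: eq_integral => om _; rewrite -!indE !indicE in_setI -mulnb natrM.
under [X in (_ * X)%E]eq_integral do rewrite indE.
have := H01; rewrite /D => ->; have := H1; rewrite /D => ->.
rewrite (intM H (fun om => p0 om * p1 om)) (intM H p1).
have i0 om : 0 <= \1_S0 (sigma s om) :> R by [].
have m0 : measurable_fun setT (fun om => \1_S0 (sigma s om) : R) by exact: measurable_indic_comp.
have mp0T : measurable_fun setT (fun om : T => p0 (to_path B om)) by exact: (measurableT_comp mp0 mto).
pose f (y : pathT) := (\1_H y * p1 y)%:E.
have mf : measurable_fun setT f.
  by apply/measurable_EFinP; apply: measurable_funM => //; exact: mindic.
have f0 y : (0 <= f y)%E by rewrite lee_fin mulr_ge0.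
have -> : (\int[P]_om (\1_H (to_path B om) * (p0 om * p1 om))%:E =
    \int[P]_om (f (to_path B om) * (p0 (to_path B om))%:E))%E.
  by apply: eq_integral => om _; rewrite /f -EFinM; congr EFin; rewrite /to_path; ring.
rewrite -(eq_integral_comp (Z := fun om => \1_S0 (sigma s om)) mto m0 mp0T i0 (fun om => p00 _) mf f0);
  last by move=> S mS; have [-> _ _] := Hp S mS.
pose f1 (y : pathT) := (p1 y)%:E.
have mf1 : measurable_fun setT f1 by exact/measurable_EFinP.
have -> : (\int[P]_om (f (to_path B om) * (\1_S0 (sigma s om))%:E) =
    \int[P]_om (f1 (to_path B om) * (\1_H (to_path B om) * \1_S0 (sigma s om))%:E))%E.
  by apply: eq_integral => om _; rewrite /f /f1 -!EFinM; congr EFin; ring.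
have mIH : measurable_fun setT (fun om => \1_H (to_path B om) : R).
  exact: (measurableT_comp (mindic mH) mto).
apply: (@le_trans _ _ (\int[P]_om (f1 (to_path B om) * (c * \1_H (to_path B om))%:E))%E).
  apply: (@le_integral_comp _ _ _ _ _ _ _ _ (fun om => c * \1_H (to_path B om)) f1) => //.
  - exact: measurable_funM.
  - exact: measurable_funM.
  - by move=> om; rewrite mulr_ge0.
  - move=> S mS; have mSH : measurable (S `&` H : set pathT) by exact: measurableI.
    have mST : measurable (S : set T) by exact: past_measurable mS.
    have mSHT : measurable (S `&` H : set T) by exact: past_measurable mSH.
    have -> : (\int[P]_(om in to_path B @^-1` S) (\1_H (to_path B om) * \1_S0 (sigma s om))%:E =
       P ((S `&` H) `&` sigma s @^-1` S0))%E.
      rewrite (PE _ _ mSHT mA0) (integral_indicM P S) (integral_indicM P (S `&` H)).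
      apply: eq_integral => om _.
      by rewrite -!EFinM -indE; congr EFin; rewrite !indicE in_setI -mulnb natrM mulrA.
    have -> : (\int[P]_(om in to_path B @^-1` S) (c * \1_H (to_path B om))%:E = c%:E * P (S `&` H))%E.
      under eq_integral do rewrite EFinM.
      by rewrite ge0_integralZl//= ?lee_fin// ?integral_indic// 1?setIC//; apply/measurable_EFinP; exact: measurable_funTS.
    exact: HE.
under eq_integral do rewrite -EFinM mulrCA EFinM.
rewrite ge0_integralZl//= ?lee_fin//.
- apply: lee_wpmul2l; rewrite ?lee_fin//.
  by rewrite le_eqVlt; apply/orP; left; apply/eqP; apply: eq_integral => om _; rewrite mulrC.
- by apply/measurable_EFinP; apply: measurable_funM => //; exact: (measurableT_comp mp1 mto).
- by move=> om _; rewrite lee_fin mulr_ge0.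
Qed.

Lemma weighted_integral_eq d' (T' : measurableType d') (pi : T -> T') (f : T' -> R) (Z Y : T -> R) :
  measurable_fun setT pi -> measurable_fun setT f -> measurable_fun setT Z -> measurable_fun setT Y ->
  (forall y, 0 <= f y) -> (forall om, 0 <= Z om) -> (forall om, 0 <= Y om) ->
  (forall S, measurable S ->
     (\int[P]_om (\1_S (pi om) * Z om)%:E = \int[P]_om (\1_S (pi om) * Y om)%:E)%E) ->
  (\int[P]_om (f (pi om) * Z om)%:E = \int[P]_om (f (pi om) * Y om)%:E)%E.
Proof.
move=> mpi mf mZ mY f0 Z0 Y0 ZY.
have F (V : T -> R) : (\int[P]_om (f (pi om) * V om)%:E = \int[P]_om ((f (pi om))%:E * (V om)%:E))%E.
  by apply: eq_integral => om _; rewrite EFinM.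
rewrite (F Z) (F Y).
apply: (eq_integral_comp (f := fun y => (f y)%:E)) => //; first exact/measurable_EFinP.
move=> S mS; rewrite (integral_indicM P (pi @^-1` S) (fun om => (Z om)%:E)) (integral_indicM P (pi @^-1` S) (fun om => (Y om)%:E)).
have G (V : T -> R) : (\int[P]_om ((\1_(pi @^-1` S) om)%:E * (V om)%:E) =
    \int[P]_om (\1_S (pi om) * V om)%:E)%E.
  by apply: eq_integral => om _; rewrite -EFinM; congr EFin; congr (_ * _); exact: indic_iff.
by rewrite (G Z) (G Y); exact: ZY.
Qed.

Definition path_exponent (l y : R) (om : T) : R :=
  \int[mu]_(w in `[0, y]) (l `^ alpha (B w om)).

Let mexpPhi l y : 0 <= l -> 0 <= y ->
  measurable_fun setT ((fun om => expR (- path_exponent l y om)) : pathT -> R).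
Proof.
move=> l0 y0.
exact: (cond_exp_measurable (sub_laplace subH l0 y0 (leey _))).
Qed.

(** Read off from the conditional Laplace transform: exp(-Phi) is measurable for the path because it
    is a version of a conditional expectation, and Phi is its negative logarithm. *)
Lemma measurable_path_exponent l y : 0 <= l -> 0 <= y ->
  measurable_fun setT (path_exponent l y : pathT -> R).
Proof.
move=> l0 y0; have -> : path_exponent l y = fun om => - ln (expR (- path_exponent l y om)).
  by apply/funext => om; rewrite expRK opprK.
by apply: measurableT_comp => //; apply: (measurableT_comp (measurable_ln (R:=R))); exact: mexpPhi.
Qed.

Let laplace_weighted (l y : R) (f : pathT -> R) : 0 <= l -> 0 <= y ->
  measurable_fun setT f -> (forall om, 0 <= f om) ->
  (\int[P]_om (f om * expR (- (l * sigma y om)))%:E =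
   \int[P]_om (f om * expR (- path_exponent l y om))%:E)%E.
Proof.
move=> l0 y0 mf f0.
apply: (weighted_integral_eq mto mf (Z := fun om => expR (- (l * sigma y om)))
  (Y := fun om => expR (- path_exponent l y om))) => //.
- apply: measurableT_comp => //; apply: measurableT_comp => //; apply: measurable_funM => //; exact: msigma.
- exact: (measurableT_comp (mexpPhi l0 y0) mto).
- move=> S mS; have := (sub_laplace subH l0 y0 (leey _)).2 S mS.
  by rewrite (intM S (fun om => expR (- (l * sigma y om)))) (intM S (fun om => expR (- path_exponent l y om))).
Qed.

Let indic01 (X : Type) (A : set X) x : 0 <= \1_A x :> R. Proof. by []. Qed.

(** One version [q] must serve for all functions of [sigma s], whereas the versions given by
    [conditional_independence] depend on the event chosen for [sigma s]. They are interchanged with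
    [q] under path-measurable weights. *)
Lemma independent_increment (s t : R) (S1 : set R) : 0 <= s -> s <= t -> measurable S1 ->
  exists q : pathT -> R, [/\ measurable_fun setT q, (forall y, 0 <= q y),
    (forall f : pathT -> R, measurable_fun setT f -> (forall om, 0 <= f om) ->
      (\int[P]_om (f om * \1_S1 (sigma t om - sigma s om))%:E =
       \int[P]_om (f om * q om)%:E)%E) &
    (forall (f : pathT -> R) (g : R -> R), measurable_fun setT f -> (forall om, 0 <= f om) ->
      measurable_fun setT g -> (forall x, 0 <= g x) ->
      (\int[P]_om (f om * (g (sigma s om) * \1_S1 (sigma t om - sigma s om)))%:E =
       \int[P]_om (f om * (g (sigma s om) * q om))%:E)%E)].
Proof.
move=> s0 st mS1.
have mD1 : measurable_fun setT (fun om => \1_S1 (sigma t om - sigma s om) : R).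
  exact: measurable_indic_comp.
have mpT (p : pathT -> R) : measurable_fun setT p -> measurable_fun setT (p : T -> R).
  by move=> mp; exact: (measurableT_comp mp mto).
have W (f q : pathT -> R) (Z : T -> R) : measurable_fun setT f -> (forall om, 0 <= f om) ->
    measurable_fun setT q -> (forall om, 0 <= q om) ->
    measurable_fun setT Z -> (forall om, 0 <= Z om) ->
    (forall E : set pathT, measurable E -> (\int[P]_(om in E) (Z om)%:E = \int[P]_(om in E) (q om)%:E)%E) ->
    (\int[P]_om (f om * Z om)%:E = \int[P]_om (f om * q om)%:E)%E.
  move=> mf f0 mq q0 mZ Z0 ZQ.
  apply: (weighted_integral_eq mto mf mZ (mpT _ mq)) => // S mS.
  by have := ZQ S mS; rewrite (intM S Z) (intM S q).
have [? [q [_ [mq q0] Hq]]] := conditional_independence s0 st measurableT mS1.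
exists q; split => // [f mf f0|].
  by apply: W => // E mE; have [] := Hq E mE.
suff key (S0 : set R) (f : pathT -> R) : measurable S0 -> measurable_fun setT f -> (forall om, 0 <= f om) ->
    (\int[P]_om (f om * (\1_S0 (sigma s om) * \1_S1 (sigma t om - sigma s om)))%:E =
       \int[P]_om (f om * (\1_S0 (sigma s om) * q om))%:E)%E.
  move=> f g mf f0 mg g0.
  have G (V : T -> R) : (\int[P]_om (f om * (g (sigma s om) * V om))%:E =
      \int[P]_om (g (sigma s om) * (f om * V om))%:E)%E.
    by apply: eq_integral => om _; rewrite mulrCA.
  rewrite (G (fun om => \1_S1 (sigma t om - sigma s om))) (G q).
  apply: (weighted_integral_eq (@msigma s) mg) => //.
  - by apply: measurable_funM => //; exact: mpT.
  - by apply: measurable_funM; exact: mpT.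
  - by move=> om; rewrite mulr_ge0.
  - by move=> om; rewrite mulr_ge0.
  - move=> S mS.
    have K (V : T -> R) : (\int[P]_om (\1_S (sigma s om) * (f om * V om))%:E =
        \int[P]_om (f om * (\1_S (sigma s om) * V om))%:E)%E.
      by apply: eq_integral => om _; rewrite mulrCA.
    by rewrite (K (fun om => \1_S1 (sigma t om - sigma s om))) (K q); exact: key.
move=> mS0 mf f0.
have [p0 [p1 [[mp0 p00] [mp1 p10] Hp]]] := conditional_independence s0 st mS0 mS1.
have m0 : measurable_fun setT (fun om => \1_S0 (sigma s om) : R) by exact: measurable_indic_comp.
rewrite (W f (fun om => p0 om * p1 om)) //; last 4 first.
- exact: measurable_funM.
- by move=> om; exact: mulr_ge0.
- exact: measurable_funM.
- by move=> E mE; have [] := Hp E mE.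
have A (V : T -> R) (U : T -> R) : (\int[P]_om (f om * (U om * V om))%:E =
    \int[P]_om (f om * U om * V om)%:E)%E.
  by apply: eq_integral => om _; rewrite mulrA.
rewrite (A p1 p0).
rewrite -(W (fun om => f om * p0 om) p1 (fun om => \1_S1 (sigma t om - sigma s om)))//; last 3 first.
- exact: measurable_funM.
- by move=> om; rewrite mulr_ge0.
- by move=> E mE; have [] := Hp E mE.
rewrite (W (fun om => f om * p0 om) q (fun om => \1_S1 (sigma t om - sigma s om)))//; last 3 first.
- exact: measurable_funM.
- by move=> om; rewrite mulr_ge0.
- by move=> E mE; have [] := Hq E mE.
have C (V : T -> R) : (\int[P]_om (f om * V om * q om)%:E =
    \int[P]_om (f om * q om * V om)%:E)%E.
  by apply: eq_integral => om _; rewrite mulrAC.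
rewrite (C p0) -(W (fun om => f om * q om) p0 (fun om => \1_S0 (sigma s om)))//.
- by rewrite (A q (fun om => \1_S0 (sigma s om))) (C (fun om => \1_S0 (sigma s om))).
- exact: measurable_funM.
- by move=> om; rewrite mulr_ge0.
- by move=> E mE; have [] := Hp E mE.
Qed.

(** Only the transforms of [sigma s] and [sigma t] are given. The variable exp(Phi_s - l sigma s)
    has conditional mean 1 given the path, also after restriction to an event of the increment,
    which is [step]; inserting it turns the increment into [sigma t]. *)
Lemma increment_laplace (l s t : R) (E : set pathT) : 0 <= l -> 0 <= s -> s <= t -> measurable E ->
  (\int[P]_(om in E) (expR (- (l * (sigma t om - sigma s om))))%:E =
   \int[P]_(om in E) (expR (- (path_exponent l t om - path_exponent l s om)))%:E)%E.
Proof.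
move=> l0 s0 st mE.
have t0 : 0 <= t by apply: le_trans st.
pose D om := sigma t om - sigma s om.
pose h om := expR (path_exponent l s om).
pose u om := expR (- (l * sigma s om)).
pose v om := expR (- (l * D om)).
have mh : measurable_fun setT (h : pathT -> R).
  by apply: measurableT_comp => //; exact: measurable_path_exponent.
have mhE : measurable_fun setT ((fun om => \1_E om * h om) : pathT -> R).
  by apply: measurable_funM => //; exact: mindic.
have mhET : measurable_fun setT ((fun om => \1_E om * h om) : T -> R) by exact: (measurableT_comp mhE mto).
have mET : measurable_fun setT (\1_E : T -> R) by exact: (measurableT_comp (mindic mE) mto).
have hE0 om : 0 <= \1_E om * h om by rewrite mulr_ge0// expR_ge0.
pose g x := expR (- (l * x)).
have mg : measurable_fun setT g.
  by apply: measurableT_comp => //; apply: measurableT_comp => //; exact: measurable_funM.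
have mu_ : measurable_fun setT u by exact: (measurableT_comp mg (@msigma s)).
have step (S1 : set R) : measurable S1 ->
    (\int[P]_om (\1_S1 (D om) * (\1_E om * h om * u om))%:E = \int[P]_om (\1_S1 (D om) * \1_E om)%:E)%E.
  move=> mS1; have [q [mq q0 Hq Hgq]] := independent_increment s0 st mS1.
  have -> : (\int[P]_om (\1_S1 (D om) * (\1_E om * h om * u om))%:E =
      \int[P]_om (\1_E om * h om * (g (sigma s om) * \1_S1 (sigma t om - sigma s om)))%:E)%E.
    by apply: eq_integral => om _; rewrite /g /u /D; congr EFin; ring.
  rewrite (Hgq (fun om => \1_E om * h om) g)//; last by move=> x; exact: expR_ge0.
  have -> : (\int[P]_om (\1_E om * h om * (g (sigma s om) * q om))%:E =
      \int[P]_om (\1_E om * h om * q om * expR (- (l * sigma s om)))%:E)%E.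
    by apply: eq_integral => om _; rewrite /g; congr EFin; ring.
  rewrite (laplace_weighted (f := fun om => \1_E om * h om * q om))//; last 2 first.
  - exact: measurable_funM.
  - by move=> om; rewrite mulr_ge0.
  have -> : (\int[P]_om (\1_E om * h om * q om * expR (- path_exponent l s om))%:E =
      \int[P]_om (\1_E om * q om)%:E)%E.
    apply: eq_integral => om _; congr EFin; rewrite mulrAC -mulrA -(mulrA (\1_E om)); congr (_ * _).
    by rewrite mulrA /h -expRD subrr expR0 mul1r.
  rewrite -(Hq (\1_E : pathT -> R) (mindic mE))//.
  by apply: eq_integral => om _; rewrite mulrC.
have := weighted_integral_eq (mdiff s t) mg (Z := fun om => \1_E om * h om * u om) (Y := \1_E).
move=> /(_ (measurable_funM mhET mu_) mET (fun x => expR_ge0 _) (fun om => mulr_ge0 (hE0 om) (expR_ge0 _))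
  (indic01 E) step) eq1.
rewrite (intM E v) (intM E (fun om => expR (- (path_exponent l t om - path_exponent l s om)))).
have -> : (\int[P]_om (\1_E (to_path B om) * v om)%:E = \int[P]_om (g (sigma t om - sigma s om) * \1_E om)%:E)%E.
  by apply: eq_integral => om _; rewrite mulrC.
rewrite -eq1.
have -> : (\int[P]_om (g (sigma t om - sigma s om) * (\1_E om * h om * u om))%:E =
    \int[P]_om (\1_E om * h om * expR (- (l * sigma t om)))%:E)%E.
  apply: eq_integral => om _; congr EFin; rewrite mulrCA; congr (_ * _).
  by rewrite /u /g -expRD; congr expR; ring.
rewrite (laplace_weighted (f := fun om => \1_E om * h om))//.
by apply: eq_integral => om _; congr EFin; rewrite -mulrA /h -expRD; congr (_ * expR _); ring.
Qed.

Let integral_onem (E : set T) (a : T -> R) : measurable E -> measurable_fun setT a ->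
  (forall om, 0 <= a om <= 1) ->
  (\int[P]_(om in E) (1 - a om)%:E = P E - \int[P]_(om in E) (a om)%:E)%E.
Proof.
move=> mE ma a01.
have -> : (P E = \int[P]_(om in E) (1 - a om)%:E + \int[P]_(om in E) (a om)%:E)%E.
  rewrite -ge0_integralD//=.
  - rewrite -[LHS]mul1e -integral_cst//; apply: eq_integral => om _.
    by rewrite -EFinD subrK.
  - by move=> om _; rewrite lee_fin subr_ge0; have /andP[] := a01 om.
  - by apply: measurable_funTS; apply/measurable_EFinP; exact: measurable_funB.
  - by move=> om _; rewrite lee_fin; have /andP[] := a01 om.
  - by apply: measurable_funTS; exact/measurable_EFinP.
rewrite addeK//.
rewrite ge0_fin_numE; last first.
  by apply: integral_ge0 => om _; rewrite lee_fin; have /andP[] := a01 om.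
apply: (@le_lt_trans _ _ (\int[P]_(om in E) 1)%E); last first.
  by rewrite integral_cst// mul1e ltey_eq fin_num_measure.
apply: ge0_le_integral => //.
- by move=> om _; rewrite lee_fin; have /andP[] := a01 om.
- by apply: measurable_funTS; exact/measurable_EFinP.
- by move=> om _; rewrite lee_fin; have /andP[] := a01 om.
Qed.

Lemma increment_laplace_le (l s t : R) (E : set pathT) : 0 <= l -> 0 <= s -> s <= t -> measurable E ->
  (forall om, path_exponent l s om <= path_exponent l t om) ->
  (\int[P]_(om in E) (1 - expR (- (l * (sigma t om - sigma s om))))%:E <=
   \int[P]_(om in E) (path_exponent l t om - path_exponent l s om)%:E)%E.
Proof.
move=> l0 s0 st mE Phi_le; have t0 : 0 <= t by apply: le_trans st.
have mET : measurable (E : set T) by exact: past_measurable mE.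
have sig_le om : sigma s om <= sigma t om.
  by move: st; rewrite le_eqVlt => /predU1P[->//|st]; apply: ltW; exact: (sub_increasing subH).
have mPhi y : 0 <= y -> measurable_fun setT (path_exponent l y).
  by move=> y0; exact: (measurableT_comp (measurable_path_exponent l0 y0) mto).
have e01 (x : R) : 0 <= x -> 0 <= expR (- x) <= 1 by move=> x0; rewrite expR_ge0 expR_le1 oppr_le0.
rewrite (integral_onem (a := fun om => expR (- (l * (sigma t om - sigma s om)))))//; last 2 first.
- apply: measurableT_comp => //; apply: measurableT_comp => //; apply: measurable_funM => //; exact: mdiff.
- by move=> om; apply: e01; rewrite mulr_ge0// subr_ge0.
rewrite (increment_laplace l0 s0 st mE).
rewrite -(integral_onem (a := fun om => expR (- (path_exponent l t om - path_exponent l s om))))//; last 2 first.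
- by apply: measurableT_comp => //; apply: measurableT_comp => //; apply: measurable_funB; exact: mPhi.
- by move=> om; apply: e01; rewrite subr_ge0.
apply: ge0_le_integral => //.
- by move=> om _; rewrite lee_fin subr_ge0; have /andP[] := e01 (path_exponent l t om - path_exponent l s om) (ltac:(by rewrite subr_ge0)).
- apply: measurable_funTS; apply/measurable_EFinP; apply: measurable_funB => //.
  by apply: measurableT_comp => //; apply: measurableT_comp => //; apply: measurable_funB; exact: mPhi.
- by apply: measurable_funTS; apply/measurable_EFinP; apply: measurable_funB; exact: mPhi.
- move=> om _; rewrite lee_fin.
  by have := expR_ge1Dx (- (path_exponent l t om - path_exponent l s om)); lra.
Qed.

End conditional_increments.

(** * Occupation times of Brownian motion *)

Section gaussian_bounds.
Context (R : realType).
Notation mu := (@lebesgue_measure R).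
Implicit Types (s x : R) (S : set R).

Let mpdf s S : measurable_fun S (fun z : R => (normal_pdf 0 s z)%:E).
Proof. by apply: measurable_funTS; apply/measurable_EFinP; exact: measurable_normal_pdf. Qed.

Lemma normal_prob_le_peak s S : 0 < s -> measurable S ->
  (normal_prob 0 s S <= (normal_peak s)%:E * mu S)%E.
Proof.
move=> s0 mS; rewrite /normal_prob -integral_cst//; apply: ge0_le_integral => //.
- by move=> z _; rewrite lee_fin normal_pdf_ge0.
- exact: mpdf.
- by move=> z _; rewrite lee_fin normal_pdf_ub// gt_eqF.
Qed.

Lemma normal_prob_ge_peak s x S : 0 < s -> measurable S -> S `<=` `[- x, x] ->
  ((normal_peak s * expR (- (x ^+ 2 / (s ^+ 2 *+ 2))))%:E * mu S <= normal_prob 0 s S)%E.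
Proof.
move=> s0 mS Sx; rewrite /normal_prob -integral_cst//; apply: ge0_le_integral => //.
- by move=> z _; rewrite lee_fin mulr_ge0 ?normal_peak_ge0 ?expR_ge0.
- exact: mpdf.
- move=> z Sz; rewrite /= lee_fin normal_pdfE ?gt_eqF// /normal_fun subr0.
  rewrite ler_wpM2l ?normal_peak_ge0// ler_expR mulNr lerN2 ler_wpM2r//.
    by rewrite invr_ge0 mulrn_wge0// sqr_ge0.
  have := Sx z Sz; rewrite /= in_itv/= => /andP[z1 z2]; clear - z1 z2; nra.
Qed.

(** Beyond x, the density with deviation s is at most sqrt 2 exp(-x^2 / (4 s^2)) times the density
    with deviation sqrt 2 s, and the latter has total mass 1. *)
Lemma normal_prob_tail s x : 0 < s -> 0 <= x ->
  (normal_prob 0 s (~` `[(- x)%R, x]) <= (Num.sqrt 2 * expR (- (x ^+ 2 / (s ^+ 2 *+ 4))))%:E)%E.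
Proof.
move=> s0 x0; pose s' := Num.sqrt 2 * s.
have s'0 : 0 < s' by rewrite mulr_gt0.
have s'2 : s' ^+ 2 = s ^+ 2 *+ 2 by rewrite exprMn sqr_sqrtr// mulr_natl.
have peakE : normal_peak s = Num.sqrt 2 * normal_peak s'.
  rewrite /normal_peak s'2.
  have -> : s ^+ 2 *+ 2 * pi *+ 2 = 2 * (s ^+ 2 * pi *+ 2) :> R by ring.
  rewrite (@sqrtrM _ 2)// invfM mulrA mulfV ?mul1r//.
pose c := Num.sqrt 2 * expR (- (x ^+ 2 / (s ^+ 2 *+ 4))).
have c0 : 0 <= c by rewrite mulr_ge0 ?expR_ge0.
have mX : measurable (~` `[- x, x]%classic) by apply: measurableC.
apply: (@le_trans _ _ (\int[mu]_(z in ~` `[(- x)%R, x]) (c%:E * (normal_pdf 0 s' z)%:E))%E).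
  apply: ge0_le_integral => //.
  - by move=> z _; rewrite lee_fin normal_pdf_ge0.
  - exact: mpdf.
  - by apply: emeasurable_funM => //; exact: mpdf.
  - move=> z /= zx; rewrite -EFinM lee_fin !normal_pdfE ?gt_eqF// /normal_fun !subr0.
    rewrite peakE /c s'2.
    rewrite [leRHS](_ : _ = Num.sqrt 2 * normal_peak s' * (expR (- (x ^+ 2 / (s ^+ 2 *+ 4))) * expR (- z ^+ 2 / (s ^+ 2 *+ 2 *+ 2)))); last by ring.
    rewrite ler_wpM2l ?mulr_ge0 ?normal_peak_ge0// -expRD ler_expR.
    have z2 : x ^+ 2 <= z ^+ 2.
      move: zx; rewrite in_itv/= => /negP; rewrite negb_and -!ltNge => /orP[]; clear - x0; nra.
    have e (a b : R) : - (a ^+ 2 / (s ^+ 2 *+ 4)) + - b ^+ 2 / (s ^+ 2 *+ 2 *+ 2) = - (a ^+ 2 + b ^+ 2) / (s ^+ 2 *+ 4).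
      by rewrite -mulrnA; ring.
    have e' (b : R) : - b ^+ 2 / (s ^+ 2 *+ 2) = - (b ^+ 2 + b ^+ 2) / (s ^+ 2 *+ 4).
      by field; rewrite gt_eqF.
    rewrite e e'.
    by rewrite ler_wpM2r ?invr_ge0 ?mulrn_wge0 ?sqr_ge0// lerN2 lerD2r.
rewrite ge0_integralZl//; last 2 first.
- exact: mpdf.
- by move=> z _; rewrite lee_fin normal_pdf_ge0.
rewrite -[leRHS]mule1 lee_wpmul2l ?lee_fin//.
rewrite -(integral_normal_pdf 0 s'); apply: ge0_subset_integral => //.
- exact: mpdf.
- by move=> z _; rewrite lee_fin normal_pdf_ge0.
Qed.

End gaussian_bounds.

Section brownian.
Context (R : realType) (d : measure_display) (T : measurableType d)
  (P : probability T R) (B : R -> {RV P >-> R}).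
Hypothesis BM : standard_Brownian_motion B.
Notation mu := (@lebesgue_measure R).
Implicit Types (u v x : R) (S : set R).

(** The maximum of the density of [B u]. *)
Definition heat_peak u : R := normal_peak (Num.sqrt u).

Let mB u : measurable_fun setT (B u) := measurable_funP (B u).

Let mpre u S : measurable S -> measurable (B u @^-1` S).
Proof. by move=> mS; rewrite -[X in measurable X]setTI; exact: mB. Qed.

Lemma brownian_lawE u S : 0 < u -> measurable S ->
  P (B u @^-1` S) = normal_prob 0 (Num.sqrt u) S.
Proof.
move=> u0 mS; have := BM_gaussian BM (lexx 0) u0 mS; rewrite subr0 => <-; congr (P _).
by apply/seteqP; split => om /=; rewrite (BM_start BM) subr0.
Qed.

Lemma brownian_law_le u S : 0 < u -> measurable S ->
  (P (B u @^-1` S) <= (heat_peak u)%:E * mu S)%E.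
Proof. by move=> u0 mS; rewrite brownian_lawE//; apply: normal_prob_le_peak; rewrite ?sqrtr_gt0. Qed.

Lemma brownian_law_ge u x S : 0 < u -> measurable S -> S `<=` `[- x, x] ->
  ((heat_peak u * expR (- (x ^+ 2 / (u *+ 2))))%:E * mu S <= P (B u @^-1` S))%E.
Proof.
move=> u0 mS Sx; rewrite brownian_lawE//.
have su0 : 0 < Num.sqrt u by rewrite sqrtr_gt0.
by have := normal_prob_ge_peak su0 mS Sx; rewrite sqr_sqrtr ?(ltW u0)// => h; exact: h.
Qed.

Lemma brownian_tail u x : 0 < u -> 0 <= x ->
  (P (B u @^-1` (~` `[(- x)%R, x])) <= (Num.sqrt 2 * expR (- (x ^+ 2 / (u *+ 4))))%:E)%E.
Proof.
move=> u0 x0; rewrite brownian_lawE//; last exact: measurableC.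
have su0 : 0 < Num.sqrt u by rewrite sqrtr_gt0.
by have := normal_prob_tail su0 x0; rewrite sqr_sqrtr ?(ltW u0)// => h; exact: h.
Qed.

(** The pair of [B u] and the increment has a product law. For each value of [B u], the increment
    must fall into a translate of [S'], whose Lebesgue measure does not depend on that value. *)
Lemma brownian_two_times u v S S' : 0 <= u -> u < v -> measurable S -> measurable S' ->
  (P (B u @^-1` S `&` B v @^-1` S') <= P (B u @^-1` S) * ((heat_peak (v - u))%:E * mu S'))%E.
Proof.
move=> u0 uv mS mS'.
have vu0 : 0 < v - u by rewrite subr_gt0.
have mD : measurable_fun setT (fun om => B v om - B u om) by exact: measurable_funB.
have mUD : measurable_fun setT (fun om => (B u om, B v om - B u om) : (R * R)%type).
  exact: measurable_fun_pair.
pose D : {mfun T >-> R} := HB.pack (fun om => B v om - B u om : R)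
  (isMeasurableFun.Build _ _ _ _ _ mD).
pose U : {mfun T >-> R} := HB.pack (B u : T -> R)
  (isMeasurableFun.Build _ _ _ _ _ (@mB u)).
pose UD : {mfun T >-> (R * R)%type} :=
  HB.pack (fun om => (B u om, B v om - B u om) : (R * R)%type)
  (isMeasurableFun.Build _ _ _ _ _ mUD).
pose lU := distribution P U; pose lD := distribution P D.
have indep (A A' : set (R)) : measurable A -> measurable A' ->
    distribution P UD (A `*` A') = (lU A * lD A')%E.
  move=> mA mA'; pose t (i : nat) : R := if i == 0%N then 0 else if i == 1%N then u else v.
  pose W (i : 'I_2) : set R := if i == ord0 then A else A'.
  have tS i : t i <= t i.+1 by case: i => [|[|i]]//; rewrite /t/= ltW.
  have mW i : measurable (W i) by rewrite /W; case: ifP.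
  have := BM_indep BM (lexx 0 : 0 <= t 0%N) tS mW.
  rewrite big_ord_recl big_ord1/= /W/= /t/= /lU /lD /distribution /pushforward/=.
  have -> : [set om | A (B u om - B 0 om)] = U @^-1` A.
    by apply/seteqP; split => om /=; rewrite (BM_start BM) subr0.
  move=> <-; congr (P _); apply/seteqP; split => om /=.
    move=> [h1 h2] i; case: (unliftP ord0 i) => [j|] -> /=; first by rewrite ord1.
    by rewrite (BM_start BM) subr0.
  by move=> h; have := h ord0; have := h ord_max; rewrite /= (BM_start BM) subr0.
pose Z : set (R * R) := [set z | S z.1 /\ S' (z.1 + z.2)].
have mZ : measurable Z.
  have -> : Z = fst @^-1` S `&` (fun z => z.1 + z.2) @^-1` S' by [].
  apply: measurableI; rewrite -[X in measurable X]setTI.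
    exact: measurable_fst.
  have ma : measurable_fun setT (fun z : R * R => (z.1 + z.2)%R : R).
    by apply: measurable_funD; [exact: measurable_fst|exact: measurable_snd].
  exact: ma.
have -> : P (B u @^-1` S `&` B v @^-1` S') = distribution P UD Z.
  by rewrite /distribution /pushforward/=; congr (P _); apply/seteqP; split => om /=; rewrite /Z/= (addrC (B u om)) subrK.
rewrite -(product_measure_unique (m1 := lU) (m2 := lD) indep mZ) /product_measure1.
apply: (@le_trans _ _ (\int[lU]_x ((\1_S x)%:E * ((heat_peak (v - u))%:E * mu S')))%E).
  apply: ge0_le_integral => //.
  - exact: measurable_fun_xsection.
  - apply: emeasurable_funM => //; apply/measurable_EFinP; exact: measurable_indic.
  - move=> x _ /=; rewrite indicE; case: (boolP (x \in S)) => [xS|xS]; last first.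
      rewrite mul0e (_ : xsection Z x = set0) ?measure0//.
      by apply/seteqP; split => // z; move=> /xsectionP [/= Sx _]; move: xS; rewrite notin_setE.
    rewrite mul1e -(lebesgue_measure_translate x mS').
    have mT : measurable ((fun s => s + x) @^-1` S').
      rewrite -[X in measurable X]setTI; exact: (measurable_funD (@measurable_id _ _ setT) (measurable_cst x)).
    have := BM_gaussian BM u0 uv mT.
    have -> : distribution P D (xsection Z x) = P [set om | ((fun s => s + x) @^-1` S') (B v om - B u om)].
      rewrite /distribution /pushforward/=; congr (P _); apply/seteqP; split => om /=.
        by move=> /xsectionP [_ /=]; rewrite addrC.
      by move=> S'x; apply/xsectionP; split => /=; [rewrite inE in xS|rewrite addrC].
    move=> ->; apply: normal_prob_le_peak => //; by rewrite sqrtr_gt0.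
rewrite ge0_integralZr//.
- by rewrite integral_indic// setIT.
- by apply/measurable_EFinP; exact: measurable_indic.
- by rewrite mule_ge0// lee_fin normal_peak_ge0.
Qed.

(** Negative times are sent to 0: continuity is known on [0, +oo[ only, while joint measurability is
    needed over the whole line. *)
Definition path_at (om : T) v : R := B (Num.max v 0) om.

Lemma path_atE om v : 0 <= v -> path_at om v = B v om.
Proof. by move=> v0; rewrite /path_at (max_idPl v0). Qed.

Let jm_aux dd (T' : measurableType dd) (pi : T' -> T) :
  (forall w, 0 <= w -> measurable_fun setT (B w \o pi)) ->
  jointly_measurable (fun (y : T') v => path_at (pi y) v).
Proof.
move=> mpi.
apply: (measurable_path (b := fun w z => B w (pi z.1)) (l := fun z : T' * measurableTypeR R => Num.max z.2 0)).
- by move=> w w0; exact: (measurableT_comp (mpi w w0) measurable_fst).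
- by move=> z; exact: BM_continuous BM _.
- by apply: measurable_maxr => //; exact: measurable_snd.
- by move=> z; rewrite le_max lexx orbT.
Qed.

Lemma jointly_measurable_path_at : jointly_measurable path_at.
Proof. by apply: (jm_aux (pi := idfun)) => w _; exact: mB. Qed.

Lemma jointly_measurable_path_space :
  jointly_measurable (path_at : path_space B -> R -> R).
Proof. by apply: (@jm_aux _ (path_space B) (fun om => om)) => w w0; exact: measurable_path_eval. Qed.

End brownian.

(** * Second moment method *)

Section second_moment.
Context (R : realType) (d : measure_display) (T : measurableType d) (P : probability T R).

(** Chebyshev's inequality. The diagonal contributes C n and the n^2 pairs contribute C / n each, so
    that the variance is at most 2 C n, and a deviation of n / 2 has probability at most 8 C / n. *)
Lemma second_moment_concentration (n : nat) (C : R) (Z : 'I_n -> T -> R) :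
  (0 < n)%N -> 0 <= C ->
  (forall i, measurable_fun setT (Z i)) -> (forall i om, 0 <= Z i om) ->
  (forall i, \int[P]_om (Z i om)%:E = 1)%E ->
  (forall i, \int[P]_om (Z i om * Z i om)%:E <= C%:E)%E ->
  (forall i j, i != j -> \int[P]_om (Z i om * Z j om)%:E <= (1 + C / n%:R)%:E)%E ->
  (P [set om | (\sum_(i < n) Z i om < n%:R / 2)%R] <= (8 * C / n%:R)%:E)%E.
Proof.
move=> n0 C0 mZ Z0 Z1 Zii Zij.
have n0' : 0 < n%:R :> R by rewrite ltr0n.
pose W om := \sum_(i < n) Z i om.
have mW : measurable_fun setT W by exact: measurable_sum.
have W0 om : 0 <= W om by exact: sumr_ge0.
have iW : (\int[P]_om (W om)%:E = n%:R%:E)%E.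
  rewrite /W; under eq_integral do rewrite -sumEFin.
  rewrite ge0_integral_sum//; last 2 first.
  - by move=> i; apply/measurable_EFinP.
  - by move=> i om _; rewrite lee_fin.
  under eq_bigr do rewrite Z1.
  by rewrite sumEFin sumr_const card_ord.
have iWW : (\int[P]_om (W om * W om)%:E <= (n%:R ^+ 2 + 2 * C * n%:R)%:E)%E.
  have -> : (\int[P]_om (W om * W om)%:E = \sum_(i < n) \sum_(j < n) \int[P]_om (Z i om * Z j om)%:E)%E.
    transitivity (\int[P]_om (\sum_(i < n) \sum_(j < n) (Z i om * Z j om)%:E))%E.
      apply: eq_integral => om _; rewrite /W mulr_suml -sumEFin; apply: eq_bigr => i _.
      by rewrite mulr_sumr -sumEFin.
    rewrite ge0_integral_sum//; last 2 first.
    - by move=> i; apply: emeasurable_sum => j; apply/measurable_EFinP; exact: measurable_funM.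
    - by move=> i om _; apply: sume_ge0 => j _; rewrite lee_fin mulr_ge0.
    apply: eq_bigr => i _; rewrite ge0_integral_sum//.
    - by move=> j; apply/measurable_EFinP; exact: measurable_funM.
    - by move=> j om _; rewrite lee_fin mulr_ge0.
  apply: (@le_trans _ _ (\sum_(i < n) \sum_(j < n) ((1 + C / n%:R) + (if i == j then C else 0))%:E)%E).
    apply: lee_sum => i _; apply: lee_sum => j _; case: eqVneq => [<-|ij].
      by apply: le_trans (Zii i) _; rewrite lee_fin; rewrite lerDr addr_ge0// divr_ge0// ltW.
    by rewrite addr0; exact: Zij.
  rewrite (eq_bigr (fun i => (n%:R + 2 * C)%:E)).
    rewrite sumEFin sumr_const card_ord lee_fin -mulr_natr.
    by rewrite le_eqVlt; apply/orP; left; apply/eqP; ring.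
  move=> i _; rewrite sumEFin big_split/= sumr_const card_ord -big_mkcond/= (big_pred1 i)/=; last by move=> j; rewrite eq_sym.
  congr EFin; have n1 : n%:R != 0 :> R by rewrite gt_eqF.
  by rewrite -mulr_natr; field.
have mV : measurable_fun setT (fun om => (W om - n%:R) * (W om - n%:R)).
  by apply: measurable_funM; apply: measurable_funB.
have V0 om : 0 <= (W om - n%:R) * (W om - n%:R) by rewrite -expr2 sqr_ge0.
have iV : (\int[P]_om ((W om - n%:R) * (W om - n%:R))%:E <= (2 * C * n%:R)%:E)%E.
  have e : (\int[P]_om ((W om - n%:R) * (W om - n%:R))%:E + (2 * n%:R * n%:R)%:E =
     \int[P]_om (W om * W om)%:E + (n%:R * n%:R)%:E)%E.
    have -> : ((2 * n%:R * n%:R)%:E = \int[P]_om (2 * n%:R * W om)%:E)%E.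
      under eq_integral do rewrite EFinM.
      rewrite ge0_integralZl ?lee_fin ?mulr_ge0//; last 2 first.
      - exact/measurable_EFinP.
      - by move=> om _; rewrite lee_fin.
      by rewrite iW.
    have -> : ((n%:R * n%:R)%:E = \int[P]_om (n%:R * n%:R : R)%:E)%E.
      by rewrite integral_cst// [X in (_ * X)%E]probability_setT mule1.
    rewrite -!ge0_integralD//=.
    - by apply: eq_integral => om _; rewrite -!EFinD; congr EFin; ring.
    - by move=> om _; rewrite lee_fin mulr_ge0.
    - by apply/measurable_EFinP; exact: measurable_funM.
    - by move=> om _; rewrite lee_fin V0.
    - exact/measurable_EFinP.
    - by move=> om _; rewrite lee_fin !mulr_ge0.
    - by apply/measurable_EFinP; exact: measurable_funM.
  rewrite -(@leeD2rE _ (2 * n%:R * n%:R)%:E)// e.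
  apply: (@le_trans _ _ ((n%:R ^+ 2 + 2 * C * n%:R)%:E + (n%:R * n%:R)%:E)%E).
    by apply: leeD.
  by rewrite -!EFinD lee_fin le_eqVlt; apply/orP; left; apply/eqP; ring.
pose E := [set om | \sum_(i < n) Z i om < n%:R / 2].
have mE : measurable E.
  have -> : E = W @^-1` `]-oo, n%:R / 2[%classic.
    by apply/seteqP; split => om; rewrite /E/= in_itv.
  by rewrite -[X in measurable X]setTI; exact: mW.
have key : ((n%:R ^+ 2 / 4)%:E * P E <= (2 * C * n%:R)%:E)%E.
  apply: le_trans iV.
  rewrite -[X in (_ * P X)%E]setIT -integral_indic// -ge0_integralZl//; last first.
    by apply/measurable_EFinP; exact: measurable_indic.
  apply: ge0_le_integral => //.
  - by apply: emeasurable_funM => //; exact/measurable_EFinP.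
  - exact/measurable_EFinP.
  - move=> om _; rewrite -EFinM lee_fin indicE; case: (boolP (om \in E)); last by rewrite mulr0 V0.
    rewrite inE /E/= -/(W om) => Wn; rewrite mulr1.
    clear - Wn n0' W0; nra.
have c0 : 0 < n%:R ^+ 2 / 4 :> R by rewrite divr_gt0// exprn_gt0.
rewrite -(@lee_pmul2l _ (n%:R ^+ 2 / 4)%:E)//.
rewrite (le_trans key)// -EFinM lee_fin le_eqVlt; apply/orP; left; apply/eqP.
by field; rewrite gt_eqF.
Qed.

End second_moment.

Section time_moments.
Context (R : realType) (d : measure_display) (T : measurableType d) (P : probability T R)
  (y K : R).
Notation mu := (@lebesgue_measure R).
Implicit Types f g : T -> R -> R.

Let I v : R := \1_(`[0, y]%classic) v.

Let mI f : jointly_measurable f -> measurable_fun setT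
  (fun z : T * measurableTypeR R => (I z.2 * f z.1 z.2)%:E).
Proof. by move=> mf; exact: jointly_measurable_indic. Qed.

Let mOm f v : jointly_measurable f -> measurable_fun setT (fun om => f om v).
Proof.
move=> mf; have := measurableT_comp mf (@measurable_pair2 _ _ T (measurableTypeR R) v).
exact.
Qed.

Let IE f om : jointly_measurable f -> (forall v, 0 <= f om v <= K) ->
  ((time_int y f om)%:E = \int[mu]_v (I v * f om v)%:E)%E.
Proof.
move=> mf fK; rewrite -(@time_intE _ _ _ y f om K)//; first by rewrite time_int_indic.
by move=> v; have /andP[f0 f1] := fK v; rewrite ger0_norm.
Qed.

Lemma mean_time_int f : jointly_measurable f -> (forall om v, 0 <= f om v <= K) ->
  (\int[P]_om (time_int y f om)%:E = \int[mu]_v ((I v)%:E * \int[P]_om (f om v)%:E))%E.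
Proof.
move=> mf fK.
have f0 om v : 0 <= f om v by have /andP[] := fK om v.
under eq_integral do rewrite IE//.
rewrite (fubini_tonelli (m1 := P) (m2 := mu) (fun z : T * measurableTypeR R => (I z.2 * f z.1 z.2)%:E) (mI mf)); last by move=> z; rewrite lee_fin mulr_ge0.
apply: eq_integral => v _; rewrite /fubini_G/=.
under eq_integral do rewrite EFinM.
rewrite ge0_integralZl// ?lee_fin//.
- by apply/measurable_EFinP; exact: mOm.
- by move=> om _; rewrite lee_fin.
Qed.

Lemma measurable_product_mean f g : jointly_measurable f -> jointly_measurable g ->
  (forall om v, 0 <= f om v) -> (forall om v, 0 <= g om v) ->
  measurable_fun setT (fun z : measurableTypeR R * measurableTypeR R =>
    \int[P]_om (f om z.1 * g om z.2)%:E)%E.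
Proof.
move=> mf mg f0 g0.
apply: (measurable_fun_fubini_tonelli_F (m2 := P)
   (fun z : (measurableTypeR R * measurableTypeR R) * T => (f z.2 z.1.1 * g z.2 z.1.2)%:E)).
- apply/measurable_EFinP; apply: measurable_funM.
  + apply: (measurableT_comp (f := fun z : T * measurableTypeR R => f z.1 z.2)
      (g := fun z : (measurableTypeR R * measurableTypeR R) * T => (z.2, z.1.1))) => //.
    apply: measurable_fun_pair; first exact: measurable_snd.
    exact: (measurableT_comp measurable_fst measurable_fst).
  + apply: (measurableT_comp (f := fun z : T * measurableTypeR R => g z.1 z.2)
      (g := fun z : (measurableTypeR R * measurableTypeR R) * T => (z.2, z.1.2))) => //.
    apply: measurable_fun_pair; first exact: measurable_snd.
    exact: (measurableT_comp measurable_snd measurable_fst).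
- by move=> z; rewrite lee_fin mulr_ge0.
Qed.

Lemma mean_product_time_int f g : jointly_measurable f -> jointly_measurable g ->
  (forall om v, 0 <= f om v <= K) -> (forall om v, 0 <= g om v <= K) ->
  (\int[P]_om (time_int y f om * time_int y g om)%:E =
   \int[mu]_u \int[mu]_v ((I u * I v)%:E * \int[P]_om (f om u * g om v)%:E))%E.
Proof.
move=> mf mg fK gK.
have f0 om v : 0 <= f om v by have /andP[] := fK om v.
have g0 om v : 0 <= g om v by have /andP[] := gK om v.
have G0 om : 0 <= time_int y g om by exact: time_int_ge0.
have mG : measurable_fun setT (time_int y g) by exact: measurable_time_int.
have -> : (\int[P]_om (time_int y f om * time_int y g om)%:E =
    \int[P]_om \int[mu]_u ((I u * f om u) * time_int y g om)%:E)%E.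
  apply: eq_integral => om _; rewrite EFinM IE//.
  rewrite -ge0_integralZr// ?lee_fin//.
  - apply/measurable_EFinP; apply: measurable_funM; first exact: measurable_indic.
    exact: jointly_measurable_section.
  - by move=> u _; rewrite lee_fin mulr_ge0.
rewrite (fubini_tonelli (m1 := P) (m2 := mu)
  (fun z : T * measurableTypeR R => (I z.2 * f z.1 z.2 * time_int y g z.1)%:E)); last 2 first.
- apply/measurable_EFinP; apply: measurable_funM; first by apply/measurable_EFinP; exact: mI.
  exact: (measurableT_comp mG measurable_fst).
- by move=> z; rewrite lee_fin !mulr_ge0.
apply: eq_integral => u _; rewrite /fubini_G/=.
have -> : (\int[P]_om (I u * f om u * time_int y g om)%:E =
    \int[P]_om \int[mu]_v ((I u * I v) * (f om u * g om v))%:E)%E.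
  apply: eq_integral => om _; rewrite EFinM IE//.
  rewrite -ge0_integralZl// ?lee_fin ?mulr_ge0//.
  - by apply: eq_integral => v _; rewrite -EFinM; congr EFin; ring.
  - apply/measurable_EFinP; apply: measurable_funM; first exact: measurable_indic.
    exact: jointly_measurable_section.
  - by move=> v _; rewrite lee_fin mulr_ge0.
rewrite (fubini_tonelli (m1 := P) (m2 := mu)
  (fun z : T * measurableTypeR R => (I u * I z.2 * (f z.1 u * g z.1 z.2))%:E)); last 2 first.
- apply/measurable_EFinP; apply: measurable_funM.
    apply: measurable_funM => //.
    by apply: measurable_indic_comp => //; exact: measurable_snd.
  apply: measurable_funM => //.
  exact: (measurableT_comp (mOm u mf) measurable_fst).
- by move=> z; rewrite lee_fin !mulr_ge0.
apply: eq_integral => v _; rewrite /fubini_G/=.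
under eq_integral do rewrite EFinM.
rewrite ge0_integralZl// ?lee_fin ?mulr_ge0//.
- by apply/measurable_EFinP; apply: measurable_funM; exact: mOm.
- by move=> om _; rewrite lee_fin mulr_ge0.
Qed.

End time_moments.

Section translation.
Context (R : realType).
Notation mu := (@lebesgue_measure R).

Lemma integral_translate (f : R -> \bar R) x : measurable_fun setT f ->
  (forall s, 0 <= f s)%E ->
  (\int[mu]_s f (s + x)%R = \int[mu]_s f s)%E.
Proof.
move=> mf f0.
have ml : measurable_fun setT (fun s : measurableTypeR R => (s + x)%R : measurableTypeR R).
  exact: measurable_funD.
pose phi : {mfun measurableTypeR R >-> measurableTypeR R} :=
  HB.pack (fun s : measurableTypeR R => (s + x)%R : measurableTypeR R)
    (isMeasurableFun.Build _ _ _ _ _ ml).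
rewrite [RHS](eq_measure_integral (pushforward mu phi)); last first.
  by move=> A mA _; exact/esym/(lebesgue_measure_translate x mA).
by rewrite ge0_integral_pushforward.
Qed.

Lemma le_integral_inv_sqrt (r : R) : 0 < r ->
  (\int[mu]_(s in `]0%R, r]) (s `^ (- 2^-1))%:E <= (2 * r `^ 2^-1)%:E)%E.
Proof.
move=> r0; have h : (2^-1 : R) < 1 by lra.
apply: le_trans (le_integral_powRN h r0) _.
rewrite lee_fin (_ : 1 - 2^-1 = 2^-1 :> R); last by lra.
by rewrite invrK mulrC.
Qed.

End translation.

(** * Occupation during well separated time blocks *)

Section blocks.
Context (R : realType) (d : measure_display) (T : measurableType d)
  (P : probability T R) (B : R -> {RV P >-> R}).
Hypothesis BM : standard_Brownian_motion B.
Notation mu := (@lebesgue_measure R).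
Implicit Types (s u v x y L : R) (S : set R).

Definition gauss_cst : R := @heat_peak R 1.

Lemma gauss_cst_gt0 : 0 < gauss_cst.
Proof. by apply: normal_peak_gt0; rewrite gt_eqF// sqrtr_gt0. Qed.

Lemma heat_peakE u : 0 < u -> heat_peak u = gauss_cst / Num.sqrt u.
Proof.
move=> u0; rewrite /gauss_cst /heat_peak /normal_peak !sqr_sqrtr ?ltW//.
rewrite mul1r -mulrnAr sqrtrM ?ltW// invfM mulrC.
by [].
Qed.

Lemma le_heat_peak u v : 0 < u -> u <= v -> heat_peak v <= heat_peak u.
Proof.
move=> u0 uv; have v0 : 0 < v by apply: lt_le_trans uv.
rewrite !heat_peakE// ler_wpM2l ?(ltW gauss_cst_gt0)// lef_pV2 ?posrE ?sqrtr_gt0//.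
by rewrite ler_sqrt// ltW.
Qed.

Lemma heat_peak_ge0 u : 0 <= heat_peak u :> R.
Proof. exact: normal_peak_ge0. Qed.

Let mpre u S : measurable S -> measurable (B u @^-1` S).
Proof. by move=> mS; rewrite -[X in measurable X]setTI; exact: (measurable_funP (B u)). Qed.

(** The time window is a dyadic block, so that all times in it are comparable to s, and blocks at
    distant scales are almost uncorrelated. *)
Definition block s S (om : T) v : R := \1_(`[s, 2 * s]%classic) v * \1_S (path_at B om v).

Lemma jointly_measurable_block s S : measurable S -> jointly_measurable (block s S).
Proof.
move=> mS; apply: measurable_funM.
  by apply: measurable_indic_comp => //; exact: measurable_snd.
by apply: measurable_indic_comp => //; exact: jointly_measurable_path_at.
Qed.

Lemma block01 s S om v : 0 <= block s S om v <= 1.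
Proof.
by rewrite /block !indicE; do 2! case: (_ \in _); rewrite /= ?mulr1 ?mulr0 ?lexx ?ler01.
Qed.

Let block_gt0 s v : 0 < s -> \1_(`[s, 2 * s]%classic) v != 0 :> R -> 0 < v.
Proof.
by move=> s0; rewrite indicE; case: (boolP (v \in _)) => [|_ /eqP//]; rewrite inE/= in_itv/= => /andP[sv _] _; exact: lt_le_trans sv.
Qed.

Lemma block_mean s S v : 0 < s -> measurable S ->
  (\int[P]_om (block s S om v)%:E = (\1_(`[s, 2 * s]%classic) v)%:E * P (B v @^-1` S))%E.
Proof.
move=> s0 mS; rewrite /block; have [->|/(block_gt0 s0) v0] := eqVneq (\1_(`[s, 2 * s]%classic) v : R) 0.
  by rewrite mul0e integral0_eq// => om _; rewrite mul0r.
rewrite -[X in (_ * P X)%E]setIT -integral_indic//; last exact: mpre.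
rewrite -ge0_integralZl//.
- apply: eq_integral => om _; rewrite EFinM path_atE ?ltW//.
- by apply/measurable_EFinP; apply: measurable_indic; exact: mpre.
Qed.

Lemma block_product_mean s s' S S' u v : 0 < s -> 0 < s' -> measurable S -> measurable S' ->
  (\int[P]_om (block s S om u * block s' S' om v)%:E =
   (\1_(`[s, 2 * s]%classic) u * \1_(`[s', 2 * s']%classic) v)%:E *
     P (B u @^-1` S `&` B v @^-1` S'))%E.
Proof.
move=> s0 s0' mS mS'; rewrite /block.
have [->|/(block_gt0 s0) u0] := eqVneq (\1_(`[s, 2 * s]%classic) u : R) 0.
  by rewrite mul0r mul0e integral0_eq// => om _; rewrite !mul0r.
have [->|/(block_gt0 s0') v0] := eqVneq (\1_(`[s', 2 * s']%classic) v : R) 0.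
  by rewrite mulr0 mul0e integral0_eq// => om _; rewrite !mul0r mulr0.
rewrite -[X in (_ * P X)%E]setIT -integral_indic//; last by apply: measurableI; exact: mpre.
rewrite -ge0_integralZl//.
- apply: eq_integral => om _; rewrite -EFinM !path_atE ?ltW//; congr EFin.
  rewrite mulrACA; congr (_ * _); symmetry.
  by apply: indicI_iff.
- by apply/measurable_EFinP; apply: measurable_indic; apply: measurableI; exact: mpre.
Qed.

Section block_pairs.
Variables (y s : R) (S : set R).
Hypotheses (s0 : 0 < s) (sy : 2 * s <= y) (mS : measurable S).

Definition block_occ := time_int y (block s S).

Lemma measurable_block_occ : measurable_fun setT block_occ.
Proof.
apply: measurable_time_int; first exact: jointly_measurable_block.
by move=> om v; have /andP[] := block01 s S om v.
Qed.

Lemma block_occ_ge0 om : 0 <= block_occ om.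
Proof. by apply: time_int_ge0 => v; have /andP[] := block01 s S om v. Qed.

Let Iblock v : \1_(`[0, y]%classic) v * \1_(`[s, 2 * s]%classic) v = \1_(`[s, 2 * s]%classic) v :> R.
Proof.
rewrite !indicE -natrM mulnb; congr ((nat_of_bool _)%:R).
apply/andP/idP => [[]//|h]; split => //; move: h.
by rewrite !inE/= !in_itv/= => /andP[h1 h2]; rewrite (le_trans (ltW s0) h1) (le_trans h2 sy).
Qed.

Lemma block_occ_mean :
  (\int[P]_om (block_occ om)%:E =
   \int[mu]_v ((\1_(`[s, 2 * s]%classic) v)%:E * P (B v @^-1` S)))%E.
Proof.
rewrite (mean_time_int P y (jointly_measurable_block s mS) (block01 s S)).
by apply: eq_integral => v _; rewrite block_mean// muleA -EFinM Iblock.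
Qed.

Lemma measurable_block_mean : measurable_fun setT
  (fun v : measurableTypeR R => (\1_(`[s, 2 * s]%classic) v)%:E * P (B v @^-1` S))%E.
Proof.
have -> : (fun v : measurableTypeR R => (\1_(`[s, 2 * s]%classic) v)%:E * P (B v @^-1` S))%E =
    (fun v : measurableTypeR R => \int[P]_om (block s S om v)%:E)%E.
  by apply/funext => v; rewrite block_mean.
apply: (measurable_fun_fubini_tonelli_G (m1 := P)
  (fun z : T * measurableTypeR R => (block s S z.1 z.2)%:E)).
- by apply/measurable_EFinP; exact: jointly_measurable_block.
- by move=> z; rewrite lee_fin; have /andP[] := block01 s S z.1 z.2.
Qed.

(** For v in [s, 2s] and x^2 <= s, the density of [B v] on [-x, x] is at least half of its peak,
    which itself is at least half of the peak at time s; the block has length s. *)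
Lemma block_occ_mean_ge x L : 0 <= x -> x ^+ 2 <= s -> S `<=` `[- x, x] -> mu S = L%:E ->
  ((gauss_cst / 4 * Num.sqrt s * L)%:E <= \int[P]_om (block_occ om)%:E)%E.
Proof.
move=> x0 xs Sx SL.
have L0 : 0 <= L by rewrite -lee_fin -SL.
rewrite block_occ_mean.
have ss0 : 0 < Num.sqrt s by rewrite sqrtr_gt0.
pose c := gauss_cst / (4 * Num.sqrt s) * L.
have c0 : 0 <= c by rewrite mulr_ge0// divr_ge0 ?ltW ?gauss_cst_gt0// mulr_gt0.
have -> : ((gauss_cst / 4 * Num.sqrt s * L)%:E = \int[mu]_v ((\1_(`[s, 2 * s]%classic) v)%:E * c%:E))%E.
  rewrite ge0_integralZr ?lee_fin//; last exact/measurable_EFinP.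
  rewrite integral_indic// setIT.
  rewrite -[X in (X * _)%E]/(mu `[s, 2 * s]%classic) lebesgue_measure_itv/= lte_fin ltr_pMl// ltr1n.
  rewrite -EFinB -EFinM; congr EFin; rewrite /c.
  have {1}-> : Num.sqrt s = s / Num.sqrt s.
    by rewrite -{2}(sqr_sqrtr (ltW s0)) expr2 mulfK// gt_eqF.
  by field; rewrite gt_eqF.
apply: ge0_le_integral => //.
- by move=> v _; rewrite mule_ge0 ?lee_fin.
- by apply: emeasurable_funM => //; apply/measurable_EFinP; exact: measurable_indic.
- exact: measurable_block_mean.
- move=> v _; have [->|] := eqVneq (\1_(`[s, 2 * s]%classic) v : R) 0; first by rewrite !mul0e.
  rewrite indicE; case: (boolP (v \in _)) => [|_ /eqP//]; rewrite inE/= in_itv/= => /andP[sv v2s] _.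
  rewrite !mul1e; have v0 : 0 < v by apply: lt_le_trans sv.
  apply: le_trans (brownian_law_ge BM v0 mS Sx); rewrite SL -EFinM lee_fin.
  rewrite /c ler_wpM2r//.
  have h1 : 2^-1 <= expR (- (x ^+ 2 / (v *+ 2))).
    apply: le_trans (expR_ge1Dx _).
    have : x ^+ 2 / (v *+ 2) <= 2^-1.
      rewrite ler_pdivrMr ?mulrn_wgt0// (_ : 2^-1 * (v *+ 2) = v); last by field.
      exact: le_trans sv.
    lra.
  (* The left-hand side is the peak at time 4 s, and v <= 2 s <= 4 s. *)
  have h2 : gauss_cst / (2 * Num.sqrt s) <= heat_peak v.
    have e : 2 * Num.sqrt s = Num.sqrt (4 * s).
      rewrite sqrtrM// (_ : 4 = 2 ^+ 2 :> R); last by ring.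
      by rewrite sqrtr_sqr ger0_norm.
    rewrite e -heat_peakE ?mulr_gt0//; apply: le_heat_peak => //.
    by apply: le_trans v2s _; apply: ler_wpM2r; rewrite ?(ltW s0)// ler_nat.
  apply: (@le_trans _ _ (gauss_cst / (2 * Num.sqrt s) * 2^-1)).
    by rewrite le_eqVlt; apply/orP; left; apply/eqP; field; rewrite gt_eqF.
  by rewrite ler_pM// ?invr_ge0// divr_ge0 ?ltW ?gauss_cst_gt0// mulr_gt0.
Qed.

End block_pairs.

(** For u in the first block and v in the second, v >= 2 n u. Hence the peak at time v - u exceeds
    that at time v by a factor at most 1/q with q = 1 - 1/(2n), and n x^2 <= s' makes the density at
    time v on [-x, x] at least q times its peak. Both losses together are at most 1 + 3/n. *)
Lemma block_occ_pair y s s' S S' n x L : (0 < n)%N -> 0 < s -> 2 * s' <= y ->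
  4 * n%:R * s <= s' -> measurable S -> measurable S' ->
  0 <= x -> n%:R * x ^+ 2 <= s' -> S' `<=` `[- x, x] -> mu S' = L%:E ->
  (\int[P]_om (block_occ y s S om * block_occ y s' S' om)%:E <=
   (1 + 3 / n%:R)%:E * ((\int[P]_om (block_occ y s S om)%:E) *
     (\int[P]_om (block_occ y s' S' om)%:E)))%E.
Proof.
move=> n0 s0 sy' ss' mS mS' x0 xs' Sx SL.
have n0' : 0 < n%:R :> R by rewrite ltr0n.
have n1 : 1 <= n%:R :> R by rewrite ler1n.
have L0 : 0 <= L by rewrite -lee_fin -SL.
have s0' : 0 < s' by apply: lt_le_trans ss'; rewrite !mulr_gt0.
have sy : 2 * s <= y.
  apply: le_trans sy'; rewrite ler_wpM2l//; apply: le_trans ss'.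
  by rewrite -[leLHS]mul1r ler_wpM2r ?ltW//; lra.
have jm := jointly_measurable_block s mS.
have jm' := jointly_measurable_block s' mS'.
rewrite (mean_product_time_int P y jm jm' (block01 s S) (block01 s' S')).
rewrite !block_occ_mean//.
pose a u : \bar R := ((\1_(`[s, 2 * s]%classic) u)%:E * P (B u @^-1` S))%E.
pose b v : \bar R := ((\1_(`[s', 2 * s']%classic) v)%:E * P (B v @^-1` S'))%E.
have a0 u : (0 <= a u)%E by rewrite mule_ge0// lee_fin.
have b0 v : (0 <= b v)%E by rewrite mule_ge0// lee_fin.
have ma : measurable_fun setT (a : measurableTypeR R -> \bar R) by exact: measurable_block_mean.
have mb : measurable_fun setT (b : measurableTypeR R -> \bar R) by exact: measurable_block_mean.
pose k := 1 + 3 / n%:R : R.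
have k0 : 0 <= k by rewrite addr_ge0// divr_ge0.
rewrite -[X in (_ <= _ * (X * _))%E]/(\int[mu]_u a u)%E -[X in (_ <= _ * (_ * X))%E]/(\int[mu]_v b v)%E.
have -> : (k%:E * ((\int[mu]_u a u) * (\int[mu]_v b v)) = \int[mu]_u \int[mu]_v (k%:E * (a u * b v)))%E.
  rewrite -ge0_integralZr//; last exact: integral_ge0.
  rewrite -ge0_integralZl//; last 2 first.
  - by apply: emeasurable_funM => //; exact: measurable_cst.
  - by move=> u _; rewrite mule_ge0// integral_ge0.
  apply: eq_integral => u _; rewrite -ge0_integralZl//.
  rewrite -ge0_integralZl//; last 2 first.
  - by apply: emeasurable_funM => //; exact: measurable_cst.
  - by move=> v _; rewrite mule_ge0.
have mJ : measurable_fun setT (fun z : measurableTypeR R * measurableTypeR R =>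
    (((\1_(`[0, y]%classic) z.1 : R) * \1_(`[0, y]%classic) z.2)%:E * \int[P]_om (block s S om z.1 * block s' S' om z.2)%:E)%E).
  apply: emeasurable_funM; last first.
    apply: measurable_product_mean => //.
    - by move=> om v; have /andP[] := block01 s S om v.
    - by move=> om v; have /andP[] := block01 s' S' om v.
  apply/measurable_EFinP; apply: measurable_funM; apply: measurable_indic_comp => //.
have J0 u v : (0 <= ((\1_(`[0, y]%classic) u : R) * \1_(`[0, y]%classic) v)%:E * \int[P]_om (block s S om u * block s' S' om v)%:E)%E.
  rewrite mule_ge0 ?lee_fin ?mulr_ge0//; apply: integral_ge0 => om _; rewrite lee_fin mulr_ge0//.
  - by have /andP[] := block01 s S om u.
  - by have /andP[] := block01 s' S' om v.
have mK : measurable_fun setT (fun z : measurableTypeR R * measurableTypeR R => (k%:E * (a z.1 * b z.2))%E).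
  apply: emeasurable_funM; first exact: measurable_cst.
  by apply: emeasurable_funM; [exact: (measurableT_comp ma measurable_fst)|exact: (measurableT_comp mb measurable_snd)].
apply: ge0_le_integral => //.
- by move=> u _; apply: integral_ge0.
- exact: (measurable_fun_fubini_tonelli_F (m2 := mu) _ mJ (fun z => J0 z.1 z.2)).
- apply: (measurable_fun_fubini_tonelli_F (m2 := mu) _ mK) => z; rewrite mule_ge0 ?lee_fin//; exact: mule_ge0.
move=> u _; apply: ge0_le_integral => //.
- exact: (measurableT_comp mJ (@measurable_pair1 _ _ (measurableTypeR R) (measurableTypeR R) u)).
- exact: (measurableT_comp mK (@measurable_pair1 _ _ (measurableTypeR R) (measurableTypeR R) u)).
move=> v _; rewrite block_product_mean// muleA -EFinM.
apply: (@le_trans _ _ ((\1_(`[s, 2 * s]%classic) u * \1_(`[s', 2 * s']%classic) v)%:E * P (B u @^-1` S `&` B v @^-1` S'))%E).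
  by rewrite lee_wpmul2r// lee_fin !indicE; do 4! case: (_ \in _); rewrite ?mulr1 ?mulr0.
rewrite /a /b !indicE; case: (boolP (u \in _)) => [|_]; last by rewrite mul0r !mul0e mule0.
case: (boolP (v \in _)) => [|_]; last by rewrite mulr0 !mul0e !mule0.
rewrite !inE/= !in_itv/= mulr1 !mul1e => /andP[s'v v2s'] /andP[su u2s].
have u0 : 0 < u by apply: lt_le_trans su.
have v0 : 0 < v by apply: lt_le_trans s'v.
have uv2 : 2 * n%:R * u <= v.
  apply: le_trans s'v; apply: le_trans ss'.
  by rewrite (_ : 4 * n%:R * s = 2 * n%:R * (2 * s)); [rewrite ler_wpM2l// mulr_ge0|ring].
have uv : u < v by apply: lt_le_trans uv2; rewrite -[ltLHS]mul1r ltr_pM2r//; lra.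
apply: le_trans (brownian_two_times BM (ltW u0) uv mS mS') _.
rewrite [leRHS]muleCA lee_wpmul2l//.
apply: (@le_trans _ _ (k%:E * ((heat_peak v * expR (- (x ^+ 2 / (v *+ 2))))%:E * mu S'))%E); last first.
  by rewrite lee_wpmul2l ?lee_fin//; exact: brownian_law_ge.
rewrite SL -!EFinM lee_fin mulrA ler_wpM2r//.
have vu0 : 0 < v - u by rewrite subr_gt0.
pose q : R := 1 - (2 * n%:R)^-1.
have sq : q * Num.sqrt v <= Num.sqrt (v - u).
  have q0 : 0 < q by rewrite subr_gt0 invf_lt1 ?mulr_gt0//; lra.
  have -> : q * Num.sqrt v = Num.sqrt (q ^+ 2 * v).
    by rewrite sqrtrM ?sqr_ge0// sqrtr_sqr gtr0_norm.
  rewrite ler_sqrt; last by rewrite ltW.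
  have h : u <= v / (2 * n%:R) by rewrite ler_pdivlMr ?mulr_gt0// mulrC.
  have q1 : q <= 1 by rewrite gerBl invr_ge0 mulr_ge0.
  apply: (@le_trans _ _ (q * v)); last by rewrite /q mulrBl mul1r mulrC lerD2l lerN2.
  by rewrite ler_wpM2r ?(ltW v0)// expr2 ler_piMl// ltW.
have ex : q <= expR (- (x ^+ 2 / (v *+ 2))).
  apply: le_trans (expR_ge1Dx _); rewrite lerD2l lerN2.
  rewrite ler_pdivrMr ?mulrn_wgt0// mulrC ler_pdivlMr ?mulr_gt0//.
  have := le_trans xs' s'v; rewrite -(mulr_natr v 2); lra.
have q0 : 0 < q by rewrite subr_gt0 invf_lt1 ?mulr_gt0//; lra.
(* With m = 1/n, the product (1 + 3m)(1 - m/2)^2 equals 1 + m (1 - m)(2 - 3m/4). *)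
have kq : 1 <= k * q ^+ 2.
  pose m : R := n%:R^-1.
  have m1 : m <= 1 by rewrite invf_le1.
  have m0 : 0 <= m by rewrite invr_ge0.
  rewrite /k /q invfM -/m (_ : _ * _ = 1 + m * (1 - m) * (2 - 3 / 4 * m)); last by field.
  by rewrite lerDl !mulr_ge0//; lra.
set ee := expR _ in ex *.
rewrite !heat_peakE//.
have -> : k * (gauss_cst / Num.sqrt v * ee) = gauss_cst * (k * ((Num.sqrt v)^-1 * ee)) by ring.
rewrite ler_wpM2l ?(ltW gauss_cst_gt0)//.
have sv0 : 0 < Num.sqrt v by rewrite sqrtr_gt0.
apply: (@le_trans _ _ (q * Num.sqrt v)^-1).
  by rewrite lef_pV2 ?posrE ?sqrtr_gt0// mulr_gt0.
apply: (@le_trans _ _ (k * ((Num.sqrt v)^-1 * q))).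
  rewrite invfM mulrCA [leLHS]mulrC ler_wpM2l ?invr_ge0 ?(ltW sv0)//.
  by rewrite -[leLHS]mul1r ler_pdivrMr// -mulrA -expr2.
by rewrite ler_wpM2l// ler_wpM2l// invr_ge0 ltW.
Qed.

(** The two terms correspond to the two orders of u and v. The earlier time is at least s and gives
    the factor [heat_peak s]; the increment gives the integrable singularity (v - u)^(-1/2). *)
Let block_product_le y s S L u v : 0 < s -> 2 * s <= y -> measurable S -> mu S = L%:E -> u != v ->
  (((\1_(`[0, y]%classic) u : R) * \1_(`[0, y]%classic) v)%:E *
     \int[P]_om (block s S om u * block s S om v)%:E <=
   (\1_(`[s, 2 * s]%classic) u)%:E *
     ((gauss_cst ^+ 2 / Num.sqrt s * L ^+ 2)%:E * (\1_(`]0, s]%classic) (v - u) * (v - u) `^ (- 2^-1))%:E) +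
   (\1_(`[s, 2 * s]%classic) v)%:E *
     ((gauss_cst ^+ 2 / Num.sqrt s * L ^+ 2)%:E * (\1_(`]0, s]%classic) (u - v) * (u - v) `^ (- 2^-1))%:E))%E.
Proof.
move=> s0 sy mS SL.
have L0 : 0 <= L by rewrite -lee_fin -SL.
pose c := gauss_cst ^+ 2 / Num.sqrt s * L ^+ 2.
have c0 : 0 <= c by rewrite mulr_ge0 ?sqr_ge0// divr_ge0 ?sqr_ge0.
have K0 (a b : R) : (0 <= (\1_(`[s, 2 * s]%classic) a)%:E * (c%:E * (\1_(`]0, s]%classic) b * b `^ (- 2^-1))%:E))%E.
  by rewrite !mule_ge0 ?lee_fin// mulr_ge0 ?powR_ge0.
suff main a b : a < b -> (((\1_(`[0, y]%classic) a : R) * \1_(`[0, y]%classic) b)%:E *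
     \int[P]_om (block s S om a * block s S om b)%:E <=
     (\1_(`[s, 2 * s]%classic) a)%:E * (c%:E * (\1_(`]0, s]%classic) (b - a) * (b - a) `^ (- 2^-1))%:E))%E.
  rewrite neq_lt => /orP[uv|vu].
    by apply: le_trans (main _ _ uv) _; rewrite leeDl// K0.
  rewrite mulrC; under eq_integral do rewrite mulrC.
  by apply: le_trans (main _ _ vu) _; rewrite leeDr// K0.
move=> ab; rewrite block_product_mean// muleA -EFinM.
apply: (@le_trans _ _ ((\1_(`[s, 2 * s]%classic) a * \1_(`[s, 2 * s]%classic) b)%:E * P (B a @^-1` S `&` B b @^-1` S))%E).
  by rewrite lee_wpmul2r// lee_fin !indicE; do 4! case: (_ \in _); rewrite ?mulr1 ?mulr0.
rewrite !indicE; case: (boolP (a \in _)) => [|_]; last by rewrite mul0r !mul0e.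
case: (boolP (b \in _)) => [|_]; last first.
  by rewrite mulr0 mul0e mul1e mule_ge0 ?lee_fin// mulr_ge0 ?powR_ge0.
rewrite !inE/= !in_itv/= mulr1 !mul1e => /andP[sb b2s] /andP[sa a2s].
have a0 : 0 < a by apply: lt_le_trans sa.
have -> : b - a \in `]0, s]%classic.
  by rewrite inE/= in_itv/= subr_gt0 ab/= lerBlDr; apply: le_trans b2s _; rewrite mulrDl mul1r lerD2l.
rewrite mul1r; apply: le_trans (brownian_two_times BM (ltW a0) ab mS mS) _.
have ba0 : 0 < b - a by rewrite subr_gt0.
apply: (@le_trans _ _ (((heat_peak s)%:E * mu S) * ((heat_peak (b - a))%:E * mu S))%E).
  rewrite lee_wpmul2r ?mule_ge0 ?lee_fin ?heat_peak_ge0//.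
  apply: le_trans (brownian_law_le BM a0 mS) _; rewrite lee_wpmul2r// lee_fin.
  exact: le_heat_peak.
rewrite SL -!EFinM lee_fin !heat_peakE// powRN powR12_sqrt ?(ltW ba0)// /c.
by rewrite le_eqVlt; apply/orP; left; apply/eqP; ring.
Qed.

(** Each order of the two times contributes 2 g^2 s L^2: the inner integral of (v - u)^(-1/2) over a
    length s is at most 2 sqrt s. The diagonal, where the pointwise bound fails, is removed as a
    null set. *)
Lemma block_occ_second y s S L : 0 < s -> 2 * s <= y -> measurable S -> mu S = L%:E ->
  (\int[P]_om (block_occ y s S om * block_occ y s S om)%:E <=
   (4 * gauss_cst ^+ 2 * s * L ^+ 2)%:E)%E.
Proof.
move=> s0 sy mS SL.
have L0 : 0 <= L by rewrite -lee_fin -SL.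
have ss0 : 0 < Num.sqrt s by rewrite sqrtr_gt0.
pose c := gauss_cst ^+ 2 / Num.sqrt s * L ^+ 2.
have c0 : 0 <= c by rewrite mulr_ge0 ?sqr_ge0// divr_ge0 ?sqr_ge0// ltW.
have jm := jointly_measurable_block s mS.
rewrite (mean_product_time_int P y jm jm (block01 s S) (block01 s S)).
pose k r : R := \1_(`]0, s]%classic) r * r `^ (- 2^-1).
have k0 r : 0 <= k r by rewrite mulr_ge0// powR_ge0.
have mk : measurable_fun setT (k : measurableTypeR R -> R).
  by apply: measurable_funM; [exact: measurable_indic|exact: measurable_powR].
pose K (u v : R) : \bar R := ((\1_(`[s, 2 * s]%classic) u)%:E * (c%:E * (k (v - u))%:E))%E.
have K0 u v : (0 <= K u v)%E by rewrite !mule_ge0 ?lee_fin.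
have mK (p q : measurableTypeR R * measurableTypeR R -> measurableTypeR R) :
    measurable_fun setT p -> measurable_fun setT q -> measurable_fun setT (fun z => K (p z) (q z)).
  move=> mp mq; apply: emeasurable_funM.
    by apply/measurable_EFinP; exact: measurable_indic_comp.
  apply: emeasurable_funM; first exact: measurable_cst.
  apply/measurable_EFinP; apply: (measurableT_comp mk).
  exact: measurable_funB.
have mK1 : measurable_fun setT (fun z : measurableTypeR R * measurableTypeR R => K z.1 z.2) by exact: mK.
have mK2 : measurable_fun setT (fun z : measurableTypeR R * measurableTypeR R => K z.2 z.1) by exact: mK.
have half : (\int[mu]_u \int[mu]_v K u v <= (2 * gauss_cst ^+ 2 * s * L ^+ 2)%:E)%E.
  have Ku u : (\int[mu]_v K u v <= (\1_(`[s, 2 * s]%classic) u)%:E * (2 * gauss_cst ^+ 2 * L ^+ 2)%:E)%E.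
    have mku : measurable_fun setT (fun v : measurableTypeR R => k (v - u)).
      by apply: (measurableT_comp mk); exact: measurable_funB.
    have e : (\int[mu]_v K u v = (\1_(`[s, 2 * s]%classic) u)%:E * (c%:E * \int[mu]_v (k (v - u))%:E))%E.
      rewrite /K ge0_integralZl; [| by [] | | | by rewrite lee_fin].
      - rewrite ge0_integralZl; [by [] | by [] | | | by rewrite lee_fin].
        + exact/measurable_EFinP.
        + by move=> v _; rewrite lee_fin.
      - by apply: emeasurable_funM => //; exact/measurable_EFinP.
      - by move=> v _; rewrite mule_ge0 ?lee_fin.
    rewrite e; apply: lee_wpmul2l; first by rewrite lee_fin.
    rewrite (integral_translate (f := fun r => (k r)%:E) (- u)); last 2 first.
    - exact/measurable_EFinP.
    - by move=> r; rewrite lee_fin.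
    have -> : (\int[mu]_r (k r)%:E = \int[mu]_(r in `]0%R, s]) (r `^ (- 2^-1))%:E)%E.
      rewrite [RHS]integral_mkcond; apply: eq_integral => r _.
      by rewrite patchE /k indicE; case: ifPn => _; rewrite (mul1r, mul0r).
    apply: (@le_trans _ _ (c%:E * (2 * s `^ 2^-1)%:E)%E).
      by rewrite lee_wpmul2l ?lee_fin//; exact: le_integral_inv_sqrt.
    rewrite -EFinM lee_fin /c powR12_sqrt ?(ltW s0)// le_eqVlt; apply/orP; left; apply/eqP.
    by field; rewrite gt_eqF.
  apply: (@le_trans _ _ (\int[mu]_u ((\1_(`[s, 2 * s]%classic) u)%:E * (2 * gauss_cst ^+ 2 * L ^+ 2)%:E))%E).
    apply: ge0_le_integral => //.
    - by move=> u _; exact: integral_ge0.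
    - exact: (measurable_fun_fubini_tonelli_F (m2 := mu) _ mK1 (fun z => K0 z.1 z.2)).
    - by apply: emeasurable_funM => //; apply/measurable_EFinP; exact: measurable_indic.
  have C0 : 0 <= 2 * gauss_cst ^+ 2 * L ^+ 2 by rewrite (mulr_ge0 (mulr_ge0 _ (sqr_ge0 _)) (sqr_ge0 _)).
  rewrite ge0_integralZr ?lee_fin//; last exact/measurable_EFinP.
  rewrite integral_indic// setIT.
  rewrite -[X in (X * _)%E]/(mu `[s, 2 * s]%classic) lebesgue_measure_itv/= lte_fin ltr_pMl// ltr1n.
  rewrite -EFinB -EFinM lee_fin le_eqVlt; apply/orP; left; apply/eqP; ring.
have mJ : measurable_fun setT (fun z : measurableTypeR R * measurableTypeR R =>
    (((\1_(`[0, y]%classic) z.1 : R) * \1_(`[0, y]%classic) z.2)%:E * \int[P]_om (block s S om z.1 * block s S om z.2)%:E)%E).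
  apply: emeasurable_funM; last first.
    by apply: measurable_product_mean => // om v; have /andP[] := block01 s S om v.
  apply/measurable_EFinP; apply: measurable_funM; apply: measurable_indic_comp => //.
have J0 u v : (0 <= ((\1_(`[0, y]%classic) u : R) * \1_(`[0, y]%classic) v)%:E * \int[P]_om (block s S om u * block s S om v)%:E)%E.
  rewrite mule_ge0 ?lee_fin ?mulr_ge0//; apply: integral_ge0 => om _; rewrite lee_fin mulr_ge0//.
  - by have /andP[] := block01 s S om u.
  - by have /andP[] := block01 s S om v.
have s1 (f : measurableTypeR R * measurableTypeR R -> \bar R) u : measurable_fun setT f -> measurable_fun setT (fun v => f (u, v)).
  by move=> mf; exact: (measurableT_comp mf (@measurable_pair1 _ _ (measurableTypeR R) (measurableTypeR R) u)).
have step : (\int[mu]_u \int[mu]_v (((\1_(`[0, y]%classic) u : R) * \1_(`[0, y]%classic) v)%:E * \int[P]_om (block s S om u * block s S om v)%:E) <=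
   \int[mu]_u (\int[mu]_v K u v + \int[mu]_v K v u))%E.
  apply: ge0_le_integral => //.
  - by move=> u _; apply: integral_ge0.
  - exact: (measurable_fun_fubini_tonelli_F (m2 := mu) _ mJ (fun z => J0 z.1 z.2)).
  - apply: emeasurable_funD.
      exact: (measurable_fun_fubini_tonelli_F (m2 := mu) _ mK1 (fun z => K0 z.1 z.2)).
    exact: (measurable_fun_fubini_tonelli_F (m2 := mu) _ mK2 (fun z => K0 z.2 z.1)).
  move=> u _; rewrite -ge0_integralD//; last 2 first.
  - exact: (s1 _ u mK1).
  - exact: (s1 _ u mK2).
  have mD : measurable ([set: measurableTypeR R] `\ u) by apply: measurableD.
  rewrite -[leLHS](@integral_setD1 _ _ u)//; last by apply: measurable_funTS; exact: (s1 _ u mJ).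
  rewrite -[leRHS](@integral_setD1 _ _ u)//; last first.
    by apply: measurable_funTS; apply: emeasurable_funD; [exact: (s1 _ u mK1)|exact: (s1 _ u mK2)].
  apply: ge0_le_integral => //.
  - by apply: measurable_funTS; exact: (s1 _ u mJ).
  - by apply: measurable_funTS; apply: emeasurable_funD; [exact: (s1 _ u mK1)|exact: (s1 _ u mK2)].
  - by move=> v [_ /= vu]; apply: (@block_product_le y s S L) => //; apply/eqP => uv; apply: vu.
apply: le_trans step _.
rewrite ge0_integralD//; last 4 first.
- by move=> u _; exact: integral_ge0.
- exact: (measurable_fun_fubini_tonelli_F (m2 := mu) _ mK1 (fun z => K0 z.1 z.2)).
- by move=> u _; exact: integral_ge0.
- exact: (measurable_fun_fubini_tonelli_F (m2 := mu) _ mK2 (fun z => K0 z.2 z.1)).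
have swap : (\int[mu]_u \int[mu]_v K v u = \int[mu]_u \int[mu]_v K u v)%E.
  exact: (fubini_tonelli (m1 := mu) (m2 := mu)
    (fun z : measurableTypeR R * measurableTypeR R => K z.2 z.1) mK2 (fun z => K0 z.2 z.1)).
apply: le_trans (leeD half (eq_ind_r (fun z => z <= _)%E half swap)) _.
by rewrite -EFinD lee_fin le_eqVlt; apply/orP; left; apply/eqP; ring.
Qed.

End blocks.

(** After division by the means, all variables being below half of their means forces the normalised
    sum below n / 2. *)
Lemma small_together (R : realType) (d : measure_display) (T : measurableType d)
    (P : probability T R) (n : nat) (C : R) (W : 'I_n -> T -> R) (m : 'I_n -> R) :
  (0 < n)%N -> 0 <= C ->
  (forall i, measurable_fun setT (W i)) -> (forall i om, 0 <= W i om) ->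
  (forall i, 0 < m i) ->
  (forall i, \int[P]_om (W i om)%:E = (m i)%:E)%E ->
  (forall i, \int[P]_om (W i om * W i om)%:E <= (C * m i ^+ 2)%:E)%E ->
  (forall i j : 'I_n, (i < j)%N ->
     \int[P]_om (W i om * W j om)%:E <= ((1 + C / n%:R) * (m i * m j))%:E)%E ->
  (P [set om | forall i, (W i om < m i / 2)%R] <= (8 * C / n%:R)%:E)%E.
Proof.
move=> n0 C0 mW W0 m0 WE Wii Wij.
pose Z (i : 'I_n) om := (m i)^-1 * W i om.
have m0' i : 0 <= (m i)^-1 by rewrite invr_ge0 ltW.
have mZ i : measurable_fun setT (Z i) by exact: measurable_funM.
have Z0 i om : 0 <= Z i om by exact: mulr_ge0.
have ZZ (i j : 'I_n) : (\int[P]_om (Z i om * Z j om)%:E = ((m i)^-1 * (m j)^-1)%:E * \int[P]_om (W i om * W j om)%:E)%E.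
  rewrite -ge0_integralZl//.
  - by apply: eq_integral => om _; rewrite -EFinM; congr EFin; rewrite /Z; ring.
  - by apply/measurable_EFinP; exact: measurable_funM.
  - by move=> om _; rewrite lee_fin mulr_ge0.
  - by rewrite lee_fin mulr_ge0.
have Z1 i : (\int[P]_om (Z i om)%:E = 1)%E.
  under eq_integral do rewrite EFinM.
  rewrite ge0_integralZl//.
  - by rewrite WE -EFinM mulVf// gt_eqF.
  - exact/measurable_EFinP.
  - by move=> om _; rewrite lee_fin.
  - by rewrite lee_fin.
have Zii i : (\int[P]_om (Z i om * Z i om)%:E <= C%:E)%E.
  rewrite ZZ; apply: (@le_trans _ _ (((m i)^-1 * (m i)^-1)%:E * (C * m i ^+ 2)%:E)%E).
    by apply: lee_wpmul2l => //; rewrite lee_fin mulr_ge0.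
  by rewrite -EFinM lee_fin le_eqVlt; apply/orP; left; apply/eqP; field; rewrite gt_eqF.
have Zij (i j : 'I_n) : (i < j)%N -> (\int[P]_om (Z i om * Z j om)%:E <= (1 + C / n%:R)%:E)%E.
  move=> ij; rewrite ZZ.
  apply: (@le_trans _ _ (((m i)^-1 * (m j)^-1)%:E * ((1 + C / n%:R) * (m i * m j))%:E)%E).
    by apply: lee_wpmul2l; [rewrite lee_fin mulr_ge0|exact: Wij].
  rewrite -EFinM lee_fin le_eqVlt; apply/orP; left; apply/eqP.
  have mi := gt_eqF (m0 i); have mj := gt_eqF (m0 j).
  have n0' : n%:R != 0 :> R by rewrite pnatr_eq0 -lt0n.
  by field; rewrite n0' mi mj.
have Zij' (i j : 'I_n) : i != j -> (\int[P]_om (Z i om * Z j om)%:E <= (1 + C / n%:R)%:E)%E.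
  move=> ij; case: (ltngtP i j) => [h|h|h]; first exact: Zij.
    by under eq_integral do rewrite mulrC; exact: Zij.
  by move/val_inj: h ij => ->; rewrite eqxx.
apply: le_trans (second_moment_concentration n0 C0 mZ Z0 Z1 Zii Zij').
apply: le_measure; rewrite ?inE.
- have -> : [set om | forall i, (W i om < m i / 2)%R] = \bigcap_i (W i @^-1` `]-oo, m i / 2[%classic).
    by apply/seteqP; split => om /= h i; have := h i; rewrite /= in_itv/=; [move=> h' _|exact].
  apply: fin_bigcap_measurable => // i _.
  by rewrite -[X in measurable X]setTI; exact: mW.
- have mO : measurable_fun setT (fun om => \sum_(i < n) Z i om) by exact: measurable_sum.
  have -> : [set om | \sum_(i < n) Z i om < n%:R / 2] = (fun om => \sum_(i < n) Z i om) @^-1` `]-oo, n%:R / 2[%classic.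
    by apply/seteqP; split => om /=; rewrite in_itv.
  by rewrite -[X in measurable X]setTI; exact: mO.
move=> om /= small; have -> : n%:R / 2 = \sum_(i < n) 2^-1 :> R.
  by rewrite sumr_const card_ord -(mulr_natr 2^-1) mulrC.
have lt i : Z i om < 2^-1.
  by rewrite /Z mulrC ltr_pdivrMr// mulrC; exact: small.
rewrite (bigD1 (Ordinal n0))//= [ltRHS](bigD1 (Ordinal n0))//=.
by apply: ltr_leD => //; apply: ler_sum => i _; exact: ltW.
Qed.

Section occupation_lower_bound.
Context (R : realType) (d : measure_display) (T : measurableType d)
  (P : probability T R) (B : R -> {RV P >-> R}).
Hypothesis BM : standard_Brownian_motion B.
Notation mu := (@lebesgue_measure R).
Implicit Types (s u v x y L : R) (D S : set R).

Definition occupation D y (om : T) : R := time_int y (fun om v => \1_D (path_at B om v)) om.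

Lemma jointly_measurable_occupation D : measurable D ->
  jointly_measurable (fun om v => \1_D (path_at B om v) : R).
Proof. by move=> mD; apply: measurable_indic_comp => //; exact: jointly_measurable_path_at. Qed.

Let ind01 D (om : T) v : `|\1_D (path_at B om v) : R| <= 1.
Proof. by rewrite indicE; case: (_ \in _); rewrite /= ?normr1 ?normr0. Qed.

Lemma measurable_occupation D y : measurable D -> measurable_fun setT (occupation D y).
Proof. by move=> mD; apply: measurable_time_int => //; exact: jointly_measurable_occupation. Qed.

Lemma block_occ_le_occupation D x y s om : measurable D -> 0 < s -> 2 * s <= y ->
  block_occ B y s (D `&` `[- x, x]) om <= occupation D y om.
Proof.
move=> mD s0 sy.
have mDx : measurable (D `&` `[- x, x]) by exact: measurableI.
apply: (@le_time_int _ _ _ y _ _ om 1 1) => //.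
- exact: jointly_measurable_block.
- exact: jointly_measurable_occupation.
- by move=> v; have /andP[b0 b1] := block01 B s (D `&` `[- x, x]) om v; rewrite ger0_norm.
- move=> v; rewrite /block !indicE in_setI.
  by do 3! case: (_ \in _); rewrite /= ?mulr1 ?mulr0 ?lexx ?ler01.
Qed.

(** The scales are s_i = t (4n)^i for i < n, with windows [-x_i, x_i], x_i = sqrt (s_i / n). A small
    occupation makes all n block occupations less than half of their means. The width of the windows
    costs the power n^(-c/2), and x0^2 n <= t puts every x_i in the range of the mass hypothesis. *)
Lemma occupation_lower_bound (c0 c x0 : R) : 0 < c0 -> 0 <= c <= 1 ->  0 < x0 ->
  exists k C : R, [/\ 0 < k, 0 <= C & forall D (n : nat) t y, measurable D ->
    (forall x, x0 <= x -> ((c0 * x `^ c)%:E <= mu (D `&` `[(- x)%R, x]))%E) ->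
    (0 < n)%N -> x0 ^+ 2 * n%:R <= t -> t * (4 * n%:R) ^+ n <= y ->
    (P [set om | (occupation D y om < k * n%:R `^ (- (c / 2)) * t `^ ((1 + c) / 2))%R] <= (C / n%:R)%:E)%E].
Proof.
move=> c00 /andP[c0' c1] x00.
have g0 := @gauss_cst_gt0 R.
(* 64 is the ratio of the second moment 4 g^2 s L^2 to the square of the lower bound (g/4) sqrt s L
   of the mean; 8 comes from Chebyshev's inequality. The factor 1/8 is half of 1/4. *)
exists (gauss_cst R / 8 * c0), (8 * 64); split => //; first by rewrite !mulr_gt0.
move=> D n t y mD HD n0 nt ty.
have n0' : 0 < n%:R :> R by rewrite ltr0n.
have n1 : 1 <= n%:R :> R by rewrite ler1n.
have t0 : 0 < t by apply: lt_le_trans nt; rewrite mulr_gt0// exprn_gt0.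
pose r : R := 4 * n%:R.
have r1 : 1 <= r by rewrite /r; lra.
pose s (i : nat) : R := t * r ^+ i.
pose x (i : nat) : R := Num.sqrt (s i / n%:R).
pose S (i : nat) : set R := D `&` `[- x i, x i].
have s0 i : 0 < s i by rewrite mulr_gt0// exprn_gt0// (lt_le_trans ltr01).
have ts i : t <= s i by rewrite ler_peMr ?(ltW t0)// exprn_ege1.
have x0i i : 0 <= x i by exact: sqrtr_ge0.
have x2 i : n%:R * x i ^+ 2 <= s i.
  by rewrite sqr_sqrtr ?divr_ge0 ?(ltW (s0 _))// mulrC divfK// gt_eqF.
have x2' i : x i ^+ 2 <= s i.
  by apply: le_trans (x2 i); rewrite ler_peMl// sqr_ge0.
have xx0 i : x0 <= x i.
  rewrite -[leLHS]ger0_norm ?(ltW x00)// -sqrtr_sqr ler_sqrt ?divr_ge0 ?(ltW (s0 _))//.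
  by rewrite ler_pdivlMr//; exact: le_trans (ts i).
have mS i : measurable (S i) by exact: measurableI.
have Sfin i : mu (S i) \is a fin_num.
  rewrite ge0_fin_numE//; apply: (@le_lt_trans _ _ (mu `[- x i, x i]%classic)).
    by apply: le_measure; rewrite ?inE//; [exact: mS|exact: subIsetr].
  by rewrite lebesgue_measure_itv/=; case: ifPn => _; rewrite ?ltry// -EFinB ltry.
pose L i := fine (mu (S i)).
have SL i : mu (S i) = (L i)%:E by rewrite /L fineK.
have Lge i : c0 * x i `^ c <= L i by rewrite -lee_fin -SL; exact: HD.
have L0 i : 0 < L i.
  by apply: lt_le_trans (Lge i); rewrite mulr_gt0// powR_gt0// (lt_le_trans x00).
have sy (i : 'I_n) : 2 * s i <= y.
  apply: le_trans ty; rewrite -/r /s mulrCA ler_wpM2l ?(ltW t0)//.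
  apply: (@le_trans _ _ (r * r ^+ i)); first by rewrite ler_wpM2r ?exprn_ge0 ?(le_trans ler01)//; rewrite /r; lra.
  by rewrite -exprS ler_weXn2l.
have MI (i : 'I_n) : (\int[P]_om (block_occ B y (s i) (S i) om)%:E)%E \is a fin_num.
  rewrite ge0_fin_numE; last by apply: integral_ge0 => om _; rewrite lee_fin block_occ_ge0.
  have y0 : 0 <= y by apply: le_trans (sy i); rewrite mulr_ge0// ltW.
  apply: (@le_lt_trans _ _ (\int[P]_om (1 * y)%:E)%E).
    apply: ge0_le_integral => //.
    - by move=> om _; rewrite lee_fin block_occ_ge0.
    - by apply/measurable_EFinP; exact: measurable_block_occ.
    - move=> om _; rewrite lee_fin; apply: time_int_le_cst => //.
        exact: (jointly_measurable_block BM _ (mS i)).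
      by move=> v; exact: block01.
  by rewrite integral_cst// [X in (_ * X)%E]probability_setT mule1 ltry.
pose m (i : 'I_n) := fine (\int[P]_om (block_occ B y (s i) (S i) om)%:E)%E.
have WE (i : 'I_n) : (\int[P]_om (block_occ B y (s i) (S i) om)%:E = (m i)%:E)%E by rewrite fineK.
have mge (i : 'I_n) : gauss_cst R / 4 * Num.sqrt (s i) * L i <= m i.
  rewrite -lee_fin -WE; apply: (block_occ_mean_ge BM (s0 i) (sy i) (mS i) (x0i i) (x2' i) _ (SL i)).
  exact: subIsetr.
have m0 i : 0 < m i by apply: lt_le_trans (mge i); rewrite !mulr_gt0// sqrtr_gt0.
have Wii (i : 'I_n) : (\int[P]_om (block_occ B y (s i) (S i) om * block_occ B y (s i) (S i) om)%:E <= (64 * m i ^+ 2)%:E)%E.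
  apply: le_trans (block_occ_second BM (s0 i) (sy i) (mS i) (SL i)) _.
  rewrite lee_fin.
  have h0 : 0 <= gauss_cst R / 4 * Num.sqrt (s i) * L i by rewrite !mulr_ge0 ?sqrtr_ge0// ltW.
  apply: (@le_trans _ _ (64 * (gauss_cst R / 4 * Num.sqrt (s i) * L i) ^+ 2)).
    by rewrite !exprMn sqr_sqrtr ?(ltW (s0 _))// le_eqVlt; apply/orP; left; apply/eqP; field.
  by rewrite ler_wpM2l// !expr2 ler_pM.
have Wij (i j : 'I_n) : (i < j)%N ->
    (\int[P]_om (block_occ B y (s i) (S i) om * block_occ B y (s j) (S j) om)%:E <= ((1 + 64 / n%:R) * (m i * m j))%:E)%E.
  move=> ij.
  have rs : 4 * n%:R * s i <= s j.
    by rewrite -/r /s mulrCA -exprS ler_wpM2l ?(ltW t0)// ler_weXn2l.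
  have := block_occ_pair BM n0 (s0 i) (sy j) rs (mS i) (mS j) (x0i j) (x2 j) (@subIsetr _ _ _) (SL j).
  rewrite (WE i) (WE j) -!EFinM => h; apply: le_trans h _; rewrite lee_fin.
  apply: ler_wpM2r; first by rewrite mulr_ge0// ltW.
  by rewrite lerD2l ler_wpM2r ?invr_ge0 ?(ltW n0')// ler_nat.
have mWi (i : 'I_n) : measurable_fun setT (block_occ B y (s i) (S i)).
  exact: (measurable_block_occ BM _ _ (mS i)).
have := small_together n0 (ler0n R 64) mWi (fun i om => block_occ_ge0 _ _ _ _ om) m0 WE Wii Wij.
apply: le_trans; apply: le_measure; rewrite ?inE.
- have mO := measurable_occupation y mD.
  set b := _ * _ `^ _; have -> : [set om | occupation D y om < b] = occupation D y @^-1` `]-oo, b[%classic.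
    by apply/seteqP; split => om /=; rewrite in_itv.
  by rewrite -[X in measurable X]setTI; exact: mO.
- have -> : [set om | forall i : 'I_n, (block_occ B y (s i) (S i) om < m i / 2)%R] = \bigcap_(i : 'I_n) (block_occ B y (s i) (S i) @^-1` `]-oo, m i / 2[%classic).
    by apply/seteqP; split => om /= h i; have := h i; rewrite /= in_itv/=; [move=> h' _|exact].
  apply: fin_bigcap_measurable => // i _.
  by rewrite -[X in measurable X]setTI; exact: mWi.
move=> om /= small i.
apply: le_lt_trans (block_occ_le_occupation (x i) om mD (s0 i) (sy i)) _.
apply: lt_le_trans small _; apply: (@le_trans _ _ (2^-1 * (gauss_cst R / 4 * Num.sqrt (s i) * L i))); last first.
  by rewrite [leRHS]mulrC ler_wpM2l.
apply: (@le_trans _ _ (2^-1 * (gauss_cst R / 4 * Num.sqrt (s i) * (c0 * x i `^ c)))); last first.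
  by apply: ler_wpM2l => //; apply: ler_wpM2l => //; rewrite !mulr_ge0 ?sqrtr_ge0// ltW.
have si0 := s0 i.
have e : Num.sqrt (s i) * (c0 * x i `^ c) = c0 * (n%:R `^ (- (c / 2)) * s i `^ ((1 + c) / 2)).
  rewrite mulrCA; congr (_ * _).
  rewrite /x -!powR12_sqrt ?divr_ge0 ?(ltW si0)// -powRrM powRM ?(ltW si0) ?invr_ge0//.
  rewrite mulrA -powRD; last by rewrite implybE; apply/orP; right; rewrite gt_eqF.
  rewrite mulrC; congr (_ * _); last by congr (_ `^ _); field.
  by rewrite -powR_inv1// -powRrM; congr (_ `^ _); field.
have tsi : t `^ ((1 + c) / 2) <= s i `^ ((1 + c) / 2).
  by rewrite ge0_ler_powR// ?nnegrE ?(ltW t0) ?(ltW si0)// divr_ge0// addr_ge0.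
apply: (@le_trans _ _ (gauss_cst R / 8 * c0 * n%:R `^ (- (c / 2)) * s i `^ ((1 + c) / 2))).
  by rewrite ler_wpM2l// !mulr_ge0 ?powR_ge0// ltW.
rewrite -(mulrA (gauss_cst R / 4)) e le_eqVlt; apply/orP; left; apply/eqP.
by field.
Qed.

End occupation_lower_bound.

Section growth.
Context (R : realType).
Implicit Types (y k : R).

(* Along this grid consecutive points are comparable on a logarithmic scale,
   while each point leaves room for [j ^ 2] well separated time scales. *)
Definition grid (j : nat) : R := expR (j%:R ^+ 4).

Lemma grid_gt0 j : 0 < grid j. Proof. exact: expR_gt0. Qed.

Lemma grid_ge1 j : 1 <= grid j.
Proof. by rewrite -[leLHS]expR0 ler_expR exprn_ge0. Qed.

Lemma le_grid i j : (i <= j)%N -> grid i <= grid j.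
Proof. by move=> ij; rewrite ler_expR lerXn2r ?nnegrE// ler_nat. Qed.

Lemma grid_powR j k : grid j `^ k = expR (k * j%:R ^+ 4).
Proof. by rewrite /grid /powR gt_eqF ?expR_gt0// expRK. Qed.

Lemma nat_le_expR (n : nat) : n%:R <= expR n%:R :> R.
Proof. by have := expR_ge1Dx (n%:R : R); lra. Qed.

(** The exponential dominates its Taylor term of an order m >= 1/e, which is already at least a
    multiple of y. *)
Lemma powR_expR_decay e : 0 < e -> exists2 K : R, 0 <= K &
  forall y, 1 <= y -> y * expR (- (y `^ e / 4)) <= K.
Proof.
move=> e0; pose m := (Num.truncn (e^-1)).+1.
have me : 1 <= e * m%:R.
  have /andP[_] := truncn_itv (ltac:(by rewrite invr_ge0 ltW) : 0 <= e^-1).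
  move=> h; apply: (@le_trans _ _ (e * e^-1)); first by rewrite mulfV ?gt_eqF.
  by rewrite ler_wpM2l ?(ltW e0)// ltW.
exists (m`!%:R * 4 ^+ m); first by rewrite mulr_ge0// exprn_ge0.
move=> y y1; have y0 : 0 < y by apply: lt_le_trans y1.
have z0 : 0 <= y `^ e / 4 by rewrite divr_ge0// powR_ge0.
have h : (y `^ e / 4) ^+ m / m`!%:R <= expR (y `^ e / 4).
  by have := @expR_ge1Dxn _ _ (Num.truncn e^-1) z0; rewrite -/m; lra.
have ym : y <= (y `^ e) ^+ m.
  rewrite -powR_mulrn ?powR_ge0// -powRrM -[leLHS]powRr1 ?(ltW y0)//.
  by apply: ler_powR.
rewrite expRN ler_pdivrMr ?expR_gt0//.
apply: (@le_trans _ _ (m`!%:R * 4 ^+ m * ((y `^ e / 4) ^+ m / m`!%:R))); last first.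
  by rewrite ler_wpM2l// mulr_ge0// exprn_ge0.
apply: le_trans ym _; rewrite expr_div_n le_eqVlt; apply/orP; left; apply/eqP.
by field; rewrite pnatr_eq0 -lt0n fact_gt0 expf_neq0.
Qed.

End growth.

(** * Growth of occupation times along the grid and in the mean *)

Section occupation_growth.
Context (R : realType) (d : measure_display) (T : measurableType d)
  (P : probability T R) (B : R -> {RV P >-> R}).
Hypothesis BM : standard_Brownian_motion B.
Notation mu := (@lebesgue_measure R).
Implicit Types (v x y : R) (D : set R).

(** With n = j^2 scales the probability is O(1/j^2). Starting them at t = exp(j^4 - 4 j^3) and
    losing powers of n changes the exponent by O(j^3), which the slack between kappa and (1 + c)/2
    absorbs on the scale j^4. *)
Lemma occupation_grid (c0 c x0 kappa : R) D : 0 < c0 -> 0 <= c <= 1 -> 0 < x0 ->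
  kappa < (1 + c) / 2 -> measurable D ->
  (forall x, x0 <= x -> ((c0 * x `^ c)%:E <= mu (D `&` `[(- x)%R, x]))%E) ->
  exists2 C : R, 0 <= C & forall j : nat,
    (P [set om | (occupation B D (grid R j) om < grid R j `^ kappa)%R] <= (C / j.+1%:R ^+ 2)%:E)%E.
Proof.
move=> c00 c01 x00 kc mD HD.
have [k [C [k0 C0 main]]] := occupation_lower_bound BM c00 c01 x00.
have /andP[c_ge0 c_le1] := c01.
pose a := (1 + c) / 2; pose b := (6 + `|ln k|) / (a - kappa).
have ak : 0 < a - kappa by rewrite subr_gt0.
(* From [J] on, (a - kappa) j^4 exceeds (6 + |ln k|) j^3, where 4 pays for the choice of t, 2 for
   the power of n, and |ln k| for the constant. Earlier indices are covered by enlarging the final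
   constant. *)
pose J := (Num.truncn (x0 ^+ 2 + b)).+1 + 5.
have HJ j : (J <= j)%N -> [/\ (5 <= j)%N, x0 ^+ 2 <= j%:R & 6 + `|ln k| <= (a - kappa) * j%:R].
  have b0 : 0 <= b by apply: divr_ge0; [exact: addr_ge0|exact: ltW].
  move=> Jj; have xb0 : 0 <= x0 ^+ 2 + b by rewrite addr_ge0 ?sqr_ge0.
  have /andP[_ h] := truncn_itv xb0.
  have x20 : 0 <= x0 ^+ 2 by exact: sqr_ge0.
  have jb : x0 ^+ 2 + b <= j%:R.
    apply: le_trans (ltW h) _; rewrite ler_nat; apply: leq_trans Jj; exact: leq_addr.
  split; first by apply: leq_trans Jj; exact: leq_addl.
    by apply: le_trans jb; rewrite lerDl.
  have : b <= j%:R by apply: le_trans jb; rewrite lerDr.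
  by rewrite /b ler_pdivrMr// mulrC.
have P1 (E : set T) : measurable E -> (P E <= 1)%E by move=> mE; exact: probability_le1.
have mE j : measurable [set om | (occupation B D (grid R j) om < grid R j `^ kappa)%R].
  have mO := measurable_occupation BM (grid R j) mD.
  set bb := _ `^ _; have -> : [set om | occupation B D (grid R j) om < bb] = occupation B D (grid R j) @^-1` `]-oo, bb[%classic.
    by apply/seteqP; split => om /=; rewrite in_itv.
  by rewrite -[X in measurable X]setTI; exact: mO.
exists (4 * C + J.+1%:R ^+ 2); first by rewrite addr_ge0 ?mulr_ge0// exprn_ge0.
move=> j; have [jJ|Jj] := ltnP j J.
  apply: le_trans (P1 _ (mE j)) _; rewrite lee_fin ler_pdivlMr ?exprn_gt0// mul1r.
  rewrite -[leLHS]add0r lerD ?mulr_ge0// lerXn2r ?nnegrE// ler_nat.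
  by rewrite ltnS ltnW.
have [j5 jx jk] := HJ j Jj.
have j1 : 1 <= j%:R :> R by rewrite ler1n (leq_trans _ j5).
have j5' : 5 <= j%:R :> R by rewrite ler_nat.
have n0 : (0 < j ^ 2)%N by rewrite expn_gt0 (leq_trans _ j5).
(* The n = j^2 scales, of ratio 4 j^2 <= exp(4 j), multiply t by at most exp(4 j^3), hence end below
   the grid point. *)
pose t : R := expR (j%:R ^+ 4 - 4 * j%:R ^+ 3).
have j43 : j%:R ^+ 3 <= j%:R ^+ 4 - 4 * j%:R ^+ 3 :> R.
  have : 5 * j%:R ^+ 3 <= j%:R ^+ 4 :> R by rewrite [leRHS]exprS ler_wpM2r// exprn_ge0.
  lra.
have j3 : 3 * j%:R <= j%:R ^+ 3 :> R.
  have : 1 * 3 <= j%:R * j%:R :> R by apply: ler_pM => //; lra.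
  by rewrite mul1r => h; rewrite exprSr expr2 ler_wpM2r.
have c1 : x0 ^+ 2 * (j ^ 2)%:R <= t.
  apply: (@le_trans _ _ (expR j%:R * (expR j%:R * expR j%:R))); last first.
    by rewrite -!expRD ler_expR; lra.
  apply: ler_pM; rewrite ?sqr_ge0//.
    by apply: le_trans jx _; exact: nat_le_expR.
  by rewrite natrX expr2; apply: ler_pM => //; exact: nat_le_expR.
have c2 : t * (4 * (j ^ 2)%:R) ^+ (j ^ 2) <= grid R j.
  have -> : grid R j = t * expR (4 * j%:R) ^+ (j ^ 2).
    by rewrite -expRM_natl /t /grid -expRD natrX; congr expR; ring.
  rewrite ler_wpM2l ?expR_ge0// lerXn2r ?nnegrE ?mulr_ge0 ?expR_ge0//.
  have -> : 4 * (j ^ 2)%:R = (2 * j)%:R * (2 * j)%:R :> R by rewrite natrX natrM; ring.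
  rewrite (_ : 4 * j%:R = (2 * j)%:R + (2 * j)%:R); last by rewrite natrM; ring.
  by rewrite expRD; apply: ler_pM => //; exact: nat_le_expR.
have := main D (j ^ 2)%N t (grid R j) mD HD n0 c1 c2.
move=> h; apply: (@le_trans _ _ (C / (j ^ 2)%:R)%:E); last first.
  rewrite lee_fin ler_pdivlMr ?exprn_gt0// mulrAC ler_pdivrMr ?ltr0n//.
  apply: (@le_trans _ _ (C * (4 * (j ^ 2)%:R))).
    rewrite ler_wpM2l// natrX; have : j.+1%:R <= 2 * j%:R :> R by rewrite -natr1; lra.
    have : 0 <= j.+1%:R :> R by []. nra.
  by rewrite mulrCA mulrA ler_wpM2r// lerDl exprn_ge0.
apply: le_trans h; apply: le_measure; rewrite ?inE//.
  have mO := measurable_occupation BM (grid R j) mD.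
  set bb := _ * _ `^ _; have -> : [set om | occupation B D (grid R j) om < bb] = occupation B D (grid R j) @^-1` `]-oo, bb[%classic.
    by apply/seteqP; split => om /=; rewrite in_itv.
  by rewrite -[X in measurable X]setTI; exact: mO.
move=> om /= hom; apply: lt_le_trans hom _.
rewrite grid_powR.
have e1 : expR (- (2 * j%:R)) <= (j ^ 2)%:R `^ (- (c / 2)) :> R.
  apply: (@le_trans _ _ ((j ^ 2)%:R `^ (- 1))); last first.
    by apply: ler_powR; rewrite ?ler1n// lerN2; lra.
  rewrite powR_inv1// expRN lef_pV2 ?posrE ?expR_gt0 ?ltr0n//.
  by rewrite natrX expr2 mulrDl mul1r expRD; apply: ler_pM => //; exact: nat_le_expR.
have e2 : t `^ ((1 + c) / 2) = expR (a * (j%:R ^+ 4 - 4 * j%:R ^+ 3)).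
  by rewrite /t /powR gt_eqF ?expR_gt0// expRK.
rewrite e2; apply: (@le_trans _ _ (expR (- `|ln k|) * expR (- (2 * j%:R)) * expR (a * (j%:R ^+ 4 - 4 * j%:R ^+ 3)))); last first.
  rewrite ler_wpM2r ?expR_ge0//; apply: ler_pM; rewrite ?expR_ge0//.
  by rewrite -[leRHS]lnK ?posrE// ler_expR lerNl -normrN ler_norm.
rewrite -!expRD ler_expR.
have a1 : a <= 1 by rewrite /a; lra.
have a0 : 0 <= a by rewrite /a; lra.
have j30 : 1 <= j%:R ^+ 3 :> R by apply: exprn_ege1.
have q1 : (6 + `|ln k|) * j%:R ^+ 3 <= (a - kappa) * j%:R ^+ 4.
  by rewrite (exprS _ 3) mulrA ler_wpM2r// (le_trans ler01).
have q2 : `|ln k| <= `|ln k| * j%:R ^+ 3 by rewrite ler_peMr.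
have q3 : a * (4 * j%:R ^+ 3) <= 4 * j%:R ^+ 3 by rewrite ler_piMl// mulr_ge0// (le_trans ler01).
have q4 : 2 * j%:R <= 2 * j%:R ^+ 3 :> R by lra.
move: q1 q2 q3 q4; rewrite mulrBr !mulrDl mulNr.
lra.
Qed.

Lemma mean_occupation D y : measurable D ->
  (\int[P]_om (occupation B D y om)%:E = \int[mu]_(v in `]0%R, y]) P (B v @^-1` D))%E.
Proof.
move=> mD; have jm := jointly_measurable_occupation BM mD.
have ind01 (om : T) v : 0 <= (\1_D (path_at B om v) : R) <= 1.
  by rewrite indicE; case: (_ \in _); rewrite /= ?lexx ?ler01.
rewrite (mean_time_int P y jm ind01).
pose q v := (\int[P]_om (\1_D (path_at B om v))%:E)%E.
have mq : measurable_fun setT (q : measurableTypeR R -> \bar R).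
  apply: (measurable_fun_fubini_tonelli_G (m1 := P)
    (fun z : T * measurableTypeR R => (\1_D (path_at B z.1 z.2))%:E)).
  - exact/measurable_EFinP.
  - by move=> z; rewrite lee_fin.
transitivity (\int[mu]_(v in `[0%R, y]) q v)%E.
  rewrite [RHS]integral_mkcond; apply: eq_integral => v _.
  by rewrite patchE indicE; case: ifPn => _; rewrite (mul1e, mul0e).
rewrite -integral_itv_obnd_cbnd; last by apply: measurable_funTS; exact: mq.
apply: eq_integral => v; rewrite inE/= in_itv/= => /andP[v0 _].
have mpre : measurable (B v @^-1` D).
  by rewrite -[X in measurable X]setTI; exact: (measurable_funP (B v)).
rewrite -[X in P X]setIT -integral_indic// /q; apply: eq_integral => om _.
by rewrite path_atE ?ltW.
Qed.

Let mlaw D y : measurable D ->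
  measurable_fun (`]0, y] : set (measurableTypeR R)) (fun v => P (B v @^-1` D)).
Proof.
move=> mD; have jm := jointly_measurable_occupation BM mD.
pose q v := (\int[P]_om (\1_D (path_at B om v))%:E)%E.
have mq : measurable_fun setT (q : measurableTypeR R -> \bar R).
  apply: (measurable_fun_fubini_tonelli_G (m1 := P)
    (fun z : T * measurableTypeR R => (\1_D (path_at B z.1 z.2))%:E)).
  - exact/measurable_EFinP.
  - by move=> z; rewrite lee_fin.
apply: (eq_measurable_fun q); last by apply: measurable_funTS; exact: mq.
move=> v; rewrite inE/= in_itv/= => /andP[v0 _].
have mpre : measurable (B v @^-1` D).
  by rewrite -[X in measurable X]setTI; exact: (measurable_funP (B v)).
rewrite -[X in P X]setIT -integral_indic// /q; apply: eq_integral => om _.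
by rewrite path_atE ?ltW.
Qed.

(** At each positive time the law of B is absolutely continuous. *)
Lemma mean_occupation_null D y : measurable D -> mu D = 0%E ->
  (\int[P]_om (occupation B D y om)%:E = 0)%E.
Proof.
move=> mD D0; rewrite mean_occupation//; apply: integral0_eq => v /=.
rewrite in_itv/= => /andP[v0 _]; apply/eqP; rewrite eq_le measure_ge0 andbT.
by apply: le_trans (brownian_law_le BM v0 mD) _; rewrite D0 mule0.
Qed.

(** Inside a window [-x, x], the peak v^(-1/2) times the mass C x^c is integrated over v, which
    gives y^(1/2) x^c; outside, the Gaussian tail is negligible. *)
Lemma mean_occupation_le (C c x0 kappa : R) D : 0 <= C -> 0 <= c <= 1 -> 0 < x0 ->
  (1 + c) / 2 < kappa -> measurable D ->
  (forall x, x0 <= x -> (mu (D `&` `[(- x)%R, x]) <= (C * x `^ c)%:E)%E) ->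
  exists2 K : R, 0 <= K & forall y, 1 <= y ->
    (\int[P]_om (occupation B D y om)%:E <= (K * y `^ kappa)%:E)%E.
Proof.
move=> C0 /andP[c0 c1] x00 ck mD HD.
pose e := kappa - (1 + c) / 2; have e0 : 0 < e by rewrite subr_gt0.
have e20 : 0 < 2 * e by rewrite mulr_gt0.
have [K1 K10 HK1] := powR_expR_decay e20.
pose x1 := Num.max x0 1.
have x11 : 1 <= x1 by rewrite le_max lexx orbT.
have x10 : 0 < x1 by apply: lt_le_trans x11.
pose g := gauss_cst R.
have g0 : 0 < g by exact: gauss_cst_gt0.
exists (2 * g * C * x1 `^ c + Num.sqrt 2 * K1).
  by rewrite addr_ge0// !mulr_ge0 ?powR_ge0// ltW.
move=> y y1; have y0 : 0 < y by apply: lt_le_trans y1.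
rewrite mean_occupation//.
(* Slightly beyond the diffusive scale: the tail is at most a multiple of exp(-y^(2e) / 4), which
   beats the factor y, while the mass in the window grows only by y^(c e) <= y^e, the slack in
   kappa. *)
pose x := x1 * y `^ (2^-1 + e).
have ye1 : 1 <= y `^ (2^-1 + e).
  by rewrite -[leLHS](powRr0 y); apply: ler_powR => //; rewrite addr_ge0// ltW.
have x0x : x0 <= x.
  apply: (@le_trans _ _ x1); first by rewrite le_max lexx.
  by rewrite /x ler_peMr ?(ltW x10).
have x_ge0 : 0 <= x by rewrite (le_trans _ x0x)// ltW.
pose A := g * (C * x `^ c).
have A0 : 0 <= A by rewrite !mulr_ge0 ?powR_ge0// ltW.
pose b := Num.sqrt 2 * expR (- (y `^ (2 * e) / 4)).
have b0 : 0 <= b by rewrite mulr_ge0 ?expR_ge0.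
have bound v : `]0, y]%classic v -> (P (B v @^-1` D) <= A%:E * (v `^ (- 2^-1))%:E + b%:E)%E.
  rewrite /= in_itv/= => /andP[v0 vy].
  have mDx : measurable (D `&` `[- x, x]) by apply: measurableI.
  have mX : measurable (~` `[- x, x]%classic) by apply: measurableC.
  have mpre S : measurable S -> measurable (B v @^-1` S).
    by move=> mS; rewrite -[X in measurable X]setTI; exact: (measurable_funP (B v)).
  apply: (@le_trans _ _ (P (B v @^-1` (D `&` `[(- x)%R, x])) + P (B v @^-1` (~` `[(- x)%R, x])))%E).
    apply: (@le_trans _ _ (P (B v @^-1` (D `&` `[(- x)%R, x]) `|` B v @^-1` (~` `[(- x)%R, x])))).
      apply: le_measure; rewrite ?inE; [exact: mpre|by apply: measurableU; exact: mpre|].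
      by move=> om /= Dom; case: (pselect (`[(- x)%R, x]%classic (B v om))) => h; [left|right].
    by apply: measureU2; exact: mpre.
  apply: leeD.
    apply: le_trans (brownian_law_le BM v0 mDx) _.
    apply: (@le_trans _ _ ((heat_peak v)%:E * (C * x `^ c)%:E)%E).
      by apply: lee_wpmul2l; [rewrite lee_fin heat_peak_ge0|exact: HD].
    rewrite -!EFinM lee_fin heat_peakE// powRN powR12_sqrt ?(ltW v0)// /A -/g.
    by rewrite le_eqVlt; apply/orP; left; apply/eqP; ring.
  apply: le_trans (brownian_tail BM v0 x_ge0) _.
  rewrite lee_fin ler_wpM2l// ler_expR lerN2.
  have x2 : y `^ (2 * e) * y <= x ^+ 2.
    rewrite /x exprMn; have -> : (y `^ (2^-1 + e)) ^+ 2 = y `^ (2 * e) * y.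
      rewrite -powR_mulrn ?powR_ge0// -powRrM.
      have -> : (2^-1 + e) * 2%:R = 2 * e + 1 by field.
      rewrite powRD; last by rewrite implybE (gt_eqF y0) orbT.
      by rewrite powRr1// ltW.
    by rewrite ler_peMl ?mulr_ge0 ?powR_ge0 ?(ltW y0)// expr_ge1// (le_trans ler01).
  rewrite ler_pdivlMr ?mulrn_wgt0// -(mulr_natr v).
  apply: (@le_trans _ _ (y `^ (2 * e) * y)) => //.
  have -> : y `^ (2 * e) / 4 * (v * 4) = y `^ (2 * e) * v by field.
  by rewrite ler_wpM2l ?powR_ge0.
have mpw : measurable_fun (`]0, y] : set (measurableTypeR R)) (fun v : R => (v `^ (- 2^-1))%:E).
  by apply: measurable_funTS; apply/measurable_EFinP; exact: measurable_powR.
apply: (@le_trans _ _ (\int[mu]_(v in `]0%R, y]) (A%:E * (v `^ (- 2^-1))%:E + b%:E))%E).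
  apply: ge0_le_integral => //.
  - exact: mlaw.
  - by apply: emeasurable_funD => //; apply: emeasurable_funM.
rewrite ge0_integralD//; last 2 first.
- by move=> v _; rewrite mule_ge0 ?lee_fin ?powR_ge0.
- by apply: emeasurable_funM.
rewrite ge0_integralZl//; last by move=> v _; rewrite lee_fin powR_ge0.
have -> : (\int[mu]_(v in `]0%R, y]) b%:E = b%:E * y%:E)%E.
  rewrite integral_cst//; congr (_ * _)%E.
  by rewrite -[LHS]/(mu `]0, y]%classic) lebesgue_measure_itv/= lte_fin y0 -EFinB subr0.
apply: (@le_trans _ _ (A%:E * (2 * y `^ 2^-1)%:E + b%:E * y%:E)%E).
  apply: leeD => //; apply: lee_wpmul2l; first by rewrite lee_fin.
  exact: le_integral_inv_sqrt.
rewrite -!EFinM -EFinD lee_fin [leRHS]mulrDl; apply: lerD.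
  have -> : A * (2 * y `^ 2^-1) = 2 * g * C * x1 `^ c * (y `^ ((2^-1 + e) * c) * y `^ 2^-1).
    rewrite /A /x powRM ?powR_ge0 ?(ltW x10)// -powRrM; ring.
  rewrite ler_wpM2l//; first by rewrite !mulr_ge0 ?powR_ge0// ltW.
  rewrite -powRD; last by rewrite implybE (gt_eqF y0) orbT.
  apply: ler_powR => //.
  have -> : kappa = (1 + c) / 2 + e by rewrite /e addrC subrK.
  have : e * c <= e by rewrite ler_piMr// ltW.
  lra.
have -> : b * y = Num.sqrt 2 * (y * expR (- (y `^ (2 * e) / 4))) by rewrite /b; ring.
rewrite -mulrA ler_wpM2l//; apply: le_trans (HK1 y y1) _.
have k0 : 0 <= kappa by apply: le_trans (ltW ck); rewrite divr_ge0// addr_ge0.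
by rewrite ler_peMr// -[leLHS](powRr0 y); exact: ler_powR.
Qed.

End occupation_growth.

(** * Lower tail of the subordinator *)

Section grid_decay.
Context (R : realType).

Lemma grid_decay (e : R) : 0 < e -> exists2 C : R, 0 <= C &
  forall j, grid R j `^ (- e) <= C / j.+1%:R ^+ 2.
Proof.
move=> e0; exists (4 * (1 + e^-1)); first by rewrite mulr_ge0// addr_ge0// invr_ge0 ltW.
move=> j; rewrite powRN ler_pdivlMr ?exprn_gt0// mulrC ler_pdivrMr ?powR_gt0 ?grid_gt0//.
apply: (@le_trans _ _ (4 * (1 + j%:R ^+ 4))).
  rewrite -natr1; have : 0 <= j%:R :> R by []. set x := j%:R => x0.
  have : 0 <= (x ^+ 2 - 1) ^+ 2 by exact: sqr_ge0.
  have : 0 <= (x - 1) ^+ 2 by exact: sqr_ge0.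
  by rewrite !expr2; nra.
rewrite -mulrA ler_wpM2l// grid_powR.
apply: (@le_trans _ _ ((1 + e^-1) * (1 + e * j%:R ^+ 4))); last first.
  by rewrite ler_wpM2l ?expR_ge1Dx// addr_ge0// invr_ge0 ltW.
have j40 : 0 <= j%:R ^+ 4 :> R by exact: exprn_ge0.
have -> : (1 + e^-1) * (1 + e * j%:R ^+ 4) = 1 + j%:R ^+ 4 + (e^-1 + e * j%:R ^+ 4).
  by field; rewrite gt_eqF.
by rewrite lerDl addr_ge0// ?invr_ge0 ?mulr_ge0// ltW.
Qed.

Lemma expRN_le_inv (x : R) : 0 < x -> expR (- x) <= x^-1.
Proof.
move=> x0; rewrite expRN lef_pV2 ?posrE ?expR_gt0//.
by have := expR_ge1Dx x; lra.
Qed.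

End grid_decay.

Section path_exponents.
Context (R : realType) (d : measure_display) (T : measurableType d)
  (P : probability T R) (alpha : R -> R) (B sigma : R -> {RV P >-> R}).
Hypotheses (malpha : measurable_fun setT alpha) (alpha01 : forall x, 0 < alpha x < 1)
  (BM : standard_Brownian_motion B) (subH : conditional_subordinator alpha B sigma).
Notation mu := (@lebesgue_measure R).
Local Notation pathT := (path_space B).
Implicit Types (l s t y v : R) (om : T).

Lemma pow_alpha_bound l x : 0 <= l -> 0 <= l `^ alpha x <= l + 1.
Proof.
move=> l0; have /andP[a0 a1] := alpha01 x; rewrite powR_ge0/=.
have [l1|l1] := leP l 1.
  apply: (@le_trans _ _ 1); last by rewrite lerDr.
  have -> : 1 = 1 `^ alpha x :> R by rewrite powR1.
  by apply: ge0_ler_powR => //; rewrite ?nnegrE// ltW.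
apply: (@le_trans _ _ l); last by rewrite lerDl.
by rewrite -[leRHS](powRr1 l0); apply: ler_powR; exact: ltW.
Qed.

Definition intensity l (om : pathT) v : R := l `^ alpha (path_at B om v).

Lemma jointly_measurable_intensity l : jointly_measurable (intensity l).
Proof.
apply: (measurableT_comp (measurable_powRr l)).
apply: (measurableT_comp malpha); exact: jointly_measurable_path_space.
Qed.

Lemma intensity_bound l om v : 0 <= l -> 0 <= intensity l om v <= l + 1.
Proof. exact: pow_alpha_bound. Qed.

Let normK l om v : 0 <= l -> `|intensity l om v| <= l + 1.
Proof. by move=> l0; have /andP[h1 h2] := intensity_bound om v l0; rewrite ger0_norm. Qed.

Lemma path_exponentE l y om : path_exponent alpha B l y om = time_int y (intensity l) om.
Proof.
apply: eq_Rintegral => v; rewrite inE/= in_itv/= => /andP[v0 _].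
by rewrite /intensity path_atE.
Qed.

Lemma time_int_restrict dd (T' : measurableType dd) (f : T' -> R -> R) s y z : 0 <= s -> s <= y ->
  time_int s f z = time_int y (fun z v => \1_(`[0, s]%classic) v * f z v) z.
Proof.
move=> s0 sy; rewrite /time_int /Rintegral; congr fine.
rewrite [LHS]integral_mkcond [RHS]integral_mkcond; apply: eq_integral => v _.
rewrite !patchE indicE.
have [vs|vs] := boolP (v \in `[0, s]%classic).
  have -> : v \in `[0, y]%classic.
    by move: vs; rewrite !inE/= !in_itv/= => /andP[-> h]/=; exact: le_trans h sy.
  by rewrite mul1r.
by case: ifPn => // _; rewrite mul0r.
Qed.

Let jmI l s : jointly_measurable (fun (om : pathT) v => \1_(`[0, s]%classic) v * intensity l om v).
Proof.
apply: measurable_funM; last exact: jointly_measurable_intensity.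
by apply: measurable_indic_comp => //; exact: measurable_snd.
Qed.

Let boundI (A : set R) l om v : 0 <= l -> `|\1_A v * intensity l om v| <= l + 1.
Proof.
move=> l0; rewrite indicE; case: (_ \in _); rewrite /= ?mul1r ?mul0r ?normr0.
  exact: normK.
by rewrite addr_ge0.
Qed.

Lemma path_exponent_increment l s t y om : 0 <= l -> 0 <= s -> s <= t -> t <= y ->
  path_exponent alpha B l t om - path_exponent alpha B l s om =
  time_int y (fun (om : pathT) v => \1_(`]s, t]%classic) v * intensity l om v) om.
Proof.
move=> l0 s0 st ty; have t0 := le_trans s0 st; have sy := le_trans st ty.
rewrite !path_exponentE (time_int_restrict _ _ t0 ty) (time_int_restrict _ _ s0 sy).
rewrite -(time_intB y (jmI l t) (jmI l s) (fun v => boundI _ om v l0) (fun v => boundI _ om v l0)).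
apply: eq_Rintegral => v; rewrite inE/= in_itv/= => /andP[v0 _].
rewrite -mulrBl; congr (_ * _); rewrite !indicE.
have -> : (v \in `[0, t]%classic) = (v <= t).
  by apply/idP/idP; rewrite inE/= in_itv/= v0.
have -> : (v \in `[0, s]%classic) = (v <= s).
  by apply/idP/idP; rewrite inE/= in_itv/= v0.
have -> : (v \in `]s, t]%classic) = (s < v <= t).
  by apply/idP/idP; rewrite inE/= in_itv/=.
have [vs|sv] := leP v s; first by rewrite (le_trans vs st) subrr.
by rewrite subr0.
Qed.

Lemma path_exponent_le l s t om : 0 <= l -> 0 <= s -> s <= t ->
  path_exponent alpha B l s om <= path_exponent alpha B l t om.
Proof.
move=> l0 s0 st; rewrite -subr_ge0 (path_exponent_increment _ l0 s0 st (lexx t)).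
by apply: time_int_ge0 => v; rewrite mulr_ge0// powR_ge0.
Qed.

Lemma path_exponent_ge0 l t om : 0 <= path_exponent alpha B l t om.
Proof. by rewrite path_exponentE; apply: time_int_ge0 => v; exact: powR_ge0. Qed.

Let msigma y : measurable_fun setT (sigma y) := measurable_funP (sigma y).

Lemma sigma_le s t om : 0 <= s -> s <= t -> sigma s om <= sigma t om.
Proof.
by move=> s0; rewrite le_eqVlt => /predU1P[->//|st]; apply: ltW; exact: (sub_increasing subH).
Qed.

Lemma sigma_ge0 s om : 0 <= s -> 0 <= sigma s om.
Proof. by move=> s0; rewrite -(sub_start subH om); exact: sigma_le. Qed.

Lemma sigma_laplace l y : 0 <= l -> 0 <= y ->
  (\int[P]_om (expR (- (l * sigma y om)))%:E =
   \int[P]_om (expR (- path_exponent alpha B l y om))%:E)%E.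
Proof.
move=> l0 y0; have := (sub_laplace subH l0 y0 (leey _)).2 setT; apply.
have -> : past B +oo%E setT = measurable (setT : set pathT) by [].
exact: measurableT.
Qed.

(** Markov's inequality: on the event, 1 <= exp(1 - sigma y / z). *)
Lemma sigma_le_prob z y : 0 < z -> 0 <= y ->
  (P [set om | (sigma y om <= z)%R] <=
   (expR 1)%:E * \int[P]_om (expR (- path_exponent alpha B z^-1 y om))%:E)%E.
Proof.
move=> z0 y0; have zi0 : 0 <= z^-1 by rewrite invr_ge0 ltW.
rewrite -sigma_laplace//.
have mE : measurable [set om | (sigma y om <= z)%R].
  have -> : [set om | (sigma y om <= z)%R] = sigma y @^-1` `]-oo, z].
    by apply/seteqP; split => om /=; rewrite in_itv.
  by rewrite -[X in measurable X]setTI; exact: msigma.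
have mex : measurable_fun setT (fun om => expR (- (z^-1 * sigma y om))).
  by apply: measurableT_comp => //; apply: measurableT_comp => //; apply: measurable_funM.
rewrite -[X in P X]setIT -integral_indic// -ge0_integralZl//; last first.
  exact/measurable_EFinP.
apply: ge0_le_integral => //.
- by apply/measurable_EFinP; exact: measurable_indic.
- by apply: emeasurable_funM => //; exact/measurable_EFinP.
move=> om _; rewrite -EFinM lee_fin indicE -expRD.
case: (boolP (om \in _)) => [|_]; last exact: expR_ge0.
rewrite inE/= => sz; rewrite -[leLHS]expR0 ler_expR subr_ge0.
by rewrite mulrC ler_pdivrMr// mul1r.
Qed.

(** With kappa strictly between zeta a and (1 + c)/2, either the occupation of D is below y^kappa,
    which is rare, or Phi_y(1/z) with z = y^zeta is at least y^(kappa - zeta a), and then exp(-Phi)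
    is at most the inverse of this power. *)
Lemma sigma_lower_tail (D : set R) (a c0 c x0 zeta : R) :
  0 < a -> 0 < c0 -> 0 <= c <= 1 -> 0 < x0 -> 0 < zeta -> zeta * a < (1 + c) / 2 ->
  measurable D -> (forall x, D x -> alpha x <= a) ->
  (forall x, x0 <= x -> ((c0 * x `^ c)%:E <= mu (D `&` `[(- x)%R, x]))%E) ->
  exists2 C : R, 0 <= C & forall j,
    (P [set om | (sigma (grid R j) om <= grid R j `^ zeta)%R] <= (C / j.+1%:R ^+ 2)%:E)%E.
Proof.
move=> a0 c00 c01 x00 zeta0 zc mD Da HD.
pose kappa := (zeta * a + (1 + c) / 2) / 2.
have k1 : zeta * a < kappa by rewrite /kappa; lra.
have k2 : kappa < (1 + c) / 2 by rewrite /kappa; lra.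
have [C1 C10 H1] := occupation_grid BM c00 c01 x00 k2 mD HD.
have e0 : 0 < kappa - zeta * a by rewrite subr_gt0.
have [C2 C20 H2] := grid_decay e0.
exists (expR 1 * (C1 + C2)); first by rewrite mulr_ge0 ?expR_ge0// addr_ge0.
move=> j; pose y := grid R j; pose z := y `^ zeta.
have y0 : 0 < y by exact: grid_gt0.
have z0 : 0 < z by exact: powR_gt0.
have z1 : 1 <= z by rewrite /z -(powRr0 y); apply: ler_powR; [exact: grid_ge1|exact: ltW].
have zi0 : 0 <= z^-1 by rewrite invr_ge0 ltW.
apply: le_trans (sigma_le_prob z0 (ltW y0)) _.
rewrite -mulrA EFinM; apply: lee_wpmul2l; first by rewrite lee_fin expR_ge0.
pose E := [set om | (occupation B D y om < y `^ kappa)%R].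
have mE : measurable E.
  have -> : E = occupation B D y @^-1` `]-oo, y `^ kappa[.
    by apply/seteqP; split => om; rewrite /E/= in_itv.
  by rewrite -[X in measurable X]setTI; exact: (measurable_occupation BM y mD).
have mPhi : measurable_fun setT (path_exponent alpha B z^-1 y).
  have := measurable_path_exponent subH zi0 (ltW y0) => h.
  exact: (measurableT_comp h (measurable_to_path (B := B))).
apply: (@le_trans _ _ (\int[P]_om ((\1_E om)%:E + (C2 / j.+1%:R ^+ 2)%:E))%E).
  apply: ge0_le_integral => //.
  - by apply/measurable_EFinP; apply: measurableT_comp => //; exact: measurableT_comp.
  - by apply: emeasurable_funD => //; apply/measurable_EFinP; exact: measurable_indic.
  move=> om _; rewrite -EFinD lee_fin indicE; have [omE|omE] := boolP (om \in E).
    apply: (@le_trans _ _ 1); last by rewrite lerDl divr_ge0// exprn_ge0.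
    by rewrite -expR0 ler_expR oppr_le0 path_exponent_ge0.
  rewrite add0r; apply: le_trans (H2 j).
  have Tk : y `^ kappa <= occupation B D y om.
    by rewrite leNgt; apply/negP => h; move: omE; rewrite notin_setE; apply.
  have lower : y `^ (kappa - zeta * a) <= path_exponent alpha B z^-1 y om.
    apply: (@le_trans _ _ (z^-1 `^ a * occupation B D y om)).
      have -> : z^-1 `^ a = y `^ (- (zeta * a)).
        by rewrite /z -powRN -powRrM mulNr.
      rewrite powRD; last by rewrite implybE (gt_eqF y0) orbT.
      by rewrite mulrC ler_wpM2l ?powR_ge0.
    rewrite path_exponentE /occupation.
    have jo := jointly_measurable_occupation BM mD.
    have o1 (v : R) : `|\1_D (path_at B om v) : R| <= 1.
      by rewrite indicE; case: (_ \in _); rewrite /= ?normr1 ?normr0.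
    rewrite -(time_intZ y (z^-1 `^ a) jo o1).
    rewrite [leRHS](_ : _ = time_int y (fun om v => z^-1 `^ alpha (path_at B om v)) om)//.
    apply: (@le_time_int R _ T y _ _ om (z^-1 `^ a) (z^-1 + 1)).
    - by apply: measurable_funM => //; exact: measurable_cst.
    - apply: (measurableT_comp (measurable_powRr z^-1)).
      by apply: (measurableT_comp malpha); exact: jointly_measurable_path_at.
    - move=> v; rewrite normrM ger0_norm ?powR_ge0//.
      by rewrite ler_piMr ?powR_ge0.
    - by move=> v; exact: normK.
    - move=> v; rewrite indicE; have [|_] := boolP (path_at B om v \in D).
        rewrite inE mulr1 => /Da h; apply: ger_powR => //.
        by rewrite invf_le1// z1 invr_gt0 z0.
      by rewrite mulr0 powR_ge0.
  apply: (@le_trans _ _ (expR (- y `^ (kappa - zeta * a)))); first by rewrite ler_expR lerN2.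
  by rewrite powRN; apply: expRN_le_inv; exact: powR_gt0.
rewrite ge0_integralD//; last 2 first.
- by apply/measurable_EFinP; exact: measurable_indic.
- by rewrite lee_fin divr_ge0// exprn_ge0.
rewrite integral_indic// setIT integral_cst// [X in (_ + _ * X)%E]probability_setT mule1.
by rewrite mulrDl EFinD; apply: leeD => //; exact: H1.
Qed.

End path_exponents.

(** * Time spent by the subordinated process in a closed set *)

Section inverse_process.
Context (R : realType) (d : measure_display) (T : measurableType d)
  (P : probability T R) (alpha : R -> R) (B sigma : R -> {RV P >-> R}).
Hypotheses (BM : standard_Brownian_motion B) (subH : conditional_subordinator alpha B sigma).
Notation mu := (@lebesgue_measure R).
Implicit Types (s t u v y : R) (om : T).

Let past_set s om := [set u : R | 0 <= u /\ s < sigma u om].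

Let past_set_lb s om : lbound (past_set s om) 0.
Proof. by move=> u []. Qed.

Lemma inverse_ge a s om : (exists2 u, 0 <= u & s < sigma u om) ->
  0 <= a -> sigma a om <= s -> a <= inverse_process sigma s om.
Proof.
move=> [u u0 su] a0 sa; apply: lb_le_inf; first by exists u.
move=> v [v0 sv]; rewrite leNgt; apply/negP => va.
by have := sigma_le subH om v0 (ltW va); rewrite leNgt (le_lt_trans sa sv).
Qed.

Lemma inverse_le b s om : 0 <= b -> s < sigma b om -> inverse_process sigma s om <= b.
Proof. by move=> b0 sb; apply: ge_inf; [exists 0; exact: past_set_lb|]. Qed.

Lemma inverse_ge0 s om : 0 <= inverse_process sigma s om.
Proof.
have [h|h] := pselect ((past_set s om) !=set0).
  by apply: lb_le_inf => //; exact: past_set_lb.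
by rewrite /inverse_process inf_out// => -[].
Qed.

(** The passage to rational times serves measurability. The hypothesis excludes the empty set, whose
    infimum is 0 by convention. *)
Lemma inverse_lt s u om : (exists n : nat, s < sigma n%:R om) ->
  inverse_process sigma s om < u <-> exists q : rat, [/\ 0 <= ratr q :> R, ratr q < u & s < sigma (ratr q) om].
Proof.
move=> [n sn]; split.
  have ne : past_set s om !=set0 by exists n%:R; split.
  move=> Lu; have [w [w0 sw] wu] := inf_lt ne Lu.
  have [q] := rat_in_itvoo wu; rewrite in_itv/= => /andP[wq qu].
  exists q; split => //; first by apply: le_trans (ltW wq).
  by apply: lt_le_trans sw _; apply: (sigma_le subH) => //; exact: ltW.
move=> [q [q0 qu sq]]; apply: le_lt_trans qu.
exact: inverse_le.
Qed.

Let mpre (z : R) : 0 <= z ->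
  measurable [set zz : T * measurableTypeR R | zz.2 < sigma z zz.1].
Proof.
move=> z0; have : measurable_fun setT (fun zz : T * measurableTypeR R => zz.2 < sigma z zz.1).
  apply: measurable_fun_ltr; first exact: measurable_snd.
  exact: (measurableT_comp (measurable_funP (sigma z)) measurable_fst).
by move=> /(_ measurableT [set true] I); rewrite setTI.
Qed.

Lemma measurable_inverse :
  measurable_fun setT (fun zz : T * measurableTypeR R => inverse_process sigma zz.2 zz.1).
Proof.
apply: (measurability _ (RGenInftyO.measurableE R)) => //.
move=> /= _ [_ [u ->] <-]; rewrite setTI.
pose E := \bigcup_(n : nat) [set zz : T * measurableTypeR R | zz.2 < sigma n%:R zz.1].
pose F := \bigcup_(q : rat) (if (0 <= ratr q :> R) && (ratr q < u) then
   [set zz : T * measurableTypeR R | zz.2 < sigma (ratr q) zz.1] else set0).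
have mE : measurable E by apply: bigcup_measurable => n _; exact: mpre.
have mF : measurable F.
  by apply: bigcupT_measurable_rat => q; case: ifPn => // /andP[q0 _]; exact: mpre.
(* If the level is never passed, the inverse takes the default value 0 of the infimum of the empty
   set; this part of the space is treated separately. *)
have L0 (zz : T * measurableTypeR R) : ~ E zz -> inverse_process sigma zz.2 zz.1 = 0.
  move=> nE; rewrite /inverse_process inf_out// => -[[w [w0 sw]] _]; apply: nE.
  exists (Num.truncn w).+1 => //=; apply: lt_le_trans sw _.
  by apply: (sigma_le subH) => //; have /andP[_ /ltW] := truncn_itv w0.
have [u0|u0] := ltP 0 u.
  have -> : (fun zz : T * measurableTypeR R => inverse_process sigma zz.2 zz.1) @^-1` `]-oo, u[%classic = (E `&` F) `|` ~` E.
    apply/seteqP; split => zz /=; rewrite in_itv/=.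
      move=> Lu; have [Ez|Ez] := pselect (E zz); last by right.
      left; split => //; have [n _ sn] := Ez.
      have [q [q0 qu sq]] := (inverse_lt u (ex_intro _ n sn)).1 Lu.
      by exists q => //; rewrite q0 qu.
    move=> [[[n _ sn] [q _]]|nE]; last by rewrite L0.
    case: ifPn => // /andP[q0 qu] sq.
    by apply/(inverse_lt u (ex_intro _ n sn)); exists q.
  by apply: measurableU; [exact: measurableI|exact: measurableC].
rewrite (_ : _ @^-1` _ = set0)//; apply/seteqP; split => // zz /=.
by rewrite in_itv/= => h; have := lt_le_trans h u0; rewrite ltNge inverse_ge0.
Qed.

Lemma measurable_subordinated :
  measurable_fun setT (fun zz : T * measurableTypeR R => subordinated_process B sigma zz.2 zz.1).
Proof.
apply: (measurable_path (b := fun w (zz : T * measurableTypeR R) => B w zz.1)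
  (l := fun zz => inverse_process sigma zz.2 zz.1)).
- by move=> w _; exact: (measurableT_comp (measurable_funP (B w)) measurable_fst).
- by move=> zz; exact: BM_continuous BM _.
- exact: measurable_inverse.
- by move=> zz; exact: inverse_ge0.
Qed.

Lemma measurable_subordinated_time om :
  measurable_fun setT (fun s : measurableTypeR R => subordinated_process B sigma s om).
Proof.
exact: (measurableT_comp measurable_subordinated (@measurable_pair1 _ _ T (measurableTypeR R) om)).
Qed.

Lemma measurable_subordinated_path s :
  measurable_fun setT (fun om => subordinated_process B sigma s om).
Proof.
exact: (measurableT_comp measurable_subordinated (@measurable_pair2 _ _ T (measurableTypeR R) s)).
Qed.

End inverse_process.

(** * Cells in which the path comes close to a set *)

Section touching.
Context (R : realType) (d : measure_display) (T : measurableType d)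
  (P : probability T R) (B : R -> {RV P >-> R}).
Hypothesis BM : standard_Brownian_motion B.
Local Notation pathT := (path_space B).
Variables (F : set R) (y : R).
Hypotheses (y0 : 0 < y).
Implicit Types (v x : R) (om : T).

Definition cell n i : R := i%:R * (y / n.+1%:R).

Lemma cell0 n : cell n 0 = 0. Proof. exact: mul0r. Qed.

Lemma cell_last n : cell n n.+1 = y.
Proof. by rewrite /cell mulrC divfK. Qed.

Lemma cell_lt n i j : (i < j)%N -> cell n i < cell n j.
Proof. by move=> ij; rewrite ltr_pM2r ?divr_gt0// ltr_nat. Qed.

Lemma cell_le n i j : (i <= j)%N -> cell n i <= cell n j.
Proof. by move=> ij; rewrite ler_wpM2r ?divr_ge0 ?(ltW y0)// ler_nat. Qed.

Lemma cell_ge0 n i : 0 <= cell n i.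
Proof. by rewrite -(cell0 n); exact: cell_le. Qed.

Lemma cell_length n i : cell n i.+1 - cell n i = y / n.+1%:R.
Proof. by rewrite /cell -natr1 mulrDl mul1r addrAC subrr add0r. Qed.

(* Splits []0, y]] into cells, so that exactly one contains [v]. *)
Lemma cell_exists n v : 0 < v -> v <= y ->
  exists2 i, (i < n.+1)%N & cell n i < v <= cell n i.+1.
Proof.
move=> v0 vy; have ex : exists i, v <= cell n i by exists n.+1; rewrite cell_last.
case: (ex_minnP ex) => -[|i] vi imin; first by move: vi; rewrite cell0 leNgt v0.
exists i; first by apply: imin; rewrite cell_last.
by rewrite vi andbT ltNge; apply/negP => /imin; rewrite ltnn.
Qed.

Lemma cell_unique n v i j : cell n i < v <= cell n i.+1 -> cell n j < v <= cell n j.+1 -> i = j.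
Proof.
have half a b : cell n a < v <= cell n a.+1 -> cell n b < v <= cell n b.+1 -> (a <= b)%N.
  move=> /andP[av _] /andP[_ vb]; rewrite leqNgt; apply/negP => ba.
  by have := lt_le_trans av vb; rewrite ltNge cell_le.
by move=> h1 h2; apply/eqP; rewrite eqn_leq !half.
Qed.

Definition near_set (e : R) : set R := [set x | exists2 z, F z & `|x - z| < e].

Lemma open_near_set e : open (near_set e).
Proof.
have -> : near_set e = \bigcup_(z in F) ball z e.
  apply/seteqP; split => x [z Fz h]; exists z => //; move: h; rewrite /ball/= distrC//.
by apply: bigcup_open => z _; exact: ball_open.
Qed.

(** Rational times make this an event of the path. They may all miss F, hence the open
    neighbourhood; its radius decreases with the mesh, so that the limit is a visit to F when F is
    closed. *)
Definition touch n i : set pathT :=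
  [set om | exists2 q : rat, cell n i <= ratr q <= cell n i.+1 & near_set n.+1%:R^-1 (B (ratr q) om)].

Lemma measurable_touch n i : measurable (touch n i).
Proof.
have -> : touch n i = \bigcup_(q : rat) (if cell n i <= ratr q <= cell n i.+1 then
    (B (ratr q) : pathT -> R) @^-1` near_set n.+1%:R^-1 else set0).
  apply/seteqP; split => om /=.
    by move=> [q h1 h2]; exists q => //; rewrite h1.
  by move=> [q _]; case: ifPn => // h1 h2; exists q.
apply: bigcupT_measurable_rat => q; case: ifPn => // /andP[q0 _].
have q0' : 0 <= ratr q :> R by apply: le_trans q0; exact: cell_ge0.
rewrite -[X in measurable X]setTI; apply: (measurable_path_eval q0') => //.
by apply: open_measurable; exact: open_near_set.
Qed.

Let path_continuity om v e : 0 <= v -> 0 < e -> exists2 del : R, 0 < del &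
  forall w, 0 <= w -> `|v - w| < del -> `|B v om - B w om| < e.
Proof.
move=> v0 e0; have /subspace_continuousP/(_ v) := @BM_continuous _ _ _ _ _ BM om.
have vin : `[0, +oo[%classic v by rewrite /= in_itv/= v0.
move=> /(_ vin)/cvgrPdist_lt/(_ e e0).
rewrite near_withinE => /nbhs_ballP[del /= del0 H]; exists del => // w w0 vw.
by apply: (H w) => //=; rewrite in_itv/= w0.
Qed.

(** By continuity of the path, a rational time of the cell close enough to v is also close to F in
    space. *)
Lemma touch_hit n i om v : cell n i <= v <= cell n i.+1 -> F (B v om) -> touch n i om.
Proof.
move=> /andP[iv vi] Fv; have v0 : 0 <= v by apply: le_trans iv; exact: cell_ge0.
have n0 : 0 < n.+1%:R^-1 :> R by rewrite invr_gt0.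
have [del del0 H] := path_continuity om v0 n0.
have lr : Num.max (cell n i) (v - del) < Num.min (cell n i.+1) (v + del).
  rewrite gt_max !lt_min cell_lt//= (le_lt_trans iv) ?ltrDl//.
  have vd : v - del < v by rewrite ltrBlDr ltrDl.
  by rewrite (lt_le_trans vd vi)/= (lt_trans vd)// ltrDl.
have [q] := rat_in_itvoo lr; rewrite in_itv/= gt_max lt_min.
move=> /andP[/andP[q1 q2] /andP[q3 q4]].
exists q; first by rewrite !ltW.
exists (B v om) => //; rewrite distrC; apply: H.
  by apply: le_trans (ltW q1); exact: cell_ge0.
by rewrite ltr_distlC; apply/andP; split.
Qed.

(** As F is closed, [B v] has positive distance from it, and by continuity the path stays away from
    F on every sufficiently short cell around v. *)
Lemma not_touch_near om v : closed F -> 0 <= v -> ~ F (B v om) ->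
  \forall n \near \oo, forall i, cell n i < v <= cell n i.+1 -> ~ touch n i om.
Proof.
move=> clF v0 nF.
have /nbhs_ballP[e /= e0 He] : nbhs (B v om) (~` F).
  by apply: open_nbhs_nbhs; split; [exact: closed_openC|].
have e20 : 0 < e / 2 by rewrite divr_gt0.
have [del del0 H] := path_continuity om v0 e20.
have dy0 : 0 < del / y by rewrite divr_gt0.
near=> n => i /andP[iv vi] [q /andP[q1 q2] [z Fz qz]].
have h1 : n.+1%:R^-1 < e / 2 by near: n; exact: (near_infty_natSinv_lt (PosNum e20)).
have h2 : n.+1%:R^-1 < del / y by near: n; exact: (near_infty_natSinv_lt (PosNum dy0)).
have len : y / n.+1%:R < del by rewrite mulrC -ltr_pdivlMr.
have q0 : 0 <= ratr q :> R by apply: le_trans q1; exact: cell_ge0.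
have vq : `|v - ratr q| < del.
  rewrite ltr_norml ltrNl opprB; apply/andP; split; apply: le_lt_trans len;
    by rewrite -(cell_length n i) lerB// ltW.
have := H _ q0 vq => Bq.
apply: (He z) => //; rewrite /ball/=.
have -> : B v om - z = (B v om - B (ratr q) om) + (B (ratr q) om - z) by ring.
by apply: le_lt_trans (ler_normD _ _) _; rewrite [ltRHS]splitr ltrD// (lt_trans qz).
Unshelve. all: by end_near. Qed.

End touching.

Section limits_of_means.
Context (R : realType) (d : measure_display) (T : measurableType d) (P : probability T R).
Notation mu := (@lebesgue_measure R).

Lemma mean_time_int_cvg (y K : R) (f_ : nat -> T -> R -> R) (f : T -> R -> R) : 0 <= y ->
  (forall n, jointly_measurable (f_ n)) -> jointly_measurable f ->
  (forall n om v, 0 <= f_ n om v <= K) -> (forall om v, 0 <= f om v <= K) ->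
  (forall om v, 0 <= v <= y -> f_ n om v @[n --> \oo] --> f om v) ->
  (\int[P]_om (time_int y (f_ n) om)%:E @[n --> \oo] --> \int[P]_om (time_int y f om)%:E)%E.
Proof.
move=> y0 mf_ mf fK_ fK cvgf.
have abs_ n om v : `|f_ n om v| <= K by have /andP[h1 h2] := fK_ n om v; rewrite ger0_norm.
have abs om v : `|f om v| <= K by have /andP[h1 h2] := fK om v; rewrite ger0_norm.
have ge0_ n om v : 0 <= f_ n om v by have /andP[] := fK_ n om v.
have ge0 om v : 0 <= f om v by have /andP[] := fK om v.
apply: (@dominated_cvg _ _ _ P setT measurableT _ _ (cst (K * y)%:E)) => //.
- by move=> n; apply/measurable_EFinP; apply: measurable_time_int.
- move=> om _; rewrite -(time_intE y mf (abs om)).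
  have -> : (fun n => (time_int y (f_ n) om)%:E) = (fun n => \int[mu]_(v in `[0%R, y]) (f_ n om v)%:E)%E.
    by apply/funext => n; rewrite (time_intE y (mf_ n) (abs_ n om)).
  apply: (@dominated_cvg _ _ _ mu `[0%R, y] _ _ _ (cst K%:E)) => //.
  + move=> n; apply: measurable_funTS; apply/measurable_EFinP.
    exact: jointly_measurable_section.
  + move=> v; rewrite /= in_itv/= => hv; apply/fine_cvgP; split; first exact: nearW.
    exact: cvgf.
  + have mc : jointly_measurable (fun (om : T) (v : R) => K) by exact: measurable_cst.
    apply: (integrable_time y (f := fun _ _ => K) (y := om) (K := `|K|)) => //.
  + by move=> n v _; rewrite lee_fin.
- exact: finite_measure_integrable_cst.
- move=> n om _; rewrite lee_fin ger0_norm; last exact: time_int_ge0.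
  by apply: time_int_le_cst.
Qed.

Lemma onem_expR_sum (n : nat) (a : 'I_n -> R) : (forall i, 0 <= a i) ->
  1 - expR (- \sum_(i < n) a i) <= \sum_(i < n) (1 - expR (- a i)).
Proof.
elim: n a => [|n IH] a a0; first by rewrite !big_ord0 oppr0 expR0 subrr.
rewrite !big_ord_recr/=; apply: (@le_trans _ _ ((1 - expR (- \sum_(i < n) a (widen_ord (leqnSn n) i))) + (1 - expR (- a ord_max)))).
  rewrite opprD expRD; set p := expR _; set q := expR _.
  have p1 : p <= 1 by rewrite expR_le1 oppr_le0 sumr_ge0.
  have q1 : q <= 1 by rewrite expR_le1 oppr_le0.
  by clear - p1 q1; nra.
by rewrite lerD2r; exact: IH.
Qed.

End limits_of_means.

(** * The clock time consumed in touched cells *)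

Section touched_time.
Context (R : realType) (d : measure_display) (T : measurableType d)
  (P : probability T R) (alpha : R -> R) (B sigma : R -> {RV P >-> R}).
Hypotheses (malpha : measurable_fun setT alpha) (alpha01 : forall x, 0 < alpha x < 1)
  (BM : standard_Brownian_motion B) (subH : conditional_subordinator alpha B sigma).
Notation mu := (@lebesgue_measure R).
Local Notation pathT := (path_space B).
Variables (F : set R) (y : R).
Hypotheses (clF : closed F) (y0 : 0 < y).
Implicit Types (l s t v x : R) (om : T).
Local Notation c := (cell y).
Local Notation touch := (@touch R d T P B F y).

Let mF : measurable F. Proof. exact: closed_measurable. Qed.

Definition touched_intensity l n (om : pathT) v : R :=
  \sum_(i < n.+1) \1_(touch n i) om * (\1_(`]c n i, c n i.+1]%classic) v * intensity alpha (B := B) l om v).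

Lemma jointly_measurable_touched_intensity l n : jointly_measurable (touched_intensity l n).
Proof.
apply: measurable_sum => i; apply: measurable_funM.
  by apply: measurable_indic_comp; [exact: measurable_touch|exact: measurable_fst].
apply: measurable_funM; last exact: jointly_measurable_intensity.
by apply: measurable_indic_comp => //; exact: measurable_snd.
Qed.

Lemma touched_intensityE l n om v i : (i < n.+1)%N -> c n i < v <= c n i.+1 ->
  touched_intensity l n om v = \1_(touch n i) om * intensity alpha (B := B) l om v.
Proof.
move=> iln vi; rewrite /touched_intensity (bigD1 (Ordinal iln))//= big1 => [|j ji].
  have -> : \1_(`]c n i, c n i.+1]%classic) v = 1 :> R by rewrite indicE mem_set//= in_itv.
  by rewrite mul1r addr0.
rewrite (_ : \1_(`]c n j, c n j.+1]%classic) v = 0) ?mul0r ?mulr0//.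
rewrite indicE (_ : (v \in _) = false)//; apply/negbTE; apply/negP; rewrite inE/= in_itv/= => vj.
by move: ji; rewrite -val_eqE/= (cell_unique y0 vj vi) eqxx.
Qed.

Lemma touched_intensity_out l n om v : ~~ (0 < v <= y) -> touched_intensity l n om v = 0.
Proof.
move=> vy; apply: big1 => i _; rewrite (_ : \1_(`]c n i, c n i.+1]%classic) v = 0) ?mul0r ?mulr0//.
rewrite indicE (_ : (v \in _) = false)//; apply/negbTE; apply: contra vy; rewrite inE/= in_itv/= => /andP[h1 h2].
rewrite (le_lt_trans (cell_ge0 y0 n i) h1)/= (le_trans h2)// -[leRHS](cell_last y n).
exact: cell_le.
Qed.

Lemma touched_intensity_bound l n om v : 0 <= l -> 0 <= touched_intensity l n om v <= l + 1.
Proof.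
move=> l0; have [/andP[v0 vy]|vy] := boolP (0 < v <= y); last first.
  by rewrite touched_intensity_out// lexx addr_ge0.
have [i iln vi] := cell_exists n v0 vy.
rewrite (touched_intensityE _ _ iln vi); have := intensity_bound B alpha01 om v l0.
by rewrite indicE; case: (_ \in _); rewrite /= ?mul1r// mul0r lexx addr_ge0.
Qed.

(** The limit of [touched_intensity] as the mesh tends to 0. Time 0 is left out because the cells
    are open on the left. *)
Definition hit_intensity l (om : pathT) v : R :=
  \1_(`]0, y]%classic) v * (\1_F (path_at B om v) * intensity alpha (B := B) l om v).

Lemma touched_intensity_cvg l om v :
  touched_intensity l n om v @[n --> \oo] --> hit_intensity l om v.
Proof.
have [/andP[v0 vy]|vy] := boolP (0 < v <= y); last first.
  rewrite /hit_intensity indicE (_ : (v \in _) = false) ?mul0r; last first.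
    by apply/negbTE; apply: contra vy; rewrite inE/= in_itv.
  by under eq_fun do rewrite touched_intensity_out//; exact: cvg_cst.
rewrite /hit_intensity indicE (_ : v \in _) ?mul1r; last by rewrite inE/= in_itv/= v0.
have [Fv|nFv] := pselect (F (path_at B om v)).
  rewrite indicE mem_set// mul1r.
  have -> : (fun n => touched_intensity l n om v) = (fun n => intensity alpha (B := B) l om v); last exact: cvg_cst.
  apply/funext => n; have [i iln vi] := cell_exists n v0 vy.
  rewrite (touched_intensityE _ _ iln vi) indicE mem_set ?mul1r//.
  apply: (touch_hit BM y0 (v := v)); last by rewrite -path_atE// ltW.
  by have /andP[/ltW -> ->] := vi.
rewrite indicE memNset// mul0r.
apply: cvg_near_cst.
have nF' : ~ F (B v om) by rewrite -path_atE// ltW.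
have := not_touch_near BM y0 clF (ltW v0) nF'.
apply: filterS => n H; have [i iln vi] := cell_exists n v0 vy.
by rewrite (touched_intensityE _ _ iln vi) indicE memNset ?mul0r//; exact: H.
Qed.

Definition touched_time n om : R :=
  \sum_(i < n.+1) \1_(touch n i) (to_path B om) * (sigma (c n i.+1) om - sigma (c n i) om).

Let mtouchT n i : measurable (touch n i : set T).
Proof. by apply: past_measurable; exact: measurable_touch. Qed.

Lemma measurable_touched_time n : measurable_fun setT (touched_time n).
Proof.
apply: measurable_sum => i; apply: measurable_funM; last exact: measurable_funB.
by apply: measurable_indic; exact: mtouchT.
Qed.

Let incr_ge0 n i om : 0 <= sigma (c n i.+1) om - sigma (c n i) om.
Proof. by rewrite subr_ge0; apply: (sigma_le subH); [exact: cell_ge0|exact: cell_le]. Qed.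

Lemma touched_time_ge0 n om : 0 <= touched_time n om.
Proof. by apply: sumr_ge0 => i _; rewrite mulr_ge0. Qed.

Let time_int_touched l n om : 0 <= l ->
  ((time_int y (touched_intensity l n) om)%:E =
   \sum_(i < n.+1) (\1_(touch n i) (to_path B om) *
     (path_exponent alpha B l (c n i.+1) om - path_exponent alpha B l (c n i) om))%:E)%E.
Proof.
move=> l0; rewrite -(time_intE y (jointly_measurable_touched_intensity l n) (K := l + 1)); last first.
  by move=> v; have /andP[h1 h2] := touched_intensity_bound n om v l0; rewrite ger0_norm.
rewrite /touched_intensity; under eq_integral do rewrite -sumEFin.
have jm i : jointly_measurable (fun (om : pathT) v => \1_(`]c n i, c n i.+1]%classic) v * intensity alpha (B := B) l om v).
  apply: measurable_funM; last exact: jointly_measurable_intensity.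
  by apply: measurable_indic_comp => //; exact: measurable_snd.
have b0 i (om' : pathT) v : 0 <= \1_(`]c n i, c n i.+1]%classic) v * intensity alpha (B := B) l om' v.
  by rewrite mulr_ge0// powR_ge0.
rewrite ge0_integral_sum//; last 2 first.
- move=> i; apply: measurable_funTS; apply/measurable_EFinP; apply: measurable_funM => //.
  exact: (jointly_measurable_section _ (jm i)).
- by move=> i v _; rewrite lee_fin mulr_ge0.
apply: eq_bigr => i _; under eq_integral do rewrite EFinM.
have ci : c n i.+1 <= y by rewrite -[leRHS](cell_last y n); exact: cell_le.
rewrite (path_exponent_increment malpha alpha01 BM om l0 (cell_ge0 y0 n i) (cell_le y0 n (leqnSn i)) ci).
rewrite ge0_integralZl//; last 2 first.
- by apply: measurable_funTS; apply/measurable_EFinP; exact: (jointly_measurable_section _ (jm i)).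
- by move=> v _; rewrite lee_fin.
have bd v : `|\1_(`]c n i, c n i.+1]%classic) v * intensity alpha (B := B) l om v| <= l + 1.
  rewrite ger0_norm//; have /andP[h1 h2] := intensity_bound B alpha01 om v l0.
  by rewrite indicE; case: (_ \in _); rewrite /= ?mul1r// mul0r addr_ge0.
by rewrite (time_intE y (jm i) bd) -EFinM.
Qed.

Let mindic_touch n i : measurable_fun setT (\1_(touch n i) : T -> R).
Proof. by apply: measurable_indic; exact: mtouchT. Qed.

Lemma touched_increments_le l n : 0 <= l ->
  (\sum_(i < n.+1) \int[P]_(om in touch n i)
     (1 - expR (- (l * (sigma (c n i.+1) om - sigma (c n i) om))))%:E <=
   \int[P]_om (time_int y (touched_intensity l n) om)%:E)%E.
Proof.
move=> l0.
have mPhi z : 0 <= z -> measurable_fun setT (path_exponent alpha B l z).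
  move=> z0; have h := measurable_path_exponent subH l0 z0.
  exact: (measurableT_comp h (measurable_to_path (B := B))).
have inc i om : 0 <= path_exponent alpha B l (c n i.+1) om - path_exponent alpha B l (c n i) om.
  by rewrite subr_ge0; apply: path_exponent_le => //; [exact: cell_ge0|exact: cell_le].
apply: (@le_trans _ _ (\sum_(i < n.+1) \int[P]_om (\1_(touch n i) (to_path B om) *
     (path_exponent alpha B l (c n i.+1) om - path_exponent alpha B l (c n i) om))%:E)%E); last first.
  rewrite -ge0_integral_sum//; last 2 first.
  - move=> i; apply/measurable_EFinP; apply: measurable_funM; first exact: mindic_touch.
    by apply: measurable_funB; apply: mPhi; exact: cell_ge0.
  - by move=> i om _; rewrite lee_fin mulr_ge0.
  rewrite le_eqVlt; apply/orP; left; apply/eqP; apply: eq_integral => om _.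
  by rewrite time_int_touched.
apply: lee_sum => i _.
have IM (f : T -> R) : (\int[P]_(om in touch n i) (f om)%:E =
    \int[P]_om (\1_(touch n i) (to_path B om) * f om)%:E)%E.
  by rewrite integral_indicM; apply: eq_integral => om _; rewrite -EFinM.
have := @increment_laplace_le _ _ _ _ _ _ _ subH l (c n i) (c n i.+1) (touch n i) l0
  (cell_ge0 y0 n i) (cell_le y0 n (leqnSn i)) (measurable_touch F y0 n i).
move=> /(_ (fun om => path_exponent_le malpha alpha01 BM om l0 (cell_ge0 y0 n i) (cell_le y0 n (leqnSn i)))).
by rewrite (IM (fun om => path_exponent alpha B l (c n i.+1) om - path_exponent alpha B l (c n i) om)).
Qed.

(** As 1 - exp(-x) is subadditive, the transforms of the single increments suffice and no joint law
    over the cells is needed. *)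
Lemma touched_time_laplace l n : 0 <= l ->
  (\int[P]_om (1 - expR (- (l * touched_time n om)))%:E <=
   \int[P]_om (time_int y (touched_intensity l n) om)%:E)%E.
Proof.
move=> l0; apply: le_trans (touched_increments_le n l0).
have e1 (x : R) : 0 <= x -> 0 <= 1 - expR (- x) by move=> x0; rewrite subr_ge0 expR_le1 oppr_le0.
pose a n i om := 1 - expR (- (l * (sigma (c n i.+1) om - sigma (c n i) om))).
have ma i : measurable_fun setT (a n i).
  apply: measurable_funB => //; apply: measurableT_comp => //; apply: measurableT_comp => //.
  by apply: measurable_funM => //; exact: measurable_funB.
apply: (@le_trans _ _ (\int[P]_om (\sum_(i < n.+1) (\1_(touch n i) (to_path B om) * a n i om)%:E))%E).
  apply: ge0_le_integral => //.
  - by move=> om _; rewrite lee_fin e1// mulr_ge0// touched_time_ge0.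
  - apply/measurable_EFinP; apply: measurable_funB => //; apply: measurableT_comp => //.
    by apply: measurableT_comp => //; apply: measurable_funM => //; exact: measurable_touched_time.
  - by apply: emeasurable_sum => i; apply/measurable_EFinP; apply: measurable_funM => //; exact: mindic_touch.
  move=> om _; rewrite sumEFin lee_fin /touched_time mulr_sumr.
  apply: le_trans (onem_expR_sum _) _; first by move=> i; rewrite !mulr_ge0.
  apply: ler_sum => i _; rewrite /a /to_path indicE; case: (_ \in _); rewrite /= ?mul1r//.
  by rewrite !mul0r mulr0 oppr0 expR0 subrr.
rewrite ge0_integral_sum//; last 2 first.
- by move=> i; apply/measurable_EFinP; apply: measurable_funM => //; exact: mindic_touch.
- by move=> i om _; rewrite lee_fin mulr_ge0// /a e1// mulr_ge0.
rewrite le_eqVlt; apply/orP; left; apply/eqP; apply: eq_bigr => i _.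
by rewrite integral_indicM; apply: eq_integral => om _; rewrite -EFinM.
Qed.

Lemma jointly_measurable_hit_intensity l : jointly_measurable (hit_intensity l).
Proof.
apply: measurable_funM.
  by apply: measurable_indic_comp => //; exact: measurable_snd.
apply: measurable_funM; last exact: jointly_measurable_intensity.
by apply: measurable_indic_comp => //; exact: jointly_measurable_path_space.
Qed.

Lemma hit_intensity_bound l om v : 0 <= l -> 0 <= hit_intensity l om v <= l + 1.
Proof.
move=> l0; have /andP[i0 i1] := intensity_bound B alpha01 om v l0; rewrite /hit_intensity !indicE.
by do 2! case: (_ \in _); rewrite /= ?mul1r ?mul0r ?mulr0 ?i0 ?i1 ?lexx ?addr_ge0.
Qed.

Lemma mean_touched_intensity_cvg l : 0 <= l ->
  (\int[P]_om (time_int y (touched_intensity l n) om)%:E @[n --> \oo] -->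
   \int[P]_om (time_int y (hit_intensity l) om)%:E)%E.
Proof.
move=> l0; pose tb (f : pathT -> R -> R) : T -> R -> R := f.
have jT (f : pathT -> R -> R) : jointly_measurable f -> jointly_measurable (tb f).
  move=> mf; have h : measurable_fun setT (fun z : T * measurableTypeR R => ((to_path B z.1, z.2) : pathT * measurableTypeR R)).
    apply: measurable_fun_pair; last exact: measurable_snd.
    exact: (measurableT_comp (measurable_to_path (B := B)) measurable_fst).
  exact: (measurableT_comp mf h).
apply: (@mean_time_int_cvg _ _ _ P y (l + 1) (fun n => tb (touched_intensity l n)) (tb (hit_intensity l))).
- exact: ltW.
- by move=> n; apply: jT; exact: jointly_measurable_touched_intensity.
- by apply: jT; exact: jointly_measurable_hit_intensity.
- by move=> n om v; exact: touched_intensity_bound.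
- by move=> om v; exact: hit_intensity_bound.
- by move=> om v _; exact: touched_intensity_cvg.
Qed.

Lemma mean_touched_intensity_lt l b : 0 <= l ->
  (\int[P]_om (time_int y (hit_intensity l) om)%:E < b%:E)%E ->
  exists n, (\int[P]_om (time_int y (touched_intensity l n) om)%:E < b%:E)%E.
Proof.
move=> l0 lt; have cvgm := mean_touched_intensity_cvg l0.
apply: contrapT => nex; move: lt; rewrite ltNge => /negP; apply.
rewrite -(cvg_lim _ cvgm)//; apply: lime_ge; first by apply/cvg_ex; eexists; exact: cvgm.
by apply: nearW => n; rewrite leNgt; apply/negP => h; apply: nex; exists n.
Qed.

(* [touched_time] is used, rather than the time that the subordinated process
   spends in [F], since its events are measurable. *)
Lemma touched_time_tail x b e : 0 < x -> 0 < e ->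
  (\int[P]_om (time_int y (hit_intensity x^-1) om)%:E <= b%:E)%E ->
  exists n, (P [set om | (x < touched_time n om)%R] <= (2 * (b + e))%:E)%E.
Proof.
move=> x0 e0 hb; have l0 : 0 <= x^-1 by rewrite invr_ge0 ltW.
have [n Hn] : exists n, (\int[P]_om (time_int y (touched_intensity x^-1 n) om)%:E < (b + e)%:E)%E.
  by apply: mean_touched_intensity_lt => //; apply: le_lt_trans hb _; rewrite lte_fin ltrDl.
exists n.
have mN := measurable_touched_time n.
have mE : measurable [set om | (x < touched_time n om)%R].
  have -> : [set om | (x < touched_time n om)%R] = touched_time n @^-1` `]x, +oo[%classic.
    by apply/seteqP; split => om /=; rewrite in_itv/= andbT.
  by rewrite -[X in measurable X]setTI; exact: mN.
have mex : measurable_fun setT (fun om => 1 - expR (- (x^-1 * touched_time n om))).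
  apply: measurable_funB => //; apply: measurableT_comp => //.
  by apply: measurableT_comp => //; apply: measurable_funM.
have ge0 om : 0 <= 1 - expR (- (x^-1 * touched_time n om)).
  by rewrite subr_ge0 expR_le1 oppr_le0 mulr_ge0// touched_time_ge0.
apply: (@le_trans _ _ (2%:E * \int[P]_om (1 - expR (- (x^-1 * touched_time n om)))%:E)%E); last first.
  rewrite EFinM; apply: lee_wpmul2l => //.
  exact: le_trans (touched_time_laplace n l0) (ltW Hn).
rewrite -[X in P X]setIT -integral_indic// -ge0_integralZl//; last 2 first.
- exact/measurable_EFinP.
- by move=> om _; rewrite lee_fin.
apply: ge0_le_integral => //.
- by apply/measurable_EFinP; exact: measurable_indic.
- by apply: emeasurable_funM => //; exact/measurable_EFinP.
move=> om _; rewrite -EFinM lee_fin indicE; case: (boolP (om \in _)) => [|_]; last by rewrite mulr_ge0.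
rewrite inE/= => xN.
have h : expR (- (x^-1 * touched_time n om)) <= expR (- 1).
  by rewrite ler_expR lerN2 mulrC ler_pdivlMr// mul1r ltW.
have h1 : expR (- 1) <= 2^-1 :> R.
  rewrite expRN lef_pV2 ?posrE ?expR_gt0//.
  by have := expR_ge1Dx (1 : R); rewrite (_ : 1 + 1 = 2)//; ring.
rewrite /=; lra.
Qed.

(** If X(s) is in F and sigma (c i) <= s < sigma (c i.+1), the inverse at s lies in cell i, which is
    thus touched. So the times spent in F are covered by the images under [sigma] of touched cells,
    of total length [touched_time]. *)
Lemma occupation_le_touched n t om : 0 <= t -> t <= sigma y om ->
  \int[mu]_(s in `[0, t]) \1_F (subordinated_process B sigma s om) <= touched_time n om.
Proof.
move=> t0 ty.
have mX := measurable_subordinated_time BM subH om.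
have mXF : measurable_fun setT (fun s : measurableTypeR R => \1_F (subordinated_process B sigma s om) : R).
  exact: measurable_indic_comp.
have key : (\int[mu]_(s in `[0%R, t]) (\1_F (subordinated_process B sigma s om))%:E <= (touched_time n om)%:E)%E.
  (* The end point is dropped because t may equal [sigma y], which lies in none of the intervals
     closed on the left only. *)
  rewrite -integral_itv_bndo_bndc; last by apply: measurable_funTS; exact/measurable_EFinP.
  pose g s : R := \sum_(i < n.+1) \1_(touch n i) (to_path B om) * \1_(`[sigma (c n i) om, sigma (c n i.+1) om[%classic) s.
  have g0 s : 0 <= g s by apply: sumr_ge0 => i _; rewrite mulr_ge0.
  have mg : measurable_fun setT (g : measurableTypeR R -> R).
    by apply: measurable_sum => i; apply: measurable_funM => //; exact: measurable_indic.
  apply: (@le_trans _ _ (\int[mu]_(s in `[0%R, t[) (g s)%:E)%E).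
    apply: ge0_le_integral => //.
    - by apply: measurable_funTS; exact/measurable_EFinP.
    - by apply: measurable_funTS; exact/measurable_EFinP.
    move=> s; rewrite /= in_itv/= lee_fin => /andP[s0 st].
    rewrite [leLHS]indicE; case: (boolP (_ \in F)) => [|_]; last exact: g0.
    rewrite inE => Fs.
    have ex : exists i, s < sigma (c n i) om by exists n.+1; rewrite cell_last; exact: lt_le_trans ty.
    case: (ex_minnP ex) => -[|i] si imin; first by move: si; rewrite cell0 (sub_start subH) ltNge s0.
    have iln : (i < n.+1)%N by apply: imin; rewrite cell_last; exact: lt_le_trans ty.
    have is_ : sigma (c n i) om <= s by rewrite leNgt; apply/negP => /imin; rewrite ltnn.
    have tch : touch n i om.
      apply: (touch_hit BM y0 (v := inverse_process sigma s om)) => //.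
      rewrite (inverse_ge subH _ (cell_ge0 y0 n i) is_)/=; last by exists (c n i.+1) => //; exact: cell_ge0.
      by apply: inverse_le => //; exact: cell_ge0.
    rewrite /g (bigD1 (Ordinal iln))//= indicE mem_set// indicE mem_set/= ?in_itv/= ?is_// mulr1 lerDl.
    by apply: sumr_ge0 => j _; rewrite mulr_ge0.
  apply: (@le_trans _ _ (\int[mu]_s (g s)%:E)%E).
    apply: ge0_subset_integral => //; first exact/measurable_EFinP.
    by move=> s _; rewrite lee_fin.
  rewrite /g; under eq_integral do rewrite -sumEFin.
  rewrite ge0_integral_sum//; last first.
    by move=> i; apply/measurable_EFinP; apply: measurable_funM => //; exact: measurable_indic.
  rewrite /touched_time -sumEFin; apply: lee_sum => i _.
  under eq_integral do rewrite EFinM.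
  rewrite ge0_integralZl//; last first.
    by apply/measurable_EFinP; exact: measurable_indic.
  rewrite integral_indic// setIT EFinM; apply: lee_wpmul2l; first by rewrite lee_fin.
  rewrite -[leLHS]/(mu `[sigma (c n i) om, sigma (c n i.+1) om[%classic) lebesgue_measure_itv/= lte_fin.
  by case: ifPn => _; rewrite -?EFinB// lee_fin.
rewrite /Rintegral -lee_fin fineK// ge0_fin_numE; first exact: le_lt_trans key (ltry _).
by apply: integral_ge0 => s _; rewrite lee_fin.
Qed.

End touched_time.

(** * Almost sure limits of occupation fractions *)

Section almost_sure_occupation.
Context (R : realType).

Lemma inv_square_series_fin (c : R) (u : nat -> \bar R) : 0 <= c ->
  (forall j, (0 <= u j)%E) -> (forall j, (u j <= (c / j.+1%:R ^+ 2)%:E)%E) ->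
  (\sum_(j <oo) u j < +oo)%E.
Proof.
move=> c0 u0 uc; apply: (@le_lt_trans _ _ (c * 2)%:E); last exact: ltry.
apply: lime_le; first by apply: is_cvg_nneseries => n _ _; exact: u0.
apply: nearW => n; apply: (@le_trans _ _ (\sum_(0 <= j < n) (c / j.+1%:R ^+ 2)%:E)%E).
  by apply: lee_sum => j _; exact: uc.
rewrite sumEFin lee_fin -mulr_sumr ler_wpM2l//.
(* Telescoping: 1/a^2 <= 2/(a (a + 1)) for a >= 1. *)
have H : \sum_(0 <= j < n) (j.+1%:R ^+ 2)^-1 <= 2 - 2 * n.+1%:R^-1 :> R; last first.
  by apply: le_trans H _; rewrite lerBlDr lerDl mulr_ge0// invr_ge0.
elim: n => [|n IH]; first by rewrite big_geq// invr1; lra.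
rewrite big_nat_recr//=; apply: le_trans (lerD IH (lexx _)) _.
rewrite -[n.+2%:R]natr1; set a : R := n.+1%:R.
have a1 : 1 <= a by rewrite ler1n.
have a0 : 0 < a by exact: lt_le_trans a1.
have b0 : 0 < a + 1 by rewrite addr_gt0.
have E : 2 * a^-1 - 2 * (a + 1)^-1 = (a * (a + 1) / 2)^-1.
  by field; rewrite !gt_eqF.
have : (a ^+ 2)^-1 <= (a * (a + 1) / 2)^-1.
  rewrite lef_pV2 ?posrE ?exprn_gt0 ?divr_gt0 ?mulr_gt0//.
  by rewrite expr2 -mulrA ler_pM2l//; lra.
rewrite -E; set p := (a ^+ 2)^-1; set q := a^-1; set r := (a + 1)^-1; lra.
Qed.

(** For j >= 1, (j + 1)^4 <= j^4 + 15 j^3, with 15 = 4 + 6 + 4 + 1, so that moving to the next grid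
    point costs a factor exp(15 xi j^3), which exp((zeta - xi) j^4) outweighs; the constant e is at
    least exp(-j). *)
Lemma grid_ratio (xi zeta e : R) : 0 < xi -> xi < zeta -> 0 < e ->
  exists N, forall j, (N <= j)%N -> grid R j.+1 `^ xi <= e * grid R j `^ zeta.
Proof.
move=> xi0 xz e0.
have dz : 0 < zeta - xi by rewrite subr_gt0.
have [N hN] : exists N : nat, (15 * xi + 1) / (zeta - xi) + e^-1 < N%:R.
  exists (Num.truncn ((15 * xi + 1) / (zeta - xi) + e^-1)).+1; exact: truncnS_gt.
have h1 : 0 <= (15 * xi + 1) / (zeta - xi) by rewrite divr_ge0 ?(ltW dz)//; lra.
have h2 : 0 < e^-1 by rewrite invr_gt0.
exists N => j Nj; set x : R := j%:R.
have xN : N%:R <= x by rewrite ler_nat.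
have x1 : 1 <= x.
  by rewrite ler1n lt0n; apply/eqP => j0; have := lt_le_trans hN xN; rewrite /x j0 ltNge addr_ge0// ltW.
rewrite !grid_powR -[j.+1%:R]natr1 -/x.
rewrite -(@lnK _ e) ?posrE// -expRD ler_expR.
have e2 : - x <= ln e.
  rewrite -[leLHS]expRK ler_ln ?posrE ?expR_gt0//; apply: le_trans (expRN_le_inv _) _; first lra.
  rewrite -[leRHS]invrK lef_pV2 ?posrE//; first lra; lra.
have e3 : 15 * xi + 1 <= (zeta - xi) * x.
  rewrite [leRHS]mulrC -ler_pdivrMr//; apply: le_trans xN; apply: ltW; apply: le_lt_trans hN; rewrite lerDl ltW//.
have e4 : xi * (x + 1) ^+ 4 <= xi * (x ^+ 4 + 15 * x ^+ 3).
  rewrite ler_pM2l//.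
  have -> : (x + 1) ^+ 4 = x ^+ 4 + 4 * x ^+ 3 + 6 * x ^+ 2 + 4 * x + 1 by ring.
  have x2 : x <= x ^+ 2 by rewrite expr2 ler_peMl//; lra.
  have x3 : x ^+ 2 <= x ^+ 3 by rewrite exprS ler_peMl// sqr_ge0.
  lra.
have e5 : x <= x ^+ 3 by rewrite -[leLHS]expr1 ler_weXn2l.
have e6 : (15 * xi + 1) * x ^+ 3 <= (zeta - xi) * x * x ^+ 3 by rewrite ler_wpM2r// exprn_ge0//; lra.
have -> : zeta * x ^+ 4 = (zeta - xi) * x * x ^+ 3 + xi * x ^+ 4 by ring.
lra.
Qed.

End almost_sure_occupation.

Section occupation_fraction.
Context (R : realType) (d : measure_display) (T : measurableType d)
  (P : probability T R) (alpha : R -> R) (B sigma : R -> {RV P >-> R}).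
Hypotheses (malpha : measurable_fun setT alpha) (alpha01 : forall x, 0 < alpha x < 1)
  (BM : standard_Brownian_motion B) (subH : conditional_subordinator alpha B sigma).
Notation mu := (@lebesgue_measure R).
Local Notation X := (subordinated_process B sigma).

Lemma occupation_fraction_bounds (G F : set R) t m om : measurable G -> measurable F ->
  ~` G `<=` F -> 0 < t -> \int[mu]_(s in `[0, t]) \1_F (X s om) <= m ->
  1 - m / t <= occupation_fraction X G t om <= 1.
Proof.
move=> mG mF GF t0 hm; have t0' := ltW t0.
pose f (S : set R) (om : T) s : R := \1_S (X s om).
have jm S : measurable S -> jointly_measurable (f S).
  move=> mS; apply: measurable_indic_comp => //; exact: measurable_subordinated BM subH.
have f01 S om' s : 0 <= f S om' s <= 1 by rewrite /f indicE; case: (_ \in _); rewrite ?lexx ?ler01.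
have fb S om' s : `|f S om' s| <= 1 by have /andP[h1 h2] := f01 S om' s; rewrite ger0_norm.
have cb (om' : T) (s : R) : `|cst (cst 1) om' s : R| <= 1 by rewrite normr1.
have jc : jointly_measurable (fun (om : T) (s : R) => 1 : R) by exact: measurable_cst.
have c1 : time_int t (fun (om : T) (s : R) => 1 : R) om = t.
  by rewrite /time_int Rintegral_cst//= lebesgue_measure_itv/= lte_fin t0 -EFinB/= subr0 mul1r.
have le1 : time_int t (f G) om <= t.
  by rewrite -[leRHS]mul1r; apply: time_int_le_cst => //; exact: jm.
have ge1 : t - m <= time_int t (f G) om.
  apply: (@le_trans _ _ (t - time_int t (f F) om)); first by rewrite lerD2l lerN2.
  have := time_intB t jc (jm F mF) (cb om) (fb F om); rewrite c1 => <-.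
  have jd : jointly_measurable (fun (om : T) s => 1 - f F om s) by apply: measurable_funB; [exact: jc|exact: jm].
  have db s : `|1 - f F om s| <= 2 by have /andP[h1 h2] := f01 F om s; rewrite ler_norml; lra.
  apply: (le_time_int t jd (jm G mG) db (fb G om)).
  move=> s; rewrite /f !indicE.
  have [sG|sG] := pselect (G (X s om)); first by rewrite (mem_set sG); case: (_ \in _); rewrite ?subrr ?subr0//= ler01.
  by rewrite (mem_set (GF _ sG)) subrr.
have -> : occupation_fraction X G t om = time_int t (f G) om / t by rewrite mulrC.
rewrite ler_pdivrMr// mul1r le1 ler_pdivlMr// mulrBl mul1r andbT.
by rewrite divfK// gt_eqF.
Qed.

(** Between sigma(y_j) and sigma(y_(j+1)), the time spent in F is at most y_(j+1)^xi, which for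
    large j is at most e y_j^zeta < e sigma(y_j) <= e t. *)
Lemma occupation_fraction_cvg1 (G F : set R) (xi zeta C C' : R) : measurable G -> closed F ->
  ~` G `<=` F -> 0 < xi -> xi < zeta -> 0 <= C -> 0 <= C' ->
  (forall j, (P [set om | (sigma (grid R j) om <= grid R j `^ zeta)%R] <= (C / j.+1%:R ^+ 2)%:E)%E) ->
  (forall j, (\int[P]_om (time_int (grid R j)
      (hit_intensity alpha (B := B) F (grid R j) (grid R j `^ xi)^-1) om)%:E <= (C' / j.+1%:R ^+ 2)%:E)%E) ->
  {ae P, forall om, occupation_fraction X G t om @[t --> +oo] --> (1 : R)}.
Proof.
move=> mG clF GF xi0 xz C0 C'0 hC hC'.
have mF : measurable F by exact: closed_measurable.
have zeta0 : 0 < zeta by exact: lt_trans xz.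
have jp (j : nat) : 0 < (j.+1%:R ^+ 2)^-1 :> R by rewrite invr_gt0 exprn_gt0.
have /choice[n hn] : forall j, exists n, (P [set om | (grid R j `^ xi < touched_time B sigma F (grid R j) n om)%R] <=
    (2 * (C' / j.+1%:R ^+ 2 + (j.+1%:R ^+ 2)^-1))%:E)%E.
  move=> j; apply: (touched_time_tail malpha alpha01 BM subH clF (grid_gt0 R j)) => //.
  by rewrite powR_gt0 ?grid_gt0.
pose E1 j := [set om | sigma (grid R j) om <= grid R j `^ zeta].
pose E2 j := [set om | grid R j `^ xi < touched_time B sigma F (grid R j) (n j) om].
have mE1 j : measurable (E1 j).
  have -> : E1 j = sigma (grid R j) @^-1` `]-oo, grid R j `^ zeta]%classic by apply/seteqP; split => om /=; rewrite in_itv.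
  by rewrite -[X in measurable X]setTI; exact: measurable_funP.
have mE2 j : measurable (E2 j).
  have -> : E2 j = touched_time B sigma F (grid R j) (n j) @^-1` `]grid R j `^ xi, +oo[%classic.
    by apply/seteqP; split => om /=; rewrite in_itv/= andbT.
  by rewrite -[X in measurable X]setTI; apply: measurable_touched_time => //; exact: grid_gt0.
have mE j : measurable (E1 j `|` E2 j) by exact: measurableU.
have null : P (lim_sup_set (fun j => E1 j `|` E2 j)) = 0%E.
  apply: lim_sup_set_cvg0 => //; apply: (@inv_square_series_fin _ (C + 2 * C' + 2)).
  - by rewrite !addr_ge0// mulr_ge0.
  - by move=> j.
  move=> j; apply: (@le_trans _ _ (P (E1 j) + P (E2 j))%E); first exact: measureU2.
  apply: le_trans (leeD (hC j) (hn j)) _; rewrite -EFinD lee_fin le_eqVlt; apply/orP; left; apply/eqP.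
  by ring.
exists (lim_sup_set (fun j => E1 j `|` E2 j)); split => //.
  by apply: bigcap_measurable => // k _; apply: bigcup_measurable => j _.
move=> om /= hno; apply: contrapT => nlim; apply: hno.
have {nlim} [N hN] : exists N, forall j, (N <= j)%N -> ~ E1 j om /\ ~ E2 j om.
  apply: contrapT => nex; apply: nlim => N _; apply: contrapT => nb; apply: nex; exists N => j Nj.
  by split => h; apply: nb; exists j => //; [left|right].
apply/cvgrPdist_le => e e0; have [N1 hN1] := grid_ratio xi0 xz e0.
have fin (q f : R) : 1 - q <= f -> f <= 1 -> q <= e -> `|1 - f| <= e by move=> h1 h2 h3; rewrite ler_norml; lra.
pose M := maxn N N1.
near=> t.
have t0 : 0 < t by near: t; exact: nbhs_pinfty_gt.
have tM : sigma (grid R M) om < t by near: t; apply: nbhs_pinfty_gt; exact: num_real.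
have g0 j : 0 <= grid R j by exact: ltW (grid_gt0 R j).
have hk : exists k, t < sigma (grid R k) om.
  (* sigma(y_k) > y_k^zeta >= 1 + zeta k^4 > t as soon as k > t / zeta and k >= 1. *)
  exists (maxn N (Num.truncn (t / zeta)).+1); set k := maxn _ _.
  have [nE1 _] := hN k (leq_maxl _ _).
  apply: (@lt_trans _ _ (grid R k `^ zeta)); last by rewrite ltNge; apply/negP.
  rewrite grid_powR; apply: lt_le_trans (expR_ge1Dx _).
  have k1 : (t / zeta) < k%:R.
    by apply: lt_le_trans (truncnS_gt _) _; rewrite ler_nat leq_maxr.
  have k2 : 1 <= k%:R :> R by rewrite ler1n leq_max orbT.
  have k3 : k%:R <= k%:R ^+ 4 :> R by rewrite -[leLHS]expr1 ler_weXn2l.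
  have k4 : t < zeta * k%:R by rewrite mulrC -ltr_pdivrMr.
  have k5 : zeta * k%:R <= zeta * k%:R ^+ 4 by rewrite ler_pM2l.
  lra.
case: (ex_minnP hk) => k tk kmin.
have Mk : (M < k)%N.
  rewrite ltnNge; apply/negP => kM; move: tk; rewrite ltNge => /negP; apply; apply: le_trans (ltW tM).
  by apply: (sigma_le subH) => //; exact: le_grid.
case: k tk kmin Mk => // j tk kmin; rewrite ltnS => Mj.
have jt : sigma (grid R j) om <= t by rewrite leNgt; apply/negP => /kmin; rewrite ltnn.
have [nE1 _] := hN j (leq_trans (leq_maxl _ _) Mj).
have [_ nE2] := hN j.+1 (leqW (leq_trans (leq_maxl _ _) Mj)).
have me0 := hN1 j (leq_trans (leq_maxr _ _) Mj).
have me : grid R j.+1 `^ xi / t <= e.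
  clear - me0 nE1 jt t0 e0; rewrite ler_pdivrMr//; apply: le_trans me0 _.
  rewrite ler_pM2l//; apply: le_trans jt; rewrite leNgt; apply/negP => h; apply: nE1; exact: ltW.
have occ : \int[mu]_(s in `[0, t]) \1_F (X s om) <= grid R j.+1 `^ xi.
  apply: le_trans (occupation_le_touched BM subH clF (grid_gt0 R j.+1) (n j.+1) (ltW t0) (ltW tk)) _.
  by rewrite leNgt; apply/negP.
have /andP[b1 b2] := occupation_fraction_bounds mG mF GF t0 occ.
exact: (fin _ _ b1 b2 me).
Unshelve. all: by end_near.
Qed.

End occupation_fraction.

Section mean_exposure.
Context (R : realType) (d : measure_display) (T : measurableType d)
  (P : probability T R) (alpha : R -> R) (B : R -> {RV P >-> R}).
Hypotheses (malpha : measurable_fun setT alpha) (alpha01 : forall x, 0 < alpha x < 1)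
  (BM : standard_Brownian_motion B).
Notation mu := (@lebesgue_measure R).

(** As l <= 1, a lower bound p of alpha bounds l^alpha by l^p. Two exponents are kept because in the
    first regime the bounded and the far part of F need different ones; the null part is the
    boundary of A. *)
Lemma mean_hit_le (F N D0 D1 : set R) p0 p1 l y : closed F -> measurable N ->
  measurable D0 -> measurable D1 -> F `<=` N `|` (D0 `|` D1) -> mu N = 0%E ->
  (forall x, D0 x -> p0 <= alpha x) -> (forall x, D1 x -> p1 <= alpha x) -> 0 < l <= 1 ->
  (\int[P]_om (time_int y (hit_intensity alpha (B := B) F y l) om)%:E <=
   (l `^ p0)%:E * \int[P]_om (occupation B D0 y om)%:E +
   (l `^ p1)%:E * \int[P]_om (occupation B D1 y om)%:E)%E.
Proof.
move=> clF mN mD0 mD1 FD N0 hp0 hp1 /andP[l0 l1].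
have l0' := ltW l0.
pose occ (S : set R) (om : T) v : R := \1_S (path_at B om v).
have jo S : measurable S -> jointly_measurable (occ S).
  move=> mS; apply: measurable_indic_comp => //; exact: jointly_measurable_path_at.
have o0 S om v : 0 <= occ S om v by [].
have o1 S om v : occ S om v <= 1 by rewrite /occ indicE; case: (_ \in _).
have ob S om v : `|occ S om v| <= 1 by rewrite ger0_norm.
have pt om : time_int y (hit_intensity alpha (B := B) F y l) om <=
    occupation B N y om + (l `^ p0 * occupation B D0 y om + l `^ p1 * occupation B D1 y om).
  have iq S (q : R) : measurable S -> 0 <= q -> mu.-integrable `[0, y] (EFin \o (fun v => q * occ S om v)).
    move=> mS q0; have mq : jointly_measurable (fun om v => q * occ S om v) by apply: measurable_funM => //; exact: jo.
    have bq v : `|q * occ S om v| <= q by rewrite ger0_norm ?mulr_ge0// ler_piMr.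
    exact: (integrable_time y mq bq).
  have ZE S (q : R) : measurable S -> q * occupation B S y om = \int[mu]_(v in `[0, y]) (q * occ S om v).
    by move=> mS; rewrite -(time_intZ y q (jo S mS) (ob S om)).
  rewrite -[occupation B N y om]mul1r !ZE// -RintegralD//; last 2 first.
  - by apply: iq => //; exact: powR_ge0.
  - by apply: iq => //; exact: powR_ge0.
  have iD : mu.-integrable `[0, y] (EFin \o (fun v => l `^ p0 * occ D0 om v + l `^ p1 * occ D1 om v)).
    have -> : (EFin \o (fun v => l `^ p0 * occ D0 om v + l `^ p1 * occ D1 om v)) =
       (EFin \o (fun v => l `^ p0 * occ D0 om v)) \+ (EFin \o (fun v => l `^ p1 * occ D1 om v)) by [].
    by apply: integrableD => //; apply: iq => //; exact: powR_ge0.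
  rewrite -RintegralD//; last exact: iq.
  apply: le_Rintegral => //.
  - have jh : jointly_measurable (hit_intensity alpha (B := B) F y l).
      exact: (jointly_measurable_hit_intensity malpha BM y clF).
    have bh v : `|hit_intensity alpha (B := B) F y l om v| <= l + 1.
      by have /andP[h1 h2] := hit_intensity_bound B alpha01 F y om v l0'; rewrite ger0_norm.
    exact: (integrable_time y jh bh).
  - have -> : (EFin \o (fun v => 1 * occ N om v + (l `^ p0 * occ D0 om v + l `^ p1 * occ D1 om v))) =
       (EFin \o (fun v => 1 * occ N om v)) \+ (EFin \o (fun v => l `^ p0 * occ D0 om v + l `^ p1 * occ D1 om v)) by [].
    by apply: integrableD => //; exact: iq.
  move=> v _; rewrite mul1r /hit_intensity indicE.
  have r0 : 0 <= occ N om v + (l `^ p0 * occ D0 om v + l `^ p1 * occ D1 om v).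
    by rewrite !addr_ge0// mulr_ge0// powR_ge0.
  case: (_ \in _); rewrite ?mul0r// mul1r indicE; case: (boolP (_ \in F)) => [|_]; last by rewrite mul0r.
  rewrite inE mul1r => /FD Fv.
  have pa x p : p <= alpha x -> l `^ alpha x <= l `^ p.
    by move=> px; apply: ger_powR => //; rewrite l0.
  rewrite /intensity /occ; set x := path_at B om v in Fv *.
  case: Fv => [xN|[xD|xD]].
  - rewrite (_ : \1_N x = 1); last by rewrite indicE mem_set.
    rewrite -[leLHS]addr0 lerD//; last by rewrite addr_ge0// mulr_ge0// powR_ge0.
    by rewrite -(powRr0 l); apply: ger_powR; rewrite ?l0//; have /andP[/ltW] := alpha01 x.
  - rewrite (_ : \1_D0 x = 1); last by rewrite indicE mem_set.
    rewrite mulr1; apply: le_trans (pa _ _ (hp0 _ xD)) _.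
    by rewrite addrCA lerDl addr_ge0// mulr_ge0// powR_ge0.
  - rewrite (_ : \1_D1 x = 1); last by rewrite indicE mem_set.
    rewrite mulr1; apply: le_trans (pa _ _ (hp1 _ xD)) _.
    by rewrite addrA lerDr addr_ge0// mulr_ge0// powR_ge0.
have mo S : measurable S -> measurable_fun setT (fun om => (occupation B S y om)%:E).
  by move=> mS; apply/measurable_EFinP; exact: measurable_occupation.
have oc0 S om : 0 <= occupation B S y om by exact: time_int_ge0.
apply: (@le_trans _ _ (\int[P]_om ((occupation B N y om)%:E + ((l `^ p0)%:E * (occupation B D0 y om)%:E + (l `^ p1)%:E * (occupation B D1 y om)%:E)))%E).
  apply: ge0_le_integral => //.
  - by move=> om _; rewrite lee_fin; apply: time_int_ge0 => v; rewrite !mulr_ge0// powR_ge0.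
  - apply/measurable_EFinP.
    have jh : jointly_measurable (hit_intensity alpha (B := B) F y l).
      exact: (jointly_measurable_hit_intensity malpha BM y clF).
    have mt : measurable_fun setT (time_int y (hit_intensity alpha (B := B) F y l)).
      by apply: measurable_time_int => // om v; rewrite !mulr_ge0// powR_ge0.
    exact: (measurableT_comp mt (measurable_to_path (B := B))).
  - by apply: emeasurable_funD; [exact: mo|apply: emeasurable_funD; apply: emeasurable_funM => //; exact: mo].
  - by move=> om _; rewrite lee_fin.
have mZ (q : R) S : measurable S -> measurable_fun setT (fun om => q%:E * (occupation B S y om)%:E)%E.
  by move=> mS; apply: emeasurable_funM => //; exact: mo.
rewrite ge0_integralD//; last 4 first.
- by move=> om _; rewrite lee_fin.
- exact: mo.
- by move=> om _; rewrite lee_fin addr_ge0// mulr_ge0// powR_ge0.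
- by apply: emeasurable_funD; exact: mZ.
rewrite (mean_occupation_null BM y mN N0) add0e ge0_integralD//; last 4 first.
- by move=> om _; rewrite lee_fin mulr_ge0// powR_ge0.
- exact: mZ.
- by move=> om _; rewrite lee_fin mulr_ge0// powR_ge0.
- exact: mZ.
have Zl S (q : R) : measurable S -> 0 <= q ->
    (\int[P]_om (q%:E * (occupation B S y om)%:E) = q%:E * \int[P]_om (occupation B S y om)%:E)%E.
  move=> mS q0; apply: ge0_integralZl => //; first exact: mo.
  by move=> om _; rewrite lee_fin.
by rewrite !Zl// powR_ge0.
Qed.

End mean_exposure.

(** * Position at a fixed time *)

Section straddling.
Context (R : realType) (d : measure_display) (T : measurableType d) (P : probability T R).
Variables (Z D : T -> R) (H : set T) (C : R).
Hypotheses (mZ : measurable_fun setT Z) (mD : measurable_fun setT D) (mH : measurable H).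
Hypotheses (C0 : 0 <= C) (D0 : forall om, 0 <= D om).
Hypothesis HZ : forall (delta : R) (S : set R), 0 < delta <= 2^-1 -> measurable S ->
  (P (H `&` (Z @^-1` `[(1 - delta)%R, 1%R] `&` D @^-1` S)) <= (C * delta)%:E * P (H `&` D @^-1` S))%E.

Let I (S : set R) : \bar R := (\int[P]_(om in H) (D om * \1_S (D om))%:E)%E.

Let mDS (S : set R) : measurable S -> measurable (D @^-1` S).
Proof. by move=> mS; rewrite -[X in measurable X]setTI; exact: mD. Qed.

Let mI (S : set R) : measurable S -> measurable_fun H (fun om => (D om * \1_S (D om))%:E).
Proof.
move=> mS; apply: measurable_funTS; apply/measurable_EFinP; apply: measurable_funM => //.
exact: measurable_indic_comp.
Qed.

Let indic_preimage (S : set R) om : \1_(D @^-1` S) om = \1_S (D om) :> R.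
Proof. by rewrite !indicE; congr (_%:R); apply/idP/idP; rewrite !inE. Qed.

Let straddle := [set om | Z om <= 1 < Z om + D om].

Let mstraddle : measurable straddle.
Proof.
have -> : straddle = Z @^-1` `]-oo, 1] `&` (fun om => Z om + D om) @^-1` `]1, +oo[.
  apply/seteqP; split => om; rewrite /straddle /= !in_itv/= ?andbT; first by move=> /andP[].
  by move=> [-> ->].
apply: measurableI; rewrite -[X in measurable X]setTI; first exact: mZ.
by apply: measurable_funD.
Qed.

(* Halving [delta] peels off the part [delta / 2 <= D < delta], where [HZ] costs
   at most [C * delta <= 2 * C * D]. *)
Lemma straddle_small m (delta : R) : 0 < delta <= 2^-1 ->
  (P (H `&` (straddle `&` D @^-1` `]-oo, delta[)) <=
   (2 * C)%:E * I `]-oo, delta[%classic + (C * delta / m.+1%:R)%:E)%E.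
Proof.
elim: m delta => [|m IH] delta /andP[d0 d1].
  apply: (@le_trans _ _ (C * delta)%:E); last first.
    rewrite divr1 leeDr//; apply: mule_ge0; first by rewrite lee_fin mulr_ge0.
    by apply: integral_ge0 => om _; rewrite lee_fin mulr_ge0.
  apply: (@le_trans _ _ (P (H `&` (Z @^-1` `[1 - delta, 1] `&` D @^-1` `]-oo, delta[%classic)))).
    apply: le_measure; rewrite ?inE.
    - by apply: measurableI => //; apply: measurableI => //; exact: mDS.
    - apply: measurableI => //; apply: measurableI; last exact: mDS.
      by rewrite -[X in measurable X]setTI; exact: mZ.
    move=> om [Hom [/andP[z1 zD]]]; rewrite /= !in_itv/= => Dd; split => //; split => //.
    by rewrite z1 andbT; move: zD Dd; lra.
  apply: le_trans (HZ _ _) _ => //; first by rewrite d0.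
  rewrite -[leRHS]mule1; apply: lee_wpmul2l; first by rewrite lee_fin mulr_ge0// ltW.
  by apply: probability_le1; apply: measurableI => //; exact: mDS.
have h1 : 0 < delta / 2 <= 2^-1 by apply/andP; split; lra.
have mS2 : measurable (`[delta / 2, delta[%classic : set R) by [].
have split_I : (I `]-oo, delta[%classic = I `]-oo, (delta / 2)%R[%classic + I `[(delta / 2)%R, delta[%classic)%E.
  rewrite /I -ge0_integralD//; last 4 first.
  - by move=> om _; rewrite lee_fin mulr_ge0.
  - exact: mI.
  - by move=> om _; rewrite lee_fin mulr_ge0.
  - exact: mI.
  apply: eq_integral => om _; rewrite -EFinD -mulrDr; congr (_ * _)%:E.
  have hlt : delta / 2 < delta by lra.
  rewrite !indicE !mem_setE !in_itv/=; case: (ltP (D om) (delta / 2)) => h.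
    by rewrite (lt_trans h hlt) addr0.
  by rewrite add0r.
have cover : H `&` (straddle `&` D @^-1` `]-oo, delta[) `<=`
    H `&` (straddle `&` D @^-1` `]-oo, (delta / 2)[) `|`
    H `&` (Z @^-1` `[1 - delta, 1] `&` D @^-1` `[delta / 2, delta[).
  move=> om [Hom [st]]; rewrite /= in_itv/= => Dd.
  case: (ltP (D om) (delta / 2)) => h; [left|right]; split => //; split => //=.
    by move: st => /andP[z1 zD]; rewrite in_itv/= z1 andbT; move: zD Dd; lra.
  by rewrite in_itv/= h.
have m1 : measurable (H `&` (straddle `&` D @^-1` `]-oo, (delta / 2)[)).
  by apply: measurableI => //; apply: measurableI => //; exact: mDS.
have m2 : measurable (H `&` (Z @^-1` `[1 - delta, 1] `&` D @^-1` `[delta / 2, delta[)).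
  apply: measurableI => //; apply: measurableI; last exact: mDS.
  by rewrite -[X in measurable X]setTI; exact: mZ.
have m0 : measurable (H `&` (straddle `&` D @^-1` `]-oo, delta[)).
  by apply: measurableI => //; apply: measurableI => //; exact: mDS.
apply: (@le_trans _ _ (P (H `&` (straddle `&` D @^-1` `]-oo, (delta / 2)%R[)) +
    P (H `&` (Z @^-1` `[(1 - delta)%R, 1%R] `&` D @^-1` `[(delta / 2)%R, delta[)))%E).
  apply: (@le_trans _ _ (P (H `&` (straddle `&` D @^-1` `]-oo, (delta / 2)%R[) `|`
    H `&` (Z @^-1` `[(1 - delta)%R, 1%R] `&` D @^-1` `[(delta / 2)%R, delta[)))); last exact: measureU2.
  by apply: le_measure => //; rewrite ?inE//; exact: measurableU.
have second : ((C * delta)%:E * P (H `&` D @^-1` `[(delta / 2)%R, delta[%classic) <=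
    (2 * C)%:E * I `[(delta / 2)%R, delta[%classic)%E.
  have -> : (2 * C)%:E = (C%:E * 2%:E :> \bar R)%E by rewrite mulrC EFinM.
  rewrite EFinM -!muleA; apply: lee_wpmul2l => //.
  rewrite setIC -integral_indic//; last exact: mDS.
  rewrite -ge0_integralZl//; last 2 first.
  - by apply: measurable_funTS; apply/measurable_EFinP; apply: measurable_indic; exact: mDS.
  - by rewrite lee_fin ltW.
  rewrite -ge0_integralZl//; last 2 first.
  - exact: mI.
  - by move=> om _; rewrite lee_fin mulr_ge0.
  apply: ge0_le_integral => //.
  - by move=> om _; rewrite mule_ge0// lee_fin ltW.
  - apply: emeasurable_funM => //; apply: measurable_funTS; apply/measurable_EFinP; apply: measurable_indic; exact: mDS.
  - by apply: emeasurable_funM => //; exact: mI.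
  move=> om _; rewrite -!EFinM lee_fin indic_preimage.
  rewrite indicE mem_setE in_itv/=; case: andP => [[h _]|_]; last by rewrite !mulr0.
  by rewrite !mulr1; move: h; lra.
apply: le_trans (leeD (IH _ h1) (le_trans (HZ (delta := delta) _ mS2) second)) _; first by rewrite d0.
have I0 S : (0 <= I S)%E by apply: integral_ge0 => om _; rewrite lee_fin mulr_ge0.
rewrite split_I; have -> := @ge0_muleDr _ (2 * C)%:E _ _ (I0 `]-oo, (delta / 2)[%classic) (I0 `[delta / 2, delta[%classic).
rewrite addeAC; apply: leeD => //; rewrite lee_fin.
rewrite -!mulrA ler_wpM2l// ler_wpM2l ?(ltW d0)// (_ : 2^-1 / m.+1%:R = (2 * m.+1%:R)^-1); last by rewrite invfM.
rewrite lef_pV2 ?posrE ?mulr_gt0//.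
by rewrite mulr_natl -[m.+2%:R]natr1 mulr2n lerD2l ler1n.
Qed.

(** For D < 1/2 the remainder of [straddle_small] tends to 0 with m, and D <= 2 (1 - exp(-D)); for D
    >= 1/2 the probability is at most 3 times the mean of 1 - exp(-D). This brings the bound into
    the form in which the increments of [sigma] are controlled. *)
Lemma straddle_le :
  (P (H `&` straddle) <= (4 * C + 3)%:E * \int[P]_(om in H) (1 - expR (- D om))%:E)%E.
Proof.
have h2 : (0 : R) < 2^-1 <= (2^-1 : R) by rewrite lexx invr_gt0 ltr0n.
have mex : measurable_fun H (fun om => (1 - expR (- D om))%:E).
  apply: measurable_funTS; apply/measurable_EFinP; apply: measurable_funB => //.
  by apply: measurableT_comp => //; exact: measurableT_comp.
have ex0 om : 0 <= 1 - expR (- D om) by rewrite subr_ge0 expR_le1 oppr_le0.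
have mlt : measurable (H `&` (straddle `&` D @^-1` `]-oo, 2^-1[)).
  by apply: measurableI => //; apply: measurableI => //; exact: mDS.
have mge : measurable (H `&` D @^-1` `[2^-1, +oo[) by apply: measurableI => //; exact: mDS.
have small : (P (H `&` (straddle `&` D @^-1` `]-oo, (2^-1)%R[)) <= (2 * C)%:E * I `]-oo, (2^-1)%R[%classic)%E.
  apply/lee_addgt0Pr => e e0.
  have [m hm] : exists m : nat, C / e < m%:R by exists (Num.truncn (C / e)).+1; exact: truncnS_gt.
  apply: le_trans (straddle_small m h2) _; apply: leeD => //; rewrite lee_fin ler_pdivrMr//.
  have : C < e * m.+1%:R.
    rewrite mulrC -ltr_pdivrMr//; apply: lt_trans hm _; rewrite ltr_nat//.
  by move: C0; lra.
have small' : ((2 * C)%:E * I `]-oo, (2^-1)%R[%classic <= (4 * C)%:E * \int[P]_(om in H) (1 - expR (- D om))%:E)%E.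
  have -> : (4 * C)%:E = ((2 * C)%:E * 2%:E :> \bar R)%E by rewrite -EFinM; congr (_%:E); ring.
  rewrite -muleA; apply: lee_wpmul2l; first by rewrite lee_fin mulr_ge0.
  rewrite -ge0_integralZl//; last by move=> om _; rewrite lee_fin.
  apply: ge0_le_integral => //.
  - by move=> om _; rewrite lee_fin mulr_ge0.
  - exact: mI.
  - exact: emeasurable_funM.
  move=> om _; rewrite -EFinM lee_fin indicE mem_setE in_itv/=.
  case: ltP => h; last by rewrite mulr0 mulr_ge0.
  rewrite mulr1; have := expR_ge1Dx (D om); have := expR_gt0 (D om); rewrite expRN.
  move=> p0 p1; set q := expR (D om) in p0 p1 *; have := D0 om; set x := D om in h p1 *.
  move=> x0; have : q^-1 <= (1 + x)^-1 by rewrite lef_pV2 ?posrE//; lra.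
  have : (1 + x)^-1 <= 1 - x / 2.
    by rewrite -[leLHS]mul1r ler_pdivrMr; [nra|lra].
  by move=> h3 h4; lra.
have large : (P (H `&` D @^-1` `[(2^-1)%R, +oo[) <= 3%:E * \int[P]_(om in H) (1 - expR (- D om))%:E)%E.
  rewrite setIC -integral_indic//; last exact: mDS.
  rewrite -ge0_integralZl//; last by move=> om _; rewrite lee_fin.
  apply: ge0_le_integral => //.
  - apply: measurable_funTS; apply/measurable_EFinP; apply: measurable_indic; exact: mDS.
  - exact: emeasurable_funM.
  move=> om _; rewrite -EFinM lee_fin indic_preimage.
  rewrite indicE mem_setE in_itv/= andbT; case: (leP 2^-1 (D om)) => h; last by rewrite mulr_ge0.
  have h3 : expR (- D om) <= 2 / 3.
    rewrite expRN -[2 / 3]invrK lef_pV2 ?posrE ?expR_gt0 ?invr_gt0 ?divr_gt0//.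
    by rewrite invf_div; apply: le_trans (expR_ge1Dx _); lra.
  by rewrite /=; lra.
have I0 : (0 <= \int[P]_(om in H) (1 - expR (- D om))%:E)%E by apply: integral_ge0 => om _; rewrite lee_fin.
rewrite EFinD ge0_muleDl ?lee_fin ?mulr_ge0//.
apply: le_trans (leeD (le_trans small small') large).
apply: (@le_trans _ _ (P (H `&` (straddle `&` D @^-1` `]-oo, 2^-1[) `|` H `&` D @^-1` `[2^-1, +oo[))); last exact: measureU2.
apply: le_measure; rewrite ?inE; [exact: measurableI|exact: measurableU|].
move=> om [Hom st]; case: (ltP (D om) 2^-1) => h; [left|right]; split => //; last by rewrite /= in_itv/= h.
Qed.

End straddling.

(** * Probability of being in a closed set at a fixed time *)

Section fixed_time.
Context (R : realType) (d : measure_display) (T : measurableType d)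
  (P : probability T R) (alpha : R -> R) (B sigma : R -> {RV P >-> R}) (amax : R).
Hypotheses (malpha : measurable_fun setT alpha) (alpha01 : forall x, 0 < alpha x < 1)
  (alpha_le : forall x, alpha x <= amax) (amax1 : amax < 1)
  (BM : standard_Brownian_motion B) (subH : conditional_subordinator alpha B sigma).
Notation mu := (@lebesgue_measure R).
Local Notation pathT := (path_space B).
Local Notation X := (subordinated_process B sigma).
Local Notation Phi l w := (path_exponent alpha B l w).
Implicit Types (t w : R) (om : T).

Lemma sigma_density_bound (M : R) : 0 <= M -> exists2 C : R, 0 <= C &
  forall t w (E : set pathT) (delta : R), 1 <= t -> 0 <= w -> measurable E ->
    (forall om, E om -> Phi t^-1 w om <= M) -> 0 < delta <= 2^-1 ->
    (P (E `&` (fun om => sigma w om / t)%R @^-1` `[(1 - delta)%R, 1%R]) <= (C * delta)%:E * P E)%E.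
Proof.
move=> M0; have a01 : 0 < amax < 1.
  by rewrite amax1 andbT; have /andP[h _] := alpha01 0; exact: lt_le_trans (alpha_le 0).
have [C C0 HC] := conditional_density_bound M0 a01; exists C => // t w E delta t1 w0 mE EM /andP[d0 d1].
have t0 : 0 < t by exact: lt_le_trans t1.
have ti0 : 0 <= t^-1 by rewrite invr_ge0 ltW.
pose ps (om : pathT) v := alpha (path_at B om v).
pose th (om : pathT) v := t^-1 `^ alpha (path_at B om v).
have mps : jointly_measurable ps.
  apply: (measurableT_comp malpha); exact: jointly_measurable_path_space.
have mth : jointly_measurable th by exact: (jointly_measurable_intensity malpha BM).
have expE l om : 0 <= l -> exponent w ps th l om = Phi (l / t) w om.
  move=> l0; rewrite path_exponentE /exponent /time_int; apply: eq_Rintegral => v _.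
  by rewrite /th /ps /intensity mulrC powRM.
have th1 (om : pathT) v : th om v <= 1.
  rewrite /th; have -> : 1 = 1 `^ alpha (path_at B om v) :> R by rewrite powR1.
  have /andP[h _] := alpha01 (path_at B om v).
  by rewrite ge0_ler_powR ?nnegrE ?ler01 ?(ltW h)// invf_le1.
have -> : `[(1 - delta)%R, 1%R]%classic = `[(1 - delta)%R, (1 - delta + delta)%R]%classic by rewrite subrK.
have [u0 u1] : 2^-1 <= 1 - delta /\ 1 - delta <= 1 by split; lra.
apply: (HC d _ T pathT P (to_path B) w ps th (fun om => sigma w om / t)) => //.
- exact: measurable_to_path.
- by move=> om v; have /andP[] := alpha01 (path_at B om v).
- by move=> om v; exact: alpha_le.
- by move=> om v; exact: powR_ge0.
- by apply: measurable_funM => //; exact: measurable_funP.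
- by move=> om; rewrite divr_ge0 ?(ltW t0)//; exact: (sigma_ge0 subH).
- move=> l E' l0 mE'; have lt0 : 0 <= l / t by rewrite divr_ge0// ltW.
  have := (sub_laplace subH lt0 w0 (leey _)).2 E' mE'.
  move=> h; transitivity (\int[P]_(om in E') (expR (- (l / t * sigma w om)))%:E)%E.
    by apply: eq_integral => om _; rewrite mulrA mulrAC.
  rewrite h; apply: eq_integral => om _; by rewrite expE.
- by move=> om Eom; rewrite expE ?ler01// mul1r; exact: EM.
- by rewrite u0.
- by rewrite d0; lra.
Qed.

(** By [le_product_prob] the density bound for sigma s / t near 1 survives intersection with events
    of the increment over the cell, which is the hypothesis of [straddle_le]. *)
Lemma straddle_cell_le (M : R) : 0 <= M -> exists2 C : R, 0 <= C &
  forall t s s' (H : set pathT), 1 <= t -> 0 <= s -> s <= s' -> measurable H ->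
    (forall om, H om -> Phi t^-1 s om <= M) ->
    (P (H `&` [set om | (sigma s om <= t < sigma s' om)%R]) <=
     C%:E * \int[P]_(om in H) (1 - expR (- (t^-1 * (sigma s' om - sigma s om))))%:E)%E.
Proof.
move=> M0; have [C C0 HC] := sigma_density_bound M0; exists (4 * C + 3).
  by rewrite addr_ge0// mulr_ge0.
move=> t s s' H t1 s0 ss' mH HM; have t0 : 0 < t by exact: lt_le_trans t1.
have mHT : measurable (H : set T) by exact: past_measurable mH.
pose Z om := sigma s om / t; pose D om := t^-1 * (sigma s' om - sigma s om).
have -> : [set om | sigma s om <= t < sigma s' om] = [set om | Z om <= 1 < Z om + D om].
  apply/funext => om /=; rewrite /Z /D mulrC -mulrDr addrC subrK.
  by rewrite mulrC ler_pdivrMr// mul1r [t^-1 * _]mulrC ltr_pdivlMr// mul1r.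
have mDf : measurable_fun setT (fun x : R => t^-1 * x) by exact: measurable_funM.
have mZf : measurable_fun setT (fun x : R => x / t) by exact: measurable_funM.
apply: straddle_le => //.
- by apply: measurable_funM => //; exact: measurable_funP.
- by apply: measurable_funM => //; apply: measurable_funB; exact: measurable_funP.
- by move=> om; rewrite mulr_ge0 ?invr_ge0 ?(ltW t0)// subr_ge0; exact: (sigma_le subH).
move=> delta S d01 mS.
apply: (@le_product_prob _ _ _ _ _ _ _ subH s s' (C * delta) H ((fun x : R => x / t) @^-1` `[(1 - delta)%R, 1%R])
  ((fun x : R => t^-1 * x) @^-1` S)) => //.
- by rewrite -[X in measurable X]setTI; exact: mZf.
- by rewrite -[X in measurable X]setTI; exact: mDf.
- by have /andP[d0 _] := d01; rewrite mulr_ge0// ltW.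
- by move=> E mE EH; apply: HC => // om /EH; exact: HM.
Qed.

Lemma large_exponent_prob t (M u : R) (E : set pathT) : 0 < t -> 0 <= u -> measurable E ->
  (forall om, E om -> M <= Phi t^-1 u om) ->
  (P (E `&` [set om | (sigma u om <= t)%R]) <= (expR (1 - M))%:E * P E)%E.
Proof.
move=> t0 u0 mE EM; have ti0 : 0 <= t^-1 by rewrite invr_ge0 ltW.
have mET : measurable (E : set T) by exact: past_measurable mE.
have mS : measurable [set om | (sigma u om <= t)%R].
  have -> : [set om | (sigma u om <= t)%R] = sigma u @^-1` `]-oo, t].
    by apply/seteqP; split => om /=; rewrite in_itv.
  by rewrite -[X in measurable X]setTI; exact: measurable_funP.
have mex : measurable_fun setT (fun om => expR (- (t^-1 * sigma u om))).
  by apply: measurableT_comp => //; apply: measurableT_comp => //; apply: measurable_funM.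
apply: (@le_trans _ _ ((expR 1)%:E * \int[P]_(om in E) (expR (- (t^-1 * sigma u om)))%:E)%E).
  rewrite setIC -integral_indic// -ge0_integralZl//; last first.
    by apply: measurable_funTS; exact/measurable_EFinP.
  apply: ge0_le_integral => //.
  - by apply: measurable_funTS; apply/measurable_EFinP; exact: measurable_indic.
  - by apply: measurable_funTS; apply: emeasurable_funM => //; exact/measurable_EFinP.
  move=> om _; rewrite -EFinM lee_fin indicE -expRD.
  case: (boolP (om \in _)) => [|_]; last exact: expR_ge0.
  rewrite inE/= => sz; rewrite -[leLHS]expR0 ler_expR subr_ge0.
  by rewrite mulrC ler_pdivrMr// mul1r.
rewrite ((sub_laplace subH ti0 u0 (leey _)).2 E mE).
rewrite expRD EFinM -muleA; apply: lee_wpmul2l; first by rewrite lee_fin expR_ge0.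
rewrite -integral_cst//; apply: ge0_le_integral => //.
- apply: measurable_funTS; apply/measurable_EFinP; apply: measurableT_comp => //; apply: measurableT_comp => //.
  exact: (measurableT_comp (measurable_path_exponent subH ti0 u0) (measurable_to_path (B := B))).
- by move=> om Eom; rewrite lee_fin ler_expR lerN2; exact: EM.
Qed.

Lemma early_exit_prob t (M : R) (u : nat -> R) k : 0 < t -> (forall i, 0 <= u i) ->
  (forall i, u i <= u i.+1) ->
  (P [set om | exists2 i, (i <= k)%N & (M < Phi t^-1 (u i) om)%R /\ (sigma (u i) om <= t)%R] <=
   (expR (1 - M))%:E * P [set om | (M < Phi t^-1 (u k) om)%R])%E.
Proof.
move=> t0 u0 ule; have ti0 : 0 <= t^-1 by rewrite invr_ge0 ltW.
pose E i : set pathT := [set om | M < Phi t^-1 (u i) om].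
have mE i : measurable (E i).
  have -> : E i = (Phi t^-1 (u i) : pathT -> R) @^-1` `]M, +oo[%classic.
    by apply/seteqP; split => om; rewrite /E/= in_itv/= andbT.
  by rewrite -[X in measurable X]setTI; exact: (measurable_path_exponent subH ti0 (u0 i)).
have mET i : measurable (E i : set T) by exact: past_measurable (mE i).
have mS i : measurable [set om | (sigma (u i) om <= t)%R].
  have -> : [set om | (sigma (u i) om <= t)%R] = sigma (u i) @^-1` `]-oo, t].
    by apply/seteqP; split => om /=; rewrite in_itv.
  by rewrite -[X in measurable X]setTI; exact: measurable_funP.
pose U k : set T := [set om | exists2 i, (i <= k)%N & M < Phi t^-1 (u i) om /\ (sigma (u i) om <= t)%R].
have mU j : measurable (U j).
  have -> : U j = \bigcup_(i in [set i | (i <= j)%N]) ((E i : set T) `&` [set om | (sigma (u i) om <= t)%R]).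
    by apply/seteqP; split => om [i ij h]; exists i.
  by apply: bigcup_measurable => i _; exact: measurableI.
rewrite -/(U k) -[X in (_ * P X)%E]/(E k : set T).
elim: k => [|k IH].
  apply: (@le_trans _ _ (P ((E 0%N : set T) `&` [set om | (sigma (u 0%N) om <= t)%R]))).
    apply: le_measure; rewrite ?inE//; first exact: measurableI.
    by move=> om [i]; rewrite leqn0 => /eqP->.
  by apply: large_exponent_prob => // om /ltW.
have EE om : E k om -> E k.+1 om.
  by move=> h; apply: lt_le_trans h _; apply: path_exponent_le.
pose G : set pathT := E k.+1 `\` E k.
have mG : measurable G by exact: measurableD.
have mGT : measurable (G : set T) by exact: past_measurable mG.
apply: (@le_trans _ _ (P (U k `|` (G : set T) `&` [set om | (sigma (u k.+1) om <= t)%R]))).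
  apply: le_measure; rewrite ?inE//; first by apply: measurableU => //; exact: measurableI.
  move=> om [i]; rewrite leq_eqVlt => /predU1P[->|ik] [h1 h2]; last by left; exists i.
  have [Ek|nEk] := pselect (E k om); last by right.
  left; exists k => //; split => //; apply: le_trans h2; exact: (sigma_le subH).
apply: (@le_trans _ _ (P (U k) + P ((G : set T) `&` [set om | (sigma (u k.+1) om <= t)%R]))%E).
  by apply: measureU2 => //; exact: measurableI.
have hG : (P ((G : set T) `&` [set om | (sigma (u k.+1) om <= t)%R]) <= (expR (1 - M))%:E * P G)%E.
  by apply: large_exponent_prob => // om [/ltW].
apply: le_trans (leeD IH hG) _.
rewrite -ge0_muleDr//; apply: lee_wpmul2l; first by rewrite lee_fin expR_ge0.
rewrite le_eqVlt; apply/orP; left; apply/eqP.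
rewrite -measureU//; last by apply/seteqP; split => // om [h1 [_]].
congr (P _); apply/seteqP; split => om; first by case => [/EE|[]].
by move=> h; have [Ek|nEk] := pselect (E k om); [left|right].
Qed.

Lemma hit_prob_le (M : R) : 0 <= M -> exists2 C : R, 0 <= C &
  forall (F : set R) (t W b e : R), closed F -> 1 <= t -> 0 < W -> 0 < e ->
    (\int[P]_om (time_int W (hit_intensity alpha (B := B) F W t^-1) om)%:E <= b%:E)%E ->
    (P [set om | F (X t om)] <=
     P [set om | (sigma W om <= t)%R] + (expR (1 - M) + C * (b + e))%:E)%E.
Proof.
move=> M0; have [C C0 HC] := straddle_cell_le M0; exists C => // F t W b e clF t1 W0 e0 hb.
have t0 : 0 < t by exact: lt_le_trans t1.
have ti0 : 0 <= t^-1 by rewrite invr_ge0 ltW.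
have [n hn] : exists n, (\int[P]_om (time_int W (touched_intensity alpha (B := B) F W t^-1 n) om)%:E < (b + e)%:E)%E.
  by apply: (mean_touched_intensity_lt malpha alpha01 BM clF W0 ti0); apply: le_lt_trans hb _; rewrite lte_fin ltrDl.
pose c := cell W n.
have c0 i : 0 <= c i by exact: cell_ge0.
have cS i : c i <= c i.+1 by exact: cell_le.
pose E i : set pathT := [set om | M < Phi t^-1 (c i) om].
have mE i : measurable (E i).
  have -> : E i = (Phi t^-1 (c i) : pathT -> R) @^-1` `]M, +oo[%classic.
    by apply/seteqP; split => om; rewrite /E/= in_itv/= andbT.
  by rewrite -[X in measurable X]setTI; exact: (measurable_path_exponent subH ti0 (c0 i)).
pose tch i : set pathT := @touch R d T P B F W n i.
have mtch i : measurable (tch i) by exact: measurable_touch.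
pose H i : set pathT := tch i `\` E i.
have mH i : measurable (H i) by exact: measurableD.
have mHT i : measurable (H i : set T) by exact: past_measurable (mH i).
have mtT i : measurable (tch i : set T) by exact: past_measurable (mtch i).
have mET i : measurable (E i : set T) by exact: past_measurable (mE i).
have mS w : measurable [set om | (sigma w om <= t)%R].
  have -> : [set om | (sigma w om <= t)%R] = sigma w @^-1` `]-oo, t].
    by apply/seteqP; split => om /=; rewrite in_itv.
  by rewrite -[X in measurable X]setTI; exact: measurable_funP.
pose V i : set T := [set om | sigma (c i) om <= t < sigma (c i.+1) om].
have mV i : measurable (V i).
  have -> : V i = [set om | (sigma (c i) om <= t)%R] `\` [set om | (sigma (c i.+1) om <= t)%R].
    apply/seteqP; split => om; rewrite /V/=; first by move=> /andP[h1 h2]; split => //; apply/negP; rewrite -ltNge.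
    by move=> [h1 /negP]; rewrite -ltNge h1.
  exact: measurableD.
pose U : set T := [set om | exists2 i, (i <= n.+1)%N & M < Phi t^-1 (c i) om /\ (sigma (c i) om <= t)%R].
have mU : measurable U.
  have -> : U = \bigcup_(i in [set i | (i <= n.+1)%N]) ((E i : set T) `&` [set om | (sigma (c i) om <= t)%R]).
    by apply/seteqP; split => om [i ij h]; exists i.
  by apply: bigcup_measurable => i _; exact: measurableI.
pose HV i : set T := (H i : set T) `&` V i.
pose K : set T := \big[setU/set0]_(i < n.+1) HV i.
have mK : measurable K by apply: bigsetU_measurable => i _; exact: measurableI.
have mX : measurable [set om | F (X t om)].
  have := measurable_subordinated_path BM subH t; move=> /(_ measurableT F (closed_measurable clF)).
  by rewrite setTI.
(* Either t is not passed by time W, or it is passed in a cell i; then the exponent at the start of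
   the cell is above M, which is [U], or the cell is touched with exponent at most M, which is
   [K]. *)
have cover : [set om | F (X t om)] `<=` [set om | (sigma W om <= t)%R] `|` (U `|` K).
  move=> om /= FX; case: (leP (sigma W om) t) => [|tW]; first by left.
  right.
  have ex : exists i, t < sigma (c i) om by exists n.+1; rewrite /c cell_last.
  case: (ex_minnP ex) => -[|i] si imin; first by move: si; rewrite /c cell0 (sub_start subH) ltNge (ltW t0).
  have iln : (i < n.+1)%N by apply: imin; rewrite /c cell_last.
  have is_ : sigma (c i) om <= t by rewrite leNgt; apply/negP => /imin; rewrite ltnn.
  have [Ei|nEi] := pselect (E i om); first by left; exists i => //; exact: ltnW.
  right; rewrite /K -(bigcup_mkord n.+1 HV); exists i => //; split; last by rewrite /V/= is_.
  split => //; apply: (touch_hit BM W0 (v := inverse_process sigma t om)) => //.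
  rewrite (inverse_ge subH _ (c0 i) is_)/=; last by exists (c i.+1) => //; exact: c0.
  by apply: inverse_le => //; exact: c0.
apply: (@le_trans _ _ (P ([set om | (sigma W om <= t)%R] `|` (U `|` K)))).
  by apply: le_measure; rewrite ?inE//; apply: measurableU => //; exact: measurableU.
apply: (@le_trans _ _ (P [set om | (sigma W om <= t)%R] + P (U `|` K))%E).
  by apply: measureU2 => //; exact: measurableU.
apply: leeD => //; apply: (@le_trans _ _ (P U + P K)%E); first exact: measureU2.
rewrite EFinD; apply: leeD.
  apply: (@le_trans _ _ ((expR (1 - M))%:E * P [set om | (M < Phi t^-1 (c n.+1) om)%R])%E).
    exact: early_exit_prob.
  rewrite -[leRHS]mule1; apply: lee_wpmul2l; first by rewrite lee_fin expR_ge0.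
  exact: (probability_le1 P (mET n.+1)).
apply: (@le_trans _ _ (\sum_(i < n.+1) P ((H i : set T) `&` V i))%E).
  apply: (@content_subadditive _ _ _ P K (fun i => (H i : set T) `&` V i) n.+1) => //.
  by move=> i _; exact: measurableI.
rewrite EFinM; apply: (@le_trans _ _ (C%:E * \int[P]_om (time_int W (touched_intensity alpha (B := B) F W t^-1 n) om)%:E)%E); last first.
  by apply: lee_wpmul2l => //; exact: ltW.
apply: le_trans (lee_wpmul2l _ (touched_increments_le malpha alpha01 BM subH F W0 n ti0)); last by [].
rewrite ge0_sume_distrr; last first.
  move=> i _; apply: integral_ge0 => om _; rewrite lee_fin subr_ge0 expR_le1 oppr_le0 mulr_ge0// subr_ge0.
  exact: (sigma_le subH).
apply: lee_sum => i _; apply: le_trans (HC t (c i) (c i.+1) (H i) t1 (c0 i) (cS i) (mH i) _) _.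
  by move=> om [_ /negP]; rewrite -leNgt.
apply: lee_wpmul2l => //; apply: ge0_subset_integral => //.
- apply: measurable_funTS; apply/measurable_EFinP; apply: measurable_funB => //.
  apply: measurableT_comp => //; apply: measurableT_comp => //; apply: measurable_funM => //.
  by apply: measurable_funB; exact: measurable_funP.
- move=> om _; rewrite lee_fin subr_ge0 expR_le1 oppr_le0 mulr_ge0// subr_ge0.
  exact: (sigma_le subH).
- by move=> om [].
Qed.

End fixed_time.

(** * Exposure along the grid and convergence in probability *)

Section along_the_grid.
Context (R : realType) (d : measure_display) (T : measurableType d)
  (P : probability T R) (alpha : R -> R) (B sigma : R -> {RV P >-> R}).
Hypotheses (malpha : measurable_fun setT alpha) (alpha01 : forall x, 0 < alpha x < 1)
  (BM : standard_Brownian_motion B) (subH : conditional_subordinator alpha B sigma).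
Notation mu := (@lebesgue_measure R).
Local Notation X := (subordinated_process B sigma).

Lemma inv_square_small (e Q : R) (j : nat) : 0 < e -> 0 <= Q -> 2 * Q / e < j%:R ->
  Q / j.+1%:R ^+ 2 <= e / 2.
Proof.
move=> e0 Q0 h1; rewrite ler_pdivrMr ?exprn_gt0// -[j.+1%:R]natr1; move: h1; rewrite ltr_pdivrMr//.
have : 0 <= j%:R :> R by [].
set x := j%:R => x0 h1; have : 0 <= e * (x ^+ 2 + 1) by rewrite mulr_ge0 ?addr_ge0 ?sqr_ge0// ltW.
by nra.
Qed.

(** At l = y^(-xi), a part with exponent p and mean occupation y^k contributes y^(k - xi p), a
    negative power of the grid point. *)
Lemma exposure_grid (F N D0 D1 : set R) (p0 p1 k0 k1 K0 K1 xi : R) : closed F -> measurable N ->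
  measurable D0 -> measurable D1 -> F `<=` N `|` (D0 `|` D1) -> mu N = 0%E ->
  (forall x, D0 x -> p0 <= alpha x) -> (forall x, D1 x -> p1 <= alpha x) ->
  0 <= K0 -> 0 <= K1 ->
  (forall y, 1 <= y -> (\int[P]_om (occupation B D0 y om)%:E <= (K0 * y `^ k0)%:E)%E) ->
  (forall y, 1 <= y -> (\int[P]_om (occupation B D1 y om)%:E <= (K1 * y `^ k1)%:E)%E) ->
  0 < xi -> k0 < xi * p0 -> k1 < xi * p1 ->
  exists2 C, 0 <= C & forall j, (\int[P]_om (time_int (grid R j)
      (hit_intensity alpha (B := B) F (grid R j) (grid R j `^ xi)^-1) om)%:E <= (C / j.+1%:R ^+ 2)%:E)%E.
Proof.
move=> clF mN mD0 mD1 FD N0 hp0 hp1 K00 K10 O0 O1 xi0 k0p k1p.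
have d0 : 0 < xi * p0 - k0 by rewrite subr_gt0.
have d1 : 0 < xi * p1 - k1 by rewrite subr_gt0.
have [C0 C00 HC0] := grid_decay d0; have [C1 C10 HC1] := grid_decay d1.
exists (K0 * C0 + K1 * C1) => [|j]; first by rewrite addr_ge0// mulr_ge0.
have g1 := grid_ge1 R j; have g0 := grid_gt0 R j.
have lE (p : R) : ((grid R j `^ xi)^-1) `^ p = grid R j `^ (- (xi * p)).
  by rewrite -powRN -powRrM mulNr.
have lb : 0 < (grid R j `^ xi)^-1 <= 1.
  rewrite invr_gt0 powR_gt0//= invf_le1 ?powR_gt0//.
  by rewrite -[leLHS](powRr0 (grid R j)) ler_powR// ltW.
apply: le_trans (mean_hit_le malpha alpha01 BM (grid R j) clF mN mD0 mD1 FD N0 hp0 hp1 lb) _.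
have step (p k K C : R) (I : \bar R) : 0 <= K -> (I <= (K * grid R j `^ k)%:E)%E ->
    grid R j `^ (- (xi * p - k)) <= C / j.+1%:R ^+ 2 ->
    ((((grid R j `^ xi)^-1) `^ p)%:E * I <= (K * C / j.+1%:R ^+ 2)%:E)%E.
  move=> K00' hI hC; apply: le_trans (lee_wpmul2l _ hI) _; first by rewrite lee_fin powR_ge0.
  rewrite -EFinM lee_fin lE mulrCA -powRD; last by rewrite (gt_eqF g0) implybT.
  by rewrite -mulrA ler_wpM2l//; move: hC; rewrite opprB addrC.
rewrite mulrDl EFinD; apply: leeD.
- exact: (step _ _ _ _ _ K00 (O0 _ g1) (HC0 j)).
- exact: (step _ _ _ _ _ K10 (O1 _ g1) (HC1 j)).
Qed.

Lemma hit_intensity_le (F : set R) y l l' : closed F -> 0 <= l -> l <= l' ->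
  (\int[P]_om (time_int y (hit_intensity alpha (B := B) F y l) om)%:E <=
   \int[P]_om (time_int y (hit_intensity alpha (B := B) F y l') om)%:E)%E.
Proof.
move=> clF l0 ll'; have l'0 := le_trans l0 ll'.
have jh m : jointly_measurable (hit_intensity alpha (B := B) F y m).
  exact: (jointly_measurable_hit_intensity malpha BM y clF).
have mt m : measurable_fun (setT : set T) (fun om : T => (time_int y (hit_intensity alpha (B := B) F y m) om)%:E).
  apply/measurable_EFinP.
  have h : measurable_fun setT (time_int y (hit_intensity alpha (B := B) F y m)).
    by apply: measurable_time_int => // om v; rewrite !mulr_ge0// powR_ge0.
  exact: (measurableT_comp h (measurable_to_path (B := B))).
have hb m om v : 0 <= m -> `|hit_intensity alpha (B := B) F y m om v| <= m + 1.
  by move=> m0; have /andP[h1 h2] := hit_intensity_bound B alpha01 F y om v m0; rewrite ger0_norm.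
apply: ge0_le_integral; [by [] | | exact: mt | exact: mt |].
  by move=> om _; rewrite lee_fin; apply: time_int_ge0 => v; rewrite !mulr_ge0// powR_ge0.
move=> om _; rewrite lee_fin; apply: (le_time_int y (jh l) (jh l') (fun v => hb l om v l0) (fun v => hb l' om v l'0)).
move=> v; rewrite /hit_intensity /intensity; do 2! (apply: ler_wpM2l => //).
apply: ge0_ler_powR; rewrite ?nnegrE//.
by have /andP[h _] := alpha01 (path_at B om v); exact: ltW.
Qed.

Lemma sigma_le_probS u v v' : v <= v' ->
  (P [set om | (sigma u om <= v)%R] <= P [set om | (sigma u om <= v')%R])%E.
Proof.
move=> vv'; have msig w : measurable [set om | (sigma u om <= w)%R].
  have -> : [set om | (sigma u om <= w)%R] = sigma u @^-1` `]-oo, w].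
    by apply/seteqP; split => om /=; rewrite in_itv.
  by rewrite -[X in measurable X]setTI; exact: measurable_funP.
by apply: le_measure; rewrite ?inE// => om /= h; exact: le_trans vv'.
Qed.

(** The horizon is the grid point with y_j^xi <= t < y_(j+1)^xi. The left inequality bounds the
    exposure at 1/t by that at y_j^(-xi); the right one gives t <= y_j^zeta for large j, so that the
    clock has probably passed t by y_j. *)
Lemma hit_prob_cvg1 (G F : set R) (amax xi zeta C C' : R) : (forall x, alpha x <= amax) -> amax < 1 ->
  measurable G -> closed F ->
  ~` G `<=` F -> 0 < xi -> xi < zeta -> 0 <= C -> 0 <= C' ->
  (forall j, (P [set om | (sigma (grid R j) om <= grid R j `^ zeta)%R] <= (C / j.+1%:R ^+ 2)%:E)%E) ->
  (forall j, (\int[P]_om (time_int (grid R j)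
      (hit_intensity alpha (B := B) F (grid R j) (grid R j `^ xi)^-1) om)%:E <= (C' / j.+1%:R ^+ 2)%:E)%E) ->
  P [set om | G (X t om)] @[t --> +oo] --> 1%E.
Proof.
move=> alpha_le amax1 mG clF GF xi0 xz C0 C'0 hC hC'.
have mXS t S : measurable S -> measurable [set om | S (X t om)].
  move=> mS; have := measurable_subordinated_path BM subH t; move=> /(_ measurableT S mS).
  by rewrite setTI.
have lowG t (b : R) : (P [set om | F (X t om)] <= b%:E -> (1 - b)%:E <= P [set om | G (X t om)])%E.
  move=> hb; have : (1 <= P [set om | F (X t om)] + P [set om | G (X t om)])%E.
    rewrite -(@probability_setT _ _ _ P).
    apply: (@le_trans _ _ (P ([set om | F (X t om)] `|` [set om | G (X t om)]))).
      apply: le_measure; rewrite ?inE//.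
        by apply: measurableU; apply: mXS => //; exact: closed_measurable.
      by move=> om _; have [h|h] := pselect (G (X t om)); [right|left; exact: GF].
    by apply: measureU2; apply: mXS => //; exact: closed_measurable.
  move=> h; rewrite EFinB leeBlDl//; apply: le_trans h _; exact: leeD.
apply/fine_cvgP; split.
  by apply: nearW => t; apply: fin_num_measure; exact: mXS.
apply/cvgrPdist_le => e e0.
(* The order of choices matters: M makes exp(1 - M) at most e/2, the constant [CM] depends on M, and
   t is taken large after both. *)
pose M := Num.max 0 (1 - ln (e / 2)).
have M0 : 0 <= M by rewrite le_max lexx.
have eM : expR (1 - M) <= e / 2.
  rewrite -[leRHS](@lnK _ (e / 2)) ?posrE ?divr_gt0// ler_expR.
  have hM : 1 - ln (e / 2) <= M by rewrite le_max lexx orbT.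
  lra.
clearbody M.
have half (a b : R) : a <= e / 2 -> b <= e / 2 -> a + b <= e by move=> h1 h2; lra.
have [CM CM0 HCM] := hit_prob_le malpha alpha01 alpha_le amax1 BM subH M0.
have [N hN] := grid_ratio xi0 xz ltr01.
pose Q := C + CM * (C' + 1).
have Q0 : 0 <= Q by rewrite addr_ge0// mulr_ge0// addr_ge0.
pose N1 := maxn N (Num.truncn (2 * Q / e)).+1.
near=> t.
have t1 : 1 <= t by near: t; apply: nbhs_pinfty_ge; exact: num_real.
have tN : grid R N1 `^ xi < t by near: t; apply: nbhs_pinfty_gt; exact: num_real.
have t0 : 0 < t by exact: lt_le_trans t1.
have ex : exists k, t < grid R k `^ xi.
  exists (Num.truncn (t / xi)).+1; rewrite grid_powR; set k := _.+1.
  apply: lt_le_trans (expR_ge1Dx _).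
  have k1 : t / xi < k%:R by exact: truncnS_gt.
  have k3 : k%:R <= k%:R ^+ 4 :> R by rewrite -[leLHS]expr1 ler_weXn2l// ler1n.
  have k4 : t < xi * k%:R by rewrite mulrC -ltr_pdivrMr.
  have k5 : xi * k%:R <= xi * k%:R ^+ 4 by rewrite ler_pM2l.
  by apply: lt_le_trans k4 _; apply: le_trans k5 _; rewrite lerDr.
case: (ex_minnP ex) => k tk kmin.
have Nk : (N1 < k)%N.
  rewrite ltnNge; apply/negP => kN; move: tk; rewrite ltNge => /negP; apply; apply: le_trans (ltW tN).
  apply: ge0_ler_powR; rewrite ?nnegrE ?(ltW xi0) ?(ltW (grid_gt0 _ _))//; exact: le_grid.
case: k tk kmin Nk => // j tk kmin; rewrite ltnS => Nj.
have jt : grid R j `^ xi <= t by rewrite leNgt; apply/negP => /kmin; rewrite ltnn.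
have tz : t <= grid R j `^ zeta.
  apply: le_trans (ltW tk) _; have := hN j (leq_trans (leq_maxl _ _) Nj); by rewrite mul1r.
have gx0 : 0 < grid R j `^ xi by rewrite powR_gt0// grid_gt0.
have ti : t^-1 <= (grid R j `^ xi)^-1 by rewrite lef_pV2 ?posrE.
have ti0 : 0 <= t^-1 by rewrite invr_ge0 ltW.
have jp : 0 < (j.+1%:R ^+ 2)^-1 :> R by rewrite invr_gt0 exprn_gt0.
have hQ : Q / j.+1%:R ^+ 2 <= e / 2.
  apply: inv_square_small => //; apply: lt_le_trans (truncnS_gt _) _; rewrite ler_nat.
  exact: leq_trans (leq_maxr _ _) Nj.
have hS := le_trans (sigma_le_probS (grid R j) tz) (hC j).
have hF := HCM F t (grid R j) (C' / j.+1%:R ^+ 2) ((j.+1%:R ^+ 2)^-1) clF t1 (grid_gt0 R j) jp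
  (le_trans (hit_intensity_le (grid R j) clF ti0 ti) (hC' j)).
have fin : (P [set om | F (X t om)] <= e%:E)%E.
  apply: le_trans hF _; apply: le_trans (leeD hS (lexx _)) _; rewrite -EFinD lee_fin.
  have -> : C / j.+1%:R ^+ 2 + (expR (1 - M) + CM * (C' / j.+1%:R ^+ 2 + j.+1%:R ^- 2)) =
     expR (1 - M) + Q / j.+1%:R ^+ 2 by rewrite /Q; ring.
  exact: half.
have := lowG t e fin.
have := probability_le1 P (mXS t G mG).
rewrite -[P [set om | G (X t om)]]fineK; last by apply: fin_num_measure; exact: mXS.
rewrite !lee_fin /=; set q := fine _ => h1 h2.
by rewrite ger0_norm ?subr_ge0// lerBlDr -lerBlDl.
Unshelve. all: by end_near.
Qed.

End along_the_grid.

(** * The two regimes *)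

Section mass_growth.
Context (R : realType).
Notation mu := (@lebesgue_measure R).

Lemma growth_bounds (c a : R) (g : R -> \bar R) : 0 < a ->
  ((x `^ (- c))%:E * g x)%E @[x --> +oo] --> a%:E ->
  exists2 x0 : R, 1 <= x0 & forall x, x0 <= x ->
    ((a / 2 * x `^ c)%:E <= g x)%E /\ (g x <= ((a + 1) * x `^ c)%:E)%E.
Proof.
move=> a0 /fine_cvgP[hfin hcvg].
have h1 : a / 2 < a by lra.
have h2 : a < a + 1 by lra.
have n1 := cvgr_gt _ hcvg _ h1; have n2 := cvgr_lt _ hcvg _ h2.
have [M [_ HM]] : (nbhs (+oo : set_system R)) (fun x => [/\ ((x `^ (- c))%:E * g x)%E \is a fin_num,
    a / 2 < fine ((x `^ (- c))%:E * g x)%E & fine ((x `^ (- c))%:E * g x)%E < a + 1]).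
  by near=> x; split; near: x; [exact: hfin|exact: n1|exact: n2].
exists (Num.max 1 (M + 1)) => [|x]; first by rewrite le_max lexx.
rewrite ge_max => /andP[x1 xM].
have [f1 f2 f3] : [/\ ((x `^ (- c))%:E * g x)%E \is a fin_num,
    a / 2 < fine ((x `^ (- c))%:E * g x)%E & fine ((x `^ (- c))%:E * g x)%E < a + 1].
  by apply: HM; lra.
have x0 : 0 < x by lra.
have p0 : 0 < x `^ c by rewrite powR_gt0.
have gE : g x = (x `^ c * fine ((x `^ (- c))%:E * g x)%E)%:E.
  rewrite EFinM fineK// muleA -EFinM -powRD ?subrr ?powRr0 ?mul1e//.
  by rewrite (gt_eqF x0) implybT.
by rewrite gE !lee_fin ![_ * x `^ c]mulrC !ler_pM2l// !ltW.
Unshelve. all: by end_near.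
Qed.

(** [I x] has length at least x - M and lies in D up to [E x], whose mass b x^c is o(x). Beyond the
    threshold both M and b x^c are at most x / 4. *)
Lemma complement_mass (c b M x0 : R) (D : set R) (I E : R -> set R) : c < 1 -> 0 <= b -> measurable D ->
  (forall x, measurable (I x)) -> (forall x, measurable (E x)) ->
  (forall x, x0 <= x -> (mu (E x) <= (b * x `^ c)%:E)%E) ->
  (forall x, x0 <= x -> ((x - M)%:E <= mu (I x))%E) ->
  (forall x, x0 <= x -> I x `<=` (D `&` `[- x, x]) `|` E x) ->
  exists2 x1 : R, 0 < x1 & forall x, x1 <= x -> ((2^-1 * x `^ 1)%:E <= mu (D `&` `[(- x)%R, x]))%E.
Proof.
move=> c1 b0 mD mI mE hE hI hcov; have d0 : 0 < 1 - c by rewrite subr_gt0.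
exists (Num.max 1 (Num.max x0 (Num.max (4 * M) ((4 * b) `^ (1 - c)^-1)))) => [|x].
  by rewrite lt_max ltr01.
rewrite !ge_max => /and4P[x1 xx0 xM xb]; have xgt : 0 < x by exact: lt_le_trans x1.
have small : b * x `^ c <= x / 4.
  have e1 : 4 * b <= x `^ (1 - c).
    have -> : 4 * b = ((4 * b) `^ (1 - c)^-1) `^ (1 - c).
      by rewrite -powRrM mulVf ?powRr1 ?mulr_ge0// gt_eqF.
    by apply: ge0_ler_powR => //; rewrite ?nnegrE ?powR_ge0// ltW.
  have e2 : x = x `^ c * x `^ (1 - c).
    by rewrite -powRD ?subrKC ?powRr1 ?ltW// (gt_eqF xgt) implybT.
  rewrite [leRHS](_ : _ = x `^ c * (x `^ (1 - c) / 4)); last by rewrite mulrA -e2.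
  by rewrite mulrC ler_wpM2l ?powR_ge0//; lra.
have h : ((x - M)%:E <= mu (D `&` `[(- x)%R, x]) + (b * x `^ c)%:E)%E.
  apply: le_trans (hI _ xx0) _; apply: (@le_trans _ _ (mu ((D `&` `[(- x)%R, x]) `|` E x))).
    apply: le_measure; rewrite ?inE//; last exact: hcov.
      exact: mI.
    by apply: measurableU; [exact: measurableI|exact: mE].
  apply: (@le_trans _ _ (mu (D `&` `[(- x)%R, x]) + mu (E x))%E).
    by apply: measureU2; [exact: measurableI|exact: mE].
  by apply: leeD => //; exact: hE.
rewrite -leeBlDr// -EFinB in h; apply: le_trans h; rewrite lee_fin powRr1 ?(ltW xgt)//; lra.
Qed.

End mass_growth.

Section mean_occupation_growth.
Context (R : realType) (d : measure_display) (T : measurableType d)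
  (P : probability T R) (B : R -> {RV P >-> R}).
Hypothesis BM : standard_Brownian_motion B.
Notation mu := (@lebesgue_measure R).

Lemma lebesgue_measure_symmetric (x : R) : 0 <= x -> mu `[(- x)%R, x]%classic = (2 * x)%:E.
Proof.
move=> x0; rewrite lebesgue_measure_itv/= lte_fin.
case: ltP => h; first by rewrite -EFinB opprK mulr_natl mulr2n.
have -> : x = 0 by lra.
by rewrite mulr0.
Qed.

Lemma mean_occupation_any (kappa : R) (D : set R) : 1 < kappa -> measurable D ->
  exists2 K : R, 0 <= K & forall y, 1 <= y ->
    (\int[P]_om (occupation B D y om)%:E <= (K * y `^ kappa)%:E)%E.
Proof.
move=> k1 mD; apply: (mean_occupation_le BM (C := 2) (c := 1) (x0 := 1)) => //.
- by rewrite ler01 lexx.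
- by rewrite -mulr2n mulfV.
move=> x x1; have x0 : 0 <= x by lra.
rewrite powRr1// -lebesgue_measure_symmetric//.
by apply: le_measure; rewrite ?inE//; exact: measurableI.
Qed.

Lemma mean_occupation_bounded (kappa L : R) (D : set R) : 2^-1 < kappa -> 0 <= L -> measurable D ->
  D `<=` `[- L, L] -> exists2 K : R, 0 <= K & forall y, 1 <= y ->
    (\int[P]_om (occupation B D y om)%:E <= (K * y `^ kappa)%:E)%E.
Proof.
move=> k1 L0 mD DL; apply: (mean_occupation_le BM (C := 2 * L) (c := 0) (x0 := 1)) => //.
- by rewrite mulr_ge0.
- by rewrite ler01 lexx.
- by rewrite addr0 mul1r.
move=> x x1; rewrite powRr0 mulr1 -lebesgue_measure_symmetric//.
apply: le_measure; rewrite ?inE//; first exact: measurableI.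
by move=> z [/DL].
Qed.

End mean_occupation_growth.

(** Room for xi < zeta < Z = (1 + c1)/(2 astar): the exponents 1/ao of the far part and 1/(2 (astar
    + beta)) of the bounded part are both below Z. The remaining numbers are midpoints of the
    resulting strict inequalities. *)
Lemma concentration_exponents (R : realType) (astar c1 ao beta : R) :
  0 < astar -> 0 <= c1 -> 0 < beta -> 2 * astar / (1 + c1) < ao ->
  exists xi zeta p1 k0 k1 : R,
    [/\ 0 < xi, xi < zeta, zeta * astar < (1 + c1) / 2 & p1 < ao] /\
    [/\ 2^-1 < k0, k0 < xi * (astar + beta), 1 < k1 & k1 < xi * p1].
Proof.
move=> astar0 c1_ge0 beta0 hao.
have c1p : 0 < 1 + c1 by lra.
pose Z := (1 + c1) / (2 * astar).
have Z0 : 0 < Z by rewrite divr_gt0 ?mulr_gt0.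
have ZE : Z * astar = (1 + c1) / 2 by rewrite /Z; field; rewrite gt_eqF.
have ao0 : 0 < ao by apply: le_lt_trans hao; rewrite divr_ge0 ?mulr_ge0// ltW.
have sb0 : 0 < astar + beta by lra.
pose m := Num.max ao^-1 ((astar + beta)^-1 / 2).
have mZ : m < Z.
  rewrite gt_max; apply/andP; split.
    by rewrite /Z -invf_div ltf_pV2 ?posrE ?divr_gt0 ?mulr_gt0.
  rewrite /Z -invfM -[ltRHS]invf_div ltf_pV2 ?posrE ?divr_gt0 ?mulr_gt0//.
  by rewrite ltr_pdivrMr//; nra.
have m0 : 0 < m by rewrite lt_max invr_gt0 ao0.
pose xi := (m + Z) / 2; pose zeta := (xi + Z) / 2.
have mxi : m < xi by rewrite /xi; lra.
have xiZ : xi < Z by rewrite /xi; lra.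
have xi0 : 0 < xi by exact: lt_trans mxi.
have xz : xi < zeta by rewrite /zeta; lra.
have zZ : zeta < Z by rewrite /zeta; lra.
have xiao : 1 < xi * ao.
  by rewrite -ltr_pdivrMr// div1r; apply: le_lt_trans mxi; rewrite le_max lexx.
have xisb : 2^-1 < xi * (astar + beta).
  by rewrite -ltr_pdivrMr// mulrC; apply: le_lt_trans mxi; rewrite le_max lexx orbT.
have zs : zeta * astar < (1 + c1) / 2 by rewrite -ZE ltr_pM2r.
clearbody zeta xi.
(* Far out, alpha is known to be at least p only for p < ao; p1 lies below ao and still satisfies xi
   p1 > 1. *)
pose p1 := (ao + xi^-1) / 2.
have xip1 : xi * p1 = (xi * ao + 1) / 2 by rewrite /p1; field; rewrite gt_eqF.
have p1ao : p1 < ao.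
  have : xi^-1 < ao by rewrite -[ltLHS]div1r ltr_pdivrMr// mulrC.
  by rewrite /p1 => h; lra.
exists xi, zeta, p1, ((2^-1 + xi * (astar + beta)) / 2), ((1 + xi * p1) / 2).
by split; split => //; rewrite ?xip1; lra.
Qed.

(** A level a is chosen with ao < a < 2 astar / (1 + c1), so that Z = (1 + c1)/(2 astar) < 1/a, and
    xi < zeta are placed between Z and 1/a. The maximum with 0 ensures a > 0. *)
Lemma escape_exponents (R : realType) (astar c1 ao : R) : 0 < astar -> 0 <= c1 ->
  ao < 2 * astar / (1 + c1) ->
  exists a xi zeta k : R, [/\ ao < a, 0 < a, 0 < xi & xi < zeta] /\
    [/\ zeta * a < (1 + 1) / 2, (1 + c1) / 2 < k, 2^-1 < k & k < xi * astar].
Proof.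
move=> astar0 c1_ge0 hao.
have c1p : 0 < 1 + c1 by lra.
pose Z := (1 + c1) / (2 * astar).
have Z0 : 0 < Z by rewrite divr_gt0 ?mulr_gt0.
have ZE : Z * astar = (1 + c1) / 2 by rewrite /Z; field; rewrite gt_eqF.
pose gam := 2 * astar / (1 + c1).
have gam0 : 0 < gam by rewrite divr_gt0 ?mulr_gt0.
have ZgV : Z = gam^-1 by rewrite /gam invf_div.
have am : Num.max ao 0 < gam by rewrite gt_max hao.
have m1 : ao <= Num.max ao 0 by rewrite le_max lexx.
have m2 : 0 <= Num.max ao 0 by rewrite le_max lexx orbT.
pose a := (Num.max ao 0 + gam) / 2.
have aoa : ao < a by rewrite /a; lra.
have a0 : 0 < a by rewrite /a; lra.
have ag : a < gam by rewrite /a; lra.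
have Za : Z < a^-1 by rewrite ZgV ltf_pV2 ?posrE.
clearbody a.
pose xi := (2 * Z + a^-1) / 3; pose zeta := (Z + 2 * a^-1) / 3.
have Zxi : Z < xi by rewrite /xi; lra.
have xz : xi < zeta by rewrite /xi /zeta; lra.
have za : zeta < a^-1 by rewrite /zeta; lra.
have xi0 : 0 < xi by exact: lt_trans Zxi.
have zeta_a : zeta * a < (1 + 1) / 2.
  have -> : (1 + 1) / 2 = 1 :> R by field.
  by rewrite -ltr_pdivlMr// div1r.
have xis : (1 + c1) / 2 < xi * astar by rewrite -ZE ltr_pM2r.
exists a, xi, zeta, (((1 + c1) / 2 + xi * astar) / 2).
by split; split => //; lra.
Qed.

(** * Concentration on A and escape from A *)

Section regimes.
Context (R : realType) (d : measure_display) (T : measurableType d)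
  (P : probability T R) (alpha : R -> R) (B sigma : R -> {RV P >-> R}).
Hypotheses (malpha : measurable_fun setT alpha) (alpha01 : forall x, 0 < alpha x < 1)
  (BM : standard_Brownian_motion B) (subH : conditional_subordinator alpha B sigma).
Notation mu := (@lebesgue_measure R).
Local Notation X := (subordinated_process B sigma).
Variables (amax astar c1 ao K x0 : R) (A : set R).
Hypotheses (alpha_le : forall x, alpha x <= amax) (amax1 : amax < 1)
  (astar0 : 0 < astar) (alpha_ge : forall x, astar <= alpha x)
  (mA : measurable A) (alphaA : forall x, A x -> alpha x = astar)
  (c1_ge0 : 0 <= c1) (c1_lt1 : c1 < 1) (x0_gt0 : 0 < x0)
  (boundary : mu (closure A `\` interior A) = 0%E).

Let mboundary : measurable (closure A `\` interior A).
Proof.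
apply: measurableD; first by apply: closed_measurable; exact: closed_closure.
by apply: open_measurable; exact: open_interior.
Qed.

Lemma concentration_on (beta c0 : R) : 0 < beta -> (forall x, ~ A x -> astar + beta <= alpha x) ->
  2 * astar / (1 + c1) < ao ->
  (forall p, p < ao -> exists2 L, 0 <= L & forall x, ~ A x -> L < `|x| -> p <= alpha x) ->
  0 < c0 -> (forall x, x0 <= x -> ((c0 * x `^ c1)%:E <= mu (A `&` `[(- x)%R, x]))%E) ->
  {ae P, forall om, occupation_fraction X A t om @[t --> +oo] --> (1 : R)} /\
  P [set om | A (X t om)] @[t --> +oo] --> 1%E.
Proof.
move=> beta0 hbeta hao hfar c00 hmass.
have [xi [zeta [p1 [k0 [k1 [[xi0 xz zs p1ao] [k0_gt k0_lt k1_gt k1_lt]]]]]]] :=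
  concentration_exponents astar0 c1_ge0 beta0 hao.
have zeta0 : 0 < zeta by exact: lt_trans xz.
have [L L0 hL] := hfar p1 p1ao.
pose F := closure (~` A); pose D0 := ~` A `&` `[- L, L]; pose D1 := ~` A `\` `[- L, L].
have mnA : measurable (~` A) by exact: measurableC.
have mD0 : measurable D0 by exact: measurableI.
have mD1 : measurable D1 by exact: measurableD.
have clF : closed F by exact: closed_closure.
have GF : ~` A `<=` F by exact: subset_closure.
have FD : F `<=` (closure A `\` interior A) `|` (D0 `|` D1).
  move=> x Fx; have [Ax|nAx] := pselect (A x); last first.
    by right; have [h|h] := pselect (`[- L, L]%classic x); [left|right].
  left; split; first exact: subset_closure.
  by move=> /Fx[z [nAz]].
have [K0 K00 O0] := mean_occupation_bounded BM k0_gt L0 mD0 (@subIsetr _ _ _).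
have [K1 K10 O1] := mean_occupation_any BM k1_gt mD1.
have h0 x : D0 x -> astar + beta <= alpha x by move=> [+ _]; exact: hbeta.
have h1 x : D1 x -> p1 <= alpha x.
  move=> [nA nL]; apply: hL => //; rewrite ltNge; apply/negP => h; apply: nL.
  by rewrite /= in_itv/= -ler_norml.
have [C' C'0 hC'] := exposure_grid malpha alpha01 BM clF mboundary mD0 mD1 FD boundary h0 h1
  K00 K10 O0 O1 xi0 k0_lt k1_lt.
have c01 : 0 <= c1 <= 1 by rewrite c1_ge0 ltW.
have hA x : A x -> alpha x <= astar by move=> /alphaA ->.
have [C C0 hC] := sigma_lower_tail malpha alpha01 BM subH astar0 c00 c01 x0_gt0 zeta0 zs mA hA hmass.
split.
- exact: (occupation_fraction_cvg1 malpha alpha01 BM subH mA clF GF xi0 xz C0 C'0 hC hC').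
- exact: (hit_prob_cvg1 malpha alpha01 BM subH alpha_le amax1 mA clF GF xi0 xz C0 C'0 hC hC').
Qed.

(** The clock is driven by {alpha <= a}, of linear mass in [-x, x], while A and [-K, K] are both
    estimated with alpha >= astar and have mean occupations of exponents just above (1 + c1)/2 and
    1/2. *)
Lemma escape_from (Cu : R) : 0 < K -> ao < 2 * astar / (1 + c1) ->
  (forall a, ao < a -> exists2 x1 : R, 0 < x1 & forall x, x1 <= x ->
    ((2^-1 * x `^ 1)%:E <= mu ([set z | (alpha z <= a)%R] `&` `[(- x)%R, x]))%E) ->
  0 <= Cu -> (forall x, x0 <= x -> (mu (A `&` `[(- x)%R, x]) <= (Cu * x `^ c1)%:E)%E) ->
  {ae P, forall om, occupation_fraction X (~` `[- K, K] `&` ~` A) t om @[t --> +oo] --> (1 : R)}.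
Proof.
move=> KK0 hao hfar Cu0 hmass.
have [a [xi [zeta [k [[aoa a0 xi0 xz] [zeta_a k_gt k_half k_lt]]]]]] := escape_exponents astar0 c1_ge0 hao.
have zeta0 : 0 < zeta by exact: lt_trans xz.
pose F := closure A `|` `[- K, K].
have clF : closed F by apply: closedU; [exact: closed_closure|exact: interval_closed].
have FD : F `<=` (closure A `\` interior A) `|` (A `|` `[- K, K]).
  move=> x [cA|]; last by right; right.
  have [iA|nA] := pselect (interior A x); last by left.
  by right; left; exact: interior_subset.
have mK : measurable (`[- K, K]%classic : set R) by [].
have mG : measurable (~` `[- K, K] `&` ~` A) by apply: measurableI; exact: measurableC.
have GF : ~` (~` `[- K, K] `&` ~` A) `<=` F.
  move=> x; rewrite setCI !setCK => -[h|h]; first by right.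
  by left; exact: subset_closure.
have c01 : 0 <= c1 <= 1 by rewrite c1_ge0 ltW.
have [K0 K00 O0] := mean_occupation_le BM Cu0 c01 x0_gt0 k_gt mA hmass.
have [K1 K10 O1] := mean_occupation_bounded BM k_half (ltW KK0) mK (@subset_refl _ _).
have [C' C'0 hC'] := exposure_grid malpha alpha01 BM clF mboundary mA mK FD boundary
  (fun x _ => alpha_ge x) (fun x _ => alpha_ge x) K00 K10 O0 O1 xi0 k_lt k_lt.
have [x1 x10 hx1] := hfar a aoa.
have mD : measurable [set z | alpha z <= a].
  have -> : [set z | alpha z <= a] = alpha @^-1` `]-oo, a]%classic.
    by apply/seteqP; split => z /=; rewrite in_itv.
  by rewrite -[X in measurable X]setTI; exact: malpha.
have one : 0 <= (1 : R) <= 1 by rewrite ler01 lexx.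
have half0 : 0 < (2^-1 : R) by [].
have [C C0 hC] := sigma_lower_tail malpha alpha01 BM subH a0 half0 one x10 zeta0 zeta_a mD (fun z h => h) hx1.
exact: (occupation_fraction_cvg1 malpha alpha01 BM subH mG clF GF xi0 xz C0 C'0 hC hC').
Qed.

End regimes.

Theorem theorem4p17
  (R : realType) (d : measure_display) (T : measurableType d)
  (P : probability T R)
  (alpha : R -> R) (B sigma : R -> {RV P >-> R})
  (alphamax astar c1 c2 a1 a2 alphaI alphaJ : R) (A : set R)
  (alpha_measurable : measurable_fun setT alpha)
  (B_BM : standard_Brownian_motion B)
  (sigma_sub : conditional_subordinator alpha B sigma)
  (alpha01 : forall x, 0 < alpha x < 1)
  (Hmax : (exists x, alpha x = alphamax) /\ (forall x, alpha x <= alphamax))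
  (max_lt1 : alphamax < 1)
  (Hmin : (exists x, alpha x = astar) /\ (forall x, astar <= alpha x))
  (min_gt0 : 0 < astar)
  (HA : A = [set x | alpha x = astar])
  (A_unbounded : ~ bounded_set A)
  (c1_lt1 : c1 < 1) (c2_le_c1 : c2 <= c1) (c2_ge0 : 0 <= c2)
  (a1_gt0 : 0 < a1) (a2_gt0 : 0 < a2)
  (HA_right :
    ((x `^ (- c1))%:E * lebesgue_measure (A `&` `[0%R, x]))%E
      @[x --> +oo] --> a1%:E)
  (HA_left :
    ((x `^ (- c2))%:E *
      lebesgue_measure (A `&` `]-oo, 0%R[ `&` `[(- x)%R, 0%R]))%E
      @[x --> +oo] --> a2%:E)
  (HA_boundary : lebesgue_measure (closure A `\` interior A) = 0%E)
  (HA_beta : \forall beta \near (0 : R)^'+,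
    astar + beta < 1 /\ A = [set x | alpha x < astar + beta])
  (HalphaI : alpha x @[x --> within (~` A) +oo] --> alphaI)
  (HalphaJ : alpha x @[x --> within (~` A) -oo] --> alphaJ) :
  let X := subordinated_process B sigma in
  let alphao := Num.min alphaI alphaJ in
  (2 * astar / (1 + c1) < alphao ->
     {ae P, forall om, occupation_fraction X A t om @[t --> +oo] --> (1 : R)} /\
     P [set om | A (X t om)] @[t --> +oo] --> 1%E) /\
  (alphao < 2 * astar / (1 + c1) ->
     forall K : R, 0 < K ->
       {ae P, forall om,
          occupation_fraction X (~` `[- K, K] `&` ~` A) t om
            @[t --> +oo] --> (1 : R)}).
Proof.
move=> X alphao.
pose mu := @lebesgue_measure R.
have mA : measurable A.
  have -> : A = alpha @^-1` [set astar] by rewrite HA.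
  by rewrite -[X in measurable X]setTI; exact: alpha_measurable.
have alphaA x : A x -> alpha x = astar by rewrite HA.
have alpha_ge := Hmin.2; have alpha_le := Hmax.2.
have c1_ge0 : 0 <= c1 by exact: le_trans c2_le_c1.
have mR x : measurable (A `&` `[0, x]) by exact: measurableI.
have mL x : measurable (A `&` `]-oo, 0[ `&` `[- x, 0]) by apply: measurableI => //; exact: measurableI.
have mS x : measurable (A `&` `[- x, x]) by exact: measurableI.
have [xR xR1 HR] := growth_bounds a1_gt0 HA_right.
have [xL xL1 HL] := growth_bounds a2_gt0 HA_left.
pose x0 := Num.max xR xL.
have x01 : 1 <= x0 by rewrite le_max xR1.
have x0_gt0 : 0 < x0 by exact: lt_le_trans x01.
have b1 : 0 <= a1 + 1 by rewrite addr_ge0// ltW.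
have b2 : 0 <= a2 + 1 by rewrite addr_ge0// ltW.
split => [hao|hao K K0].
  have [beta [beta0 hbeta]] : exists beta, 0 < beta /\ forall x, ~ A x -> astar + beta <= alpha x.
    have [beta [beta0 [_ Abeta]]] : exists beta, 0 < beta /\ (astar + beta < 1 /\ A = [set x | alpha x < astar + beta]).
      near (0 : R)^'+ => beta; exists beta; split => //.
      by near: beta.
    exists beta; split => // x; rewrite Abeta /= => /negP; by rewrite -leNgt.
  have hfar p : p < alphao -> exists2 L, 0 <= L & forall x, ~ A x -> L < `|x| -> p <= alpha x.
    rewrite lt_min => /andP[pI pJ].
    have [M1 [_ HM1]] := cvgr_gt _ HalphaI _ pI.
    have [M2 [_ HM2]] := cvgr_gt _ HalphaJ _ pJ.
    exists (Num.max 0 (Num.max M1 (- M2))); first by rewrite le_max lexx.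
    move=> x nA; rewrite !gt_max => /and3P[_ h1 h2].
    have [x_ge0|x_lt0] := leP 0 x.
      by apply: ltW; apply: HM1 => //; rewrite ger0_norm in h1.
    by apply: ltW; apply: HM2 => //; rewrite ltr0_norm ?ltrN2 in h2.
  have a10 : 0 < a1 / 2 by rewrite divr_gt0.
  apply: (concentration_on alpha_measurable alpha01 B_BM sigma_sub alpha_le max_lt1 min_gt0 mA alphaA
    c1_ge0 c1_lt1 x0_gt0 HA_boundary beta0 hbeta hao hfar a10) => x.
  rewrite ge_max => /andP[xxR _]; apply: le_trans (HR x xxR).1 _.
  apply: le_measure; rewrite ?inE; [exact: mR|exact: mS|].
  move=> z [Az]; rewrite /= !in_itv/= => /andP[z0 ->]; split => //=; rewrite andbT.
  by apply: le_trans z0; rewrite oppr_le0; lra.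
have Cu0 : 0 <= a1 + 1 + (a2 + 1) by rewrite addr_ge0.
apply: (escape_from alpha_measurable alpha01 B_BM sigma_sub min_gt0 alpha_ge mA
    c1_ge0 c1_lt1 x0_gt0 HA_boundary K0 hao _ Cu0) => [a|x].
- have md : measurable [set z | alpha z <= a].
    have -> : [set z | alpha z <= a] = alpha @^-1` `]-oo, a]%classic.
      by apply/seteqP; split => z /=; rewrite in_itv.
    by rewrite -[X in measurable X]setTI; exact: alpha_measurable.
  (* The side whose limit is below a provides the linear mass of {alpha <= a}: beyond M, every point
     of that side outside A belongs to this set. *)
  rewrite gt_min => /orP[aI|aJ].
    have [M1 [_ HM1]] := cvgr_lt _ HalphaI _ aI.
    pose M := Num.max 0 M1.
    apply: (@complement_mass _ c1 (a1 + 1) M (Num.max x0 M) _ (fun x => `]M, x]%classic) (fun x => A `&` `[0, x])) => //.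
    + by move=> x; rewrite ge_max => /andP[+ _]; rewrite ge_max => /andP[xxR _]; exact: (HR x xxR).2.
    + move=> x; rewrite ge_max => /andP[_ Mx]; rewrite lebesgue_measure_itv/= lte_fin.
      by case: ltP => h; [rewrite -EFinB|rewrite lee_fin subr_le0].
    + move=> x; rewrite ge_max => /andP[_ Mx] z; rewrite /= !in_itv/= => /andP[Mz zx].
      have z0 : 0 < z by apply: le_lt_trans Mz; rewrite le_max lexx.
      have zM1 : M1 < z by apply: le_lt_trans Mz; rewrite le_max lexx orbT.
      have [Az|nA] := pselect (A z); [right|left]; split => //=.
      - by rewrite zx ltW.
      - by apply: ltW; exact: HM1.
      - by rewrite zx andbT; lra.
  have [M1 [_ HM1]] := cvgr_lt _ HalphaJ _ aJ.
  pose M := Num.max 0 (- M1).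
  apply: (@complement_mass _ c2 (a2 + 1) M (Num.max x0 M) _ (fun x => `[- x, - M[%classic) (fun x => A `&` `]-oo, 0[ `&` `[- x, 0])) => //.
  + exact: le_lt_trans c1_lt1.
  + by move=> x; rewrite ge_max => /andP[+ _]; rewrite ge_max => /andP[_ xxL]; exact: (HL x xxL).2.
  + move=> x; rewrite ge_max => /andP[_ Mx]; rewrite lebesgue_measure_itv/= lte_fin.
    case: ltP => h; first by rewrite -EFinB lee_fin opprK addrC.
    by rewrite lee_fin; move: h; lra.
  + move=> x; rewrite ge_max => /andP[_ Mx] z; rewrite /= !in_itv/= => /andP[zx Mz].
    have M0 : 0 <= M by rewrite le_max lexx.
    have MM1 : - M <= M1 by rewrite lerNl le_max lexx orbT.
    have [Az|nA] := pselect (A z); [right|left]; split => //=.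
    - by split => //; lra.
    - by rewrite zx/=; lra.
    - by apply: ltW; apply: HM1 => //; lra.
    - by rewrite zx/=; lra.
rewrite ge_max => /andP[xxR xxL].
have x1 : 1 <= x by exact: le_trans xxR.
apply: (@le_trans _ _ (mu ((A `&` `[0, x]) `|` (A `&` `]-oo, 0[ `&` `[- x, 0])))).
  apply: le_measure; rewrite ?inE; [exact: mS|by apply: measurableU; [exact: mR|exact: mL]|].
  move=> z [Az]; rewrite /= in_itv/= => /andP[zx xz].
  have [z0|z0] := leP 0 z; [left|right]; split => //=; rewrite ?in_itv/= ?z0 ?zx ?xz ?(ltW z0)//.
apply: (@le_trans _ _ (mu (A `&` `[0%R, x]) + mu (A `&` `]-oo, 0%R[ `&` `[(- x)%R, 0%R]))%E).
  by apply: measureU2; [exact: mR|exact: mL].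
apply: le_trans (leeD (HR x xxR).2 (HL x xxL).2) _.
(* The left mass, of order x^c2, is absorbed into x^c1, since x >= 1 and c2 <= c1. *)
rewrite -EFinD lee_fin [leRHS]mulrDl lerD2l ler_wpM2l//.
by rewrite ler_powR.
Unshelve. all: by end_near.
Qed.
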